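(* Let $W_\Gamma \cong W_{\Gamma_{\mathrm{sph}}}\times W_{\Gamma_{\mathrm{aff}}}\times W_{\Gamma_{\mathrm{gen}}}$ and $W_\Omega \cong W_{\Omega_{\mathrm{sph}}}\times W_{\Omega_{\mathrm{aff}}}\times W_{\Omega_{\mathrm{gen}}}$ be Coxeter groups written in their spherical/affine/generic decompositions, and suppose $\widehat{W_\Gamma}\cong\widehat{W_\Omega}$. Then \[W_{\Gamma_{\mathrm{sph}}}\cong W_{\Omega_{\mathrm{sph}}},\qquad W_{\Gamma_{\mathrm{aff}}}\cong W_{\Omega_{\mathrm{aff}}},\qquad \widehat{W_{\Gamma_{\mathrm{gen}}}}\cong\widehat{W_{\Omega_{\mathrm{gen}}}}.\] In particular, $W_\Gamma$ is profinitely rigid amongst Coxeter groups if and only if $W_{\Gamma_{\mathrm{gen}}}$ is profinitely rigid amongst Coxeter groups.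
   Context: A Coxeter graph is a finite simplicial graph $\Gamma$ with edge labelling $m\colon E(\Gamma)\to\mathbb{N}_{\geq 2}$; the Coxeter group is $W_\Gamma=\langle V(\Gamma)\mid v^2\ (v\in V(\Gamma)),\ (vw)^{m(\{v,w\})}\ (\{v,w\}\in E(\Gamma))\rangle$. $\widehat{G}$ denotes the profinite completion. Every Coxeter group decomposes as $W_\Gamma\cong W_{\Gamma_{\mathrm{sph}}}\times W_{\Gamma_{\mathrm{aff}}}\times W_{\Gamma_{\mathrm{gen}}}$ where the spherical part $W_{\Gamma_{\mathrm{sph}}}$ is trivial or a finite Coxeter group, the affine part $W_{\Gamma_{\mathrm{aff}}}$ is trivial or a direct product of irreducible affine Coxeter groups, and the generic part $W_{\Gamma_{\mathrm{gen}}}$ is trivial or a Coxeter group each of whose irreducible direct factors is an infinite non-affine Coxeter group. A Coxeter group $W$ is profinitely rigid amongst Coxeter groups if every Coxeter group $W'$ with $\widehat{W'}\cong\widehat W$ satisfies $W'\cong W$. *)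

(* Defs.v *)
From HB Require Import structures.
From mathcomp Require Import all_boot all_order all_algebra.
From mathcomp Require Import boolp reals trigo Rstruct.
Set Implicit Arguments. Unset Strict Implicit. Unset Printing Implicit Defensive.
Import Order.TTheory GRing.Theory Num.Theory.

(* Coxeter graphs.  A Coxeter graph on a finite vertex type V is given  *)
(* by a labelling  m : V -> V -> nat  where  m s t = 0  means "no edge" *)
(* between s and t (no relation, i.e. (st) has infinite order), and     *)
(* m s t = k >= 2 means an edge labelled k.                             *)

Definition is_cox_graph (V : finType) (m : V -> V -> nat) : Prop :=
  (forall s t, m s t = m t s) /\ (forall s, m s s = 0) /\ (forall s t, m s t <> 1).

Section Coxeter.
Variables (V : finType) (m : V -> V -> nat).

Fixpoint alt (n : nat) (s t : V) : seq V :=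
  if n is n'.+1 then s :: t :: alt n' s t else [::].

(* The congruence on words over V generated by the Coxeter relations;  *)
(* words modulo coxeq form the Coxeter group W_Gamma (inverse = rev).   *)
Inductive coxeq : seq V -> seq V -> Prop :=
| cx_refl w : coxeq w w
| cx_sym u w : coxeq u w -> coxeq w u
| cx_trans u v w : coxeq u v -> coxeq v w -> coxeq u w
| cx_ctx a b u w : coxeq u w -> coxeq (a ++ u ++ b) (a ++ w ++ b)
| cx_sq s : coxeq [:: s; s] [::]
| cx_braid s t : s != t -> m s t != 0%N -> coxeq (alt (m s t) s t) [::].

Definition cox_finite : Prop :=
  exists l : seq (seq V), forall w, exists2 u, u \in l & coxeq w u.

(* Finite-index normal subgroups of W_Gamma, represented by the         *)
(* corresponding congruences on words (coarser than coxeq) having       *)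
(* finitely many classes.                                               *)
Record fincong := FinCong {
  fc_rel :> seq V -> seq V -> Prop;
  fc_refl : forall w, fc_rel w w;
  fc_sym : forall u w, fc_rel u w -> fc_rel w u;
  fc_trans : forall u v w, fc_rel u v -> fc_rel v w -> fc_rel u w;
  fc_cong : forall a b c d, fc_rel a b -> fc_rel c d -> fc_rel (a ++ c) (b ++ d);
  fc_cox : forall u w, coxeq u w -> fc_rel u w;
  fc_fin : exists l : seq (seq V), forall w, exists2 u, u \in l & fc_rel w u }.

(* The profinite completion: the inverse limit of the W/N.  An element  *)
(* chooses, for every N, a representative word of its class in W/N.     *)
Definition prof_elt := forall N : fincong, seq V.

Definition is_prof (x : prof_elt) : Prop :=
  forall N M : fincong, (forall u w, N u w -> M u w) -> M (x N) (x M).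

Definition prof_eq (x y : prof_elt) : Prop := forall N : fincong, N (x N) (y N).

Definition prof_mul (x y : prof_elt) : prof_elt := fun N => x N ++ y N.

(* adjacency in the Coxeter diagram: s, t do not commute *)
Definition dadj : rel V := fun s t => (s != t) && (m s t != 2%N).

Definition comp (v : V) : {set V} := [set u | connect dadj v u].

Definition gram (s t : V) : Rdefinitions.R :=
  if s == t then 1%R
  else if m s t == 0%N then (-1)%R
  else (- cos (pi / (m s t)%:R))%R.

Definition qform (A : {set V}) (x : V -> Rdefinitions.R) : Rdefinitions.R :=
  (\sum_(s in A) \sum_(t in A) x s * gram s t * x t)%R.

(* the (irreducible) Coxeter group on the vertex set A is affine: its   *)
(* cosine form is positive semidefinite but degenerate                  *)
Definition cox_affine_on (A : {set V}) : Prop :=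
  (forall x, (0 <= qform A x)%R) /\
  (exists x, (exists2 s, s \in A & x s != 0%R) /\ qform A x = 0%R).

End Coxeter.

Definition subV (V : finType) (A : {set V}) : finType := {x : V | x \in A}.
Definition restrict (V : finType) (m : V -> V -> nat) (A : {set V})
  : subV A -> subV A -> nat := fun x y => m (val x) (val y).
Arguments restrict {V} m A.

Definition sph_set (V : finType) (m : V -> V -> nat) : {set V} :=
  [set v | `[< cox_finite (restrict m (comp m v)) >]].
Definition aff_set (V : finType) (m : V -> V -> nat) : {set V} :=
  [set v | `[< cox_affine_on m (comp m v) >]].
Definition gen_set (V : finType) (m : V -> V -> nat) : {set V} :=
  ~: (sph_set m :|: aff_set m).

Definition cox_iso (V1 V2 : finType) (m1 : V1 -> V1 -> nat) (m2 : V2 -> V2 -> nat)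
  : Prop :=
  exists f : seq V1 -> seq V2,
    [/\ (forall u w, coxeq m1 u w -> coxeq m2 (f u) (f w)),
        (forall u w, coxeq m2 (f (u ++ w)) (f u ++ f w)),
        (forall u w, coxeq m2 (f u) (f w) -> coxeq m1 u w) &
        (forall y, exists x, coxeq m2 (f x) y)].

(* isomorphism of profinite groups  hat W_Gamma1 ~= hat W_Gamma2        *)
(* (a continuous group isomorphism; its inverse is then automatically    *)
(* continuous since the groups are compact Hausdorff)                   *)
Definition prof_iso (V1 V2 : finType) (m1 : V1 -> V1 -> nat) (m2 : V2 -> V2 -> nat)
  : Prop :=
  exists F : prof_elt m1 -> prof_elt m2,
    (forall x, is_prof x -> is_prof (F x)) /\
    [/\
        (forall x y, is_prof x -> is_prof y -> prof_eq x y -> prof_eq (F x) (F y)),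
        (forall x y, is_prof x -> is_prof y ->
                     prof_eq (F (prof_mul x y)) (prof_mul (F x) (F y))),
        (forall x y, is_prof x -> is_prof y -> prof_eq (F x) (F y) -> prof_eq x y),
        (forall y, is_prof y -> exists2 x, is_prof x & prof_eq (F x) y) &
        (forall N2 : fincong m2, exists N1 : fincong m1, forall x y,
            is_prof x -> is_prof y -> N1 (x N1) (y N1) -> N2 (F x N2) (F y N2))].

Definition prof_rigid (V : finType) (m : V -> V -> nat) : Prop :=
  forall (V' : finType) (m' : V' -> V' -> nat),
    is_cox_graph m' -> prof_iso m' m -> cox_iso m' m.

(* Main.v *)
Require Import Defs.
From HB Require Import structures.
From mathcomp Require Import all_boot all_order all_fingroup all_algebra all_field.
From mathcomp Require Import cyclic ring lra zify.
From mathcomp Require Import boolp reals trigo Rstruct.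
From mathcomp Require classical_sets filter.
Set Implicit Arguments. Unset Strict Implicit. Unset Printing Implicit Defensive.
Import Order.TTheory GRing.Theory Num.Theory.
Import Defs.

(* Write W = S x A x G for the spherical, affine and generic parts.

   Generic part.  The matrix entries of the reflection representation lie in a ring Z[2 cos(pi/N)], which
   maps to finite fields of almost every characteristic; the kernels of the resulting finite representations
   are torsion-free.  Elements of W that fix a simple root a up to sign in two such fields therefore move a
   either to +-a or to a root whose wall is disjoint from that of a, and the disjoint walls so obtained cut the
   Coxeter complex into regions.  A generic component has at least four walls on the boundary of a region.  The
   parity of crossings of these walls is a cocycle with values in Z/4, and a counting argument with it shows
   that a normal subgroup of the profinite completion which acts by signs in finite characteristic and is
   centralized by an open subgroup commutes with the reflection in a.  Hence every homomorphism from the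
   completion of W onto the completion of a generic group sends the (virtually abelian) completion of S x A into
   the centre, and its image dies in every abelian quotient.  An isomorphism of completions then has invertible
   diagonal blocks with respect to (S x A) x G: if M is the product of the off-diagonal blocks, M is central and
   M^2 = 1, so that x -> x M(x)^-1 inverts the twist.

   Affine part.  The reflections generate T x| W0, where T is the lattice of translations, with a basis t_i such
   that r_j t_i r_j = t_i - n_ji t_j.  The completion of T is its own centralizer and torsion-free, so it is
   preserved by isomorphisms of completions, and completions of affine groups have no finite normal subgroup,
   which separates S from A.  Averaging over W0 an isomorphism of lattices mod N gives an integral intertwiner
   t_i -> z_i t'_i; comparing several N shows that |z_i| is constant on components and that the t'_i form a
   basis, so dividing by |z_i| gives an isomorphism of the discrete groups. *)

(** * Coxeter groups, their finite quotients and profinite completions *)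

(** Roots and walls have no place in the completion, so every argument about them must pass through
    finite quotients. Reduction to a finite field produces families of walls that do not cross. The
    crossing cocycle has finite coefficients, so it factors through a finite quotient; modulo 2 a
    value equal to its own negative carries no information, while modulo 4 it must be even, which is
    why the coefficients lie in Z/4 although only parities are used. Four walls per region are
    needed because a wall borders at most two regions: walls are then at least twice as numerous as
    regions, and the parities along walls would give too many independent functions on regions. One
    reduction yields only three walls; a second one, chosen to remove one of the three, doubles the
    other two by reflection in it, and a third keeps the four roots distinct in the finite quotient.
    Centrality of the image of S x A is obtained in two rounds: first for an abelian open subgroup,
    which centralizes itself, and then, that subgroup being central, for the whole factor. *)

Definition hom (G H : groupType) (f : G -> H) := {morph f : x y / (x * y)%g}.

Section Hom.
Variables (G H : groupType) (f : G -> H) (hf : hom f).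
Lemma hom1 : f 1%g = 1%g.
Proof. by apply: (@mulgI H (f 1%g)); rewrite -hf !mulg1. Qed.
Lemma homV x : f x^-1%g = ((f x)^-1)%g.
Proof. by apply: (@mulgI H (f x)); rewrite -hf !mulgV hom1. Qed.
Lemma homX x n : f (x ^+ n)%g = (f x ^+ n)%g.
Proof. by elim: n => [|n IH]; rewrite ?expg0 ?hom1 // !expgS hf IH. Qed.
End Hom.

Section Quotient.
Variables (V : finType) (m : V -> V -> nat).

(** Trivial squares make the reversed word an inverse, so one construction serves both for the
    Coxeter group and for all its finite quotients. *)
Record wcong := WCong {
  wc_rel :> seq V -> seq V -> Prop;
  wc_refl : forall w, wc_rel w w;
  wc_sym : forall u w, wc_rel u w -> wc_rel w u;
  wc_trans : forall u v w, wc_rel u v -> wc_rel v w -> wc_rel u w;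
  wc_cong : forall a b c d, wc_rel a b -> wc_rel c d -> wc_rel (a ++ c) (b ++ d);
  wc_sq : forall s, wc_rel [:: s; s] [::] }.

Variable R : wcong.
(** [choose] depends only on the extension of the predicate, so equivalent words get the same
    representative, and the quotient becomes a countable subtype of words with decidable
    equality. *)
Definition canon (w : seq V) : seq V := choose (fun u => `[< R w u >]) w.
Lemma canonP w : R w (canon w).
Proof.
apply/asboolP; apply: (@chooseP _ (fun u => `[< R w u >])).
by apply/asboolP; apply: wc_refl.
Qed.
Lemma eq_canon u w : R u w -> canon u = canon w.
Proof.
move=> h; rewrite /canon (@eq_choose _ _ (fun v => `[< R w v >])).
  by apply: choose_id; apply/asboolP; [apply: wc_sym|apply: wc_refl].
move=> v; apply/idP/idP => /asboolP h2; apply/asboolP; apply: wc_trans h2 => //.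
exact: wc_sym.
Qed.
Lemma canon_idem w : canon (canon w) == canon w.
Proof. by apply/eqP; apply: eq_canon; apply: wc_sym; apply: canonP. Qed.
Definition qgrp := {w : seq V | canon w == w}.
HB.instance Definition _ := Countable.on qgrp.
Definition cls (w : seq V) : qgrp := exist _ (canon w) (canon_idem w).
Definition wrep (x : qgrp) : seq V := val x.

Lemma clsP u w : cls u = cls w <-> R u w.
Proof.
split=> [/(congr1 val) /= h|h]; last by apply: val_inj; apply: eq_canon.
by apply: wc_trans (canonP u) _; rewrite h; apply: wc_sym; apply: canonP.
Qed.
Lemma cls_repr x : cls (wrep x) = x.
Proof. by apply: val_inj; apply/eqP; apply: (valP x). Qed.
Lemma cls_surj x : exists w, x = cls w.
Proof. by exists (wrep x); rewrite cls_repr. Qed.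

Definition qmul (x y : qgrp) := cls (wrep x ++ wrep y).
Definition qinv (x : qgrp) := cls (rev (wrep x)).
Lemma repr_cls w : R (wrep (cls w)) w.
Proof. by apply/clsP; rewrite cls_repr. Qed.
Lemma qmulE u w : qmul (cls u) (cls w) = cls (u ++ w).
Proof. by apply/clsP; apply: wc_cong; apply: repr_cls. Qed.
Lemma qmulA : associative qmul.
Proof.
move=> x y z; rewrite -(cls_repr x) -(cls_repr y) -(cls_repr z).
by rewrite !qmulE catA.
Qed.
Lemma qmul1 : left_id (cls [::]) qmul.
Proof. by move=> x; rewrite -(cls_repr x) qmulE. Qed.
Lemma wc_rev w : R (rev w ++ w) [::].
Proof.
elim: w => [|s w IH]; first exact: wc_refl.
rewrite rev_cons -cats1 -catA /=; apply: wc_trans IH.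
apply: wc_cong; first exact: wc_refl.
by rewrite -(cat1s s w) -cat_cons -[X in R _ X]cat0s; apply: wc_cong; [exact: wc_sq|exact: wc_refl].
Qed.
Lemma qmulV : left_inverse (cls [::]) qinv qmul.
Proof. by move=> x; rewrite -{2}(cls_repr x) /qinv qmulE; apply/clsP; apply: wc_rev. Qed.
Lemma qmul1r : right_id (cls [::]) qmul.
Proof. by move=> x; rewrite -(cls_repr x) qmulE cats0. Qed.
Lemma qmulVr : right_inverse (cls [::]) qinv qmul.
Proof.
move=> x; rewrite -{1}(cls_repr x) /qinv qmulE; apply/clsP.
by rewrite -{1}(revK (wrep x)); apply: wc_rev.
Qed.
HB.instance Definition _ := isGroup.Build qgrp qmulA qmul1 qmul1r qmulV qmulVr.

Lemma clsM u w : cls (u ++ w) = (cls u * cls w)%g.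
Proof. by rewrite -qmulE. Qed.
Lemma clsV w : cls (rev w) = ((cls w)^-1)%g.
Proof.
by symmetry; apply: mulg1_eq; rewrite -clsM; apply/clsP; rewrite -{1}(revK w); apply: wc_rev.
Qed.
Lemma cls_cons s w : cls (s :: w) = (cls [:: s] * cls w)%g.
Proof. by rewrite -clsM. Qed.
Lemma cls_sq s : (cls [:: s] * cls [:: s])%g = 1%g.
Proof. by rewrite -clsM; apply/clsP; apply: wc_sq. Qed.
End Quotient.

Section Cox.
Variables (V : finType) (m : V -> V -> nat).

Lemma coxeq_cong a b c d : coxeq m a b -> coxeq m c d -> coxeq m (a ++ c) (b ++ d).
Proof.
move=> h1 h2; apply: (@cx_trans _ _ _ (b ++ c)).
  by have := cx_ctx [::] c h1.
by have := cx_ctx b [::] h2; rewrite !cats0.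
Qed.
Definition coxc : wcong V :=
  @WCong V (coxeq m) (@cx_refl _ m) (@cx_sym _ m) (@cx_trans _ m) coxeq_cong (@cx_sq _ m).
Definition cox := qgrp coxc.
HB.instance Definition _ := Group.on cox.
Definition fcc (N : fincong m) : wcong V :=
  @WCong V N (@fc_refl _ _ N) (@fc_sym _ _ N) (@fc_trans _ _ N) (@fc_cong _ _ N)
  (fun s => fc_cox N (@cx_sq _ m s)).
Definition fq (N : fincong m) := qgrp (fcc N).
HB.instance Definition _ N := Group.on (fq N).

Definition wd (w : seq V) : cox := cls coxc w.
Definition fwd N (w : seq V) : fq N := cls (fcc N) w.
Definition sg s := wd [:: s].
Lemma wdP u w : wd u = wd w <-> coxeq m u w. Proof. exact: clsP. Qed.
Lemma fwdP N u w : fwd N u = fwd N w <-> N u w. Proof. exact: clsP. Qed.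
Lemma wdM u w : wd (u ++ w) = (wd u * wd w)%g. Proof. exact: clsM. Qed.
Lemma fwdM N u w : fwd N (u ++ w) = (fwd N u * fwd N w)%g. Proof. exact: clsM. Qed.
Lemma wd_cons s w : wd (s :: w) = (sg s * wd w)%g. Proof. exact: cls_cons. Qed.
Lemma wd_nil : wd [::] = 1%g. Proof. by []. Qed.
Lemma wd_rev w : wd (rev w) = ((wd w)^-1)%g. Proof. exact: clsV. Qed.
Lemma wd_repr (x : cox) : wd (wrep x) = x. Proof. exact: cls_repr. Qed.
Lemma wd_surj (x : cox) : exists w, x = wd w. Proof. exact: cls_surj. Qed.
Lemma fwd_surj N (x : fq N) : exists w, x = fwd N w. Proof. exact: cls_surj. Qed.
Lemma sg_sq s : (sg s * sg s)%g = 1%g. Proof. exact: cls_sq. Qed.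
Lemma sgV s : ((sg s)^-1)%g = sg s.
Proof. by apply: mulg1_eq; exact: sg_sq. Qed.

Lemma fq_list N : exists l : seq (fq N), forall x, x \in l.
Proof.
have [l hl] := fc_fin N; exists (map (fwd N) l) => x.
have [w ->] := fwd_surj x; have [u ul h] := hl w.
by apply/mapP; exists u => //; apply/fwdP.
Qed.
Definition fq_enum N : seq (fq N) := undup (projT1 (cid (fq_list N))).
Lemma fq_enumP N : Finite.axiom (fq_enum N).
Proof.
apply: Finite.uniq_enumP; first exact: undup_uniq.
by move=> x; rewrite mem_undup; case: cid => l /= ->.
Qed.
HB.instance Definition _ N := Countable.on (fq N).
HB.instance Definition _ N := isFinite.Build (fq N) (@fq_enumP N).
End Cox.

Section Lift.
Variables (V : finType) (m : V -> V -> nat) (H : groupType) (f : V -> H).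
Definition evalw (w : seq V) : H := foldr (fun s x => f s * x)%g 1%g w.
Lemma evalw_cat u w : evalw (u ++ w) = (evalw u * evalw w)%g.
Proof. by elim: u => [|s u IH] /=; rewrite ?mul1g // IH mulgA. Qed.
Lemma evalw_alt n s t : evalw (alt n s t) = ((f s * f t) ^+ n)%g.
Proof. by elim: n => [|n IH] //=; rewrite IH expgS mulgA. Qed.
Hypothesis hsq : forall s, (f s * f s)%g = 1%g.
Hypothesis hbr : forall s t, s != t -> m s t != 0%N -> ((f s * f t) ^+ (m s t))%g = 1%g.
Lemma evalw_coxeq u w : coxeq m u w -> evalw u = evalw w.
Proof.
elim=> {u w} //.
- by move=> u v w _ -> _ ->.
- by move=> a b u w _ IH; rewrite !evalw_cat IH.
- by move=> s /=; rewrite mulg1 hsq.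
- by move=> s t st mst; rewrite evalw_alt hbr.
Qed.
Definition clift (x : cox m) : H := evalw (wrep x).
Lemma clift_wd w : clift (wd m w) = evalw w.
Proof. by apply: evalw_coxeq; apply/wdP; rewrite wd_repr. Qed.
Lemma clift_sg s : clift (sg m s) = f s.
Proof. by rewrite clift_wd /= mulg1. Qed.
Lemma clift_hom : hom clift.
Proof.
move=> x y; have [u ->] := wd_surj x; have [w ->] := wd_surj y.
by rewrite -wdM !clift_wd evalw_cat.
Qed.
End Lift.

Section CoxHom.
Variables (V : finType) (m : V -> V -> nat).
Lemma sg_rel s t : s != t -> m s t != 0%N -> ((sg m s * sg m t) ^+ (m s t))%g = 1%g.
Proof.
move=> st mst; rewrite -(evalw_alt (sg m)) -(wd_nil m).
have -> : evalw (sg m) (alt (m s t) s t) = wd m (alt (m s t) s t).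
  by elim: (alt _ _ _) => [|r w IH] //=; rewrite IH -wd_cons.
by apply/wdP/cx_braid.
Qed.
Lemma cox_ind (P : cox m -> Prop) :
  P 1%g -> (forall s x, P x -> P (sg m s * x)%g) -> forall x, P x.
Proof.
move=> h1 hS x; have [w ->] := wd_surj x.
by elim: w => [|s w IH]; rewrite ?wd_nil // wd_cons; apply: hS.
Qed.
Lemma hom_ext (H : groupType) (f g : cox m -> H) : hom f -> hom g ->
  (forall s, f (sg m s) = g (sg m s)) -> f =1 g.
Proof.
move=> hf hg e; elim/cox_ind => [|s x IH]; first by rewrite (hom1 hf) (hom1 hg).
by rewrite hf hg e IH.
Qed.

Definition proj (N : fincong m) (x : cox m) : fq N := fwd N (wrep x).
Arguments proj : clear implicits.
Lemma proj_wd N w : proj N (wd m w) = fwd N w.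
Proof. by apply/fwdP/fc_cox/wdP; rewrite wd_repr. Qed.
Lemma proj_hom N : hom (proj N).
Proof.
move=> x y; have [u ->] := wd_surj x; have [w ->] := wd_surj y.
by rewrite -wdM !proj_wd fwdM.
Qed.
Lemma proj_surj N (q : fq N) : exists x, q = proj N x.
Proof. by have [w ->] := fwd_surj q; exists (wd m w); rewrite proj_wd. Qed.

Section Mk.
Variables (r : cox m -> cox m -> Prop).
Hypotheses (r_refl : forall x, r x x) (r_sym : forall x y, r x y -> r y x)
  (r_trans : forall x y z, r x y -> r y z -> r x z)
  (r_mul : forall a b c d, r a b -> r c d -> r (a * c)%g (b * d)%g)
  (r_fin : exists l : seq (cox m), forall x, exists2 y, y \in l & r x y).
Definition mkfc : fincong m.
Proof.
refine (@FinCong V m (fun u w => r (wd m u) (wd m w)) _ _ _ _ _ _).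
- by move=> w; apply: r_refl.
- by move=> u w; apply: r_sym.
- by move=> u v w; apply: r_trans.
- by move=> a b c d h1 h2; rewrite !wdM; apply: r_mul.
- by move=> u w h; have -> : wd m u = wd m w by apply/wdP.
- have [l hl] := r_fin; exists (map (@wrep _ _) l) => w.
  have [y yl h] := hl (wd m w); exists (wrep y); first exact: map_f.
  by rewrite wd_repr.
Defined.
Lemma mkfcP x y : proj mkfc x = proj mkfc y <-> r x y.
Proof.
have [u ->] := wd_surj x; have [w ->] := wd_surj y.
by rewrite !proj_wd; apply: fwdP.
Qed.
End Mk.

Section Ker.
Variables (H : groupType) (f : cox m -> H) (hf : hom f)
  (ffin : exists l : seq H, forall x, f x \in l).
Lemma ker_fin : exists l : seq (cox m), forall x, exists2 y, y \in l & f x = f y.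
Proof.
have [l hl] := ffin.
pose g h := if pselect (exists y, f y = h) is left e then projT1 (cid e) else 1%g.
exists (map g l) => x; exists (g (f x)); first exact: map_f.
rewrite /g; case: pselect => [e|]; last by case; exists x.
by case: cid.
Qed.
Definition kfc : fincong m.
Proof.
refine (@mkfc (fun x y => f x = f y) _ _ _ _ ker_fin) => //.
- by move=> x y z -> ->.
- by move=> a b c d h1 h2; rewrite !hf h1 h2.
Defined.
Lemma kfcP x y : proj kfc x = proj kfc y <-> f x = f y.
Proof. exact: mkfcP. Qed.
End Ker.

Lemma fin_list (T : finType) : exists l : seq T, forall x, x \in l.
Proof. by exists (enum T) => x; rewrite mem_enum. Qed.

Definition projsub (N M : fincong m) := forall u w, N u w -> M u w.
Lemma projsubP N M : projsub N M <-> forall x y, proj N x = proj N y -> proj M x = proj M y.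
Proof.
split=> h.
  move=> x y; have [u ->] := wd_surj x; have [w ->] := wd_surj y.
  by rewrite !proj_wd => /fwdP /h e; apply/fwdP.
by move=> u w e; apply/fwdP; rewrite -!proj_wd; apply: h; rewrite !proj_wd; apply/fwdP.
Qed.

Definition fmeet (N M : fincong m) : fincong m.
Proof.
refine (@kfc (fq N * fq M)%type (fun x => (proj N x, proj M x)) _ _).
- by move=> x y; rewrite !proj_hom.
- by have [l hl] := fin_list (fq N * fq M)%type; exists l => x; apply: hl.
Defined.
Lemma fmeetP N M x y : proj (fmeet N M) x = proj (fmeet N M) y <->
  proj N x = proj N y /\ proj M x = proj M y.
Proof.
split=> [/kfcP e|[h1 h2]]; last by apply/kfcP; rewrite h1 h2.
by split; [exact: (congr1 fst e)|exact: (congr1 snd e)].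
Qed.
Lemma fmeetl N M : projsub (fmeet N M) N.
Proof. by apply/projsubP => x y /fmeetP[]. Qed.
Lemma fmeetr N M : projsub (fmeet N M) M.
Proof. by apply/projsubP => x y /fmeetP[]. Qed.
End CoxHom.
Arguments proj {V m} N x.

Section Pull.
Variables (V1 V2 : finType) (m1 : V1 -> V1 -> nat) (m2 : V2 -> V2 -> nat).
Variables (f : cox m1 -> cox m2) (hf : hom f).
Definition fpull (N : fincong m2) : fincong m1.
Proof.
refine (@kfc _ m1 (fq N) (fun x => proj N (f x)) _ _).
- by move=> x y; rewrite hf proj_hom.
- by have [l hl] := fin_list (fq N); exists l.
Defined.
Lemma fpullP N x y : proj (fpull N) x = proj (fpull N) y <-> proj N (f x) = proj N (f y).
Proof. exact: kfcP. Qed.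
End Pull.

(** * The profinite completion as a group *)

Section Prof.
Variables (V : finType) (m : V -> V -> nat).
(** Coordinates are tested against elements of W. Since every element of W/N is the image of one,
    this is compatibility with the maps W/N -> W/M. *)
Record prof := Prof {
  pv : forall N : fincong m, fq N;
  pvP : forall N M x, projsub N M -> pv N = proj N x -> pv M = proj M x }.
HB.instance Definition _ := gen_eqMixin prof.
HB.instance Definition _ := gen_choiceMixin prof.
Lemma pv_ext (x y : prof) : (forall N, pv x N = pv y N) -> x = y.
Proof.
case: x y => [x hx] [y hy] /= h.
have e : x = y by apply: functional_extensionality_dep.
by move: hy; rewrite -e => hy; rewrite (Prop_irrelevance hx hy).
Qed.
Definition iota (x : cox m) : prof := Prof
  (pv := fun N => proj N x) (fun N M y (h : projsub N M) e => (projsubP N M).1 h _ _ e).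
Lemma approx (x : prof) N : exists w, pv x N = proj N w.
Proof. exact: proj_surj. Qed.
Lemma approx2 (x : prof) N M : exists w, pv x N = proj N w /\ pv x M = proj M w.
Proof.
have [w h] := approx x (fmeet N M); exists w; split.
  exact: pvP (@fmeetl _ _ N M) h.
exact: pvP (@fmeetr _ _ N M) h.
Qed.
Definition pmul (x y : prof) : prof.
Proof.
refine (@Prof (fun N => pv x N * pv y N)%g _).
move=> N M z NM.
have [u [h1 h2]] := approx2 x N M; have [w [h3 h4]] := approx2 y N M.
rewrite h1 h2 h3 h4 -!proj_hom; exact: ((projsubP N M).1 NM).
Defined.
Definition pinv (x : prof) : prof.
Proof.
refine (@Prof (fun N => (pv x N)^-1)%g _).
move=> N M z NM.
have [u [h1 h2]] := approx2 x N M.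
rewrite h1 h2 -!(homV (@proj_hom _ _ _)); exact: ((projsubP N M).1 NM).
Defined.
Lemma pmulA : associative pmul.
Proof. by move=> x y z; apply: pv_ext => N /=; rewrite mulgA. Qed.
Lemma pmul1 : left_id (iota 1%g) pmul.
Proof. by move=> x; apply: pv_ext => N /=; rewrite (hom1 (@proj_hom _ _ _)) mul1g. Qed.
Lemma pmul1r : right_id (iota 1%g) pmul.
Proof. by move=> x; apply: pv_ext => N /=; rewrite (hom1 (@proj_hom _ _ _)) mulg1. Qed.
Lemma pmulV : left_inverse (iota 1%g) pinv pmul.
Proof. by move=> x; apply: pv_ext => N /=; rewrite (hom1 (@proj_hom _ _ _)) mulVg. Qed.
Lemma pmulVr : right_inverse (iota 1%g) pinv pmul.
Proof. by move=> x; apply: pv_ext => N /=; rewrite (hom1 (@proj_hom _ _ _)) mulgV. Qed.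
HB.instance Definition _ := isGroup.Build prof pmulA pmul1 pmul1r pmulV pmulVr.

Lemma pvM N : hom (fun x : prof => pv x N). Proof. by []. Qed.
Lemma pv1 N : pv (1%g : prof) N = 1%g. Proof. exact: hom1 (pvM N). Qed.
Lemma pvV N x : pv (x^-1%g) N = ((pv x N)^-1)%g. Proof. by []. Qed.
Lemma pvX N x n : pv (x ^+ n)%g N = (pv x N ^+ n)%g. Proof. exact: homX (pvM N) x n. Qed.
Lemma iota_hom : hom iota.
Proof. by move=> x y; apply: pv_ext => N /=; rewrite proj_hom. Qed.
Lemma pv_iota N x : pv (iota x) N = proj N x. Proof. by []. Qed.
Lemma pv_sub (x y : prof) N M : projsub N M -> pv x N = pv y N -> pv x M = pv y M.
Proof.
by move=> NM; have [w h] := approx y N; rewrite (pvP NM h) h => /(pvP NM).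
Qed.
End Prof.
Arguments iota {V m} x.

Definition cts (V1 V2 : finType) (m1 : V1 -> V1 -> nat) (m2 : V2 -> V2 -> nat)
    (F : prof m1 -> prof m2) :=
  forall N2, exists N1, forall x, pv x N1 = 1%g -> pv (F x) N2 = 1%g.

Section Cts.
Variables (V1 V2 V3 : finType) (m1 : V1 -> V1 -> nat) (m2 : V2 -> V2 -> nat)
  (m3 : V3 -> V3 -> nat).
Lemma cts_eq (F : prof m1 -> prof m2) : hom F -> cts F -> forall N2, exists N1,
  forall x y, pv x N1 = pv y N1 -> pv (F x) N2 = pv (F y) N2.
Proof.
move=> hF cF N2; have [N1 h] := cF N2; exists N1 => x y e.
have := h (x * y^-1)%g; rewrite pvM pvV e mulgV => /(_ erefl).
by rewrite hF (homV hF) pvM pvV => /eqP; rewrite divg_eq1 => /eqP.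
Qed.
Lemma cts_comp (F : prof m1 -> prof m2) (G : prof m2 -> prof m3) :
  cts F -> cts G -> cts (G \o F).
Proof.
move=> cF cG N3; have [N2 h2] := cG N3; have [N1 h1] := cF N2.
by exists N1 => x /h1 /h2.
Qed.
(** W is dense in its completion: at each finite level both maps are determined by their value at
    one element of W. *)
Lemma cts_ext (F G : prof m1 -> prof m2) : hom F -> hom G -> cts F -> cts G ->
  (forall s, F (iota (sg m1 s)) = G (iota (sg m1 s))) -> F =1 G.
Proof.
move=> hF hG cF cG e x; apply: pv_ext => N2.
have [N1 h1] := cts_eq hF cF N2; have [M1 k1] := cts_eq hG cG N2.
have [w [a b]] := approx2 x N1 M1.
rewrite (h1 x (iota w)) ?a // (k1 x (iota w)) ?b //.
have -> // : F (iota w) = G (iota w).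
apply: (@hom_ext _ _ _ (fun w => F (iota w)) (fun w => G (iota w))) => // u v.
  by rewrite iota_hom hF.
by rewrite iota_hom hG.
Qed.
End Cts.

Section Phat.
Variables (V1 V2 : finType) (m1 : V1 -> V1 -> nat) (m2 : V2 -> V2 -> nat).
Variables (f : cox m1 -> cox m2) (hf : hom f).
(** The coordinate at [N] is read at the level of the preimage of [N], where any representative
    gives the same value. *)
Definition phat (x : prof m1) : prof m2.
Proof.
refine (@Prof _ _ (fun N => proj N (f (wd m1 (wrep (pv x (fpull hf N)))))) _).
move=> N M z NM.
set P := fpull hf N; set Q := fpull hf M.
have [w [h1 h2]] := approx2 x P Q.
have e1 : proj P (wd m1 (wrep (pv x P))) = proj P w by rewrite proj_wd -h1; exact: cls_repr.
have e2 : proj Q (wd m1 (wrep (pv x Q))) = proj Q w by rewrite proj_wd -h2; exact: cls_repr.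
rewrite ((fpullP hf N _ _).1 e1) ((fpullP hf M _ _).1 e2).
exact: ((projsubP N M).1 NM).
Defined.
Lemma pv_phat N x w : pv x (fpull hf N) = proj (fpull hf N) w -> pv (phat x) N = proj N (f w).
Proof.
move=> h /=; apply/(fpullP hf); rewrite -h proj_wd; exact: cls_repr.
Qed.
Lemma phat_iota w : phat (iota w) = iota (f w).
Proof. by apply: pv_ext => N; rewrite (@pv_phat N _ w). Qed.
Lemma phat_hom : hom phat.
Proof.
move=> x y; apply: pv_ext => N; have [u hu] := approx x (fpull hf N).
have [w hw] := approx y (fpull hf N).
rewrite (@pv_phat N _ (u * w)%g) ?proj_hom -?hu -?hw // pvM.
by rewrite (pv_phat hu) (pv_phat hw) hf proj_hom.
Qed.
Lemma phat_cts : cts phat.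
Proof.
move=> N; exists (fpull hf N) => x h.
rewrite (@pv_phat N _ 1%g) ?h ?(hom1 (@proj_hom _ _ _)) // (hom1 hf).
by rewrite (hom1 (@proj_hom _ _ _)).
Qed.
End Phat.

(** * Reflection representations *)

Section Act.
Variables (S : finType) (A : comNzRingType) (a : S -> S -> A).
Local Open Scope ring_scope.
(** The ring stays general because the same vectors are used over the reals, over integer
    polynomials and over finite fields. *)
Definition vec := {ffun S -> A^o}.
HB.instance Definition _ := GRing.Lmodule.on vec.
Implicit Types (u v w : vec) (p q : seq S).
Definition ev s : vec := [ffun t => (t == s)%:R].
Definition pair s v : A := \sum_t a s t * v t.
Definition refl s v : vec := v - pair s v *: ev s.
Definition actw p v : vec := foldr refl v p.
Definition bil u v : A := \sum_s u s * pair s v.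
Definition rv (b : vec) v : vec := v - bil b v *: b.

Lemma vecD u v s : (u + v) s = u s + v s. Proof. by rewrite ffunE. Qed.
Lemma vecN u s : (- u) s = - u s. Proof. by rewrite ffunE. Qed.
Lemma vecZ (x : A) u s : (x *: u) s = x * u s. Proof. by rewrite ffunE. Qed.
Lemma vecS (I : Type) (r : seq I) (P : pred I) (F : I -> vec) s :
  (\sum_(i <- r | P i) F i) s = \sum_(i <- r | P i) F i s.
Proof.
elim/big_rec2: _ => [|i y1 y2 _ <-]; first by rewrite ffunE.
by rewrite vecD.
Qed.
Definition vecE := (vecD, vecN, vecZ, vecS).
Lemma vec_sum v : v = \sum_s v s *: ev s.
Proof.
apply/ffunP => t; rewrite vecS (bigD1 t) //= vecZ ffunE eqxx mulr1 big1 ?addr0 // => s st.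
by rewrite vecZ ffunE eq_sym (negbTE st) mulr0.
Qed.

Lemma pairP s (x : A) u v : pair s (x *: u + v) = x * pair s u + pair s v.
Proof.
rewrite /pair mulr_sumr -big_split; apply: eq_bigr => t _ /=.
by rewrite !vecE; ring.
Qed.
Lemma reflP s (x : A) u v : refl s (x *: u + v) = x *: refl s u + refl s v.
Proof.
by apply/ffunP => t; rewrite /refl !vecE pairP; ring.
Qed.
Lemma actwP p (x : A) u v : actw p (x *: u + v) = x *: actw p u + actw p v.
Proof. by elim: p => [|s p IH] //=; rewrite IH reflP. Qed.
Lemma bilPr u (x : A) v w : bil u (x *: v + w) = x * bil u v + bil u w.
Proof.
rewrite /bil mulr_sumr -big_split; apply: eq_bigr => t _ /=.
by rewrite pairP; ring.
Qed.
Lemma bilPl u (x : A) v w : bil (x *: v + w) u = x * bil v u + bil w u.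
Proof.
rewrite /bil mulr_sumr -big_split; apply: eq_bigr => t _ /=.
by rewrite !vecE; ring.
Qed.
HB.instance Definition _ p := GRing.isLinear.Build A vec vec _ (actw p) (actwP p).
HB.instance Definition _ u := GRing.isLinear.Build A vec A^o _ (bil u : vec -> A^o) (bilPr u).
Lemma bilZr u x v : bil u (x *: v) = x * bil u v. Proof. exact: linearZ. Qed.
Lemma bilDr u v w : bil u (v + w) = bil u v + bil u w. Proof. exact: raddfD. Qed.
Lemma bilNr u v : bil u (- v) = - bil u v. Proof. exact: raddfN. Qed.
Lemma bilDl u v w : bil (v + w) u = bil v u + bil w u.
Proof. by rewrite -[v]scale1r bilPl scale1r mul1r. Qed.
Lemma bil0l u : bil 0 u = 0.
Proof. by rewrite -[0 in LHS](subrr 0) bilDl oppr0 /bil big1 ?addr0 // => s _; rewrite ffunE mul0r. Qed.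
Lemma bilZl u x v : bil (x *: v) u = x * bil v u.
Proof. by rewrite -[x *: v]addr0 bilPl bil0l addr0. Qed.
Lemma bilNl u v : bil (- v) u = - bil v u.
Proof. by rewrite -scaleN1r bilZl mulN1r. Qed.
Lemma bil_suml u (I : Type) (r : seq I) (P : pred I) (F : I -> vec) :
  bil (\sum_(i <- r | P i) F i) u = \sum_(i <- r | P i) bil (F i) u.
Proof.
elim/big_rec2: _ => [|i y1 y2 _ <-]; first exact: bil0l.
by rewrite bilDl.
Qed.
Lemma bil_sumr u (I : Type) (r : seq I) (P : pred I) (F : I -> vec) :
  bil u (\sum_(i <- r | P i) F i) = \sum_(i <- r | P i) bil u (F i).
Proof. exact: raddf_sum. Qed.
Lemma actw_cat p q v : actw (p ++ q) v = actw p (actw q v).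
Proof. by rewrite /actw foldr_cat. Qed.
Lemma bil_ev s v : bil (ev s) v = pair s v.
Proof.
rewrite /bil (bigD1 s) //= ffunE eqxx mul1r big1 ?addr0 // => t ts.
by rewrite ffunE (negbTE ts) mul0r.
Qed.
Lemma pair_ev s t : pair s (ev t) = a s t.
Proof.
rewrite /pair (bigD1 t) //= ffunE eqxx mulr1 big1 ?addr0 // => r rt.
by rewrite ffunE (negbTE rt) mulr0.
Qed.
Lemma bil_evev s t : bil (ev s) (ev t) = a s t.
Proof. by rewrite bil_ev pair_ev. Qed.
Lemma refl_rv s v : refl s v = rv (ev s) v.
Proof. by rewrite /rv bil_ev. Qed.

Hypotheses (a_sym : forall s t, a s t = a t s) (a_diag : forall s, a s s = 2%:R).
Lemma bilC u v : bil u v = bil v u.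
Proof.
rewrite /bil; under eq_bigr => s _ do rewrite mulr_sumr.
rewrite exchange_big; apply: eq_bigr => t _; rewrite mulr_sumr.
by apply: eq_bigr => s _; rewrite a_sym; ring.
Qed.
Lemma rvK b v : bil b b = 2%:R -> rv b (rv b v) = v.
Proof.
move=> bb; rewrite /rv bilDr bilNr bilZr bb.
by apply/ffunP => t; rewrite !vecE; ring.
Qed.
Lemma bil_rv b u v : bil b b = 2%:R -> bil (rv b u) (rv b v) = bil u v.
Proof.
move=> bb; rewrite /rv !(bilDr, bilDl, bilNr, bilNl, bilZr, bilZl) bb (bilC u b).
by ring.
Qed.
Lemma ev2 s : bil (ev s) (ev s) = 2%:R. Proof. by rewrite bil_evev a_diag. Qed.
Lemma reflK s : involutive (refl s).
Proof. by move=> v; rewrite !refl_rv rvK ?ev2. Qed.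
Lemma bil_refl s u v : bil (refl s u) (refl s v) = bil u v.
Proof. by rewrite !refl_rv bil_rv ?ev2. Qed.
Lemma bil_actw p u v : bil (actw p u) (actw p v) = bil u v.
Proof. by elim: p => //= s p IH; rewrite bil_refl. Qed.
Lemma actw_revK p : cancel (actw p) (actw (rev p)).
Proof.
by elim: p => [|s p IH] v //=; rewrite rev_cons -cats1 actw_cat /= reflK IH.
Qed.
Lemma actw_rv p b v : actw p (rv b v) = rv (actw p b) (actw p v).
Proof. by rewrite /rv bil_actw linearB linearZ. Qed.
Lemma rvN b v : rv (- b) v = rv b v.
Proof. by rewrite /rv bilNl scaleNr scalerN opprK. Qed.
Lemma rv_self b : bil b b = 2%:R -> rv b b = - b.
Proof. by move=> bb; rewrite /rv bb; apply/ffunP => t; rewrite !vecE; ring. Qed.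
End Act.

Section ActGroup.
Variables (S : finType) (m : S -> S -> nat) (A : comNzRingType) (a : S -> S -> A).
Local Open Scope ring_scope.
Hypothesis resp : forall u w v, coxeq m u w -> actw a u v = actw a w v.
Hypotheses (a_sym : forall s t, a s t = a t s) (a_diag : forall s, a s s = 2%:R).
Definition ga (g : cox m) (v : vec S A) : vec S A := actw a (wrep g) v.
Lemma ga_wd p v : ga (wd m p) v = actw a p v.
Proof. by apply: resp; apply/wdP; rewrite wd_repr. Qed.
Lemma gaM g h v : ga (g * h)%g v = ga g (ga h v).
Proof.
have [u ->] := wd_surj g; have [w ->] := wd_surj h.
by rewrite -wdM !ga_wd actw_cat.
Qed.
Lemma ga1 v : ga 1%g v = v.
Proof. by rewrite -(wd_nil m) ga_wd. Qed.
Lemma ga_sg s v : ga (sg m s) v = refl a s v.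
Proof. by rewrite ga_wd. Qed.
HB.instance Definition _ g := GRing.isLinear.Build A (vec S A) (vec S A) _ (ga g)
  (fun x => actwP a (wrep g) x).
Lemma gaD g u v : ga g (u + v) = ga g u + ga g v. Proof. exact: linearD. Qed.
Lemma gaN g u : ga g (- u) = - ga g u. Proof. exact: linearN. Qed.
Lemma gaB g u v : ga g (u - v) = ga g u - ga g v. Proof. exact: linearB. Qed.
Lemma gaZ g x u : ga g (x *: u) = x *: ga g u. Proof. exact: linearZ. Qed.
Lemma gaK g : cancel (ga g) (ga g^-1%g).
Proof. by move=> v; rewrite -gaM mulVg ga1. Qed.
Lemma gaVK g : cancel (ga g^-1%g) (ga g).
Proof. by move=> v; rewrite -gaM mulgV ga1. Qed.
Lemma ga_inj g : injective (ga g). Proof. exact: can_inj (gaK g). Qed.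
Lemma bil_ga g u v : bil a (ga g u) (ga g v) = bil a u v.
Proof. exact: bil_actw. Qed.
Lemma bil_gaV g u v : bil a (ga g^-1%g u) v = bil a u (ga g v).
Proof. by rewrite -(bil_ga g) gaVK. Qed.
Lemma ga_rv g b v : ga g (rv a b v) = rv a (ga g b) (ga g v).
Proof. by rewrite /rv bil_ga gaB gaZ. Qed.
Lemma ga_conj g s v : ga (g * sg m s * g^-1)%g v = rv a (ga g (ev A s)) v.
Proof.
by rewrite !gaM ga_sg refl_rv /ga actw_rv // -/(ga g _) -/(ga g _) gaVK.
Qed.
Lemma root2 g s : bil a (ga g (ev A s)) (ga g (ev A s)) = 2%:R.
Proof. by rewrite bil_ga ev2. Qed.
End ActGroup.

Local Open Scope ring_scope.

Notation RR := Rdefinitions.R.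

(** * Chebyshev recursion and the braid relations in the reflection representation *)

Section Un.
Variable (A : comNzRingType) (x : A).
(** Chebyshev polynomials of the second kind: at x = 2 cos t the value [un n] is sin(n t) / sin
    t. *)
Fixpoint un2 (n : nat) : A * A :=
  if n is n'.+1 then ((un2 n').2, x * (un2 n').2 - (un2 n').1) else (0, 1).
Definition un n := (un2 n).1.
Lemma un0 : un 0 = 0. Proof. by []. Qed.
Lemma un1 : un 1 = 1. Proof. by []. Qed.
Lemma unSS n : un n.+2 = x * un n.+1 - un n. Proof. by []. Qed.
End Un.

Lemma ind2 (P : nat -> Prop) : P 0%N -> P 1%N -> (forall n, P n -> P n.+1 -> P n.+2) ->
  forall n, P n.
Proof.
move=> h0 h1 hS n; suff: P n /\ P n.+1 by case.
by elim: n => [|n [IH1 IH2]]; split=> //; apply: hS.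
Qed.

Section Trig.
Variables (k : nat) (hk : (2 <= k)%N).
Let th : RR := pi / k%:R.
Let x := 2%:R * cos th.
Lemma th_pos : 0 < th.
Proof. by rewrite /th divr_gt0 ?pi_gt0 // ltr0n; apply: leq_trans hk. Qed.
Lemma k_th : k%:R * th = pi.
Proof. by rewrite /th mulrC divfK // pnatr_eq0; lia. Qed.
Lemma sin_th j : (0 < j < k)%N -> 0 < sin (j%:R * th).
Proof.
move=> /andP[j0 jk]; apply: sin_gt0_pi; rewrite mulr_gt0 ?ltr0n ?th_pos //=.
by rewrite -k_th ltr_pM2r ?th_pos // ltr_nat.
Qed.
Lemma un_sin n : un x n * sin th = sin (n%:R * th).
Proof.
elim/ind2: n => [||n IH1 IH2].
- by rewrite un0 !mul0r sin0.
- by rewrite un1 !mul1r.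
rewrite unSS mulrBl -mulrA IH2 IH1.
have -> : n.+2%:R * th = n.+1%:R * th + th by rewrite -[n.+2]addn1 natrD; ring.
have -> : sin (n%:R * th) = sin (n.+1%:R * th - th).
  by congr sin; rewrite -[n.+1]addn1 natrD; ring.
by rewrite !trigo.sinD trigo.sinN trigo.cosN /x; ring.
Qed.
Lemma sin_th1 : 0 < sin th.
Proof. by have := @sin_th 1; rewrite mul1r; apply; lia. Qed.
Lemma un_ge0 j : (j <= k)%N -> 0 <= un x j.
Proof.
move=> jk; rewrite -(pmulr_lge0 _ sin_th1) un_sin.
case: j jk => [|j] jk; first by rewrite mul0r sin0.
move: jk; rewrite leq_eqVlt => /orP[/eqP->|jk]; first by rewrite k_th sinpi.
by apply/ltW/sin_th.
Qed.
Lemma un_2k : un x (2 * k) = 0.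
Proof.
apply: (mulIf (lt0r_neq0 sin_th1)); rewrite un_sin mul0r natrM -mulrA k_th.
by rewrite -[2]/(1+1) mulrDl mul1r trigo.sinD sinpi !(mul0r, mulr0) addr0.
Qed.
Lemma un_2k1 : un x (2 * k).+1 = 1.
Proof.
apply: (mulIf (lt0r_neq0 sin_th1)); rewrite un_sin mul1r.
have -> : (2 * k).+1%:R * th = pi + (pi + th).
  by rewrite -k_th -[(2 * k).+1]addn1 natrD natrM; ring.
by rewrite trigo.sinD sinpi mul0r add0r cospi trigo.sinD sinpi cospi; ring.
Qed.
(** This number is the Gram determinant of two simple roots, so a finite dihedral pair spans a
    nondegenerate plane. *)
Lemma disc : 4%:R - x ^+ 2 != 0.
Proof.
have -> : 4%:R - x ^+ 2 = 4%:R * sin th ^+ 2.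
  by have := cos2Dsin2 th; rewrite /x => h; rewrite -[4%:R in LHS]mulr1 -{1}h; ring.
by rewrite mulf_neq0 ?pnatr_eq0 // expf_neq0 // lt0r_neq0 // sin_th1.
Qed.
End Trig.

Section Dihedral.
Variables (S : finType) (A : comNzRingType) (a : S -> S -> A) (s t : S) (x : A).
Hypotheses (ass : a s s = 2%:R) (att : a t t = 2%:R) (ast : a s t = - x) (ats : a t s = - x).
Let es := ev A s.
Let et := ev A t.
Lemma refl_s p q : refl a s (p *: es + q *: et) = (x * q - p) *: es + q *: et.
Proof.
rewrite /refl -bil_ev bilDr !bilZr !bil_evev ass ast.
by apply/ffunP => r; rewrite !vecE; ring.
Qed.
End Dihedral.

Section TitsRep.
Variables (S : finType) (m : S -> S -> nat) (hm : is_cox_graph m).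
(** Twice the cosine form: roots get norm 2, and the reflection formula involves no division. *)
Definition aR (s t : S) : RR := 2%:R * gram m s t.
Local Notation es := (ev RR).
Lemma mC s t : m s t = m t s. Proof. by case: hm. Qed.
Lemma aR_sym s t : aR s t = aR t s.
Proof. by rewrite /aR /gram eq_sym mC. Qed.
Lemma aR_diag s : aR s s = 2%:R.
Proof. by rewrite /aR /gram eqxx mulr1. Qed.
#[local] Hint Resolve aR_sym aR_diag : core.
Definition xx (k : nat) : RR := if k == 0%N then 2%:R else 2%:R * cos (pi / k%:R).
Lemma aR_off s t : s != t -> aR s t = - xx (m s t).
Proof.
move=> st; rewrite /aR /gram (negbTE st) /xx; case: ifP => _; first by rewrite mulrN mulr1.
by rewrite mulrN.
Qed.
Lemma m_ge2 s t : m s t != 0%N -> (2 <= m s t)%N.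
Proof. by case: hm => _ [_ /(_ s t)]; lia. Qed.
Lemma xxP k : k != 0%N -> xx k = 2%:R * cos (pi / k%:R).
Proof. by rewrite /xx => /negbTE->. Qed.

Lemma alt_ev s t n : s != t ->
  actw aR (alt n s t) (es s) =
  un (xx (m s t)) (2 * n).+1 *: es s + un (xx (m s t)) (2 * n) *: es t.
Proof.
move=> st; have ts : t != s by rewrite eq_sym.
elim: n => [|n IH]; first by rewrite un1 un0 scale1r scale0r addr0.
rewrite /= IH [X in refl _ _ (refl _ _ X)]addrC (@refl_s _ _ _ _ _ (xx (m s t)));
  rewrite ?aR_diag ?aR_off // mC //.
rewrite addrC (@refl_s _ _ _ _ _ (xx (m s t))) ?aR_diag ?aR_off // 1?mC //.
have -> : (2 * n.+1 = (2 * n).+2)%N by lia.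
by rewrite [un _ (2 * n).+3]unSS !unSS.
Qed.

Lemma alt_revE n (s t : S) : rev (alt n s t) = alt n t s.
Proof.
have h : forall n (s t : S) w, rcons (rcons (alt n s t) s) t ++ w = s :: t :: alt n s t ++ w.
  by elim=> [|k IH] //= u v w; rewrite IH.
elim: n => [|n IH] //=; rewrite !rev_cons IH.
by have := h n t s [::]; rewrite !cats0.
Qed.

(** The braid word acts trivially on the plane of the two simple roots by the Chebyshev values at
    2k, and on its orthogonal complement because both reflections do; the plane splits off by
    [disc]. *)
Lemma braid_act s t : s != t -> m s t != 0%N ->
  forall v, actw aR (alt (m s t) s t) v = v.
Proof.
move=> st mst.
have k2 := m_ge2 mst; have ts : t != s by rewrite eq_sym.
have fs : forall s t, s != t -> m s t != 0%N -> actw aR (alt (m s t) s t) (es s) = es s.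
  move=> s1 t1 st1 mst1; rewrite alt_ev // xxP // un_2k1 ?un_2k ?m_ge2 //.
  by rewrite scale1r scale0r addr0.
(* The braid word read backwards is the one with [s] and [t] exchanged, and it is the inverse
   map. *)
have ft : actw aR (alt (m s t) s t) (es t) = es t.
  have := fs t s ts; rewrite [m t s]mC => /(_ mst) {1}<-.
  by rewrite -alt_revE actw_revK.
move=> v; set x := xx (m s t).
have D : 4%:R - x ^+ 2 != 0 by rewrite /x xxP // disc.
set P := pair aR s v; set Q := pair aR t v.
(* Solution of the two linear equations that make [w] orthogonal to both simple roots. *)
pose p := (2%:R * P + x * Q) / (4%:R - x ^+ 2).
pose q := (2%:R * Q + x * P) / (4%:R - x ^+ 2).
pose w := v - p *: es s - q *: es t.
have vE : v = p *: es s + (q *: es t + w).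
  by apply/ffunP => r; rewrite /w !vecE; ring.
have pw r : pair aR r w = pair aR r v - p * aR r s - q * aR r t.
  by rewrite -!bil_ev /w !(bilDr, bilNr, bilZr) !bil_evev.
have ws : refl aR s w = w.
  rewrite /refl pw aR_diag (aR_off st) -/x -/P.
  have -> : P - p * 2%:R - q * - x = 0 by rewrite /p /q; field.
  by rewrite scale0r subr0.
have wt : refl aR t w = w.
  rewrite /refl pw aR_diag (aR_off ts) [m t s]mC -/x -/Q.
  have -> : Q - p * - x - q * 2%:R = 0 by rewrite /p /q; field.
  by rewrite scale0r subr0.
have fw n : actw aR (alt n s t) w = w by elim: n => //= n ->; rewrite wt ws.
by rewrite {1}vE !actwP fs // ft fw -vE.
Qed.

Lemma resp_aR u w v : coxeq m u w -> actw aR u v = actw aR w v.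
Proof.
move=> h; elim: h v => {u w} //.
- by move=> u v w _ h1 _ h2 x; rewrite h1 h2.
- by move=> b c u w _ IH v; rewrite !actw_cat IH.
- by move=> s v /=; rewrite reflK.
- by move=> s t st mst v; rewrite braid_act.
Qed.
End TitsRep.

(** * Lengths and positive roots *)

Section Length.
Variables (S : finType) (m : S -> S -> nat).
Lemma len_ex (g : cox m) : exists n, `[< exists w, size w = n /\ g = wd m w >].
Proof. by have [w ->] := wd_surj g; exists (size w); apply/asboolP; exists w. Qed.
Definition len (g : cox m) : nat := ex_minn (len_ex g).
Lemma lenP (g : cox m) : exists w, size w = len g /\ g = wd m w.
Proof. by rewrite /len; case: ex_minnP => n /asboolP h _. Qed.
Lemma len_wd w : (len (wd m w) <= size w)%N.
Proof. by rewrite /len; case: ex_minnP => n _; apply; apply/asboolP; exists w. Qed.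
Lemma len1 : len (1%g : cox m) = 0%N.
Proof. by apply/eqP; rewrite -leqn0 -(wd_nil m) (leq_trans (len_wd _)). Qed.
Lemma lenM (g h : cox m) : (len (g * h)%g <= len g + len h)%N.
Proof.
have [u [<- ->]] := lenP g; have [w [<- ->]] := lenP h.
by rewrite -wdM (leq_trans (len_wd _)) // size_cat.
Qed.
Lemma len_sg s : (len (sg m s) <= 1)%N. Proof. exact: len_wd. Qed.
Lemma lenMg (g : cox m) s : (len (g * sg m s)%g <= len g + 1)%N.
Proof. by apply: leq_trans (lenM _ _) _; rewrite leq_add2l len_sg. Qed.
Lemma mulgg (g : cox m) s : (g * sg m s * sg m s)%g = g.
Proof. by rewrite -mulgA sg_sq mulg1. Qed.
Lemma len_last (g : cox m) : g != 1%g -> exists s, (len (g * sg m s)%g < len g)%N.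
Proof.
move=> g1; have [w [ws gw]] := lenP g; case/lastP: w ws gw => [|w s] ws gw.
  by rewrite gw wd_nil eqxx in g1.
exists s; rewrite -ws gw -cats1 wdM mulgg size_cat addn1 ltnS.
exact: len_wd.
Qed.
End Length.

Section Tits.
Variables (S : finType) (m : S -> S -> nat) (hm : is_cox_graph m).
Local Notation es := (ev RR).
Local Notation "g ** v" := (ga (aR m) g v) (at level 40).
Local Notation B := (bil (aR m)).
Local Notation W := (cox m).
Let aRs := aR_sym hm.
Let aRd := aR_diag m.
Let aRr := resp_aR hm.
#[local] Hint Resolve aRs aRd aRr : core.

Section Alt.
Variables (s t : S).
(** Letters are added on the left, so the last letter is always [t]: this is the shape of the
    dihedral part of an element that [t] shortens. *)
Fixpoint ag (k : nat) : W :=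
  if k is k'.+1 then ((if odd k' then sg m s else sg m t) * ag k')%g else 1%g.
Lemma ag_len k : (len (ag k) <= k)%N.
Proof.
elim: k => [|k IH] /=; first by rewrite len1.
by apply: leq_trans (lenM _ _) _; rewrite -add1n leq_add //; case: ifP => _; apply: len_sg.
Qed.
Lemma agD j k : ~~ odd k -> ag (j + k) = (ag j * ag k)%g.
Proof.
move=> ek; elim: j => [|j IH] /=; first by rewrite mul1g.
by rewrite IH mulgA oddD (negbTE ek) addbF.
Qed.
Lemma ag2 j : ag (2 * j) = ((sg m s * sg m t) ^+ j)%g.
Proof.
elim: j => [|j IH] //; have -> : (2 * j.+1 = 2 + 2 * j)%N by lia.
by rewrite agD ?IH ?expgS /= ?mulg1 // oddM.
Qed.
End Alt.

Lemma expgMJ (x y : W) j : ((x * y) ^+ j * x = x * (y * x) ^+ j)%g.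
Proof. by elim: j => [|j IH]; rewrite ?expg0 ?mulg1 ?mul1g // expgS -!mulgA IH expgS !mulgA. Qed.
Lemma ag_braid s t : s != t -> m s t != 0%N -> ag s t (m s t) = ag t s (m s t).
Proof.
move=> st mst; have := sg_rel st mst; move: (m s t) => k hk.
set x := sg m s in hk *; set y := sg m t in hk *.
have xx : (x * x = 1)%g := sg_sq m s; have yy : (y * y = 1)%g := sg_sq m t.
have yxV : (y * x)%g = ((x * y)^-1)%g by rewrite invMg /x /y !sgV.
have inv j : ((x * y) ^+ j * (y * x) ^+ j = 1)%g.
  by rewrite yxV expVgn mulgV.
have [e|o] := boolP (odd k); last first.
  have -> : k = (2 * k./2)%N by rewrite -{1}(odd_double_half k) (negbTE o) -mul2n.
  rewrite !ag2 -/x -/y -[RHS]mul1g.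
  have -> : 1%g = ((x * y) ^+ (k./2) * (x * y) ^+ (k./2))%g :> W.
    by rewrite -expgnDr addnn -{1}hk -{1}(odd_double_half k) (negbTE o).
  by rewrite -!mulgA inv mulg1.
have hj : (2 * k./2).+1 = k by rewrite -{2}(odd_double_half k) e -mul2n.
rewrite -[in LHS]hj -[in RHS]hj /= !oddM /= !ag2 -/x -/y.
set j := k./2 in hj *.
have qq : ((x * (y * x) ^+ j) * (x * (y * x) ^+ j) = 1)%g.
  by rewrite -{1}expgMJ mulgA -[((x * y) ^+ j * x * x)%g]mulgA xx mulg1 inv.
apply: (mulIg (x * (y * x) ^+ j)%g); rewrite qq -mulgA [((x * y) ^+ j * (x * _))%g]mulgA expgMJ.
rewrite -!mulgA -expgnDr [(y * (x * _))%g]mulgA -expgS.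
by rewrite yxV expVgn addnn -mul2n hj hk invg1.
Qed.

Lemma ag_ev s t k : s != t ->
  let u := un (xx (m s t)) in
  ag s t k ** es s = (if odd k then u k else u k.+1) *: es s + (if odd k then u k.+1 else u k) *: es t.
Proof.
move=> st u; have ts : t != s by rewrite eq_sym.
elim: k => [|k IH]; first by rewrite /u ga1 // un1 un0 scale1r scale0r addr0.
rewrite /= gaM // IH; case: (odd k) => /=.
  have e1 : aR m s t = - xx (m s t) by rewrite aR_off.
  have e2 : aR m t s = - xx (m s t) by rewrite aR_off // (mC hm).
  by rewrite ga_sg // (@refl_s _ _ _ _ _ (xx (m s t))) ?aR_diag.
have e1 : aR m s t = - xx (m s t) by rewrite aR_off.
have e2 : aR m t s = - xx (m s t) by rewrite aR_off // (mC hm).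
rewrite ga_sg // addrC (@refl_s _ _ _ _ _ (xx (m s t))) ?aR_diag //.
by rewrite addrC.
Qed.

Definition posv (v : vec S RR) := forall r, 0 <= v r.
Lemma posv_ev s : posv (es s).
Proof. by move=> r; rewrite ffunE ler0n. Qed.
Lemma posvD u v : posv u -> posv v -> posv (u + v).
Proof. by move=> hu hv r; rewrite vecD addr_ge0. Qed.
Lemma posvZ x v : 0 <= x -> posv v -> posv (x *: v).
Proof. by move=> hx hv r; rewrite vecZ mulr_ge0. Qed.

Lemma un_xx_ge0 s t k : m s t = 0%N \/ (k <= m s t)%N -> 0 <= un (xx (m s t)) k.
Proof.
case: (boolP (m s t == 0%N)) => [/eqP->|mst [|]]; last 2 first.
- by move/eqP: mst.
- by rewrite xxP //; apply: un_ge0; apply: m_ge2.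
move=> _; have -> : un (xx 0) k = k%:R; last exact: ler0n.
elim/ind2: k => [||n IH1 IH2]; rewrite ?un0 ?un1 // unSS IH1 IH2 /xx eqxx.
by rewrite -addn2 -addn1 !natrD; ring.
Qed.

(** Induction on length. Write [g] as [v] times an alternating product in [s] and [t] with [v] as
    short as possible, so that neither letter shortens [v]. The alternating product sends [e_s] to a
    nonnegative combination of [e_s] and [e_t] as long as its length is below [m s t]. *)
Lemma tits_pos (g : W) s : (len g <= len (g * sg m s)%g)%N -> posv (g ** es s).
Proof.
have [n] := ubnP (len g); elim: n g s => // n IH g s /ltnSE gn gs.
have [->|g1] := eqVneq g 1%g; first by rewrite ga1 //; exact: posv_ev.
have [t gt] := len_last g1.
have st : s != t by apply: contraTneq gs => ->; rewrite -ltnNge.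
have ts : t != s by rewrite eq_sym.
pose Q j := `[< exists v k, [/\ (0 < k)%N, g = (v * ag s t k)%g, len v = j & (j + k = len g)%N] >].
have exQ : exists j, Q j.
  exists (len (g * sg m t)%g); apply/asboolP; exists (g * sg m t)%g, 1%N; split=> //.
    by rewrite /= mulg1 mulgg.
  apply/eqP; rewrite eqn_leq addn1 gt -addn1 /=.
  by have := lenMg (g * sg m t)%g t; rewrite mulgg.
case: (ex_minnP exQ) => j /asboolP [v [k [k0 gE vj jk]]] jmin.
(* A letter that shortens [v] either extends the alternating product, against the choice of [j], or
   cancels its first letter, against the length of [g]. *)
have minv r : r = s \/ r = t -> (len v <= len (v * sg m r)%g)%N.
  move=> rst; rewrite leqNgt; apply/negP => lt.
  pose c := if odd k then s else t.
  have agk : ag s t k.+1 = (sg m c * ag s t k)%g by rewrite /= /c; case: (odd k).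
  have [rc|rc] := eqVneq r c.
    have := jmin (len (v * sg m r)%g); rewrite -vj leqNgt lt /=.
    suff: Q (len (v * sg m r)%g) by move=> h /(_ h).
    apply/asboolP; exists (v * sg m r)%g, k.+1; split=> //.
      by rewrite agk rc mulgA mulgg -gE.
    apply/eqP; rewrite eqn_leq addnS -addSn -jk -vj leq_add2r lt /=.
    by rewrite addSn -addnS; have := lenMg (v * sg m r)%g r; rewrite mulgg addn1 -(leq_add2r k) addSn addnS.
  have rE : ag s t k = (sg m r * ag s t k.-1)%g.
    move: rc; rewrite /c; case: (k) k0 => [//|i] _ /=.
    by case: (odd i) => /=; case: rst => ->; rewrite ?eqxx.
  have : (len g <= len (v * sg m r)%g + k.-1)%N.
    rewrite gE rE mulgA; apply: leq_trans (lenM _ _) _.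
    by rewrite leq_add2l ag_len.
  by rewrite -jk -vj; lia.
have vn : (len v < n)%N by rewrite vj; lia.
have vs := IH v s vn (minv s (or_introl erefl)).
have vt := IH v t vn (minv t (or_intror erefl)).
(* At length [m s t] the braid relation would let the word end in [s], and [s] would shorten [g]. *)
have km : m s t = 0%N \/ (k < m s t)%N.
  case: (posnP (m s t)) => [->|m0]; [by left|right].
  rewrite ltnNge; apply/negP => mk.
  have mst : m s t != 0%N by rewrite -lt0n.
  have : (len (g * sg m s)%g <= j + (k - m s t) + (m s t).-1)%N; last by lia.
  have agD' : forall i l, exists2 b : W, ag s t (i + l) = (b * ag s t l)%g & (len b <= i)%N.
    elim=> [|i IHi] l; first by exists 1%g; rewrite ?mul1g ?len1.
    have [b bE bl] := IHi l; rewrite addSn /=.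
    exists ((if odd (i + l) then sg m s else sg m t) * b)%g; first by rewrite bE mulgA.
    by apply: leq_trans (lenM _ _) _; rewrite -add1n leq_add //; case: ifP => _; apply: len_sg.
  have [b bE bl] := agD' (k - m s t)%N (m s t).
  have tail : (len (ag s t (m s t) * sg m s)%g <= (m s t).-1)%N.
    rewrite ag_braid //; case: (m s t) m0 => [//|i] _.
    have agT : forall i, exists2 b : W, ag t s i.+1 = (b * sg m s)%g & (len b <= i)%N.
      elim=> [|l [c cE cl]]; first by exists 1%g; rewrite ?mul1g /= ?mulg1 ?len1.
      have -> : ag t s l.+2 = ((if odd l.+1 then sg m t else sg m s) * ag t s l.+1)%g by [].
      exists ((if odd l.+1 then sg m t else sg m s) * c)%g; first by rewrite cE mulgA.
      by apply: leq_trans (lenM _ _) _; rewrite -add1n leq_add //; case: ifP => _; apply: len_sg.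
    by have [c -> cl] := agT i; rewrite mulgg.
  rewrite subnK // in bE; rewrite gE bE -!mulgA.
  apply: leq_trans (lenM _ _) _; rewrite vj -addnA leq_add2l.
  by apply: leq_trans (lenM _ _) _; rewrite leq_add.
rewrite gE gaM // ag_ev //= linearD !linearZ /=.
have u0 i : (i <= k.+1)%N -> 0 <= un (xx (m s t)) i.
  by move=> ik; apply: un_xx_ge0; case: km; [left|right; lia].
by apply: posvD; apply: posvZ; (exact: vs || exact: vt || (case: (odd k); apply: u0)).
Qed.
End Tits.

Lemma inj_unbounded (T : eqType) (f : nat -> T) (l : seq T) :
  injective f -> ~ (forall n, f n \in l).
Proof.
move=> fi h; have : (size [seq f i | i <- seq.iota 0 (size l).+1] <= size l)%N.
  apply: uniq_leq_size; first by rewrite map_inj_uniq ?iota_uniq.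
  by move=> x /mapP[i _ ->].
by rewrite size_map seq.size_iota ltnn.
Qed.

Lemma un_incr (k : RR) n : 2%:R <= k -> un k n + 1 <= un k n.+1 /\ 0 <= un k n.
Proof.
move=> k2; elim: n => [|n [IH1 IH2]]; first by rewrite un0 un1; lra.
by rewrite unSS; split; nra.
Qed.

(** * Roots and the walls that separate chambers *)

Section Roots.
Variables (S : finType) (m : S -> S -> nat) (hm : is_cox_graph m).
Local Notation es := (ev RR).
Local Notation "g ** v" := (@ga S m _ (aR m) g v) (at level 40).
Local Notation B := (bil (aR m)).
Local Notation W := (cox m).
Local Notation vv := (vec S RR).
Let aRs := aR_sym hm.
Let aRd := aR_diag m.
Let aRr := resp_aR hm.
#[local] Hint Resolve aRs aRd aRr : core.

Definition wroot (b : vv) := exists (g : W) s, b = g ** es s.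
Lemma root_ev s : wroot (es s).
Proof. by exists 1%g, s; rewrite ga1. Qed.
Lemma root_ga g b : wroot b -> wroot (g ** b).
Proof. by move=> [h [s ->]]; exists (g * h)%g, s; rewrite gaM. Qed.
Lemma root_B b : wroot b -> B b b = 2%:R.
Proof. by move=> [h [s ->]]; rewrite root2. Qed.
Lemma ga_refl s v : sg m s ** v = refl (aR m) s v. Proof. by rewrite ga_sg. Qed.
Lemma ga_ev s : sg m s ** es s = - es s.
Proof. by rewrite ga_refl refl_rv rv_self // ev2. Qed.
Lemma rootN b : wroot b -> wroot (- b).
Proof.
move=> [h [s ->]]; exists (h * sg m s)%g, s.
by rewrite gaM // ga_ev gaN.
Qed.
Lemma root_sign b : wroot b -> posv b \/ posv (- b).
Proof.
move=> [g [s ->]]; have [h|h] := leqP (len g) (len (g * sg m s)%g).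
  by left; apply: tits_pos.
right; have := @tits_pos _ _ hm (g * sg m s)%g s.
by rewrite mulgg gaM // ga_ev gaN; apply; apply: ltnW.
Qed.
Lemma root_neq0 b : wroot b -> b != 0.
Proof.
move=> h; apply/eqP => b0; have := root_B h; rewrite b0 bil0l => /esym/eqP.
by rewrite pnatr_eq0.
Qed.
Lemma posv_excl b : wroot b -> posv b -> ~ posv (- b).
Proof.
move=> /root_neq0 b0 h1 h2; move/eqP: b0; apply; apply/ffunP => r; apply/eqP.
by rewrite ffunE eq_le h1 andbT -oppr_ge0; have := h2 r; rewrite vecN.
Qed.
Lemma nposv b : wroot b -> ~ posv b -> posv (- b).
Proof. by move=> /root_sign[]. Qed.

Definition cs (v : vv) : RR := \sum_r v r.
Lemma csD u v : cs (u + v) = cs u + cs v.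
Proof. by rewrite /cs -big_split; apply: eq_bigr => r _; rewrite vecD. Qed.
Lemma csZ x v : cs (x *: v) = x * cs v.
Proof. by rewrite /cs mulr_sumr; apply: eq_bigr => r _; rewrite vecZ. Qed.
Lemma csN v : cs (- v) = - cs v.
Proof. by rewrite -scaleN1r csZ mulN1r. Qed.
Lemma aR_le2 s t : aR m s t <= 2%:R.
Proof.
rewrite /aR /gram; case: ifP => _; first by rewrite mulr1.
case: ifP => _; first by lra.
by have /ler_normlP[] := cos_max (pi / (m s t)%:R : RR); lra.
Qed.
(** All entries of the form are at most 2, so the norm of a nonnegative vector is at most twice the
    square of its coordinate sum. *)
Lemma cs_ge1 b : wroot b -> posv b -> 1 <= cs b.
Proof.
move=> rb pb; have c0 : 0 <= cs b by apply: sumr_ge0 => r _; apply: pb.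
suff: 2%:R <= 2%:R * (cs b * cs b) by nra.
rewrite -{1}(root_B rb) /bil /cs mulr_suml mulr_sumr; apply: ler_sum => s _.
rewrite /pair mulrCA; apply: ler_wpM2l; first exact: pb.
rewrite mulr_sumr; apply: ler_sum => t _; apply: ler_wpM2r; first exact: pb.
exact: aR_le2.
Qed.

(** The reflection changes only the coordinate at [s]. If the image were negative, all other
    coordinates would vanish, and norm 2 leaves only [e_s]. *)
Lemma pos_refl b s : wroot b -> posv b -> b != es s -> posv (sg m s ** b).
Proof.
move=> rb pb bs; have rsb := root_ga (sg m s) rb.
case: (root_sign rsb) => // neg; case/eqP: bs.
have h r : r != s -> b r = 0.
  move=> rs; apply/eqP; rewrite eq_le pb andbT -oppr_ge0.
  by have := neg r; rewrite vecN ga_refl /refl !vecE ffunE (negbTE rs) mulr0 subr0.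
have bE : b = b s *: es s.
  apply/ffunP => r; rewrite vecZ ffunE; have [->|rs] := eqVneq r s; first by rewrite mulr1.
  by rewrite h // mulr0.
have := root_B rb; have := pb s; move: (b s) bE => c ->.
rewrite bilZl bilZr ev2 // => c0 c2.
have -> : c = 1 by nra.
by rewrite scale1r.
Qed.

(** The walls crossed by the gallery that reads [p] from the fundamental chamber, each oriented
    towards the chamber being left. *)
Fixpoint proots (p : seq S) : seq vv :=
  if p is s :: p' then es s :: map (refl (aR m) s) (proots p') else [::].
Lemma proots_sep p b : wroot b -> posv b -> posv (- ((wd m p)^-1%g ** b)) -> b \in proots p.
Proof.
elim: p b => [|s p IH] b rb pb.
  by rewrite wd_nil invg1 ga1 // => /(posv_excl rb pb).
rewrite wd_cons invMg gaM // sgV => neg /=; rewrite inE.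
have [->//|bs] := eqVneq b (es s); rewrite orFb.
have := IH _ (root_ga (sg m s) rb) (pos_refl rb pb bs) neg; rewrite ga_refl => h.
by apply/mapP; exists (refl (aR m) s b); rewrite ?reflK.
Qed.

Definition sepl (g h : W) : seq vv := map (ga (aR m) g) (proots (wrep (g^-1 * h)%g)).
Lemma sep_fin g h b : wroot b -> posv (g^-1%g ** b) -> posv (- (h^-1%g ** b)) -> b \in sepl g h.
Proof.
move=> rb p1 p2; rewrite /sepl -[b](gaVK aRr g) map_f //.
apply: proots_sep => //; first exact: root_ga.
by rewrite wd_repr invMg invgK gaM // gaVK.
Qed.

Lemma cox_faithful (g : W) : (forall s, g ** es s = es s) -> g = 1%g.
Proof.
move=> h; apply/eqP; apply/negP => /negP /len_last [s lt].
have := @tits_pos _ _ hm (g * sg m s)%g s; rewrite mulgg => /(_ (ltnW lt)).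
rewrite gaM // ga_ev gaN h => ng.
by apply: (posv_excl (root_ev s)) ng; apply: posv_ev.
Qed.
Lemma cox_faithful2 (g h : W) : (forall s, g ** es s = h ** es s) -> g = h.
Proof.
move=> e; have e1 : (h^-1 * g)%g = 1%g by apply: cox_faithful => s; rewrite gaM // e gaK.
by rewrite -[g](mulVKg h) e1 mulg1.
Qed.

Lemma root_refl b : wroot b -> exists r : W, (r * r = 1)%g /\ forall v, r ** v = rv (aR m) b v.
Proof.
move=> [g [s ->]]; exists (g * sg m s * g^-1)%g; split; last by move=> v; rewrite ga_conj.
by rewrite -!mulgA mulKg [(sg m s * (sg m s * _))%g]mulgA sg_sq mul1g mulgV.
Qed.

(* Otherwise infinitely many roots in the plane of b and c separate g from h. *)
Lemma nested b c g h : wroot b -> wroot c -> 2%:R <= B b c ->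
  posv (g^-1%g ** b) -> posv (- (g^-1%g ** c)) ->
  posv (- (h^-1%g ** b)) -> posv (h^-1%g ** c) -> False.
Proof.
move=> rb rc k2 gb gc hb hc; set k := B b c in k2.
have [r [rr rE]] := root_refl rb; have [q [qq qE]] := root_refl rc.
(* Images of [b] under the powers of the product of the two reflections; their coefficients increase
   because [k] is at least 2. *)
pose d n := un k (2 * n).+1 *: b - un k (2 * n) *: c.
have dr n : wroot (d n).
  elim: n => [|n IH]; first by rewrite /d un1 un0 scale1r scale0r subr0.
  have -> : d n.+1 = (r * q)%g ** d n; last exact: root_ga.
  rewrite gaM // rE qE /d /rv !(bilDr, bilNr, bilZr, root_B) // (bilC aRs c b) -/k.
  have -> : (2 * n.+1 = (2 * n).+2)%N by lia.
  rewrite [un _ (2 * n).+3]unSS !unSS.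
  by apply/ffunP => x; rewrite !vecE; ring.
have u0 n : 0 <= un k n by case: (un_incr n k2).
have dl n : d n \in sepl g h.
  apply: sep_fin => //; rewrite /d gaB !gaZ.
    by apply: posvD; [apply: posvZ | rewrite -scalerN; apply: posvZ].
  by rewrite opprB; apply: posvD; [apply: posvZ | rewrite -scalerN; apply: posvZ].
have rgb : wroot (g^-1%g ** b) by apply: root_ga.
have rgc : wroot (- (g^-1%g ** c)) by apply/rootN/root_ga.
have c1 := cs_ge1 rgb gb; have c2 := cs_ge1 rgc gc.
have inc i : cs (g^-1%g ** d i) < cs (g^-1%g ** d i.+1).
  rewrite /d !gaB !gaZ !csD !csN !csZ; rewrite csN in c2.
  have [a1 _] := un_incr (2 * i) k2; have [a2 _] := un_incr (2 * i).+1 k2.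
  have [a3 _] := un_incr (2 * i).+2 k2.
  have -> : (2 * i.+1 = (2 * i).+2)%N by lia.
  by nra.
apply: (inj_unbounded _ dl) => i j dij.
have mono : {homo (fun i => cs (g^-1%g ** d i)) : x y / (x < y)%N >-> x < y}.
  by apply: homo_ltn => //; apply: lt_trans.
by case: (ltngtP i j) => // /mono; rewrite dij ltxx.
Qed.

Definition sg_pos (g : W) (b : vv) : bool := `[< posv (g^-1%g ** b) >].
Lemma sg_posN g b : wroot b -> sg_pos g (- b) = ~~ sg_pos g b.
Proof.
move=> rb; have rg := root_ga g^-1%g rb; rewrite /sg_pos gaN.
apply/idP/idP => [/asboolP h|/asboolPn h].
  by apply/asboolPn => h2; exact: (posv_excl rg h2 h).
by apply/asboolP; apply: nposv.
Qed.
Lemma sg_posF g b : wroot b -> sg_pos g b = false -> posv (- (g^-1%g ** b)).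
Proof. by move=> rb /negbT; rewrite -sg_posN // /sg_pos gaN => /asboolP. Qed.
(** Two such walls do not cross, so one of the four intersections of their half-spaces is empty;
    changing the sign of [c] if necessary reduces this to [nested]. *)
Lemma quad b c (g1 g2 g3 g4 : W) : wroot b -> wroot c -> 2%:R <= `|B b c| ->
  sg_pos g1 b -> sg_pos g1 c -> sg_pos g2 b -> ~~ sg_pos g2 c ->
  ~~ sg_pos g3 b -> sg_pos g3 c -> ~~ sg_pos g4 b -> ~~ sg_pos g4 c -> False.
Proof.
move=> rb rc; rewrite ler_normr => /orP[k2|k2] h1 h2 h3 h4 h5 h6 h7 h8.
  apply: (nested rb rc k2 (asboolP _ h3) _ _ (asboolP _ h6)).
    by apply: sg_posF => //; apply: negbTE.
  by apply: sg_posF => //; apply: negbTE.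
have rn := rootN rc; rewrite -bilNr in k2.
apply: (@nested _ _ g1 g4 rb rn k2); first exact/asboolP.
- by rewrite gaN opprK; apply/asboolP.
- by apply: sg_posF => //; apply: negbTE.
- by rewrite gaN; apply: sg_posF => //; apply: negbTE.
Qed.

(* If |B b c| < 2, the coordinate sums a_i of the roots (r q)^i b eventually have constant sign and absolute value at least 1, and satisfy a_(i+1) + a_(i-1) = tau a_i with tau < 2, which is impossible. *)
Lemma inf_order b c (r q : W) : wroot b -> wroot c ->
  (forall v, r ** v = rv (aR m) b v) -> (forall v, q ** v = rv (aR m) c v) ->
  (forall n, (0 < n)%N -> ((r * q) ^+ n)%g <> 1%g) -> 2%:R <= `|B b c|.
Proof.
move=> rb rc rE qE inf; rewrite leNgt; apply/negP => /ltr_normlP[k1 k2].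
set k := B b c in k1 k2.
have bb := root_B rb; have cc := root_B rc.
have rr : (r * r = 1)%g by apply: cox_faithful => s; rewrite gaM // !rE rvK.
have qq : (q * q = 1)%g by apply: cox_faithful => s; rewrite gaM // !qE rvK.
have rV : (r^-1 = r)%g by apply: mulg1_eq.
have qV : (q^-1 = q)%g by apply: mulg1_eq.
set x := (r * q)%g in inf; have xV : (x^-1 = q * r)%g by rewrite invMg rV qV.
pose v i := (x ^+ i)%g ** b.
have vr i : wroot (v i) by apply: root_ga.
have rec i : v i.+2 = (k ^+ 2 - 2%:R) *: v i.+1 - v i.
  have e : x ** b + x^-1%g ** b = (k ^+ 2 - 2%:R) *: b.
    rewrite xV !gaM // !rE !qE /rv !(bilDr, bilNr, bilZr) bb (bilC aRs c b) -/k.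
    by apply/ffunP => y; rewrite !vecE; ring.
  have e1 : v i.+2 = (x ^+ i.+1)%g ** (x ** b) by rewrite -gaM // -expgSr.
  have e2 : v i = (x ^+ i.+1)%g ** (x^-1%g ** b) by rewrite -gaM // expgSr mulgK.
  by rewrite e1 e2 /v -gaZ -e gaD addrK.
have xr n : (r * x ^+ n * r = x ^- n)%g.
  have cE y : (r * y * r = y ^ r)%g by rewrite conjgE rV mulgA.
  by rewrite cE conjXg -cE /x !mulgA rr mul1g -xV expVgn.
(* If a positive power of [x] fixes [b], it commutes with the reflection in [b], which also inverts
   it; then [x] has finite order. *)
have vinj : injective v.
  suff h : forall i d, v i = v (i + d.+1)%N -> False.
    move=> i j e; case: (ltngtP i j) => // lt; [case: (h i (j - i).-1)|case: (h j (i - j).-1)].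
      by rewrite prednK ?subn_gt0 // subnKC // ltnW.
    by rewrite prednK ?subn_gt0 // subnKC // ltnW.
  move=> i d; rewrite /v expgnDr gaM // => /(ga_inj aRr) e.
  have c1 : (x ^+ d.+1 * r * x ^- d.+1 = r)%g.
    apply: cox_faithful2 => s; rewrite !gaM // !rE /ga actw_rv // -/(ga (m:=m) _ _ _) -/(ga (m:=m) _ _ _).
    by rewrite -[ga _ _ b]e gaVK.
  have c2 : (x ^+ d.+1 = x ^- d.+1)%g.
    have c3 : (r * x ^+ d.+1 = x ^+ d.+1 * r)%g by rewrite -{1}c1 mulgVK.
    by rewrite -xr c3 -mulgA rr mulg1.
  apply: (inf (d.+1 + d.+1)%N) => //.
  by rewrite expgnDr {2}c2 mulgV.
(* Each sign change along the orbit is a root, up to sign, whose wall separates 1 from the inverse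
   of [x]; there are finitely many of these. *)
have fin : exists N, forall i, (N <= i)%N -> `[< posv (v i) >] = `[< posv (v i.+1) >].
  apply: contrapT => nf.
  have ex N : exists i, (N <= i)%N /\ `[< posv (v i) >] <> `[< posv (v i.+1) >].
    by apply: contrapT => h; apply: nf; exists N => i Ni; apply: contrapT => h2; apply: h; exists i.
  pose nx N := projT1 (cid (ex N)).
  have nxP N : (N <= nx N)%N /\ `[< posv (v (nx N)) >] <> `[< posv (v (nx N).+1) >].
    by rewrite /nx; case: cid.
  pose f := fix f n := if n is n'.+1 then nx (f n').+1 else nx 0%N.
  have fmono : {homo f : i j / (i < j)%N >-> (i < j)%N}.
    apply: (@homo_ltn _ f (fun i j => (i < j)%N)) => [y z w|i]; first exact: ltn_trans.
    by have [] := nxP (f i).+1.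
  have fne i : `[< posv (v (f i)) >] <> `[< posv (v (f i).+1) >].
    by case: i => [|i] /=; [case: (nxP 0%N)|case: (nxP (f i).+1)].
  pose w i := v (f i).
  have winj : injective w.
    move=> i j /vinj e; case: (ltngtP i j) => // /fmono; rewrite e ltnn //.
  apply: (inj_unbounded (f := w) (l := sepl 1%g x^-1%g ++ map -%R (sepl 1%g x^-1%g))) => // i.
  have vS : v (f i).+1 = x^-1^-1%g ** v (f i) by rewrite invgK -gaM // -expgS.
  rewrite mem_cat; have := fne i; rewrite vS /w.
  case: asboolP => p1; case: asboolP => p2 // _.
    by rewrite (@sep_fin 1%g) // ?invg1 ?ga1 //; apply: nposv => //; apply: root_ga.
  apply/orP; right; rewrite -[v _]opprK map_f //.
  apply: sep_fin => //; first exact: rootN.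
    by rewrite invg1 ga1 //; apply: nposv.
  by rewrite gaN opprK.
case: fin => N hN.
have [eps epos] : exists eps : RR, forall i, (N <= i)%N -> eps ^+ 2 = 1 /\ 1 <= eps * cs (v i).
  have st i : `[< posv (v (N + i)%N) >] = `[< posv (v N) >].
    by elim: i => [|i <-]; rewrite ?addn0 // addnS -hN // leq_addr.
  exists (if `[< posv (v N) >] then 1 else -1) => i Ni; split; first by case: ifP => _; ring.
  have := st (i - N)%N; rewrite subnKC // => <-; case: asboolP => p.
    by rewrite mul1r cs_ge1.
  by rewrite mulN1r -csN; apply: cs_ge1; [apply: rootN|apply: nposv].
pose A i := eps * cs (v (N + i)%N).
have A1 i : 1 <= A i by case: (epos (N + i)%N) => //; rewrite leq_addr.
have Ar i : A i.+2 = (k ^+ 2 - 2%:R) * A i.+1 - A i.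
  by rewrite /A !addnS rec csD csN csZ; ring.
pose dl := 4%:R - k ^+ 2; have dl0 : 0 < dl by rewrite /dl; nra.
have dec i : A i.+1 - A i <= A 1%N - A 0%N - i%:R * dl.
  elim: i => [|i IH]; first by lra.
  have : dl <= dl * A i.+1 by rewrite ler_peMr // ltW.
  by rewrite Ar; move: IH; rewrite -[i.+1%:R]natr1 /dl; lra.
have [n hn] : exists n : nat, `|A 1%N - A 0%N| / dl < n%:R.
  by exists (Num.bound (`|A 1%N - A 0%N| / dl)); rewrite archi_boundP // divr_ge0 // ltW.
have le0 i : A (n + i).+1 - A (n + i)%N <= - (i%:R * dl).
  apply: le_trans (dec _) _; rewrite natrD mulrDl.
  move: hn; rewrite ltr_pdivrMr // => hn.
  by have := ler_norm (A 1%N - A 0%N); lra.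
have bd i : A (n + 1 + i)%N <= A (n + 1)%N - i%:R * dl.
  elim: i => [|i IH]; first by rewrite addn0 mul0r subr0.
  have := le0 (1 + i)%N; rewrite addnA => h; rewrite addnS -natr1.
  have : 0 <= i%:R * dl by rewrite mulr_ge0 // ltW.
  rewrite natrD in h; lra.
have [l hl] : exists l : nat, A (n + 1)%N / dl < l%:R.
  exists (Num.bound (A (n + 1)%N / dl)); rewrite archi_boundP // divr_ge0 // ?ltW //.
  by apply: lt_le_trans (A1 _).
have := bd l; have := A1 (n + 1 + l)%N; move: hl; rewrite ltr_pdivrMr //; lra.
Qed.

Lemma len_wdV (p : seq S) : len ((wd m p)^-1)%g = len (wd m p).
Proof.
have h (g : W) : (len (g^-1)%g <= len g)%N.
  by have [w [<- ->]] := lenP g; rewrite -wd_rev (leq_trans (len_wd _ _)) // size_rev.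
by apply/eqP; rewrite eqn_leq h -{1}[wd m p]invgK h.
Qed.

Lemma proots_cat p q : proots (p ++ q) = proots p ++ map (actw (aR m) p) (proots q).
Proof.
elim: p => [|s p IH] /=; first by rewrite map_id.
by rewrite IH map_cat -map_comp.
Qed.

(** Prefixes and suffixes of a reduced word are reduced, so [tits_pos] applies on both sides of each
    crossing. *)
Lemma reduced_sep p b : size p = len (wd m p) -> b \in proots p ->
  [/\ wroot b, sg_pos 1%g b & ~~ sg_pos (wd m p) b].
Proof.
move=> red; have prefixes : forall p1 s p2, p = p1 ++ s :: p2 ->
    let c := wd m p1 ** es s in [/\ wroot c, sg_pos 1%g c & ~~ sg_pos (wd m p) c].
  move=> p1 s p2 pE c.
  have rc : wroot c by apply/root_ga/root_ev.
  have l1 : len (wd m p1) = size p1.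
    apply/eqP; rewrite eqn_leq len_wd /=; have := red; rewrite pE wdM size_cat => e.
    have := lenM (wd m p1) (wd m (s :: p2)); rewrite -e.
    by have := len_wd m (s :: p2); lia.
  have l2 : len (wd m (s :: p2)) = size (s :: p2).
    apply/eqP; rewrite eqn_leq len_wd /=; have := red; rewrite pE wdM size_cat => e.
    by have := lenM (wd m p1) (wd m (s :: p2)); rewrite -e l1 /=; lia.
  split=> //.
    apply/asboolP; rewrite invg1 ga1 //; apply: tits_pos => //.
    have := red; rewrite pE -cat1s catA wdM size_cat => e.
    have := lenM (wd m (p1 ++ [:: s])) (wd m p2); rewrite -e size_cat wdM -/(sg m s) l1.
    by have := len_wd m p2; rewrite /=; lia.
  rewrite -sg_posN //; apply/asboolP.
  have -> : (wd m p)^-1%g ** - c = (wd m p2)^-1%g ** es s.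
    by rewrite pE wdM wd_cons !invMg sgV /c !gaM // gaN gaK // gaN ga_ev opprK.
  apply: tits_pos => //; rewrite len_wdV; apply: leq_trans (len_wd _ _) _.
  have -> : ((wd m p2)^-1 * sg m s)%g = ((wd m (s :: p2))^-1)%g by rewrite wd_cons invMg sgV.
  by rewrite len_wdV l2 /=.
have h : forall q p1, p = p1 ++ q -> b \in map (actw (aR m) p1) (proots q) ->
    exists s p2 p3, p = p2 ++ s :: p3 /\ b = wd m p2 ** es s.
  elim=> [|s q IH] p1 pE //=; rewrite inE => /orP[/eqP->|].
    by exists s, p1, q; split=> //; rewrite ga_wd.
  rewrite -map_comp => hb; apply: (IH (p1 ++ [:: s])); first by rewrite -catA.
  by apply: etrans hb; congr (_ \in _); apply: eq_map => v; rewrite actw_cat.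
move=> bp; have [|s [p2 [p3 [pE ->]]]] := h p [::] erefl; last exact: prefixes pE.
by rewrite map_id.
Qed.
End Roots.

Notation pos_at := sg_pos.

(** * Reduction of the reflection representation to finite fields *)

(** Elements of Z[c] are handled as integer polynomials, and an identity in Z[c] is the vanishing of
    [evp c]. *)
Definition evp (A : comNzRingType) (x : A) : {poly int} -> A :=
  horner_eval x \o map_poly (intr : int -> A).
HB.instance Definition _ (A : comNzRingType) (x : A) := GRing.RMorphism.copy (evp x)
  (horner_eval x \o map_poly (intr : int -> A)).

Lemma evpC (A : comNzRingType) (x : A) (k : int) : evp x k%:P = k%:~R.
Proof. by rewrite /evp /= /horner_eval map_polyC hornerC. Qed.
Lemma evpX (A : comNzRingType) (x : A) : evp x 'X = x.
Proof. by rewrite /evp /= /horner_eval map_polyX hornerX. Qed.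
Lemma evpZ (A : comNzRingType) (x : A) (k : int) f : evp x (k *: f) = k%:~R * evp x f.
Proof. by rewrite -mul_polyC rmorphM /= evpC. Qed.

Section MinPoly.
Variables (c : RR) (h0 : {poly int}) (h00 : h0 != 0) (h0c : evp c h0 = 0).

Lemma min_ex : exists f0 : {poly int}, [/\ f0 != 0, evp c f0 = 0 &
  forall f, f != 0 -> evp c f = 0 -> (size f0 <= size f)%N].
Proof.
pose P n := `[< exists f : {poly int}, [/\ f != 0, evp c f = 0 & size f = n] >].
have exP : exists n, P n by exists (size h0); apply/asboolP; exists h0.
case: (ex_minnP exP) => n /asboolP [f [f0 fc <-]] mn; exists f; split=> // g g0 gc.
by apply: mn; apply/asboolP; exists g.
Qed.
Definition mp := projT1 (cid min_ex).
Lemma mp0 : mp != 0. Proof. by rewrite /mp; case: cid => f []. Qed.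
Lemma mpc : evp c mp = 0. Proof. by rewrite /mp; case: cid => f []. Qed.
Lemma mp_min f : f != 0 -> evp c f = 0 -> (size mp <= size f)%N.
Proof. by rewrite /mp; case: (cid min_ex) => g [h1 h2 h3]; apply: h3. Qed.
Lemma mp_size : (1 < size mp)%N.
Proof.
rewrite ltnNge; apply/negP => /size1_polyC e.
have := mpc; rewrite e evpC => /eqP; rewrite intr_eq0 => /eqP k0.
by have := mp0; rewrite e k0 eqxx.
Qed.
Lemma pdivE (f g : {poly int}) : g != 0 -> exists k q r,
  lead_coef g ^+ k *: f = q * g + r /\ (size r < size g)%N.
Proof.
move=> g0; exists (scalp f g), (f %/ g), (f %% g).
by rewrite ltn_modp g0 Pdiv.Idomain.divp_eq.
Qed.
(** Pseudo-division: the remainder vanishes at [c] and is smaller than [mp]. Only the leading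
    coefficient of [mp] has to be inverted later. *)
Lemma mp_dvd f : evp c f = 0 -> exists k q, lead_coef mp ^+ k *: f = q * mp.
Proof.
move=> fc; have [k [q [r [e sr]]]] := pdivE f mp0; exists k, q.
suff r0 : r = 0 by rewrite r0 addr0 in e.
apply/eqP; apply: contraTT sr => r0; rewrite -leqNgt; apply: mp_min => //.
have := congr1 (evp c) e; rewrite rmorphD rmorphM /= mpc mulr0 add0r evpZ fc mulr0.
by move=> <-.
Qed.
(** A nonzero element of least size in the ideal of [f] and [mp] divides both up to powers of its
    leading coefficient, hence does not vanish at [c]. Its cofactor in [mp] does vanish there and so
    is at least as large as [mp], which leaves only a constant. *)
Lemma bezout f : evp c f != 0 -> exists u v (n : int), n != 0 /\ u * f + v * mp = n%:P.
Proof.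
move=> fc.
pose P n := `[< exists h u v : {poly int}, [/\ h != 0, h = u * f + v * mp & size h = n] >].
have exP : exists n, P n.
  exists (size mp); apply/asboolP; exists mp, 0, 1; split=> //; first exact: mp0.
  by rewrite mul0r mul1r add0r.
case: (ex_minnP exP) => n /asboolP [h [u [v [hn0 hE hs]]]] mn.
have red : forall g a b, g = a * f + b * mp -> exists k q, lead_coef h ^+ k *: g = q * h.
  move=> g a b gE; have [k [q [r [e sr]]]] := pdivE g hn0; exists k, q.
  suff r0 : r = 0 by rewrite r0 addr0 in e.
  apply/eqP; apply: contraTT sr => r0; rewrite -leqNgt hs; apply: mn; apply/asboolP.
  exists r, ((lead_coef h ^+ k)%:P * a - q * u), ((lead_coef h ^+ k)%:P * b - q * v).
  split=> //; have -> : r = lead_coef h ^+ k *: g - q * h by rewrite e addrC addKr.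
  by rewrite -mul_polyC gE hE; ring.
have [k [q e]] : exists k q, lead_coef h ^+ k *: f = q * h.
  by apply: (red f 1 0); rewrite mul1r mul0r addr0.
have hc : evp c h != 0.
  apply: contraNneq fc => hc; have := congr1 (evp c) e; rewrite rmorphM /= hc mulr0 evpZ.
  move/eqP; rewrite mulf_eq0 intr_eq0 expf_eq0 lead_coef_eq0 (negbTE hn0) andbF /=.
  by [].
have [k' [q' e']] : exists k q, lead_coef h ^+ k *: mp = q * h.
  by apply: (red mp 0 1); rewrite mul1r mul0r add0r.
have q'0 : q' != 0.
  apply/eqP => q0; move: e'; rewrite q0 mul0r => /eqP.
  by rewrite -mul_polyC mulf_eq0 polyC_eq0 expf_eq0 lead_coef_eq0 (negbTE hn0) (negbTE mp0) andbF.
have q'c : evp c q' = 0.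
  have := congr1 (evp c) e'; rewrite rmorphM /= evpZ mpc mulr0 => /esym/eqP.
  by rewrite mulf_eq0 (negbTE hc) orbF => /eqP.
have := mp_min q'0 q'c => le.
have sh : (size h <= 1)%N.
  have := congr1 (fun p : {poly int} => size p) e'; rewrite size_mul //.
  rewrite size_scale ?expf_eq0 ?lead_coef_eq0 ?(negbTE hn0) ?andbF // => es.
  by move: le es; move: mp_size; set A := size mp; set B := size q'; set C := size h; lia.
exists u, v, (h`_0); split; last by rewrite -hE; apply: size1_polyC.
by apply: contraNneq hn0 => h0'; rewrite (size1_polyC sh) h0'.
Qed.
End MinPoly.

Lemma int_char (F : fieldType) (p : nat) (n : int) : p \in [pchar F] -> n != 0 ->
  (`|n| < p)%N -> n%:~R != 0 :> F.
Proof.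
move=> pF n0 np; have h : (`|n|%N)%:R != 0 :> F.
  by rewrite -(dvdn_pcharf pF) gtnNdvd // absz_gt0.
by case: (intP n) h => // k; rewrite ?abszN /= ?mulrNz ?oppr_eq0.
Qed.

Section FinField.
Lemma ff_root (p : nat) (f : {poly int}) : prime p -> (1 < size f)%N ->
  ((lead_coef f)%:~R != 0 :> 'F_p) ->
  exists (F : finFieldType) (g : F), p \in [pchar F] /\ evp g f = 0.
Proof.
move=> pp sf lf; pose fp := map_poly (intr : int -> 'F_p) f.
have sfp : size fp = size f by rewrite size_map_poly_id0.
have fp0 : fp != 0 by rewrite -size_poly_gt0 sfp; lia.
case: (FinSplittingFieldFor fp0) => L [rs rsE _].
have pL : p \in [pchar L] by rewrite pchar_lalg pchar_Fp.
have mE : map_poly (in_alg L) fp = map_poly (intr : int -> L) f.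
  by rewrite /fp -map_poly_comp; apply: eq_map_poly => x; exact: (rmorph_int (in_alg L)).
case: rs rsE => [|g rs] rsE.
  have := eqp_size rsE; rewrite big_nil size_poly1 size_map_poly sfp; lia.
exists (FinFieldExtType L), (g : FinFieldExtType L); split=> //.
have : root (map_poly (in_alg L) fp) g by rewrite (eqp_root rsE) big_cons rootM root_XsubC eqxx.
by rewrite mE => /rootP.
Qed.
End FinField.

Section Spec0.
Variables (c : RR) (h0 : {poly int}) (h00 : h0 != 0) (h0c : evp c h0 = 0).
(** Take a root of [mp] modulo a large prime. Polynomials vanishing at [c] are multiples of [mp] up
    to its leading coefficient, and each [f] of the list divides a nonzero integer modulo [mp]; the
    prime exceeds all these integers. *)
Lemma spec0 (l : seq {poly int}) (b : nat) : (forall f, f \in l -> evp c f != 0) ->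
  exists (F : finFieldType) (g : F) (p : nat), [/\ prime p, (b < p)%N, p \in [pchar F],
    (forall f, evp c f = 0 -> evp g f = 0) & (forall f, f \in l -> evp g f != 0)].
Proof.
move=> hl; pose mu := mp h00 h0c.
have [B hB] : exists B : nat, forall f, f \in l ->
    exists u v (n : int), [/\ u * f + v * mu = n%:P, n != 0 & (`|n| <= B)%N].
  elim: l hl => [|f l IH] hl; first by exists 0%N.
  have [|B hB] := IH; first by move=> g gl; apply: hl; rewrite inE gl orbT.
  have [u [v [n [n0 e]]]] := bezout h00 h0c (hl f (mem_head _ _)).
  exists (maxn B `|n|%N) => f'; rewrite inE => /predU1P[->|].
    by exists u, v, n; split=> //; rewrite leq_maxr.
  by move=> /hB[u' [v' [n' [h1 h2 h3]]]]; exists u', v', n'; split=> //; rewrite leq_max h3.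
have [p pb pp] := prime_above (maxn (maxn b B) `|lead_coef mu|%N).
move: pb; rewrite !gtn_max -andbA => /and3P[pb pB pl].
have l0 : lead_coef mu != 0 by rewrite lead_coef_eq0 mp0.
have lc := int_char (pchar_Fp pp) l0 pl.
have [F [g [pF gmu]]] := ff_root pp (mp_size h00 h0c) lc.
exists F, g, p; split=> //.
  move=> f /(mp_dvd h00 h0c) [k [q e]]; have := congr1 (evp g) e.
  rewrite rmorphM /= -/mu gmu mulr0 evpZ => /eqP; rewrite mulf_eq0 => /orP[|/eqP//].
  by rewrite rmorphXn expf_eq0 (negbTE (int_char pF l0 pl)) andbF.
move=> f fl; have [u [v [n [e n0 nB]]]] := hB f fl.
have := int_char pF n0 (leq_ltn_trans nB pB); apply: contraNneq => f0.
have := congr1 (evp g) e.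
by rewrite rmorphD !rmorphM /= f0 -/mu gmu !mulr0 addr0 evpC => <-.
Qed.
End Spec0.

Section MapAct.
Variables (S : finType) (A A' : comNzRingType) (f : {rmorphism A -> A'}).
Variables (a : S -> S -> A) (a' : S -> S -> A') (haa : forall s t, f (a s t) = a' s t).
Definition mapv (v : vec S A) : vec S A' := [ffun s => f (v s)].
Lemma mapv_ev s : mapv (ev A s) = ev A' s.
Proof. by apply/ffunP => t; rewrite !ffunE rmorph_nat. Qed.
Lemma mapv_actw p v : mapv (actw a p v) = actw a' p (mapv v).
Proof.
elim: p => [|s p IH] //=; rewrite -IH; apply/ffunP => t; rewrite /refl [LHS]ffunE !vecE !ffunE.
rewrite rmorphB rmorphM /= rmorph_nat; congr (_ - _ * _).
rewrite /pair rmorph_sum; apply: eq_bigr => r _.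
by rewrite rmorphM /= haa ffunE.
Qed.
End MapAct.

(** Chebyshev polynomials of the first kind, normalized to express 2 cos(n t) through 2 cos t. *)
Fixpoint cheb2 (n : nat) : {poly int} * {poly int} :=
  if n is n'.+1 then ((cheb2 n').2, 'X * (cheb2 n').2 - (cheb2 n').1) else (2%:R, 'X).
Definition cheb n := (cheb2 n).1.
Lemma chebSS n : cheb n.+2 = 'X * cheb n.+1 - cheb n. Proof. by []. Qed.
Lemma evp_cheb (th : RR) n : evp (2%:R * cos th) (cheb n) = 2%:R * cos (n%:R * th).
Proof.
elim/ind2: n => [||n IH1 IH2].
- by rewrite /cheb /= rmorph_nat mul0r cos0 mulr1.
- by rewrite /cheb /= evpX mul1r.
rewrite chebSS rmorphB rmorphM /= evpX IH1 IH2.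
have -> : n.+2%:R * th = n.+1%:R * th + th by rewrite -[n.+2]addn1 natrD; ring.
have -> : n%:R * th = n.+1%:R * th - th by rewrite -[n.+1]addn1 natrD; ring.
by rewrite !trigo.cosD trigo.cosN trigo.sinN; ring.
Qed.
Lemma size_cheb n : size (cheb n.+1) = n.+2.
Proof.
suff: size (cheb n.+1) = n.+2 /\ (size (cheb n) <= n.+2)%N by case.
elim: n => [|n [IH1 IH2]].
  by rewrite /cheb /= size_polyX -polyC_natr (leq_trans (size_polyC_leq1 _)).
rewrite chebSS; have sX : size ('X * cheb n.+1) = n.+3.
  rewrite mulrC size_mulX ?IH1 //.
  by rewrite -size_poly_gt0 IH1.
split; last by rewrite IH1.
by rewrite size_polyDl ?sX // size_polyN ltnS.
Qed.

(** * Specializations of the reflection representation and torsion *)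

Section SpecCox.
Variables (S : finType) (m : S -> S -> nat) (hm : is_cox_graph m).
Local Notation W := (cox m).
Let aRs := aR_sym hm.
Let aRd := aR_diag m.
Let aRr := resp_aR hm.
#[local] Hint Resolve aRs aRd aRr : core.

(** A common multiple of the finite labels, so that all entries of the form are polynomials in the
    single number [cc]. *)
Definition NN : nat := (\prod_(st : S * S | m st.1 st.2 != 0%N) m st.1 st.2)%N.
Lemma NN_gt0 : (0 < NN)%N.
Proof. by rewrite prodn_cond_gt0 // => st; rewrite lt0n. Qed.
Lemma dvd_NN s t : m s t != 0%N -> (m s t %| NN)%N.
Proof. by move=> st; rewrite /NN (bigD1 (s, t)) //= dvdn_mulr. Qed.
Definition cc : RR := 2%:R * cos (pi / NN%:R).
Definition aP (s t : S) : {poly int} :=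
  if s == t then 2%:R else if m s t == 0%N then - 2%:R else - cheb (NN %/ m s t).
Lemma evp_aP s t : evp cc (aP s t) = aR m s t.
Proof.
rewrite /aP /aR /gram; case: ifP => _; first by rewrite rmorph_nat mulr1.
case: ifP => [_|/negbT mst]; first by rewrite rmorphN rmorph_nat mulrN mulr1.
rewrite rmorphN /= evp_cheb mulrN; congr (- (_ * cos _)).
have e : NN%:R = (NN %/ m s t)%:R * (m s t)%:R :> RR by rewrite -natrM divnK // dvd_NN.
have n0 : NN%:R != 0 :> RR by rewrite pnatr_eq0 -lt0n NN_gt0.
move: n0; rewrite e mulf_eq0 negb_or => /andP[h1 h2]; field.
by rewrite h1 h2.
Qed.
(** Its value at [cc] is 2 cos(pi) + 2 = 0, which makes [cc] algebraic. *)
Definition ch0 : {poly int} := cheb NN + 2%:R.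
Lemma ch0c : evp cc ch0 = 0.
Proof.
rewrite /ch0 rmorphD /= evp_cheb rmorph_nat [NN%:R * _]mulrC divfK; last first.
  by rewrite pnatr_eq0 -lt0n NN_gt0.
by rewrite cospi; ring.
Qed.
Lemma ch00 : ch0 != 0.
Proof.
have := NN_gt0; rewrite /ch0; case: NN => // n _.
rewrite -size_poly_gt0 size_polyDl ?size_cheb //.
by rewrite -polyC_natr (leq_ltn_trans (size_polyC_leq1 _)).
Qed.

(** A ring homomorphism from Z[cc] to a finite field, given by the image of [cc]; [s_ok] makes it
    well defined. *)
Record spec := Spec {
  sF : finFieldType;
  sx : sF;
  s_ok : forall f, evp cc f = 0 -> evp sx f = 0 }.

Section Use.
Variable sp : spec.
Notation F := (sF sp).
Definition aF (s t : S) : F := evp (sx sp) (aP s t).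
Lemma aP_sym s t : aP s t = aP t s.
Proof. by rewrite /aP eq_sym (mC hm). Qed.
Lemma aF_sym s t : aF s t = aF t s. Proof. by rewrite /aF aP_sym. Qed.
Lemma aF_diag s : aF s s = 2%:R.
Proof. by rewrite /aF /aP eqxx rmorph_nat. Qed.
Definition pv_ p s : vec S {poly int} := actw aP p (ev _ s).
Lemma pv_R p s : mapv (evp cc) (pv_ p s) = actw (aR m) p (ev _ s).
Proof. by rewrite (mapv_actw evp_aP) mapv_ev. Qed.
Lemma pv_F p s : mapv (evp (sx sp)) (pv_ p s) = actw aF p (ev _ s).
Proof. by rewrite (@mapv_actw _ _ _ _ _ aF) ?mapv_ev. Qed.
(** Coordinates of roots are integer polynomials in [cc], so an identity between real roots holds in
    Z[cc] and survives the reduction. The integer [e] will be 1 or -1. *)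
Lemma transfer p q s t (e : int) :
  actw (aR m) p (ev _ s) = e%:~R *: actw (aR m) q (ev _ t) ->
  actw aF p (ev _ s) = e%:~R *: actw aF q (ev _ t).
Proof.
rewrite -!pv_R -!pv_F => h; apply/ffunP => r; rewrite vecZ !ffunE.
apply/eqP; rewrite -subr_eq0 -evpZ -rmorphB; apply/eqP/s_ok.
by rewrite rmorphB /= evpZ; move/ffunP/(_ r): h; rewrite vecZ !ffunE => ->; rewrite subrr.
Qed.
Definition dpoly p q s t (e : int) r : {poly int} := pv_ p s r - e *: pv_ q t r.
Lemma dpolyF p q s t e r : evp (sx sp) (dpoly p q s t e r) != 0 ->
  actw aF p (ev _ s) <> e%:~R *: actw aF q (ev _ t).
Proof.
move=> h /ffunP/(_ r); rewrite -!pv_F vecZ !ffunE => h2; case/eqP: h.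
by rewrite /dpoly rmorphB /= evpZ h2 subrr.
Qed.
Lemma dpolyR p q s t e : actw (aR m) p (ev _ s) <> e%:~R *: actw (aR m) q (ev _ t) ->
  exists r, evp cc (dpoly p q s t e r) != 0.
Proof.
move=> ne; apply: contrapT => h; apply: ne; rewrite -!pv_R; apply/ffunP => r; rewrite vecZ !ffunE.
apply: contrapT => /eqP h2; apply: h; exists r; move: h2.
by rewrite -subr_eq0 -evpZ -rmorphB.
Qed.
Lemma resp_aF u w v : coxeq m u w -> actw aF u v = actw aF w v.
Proof.
move=> h; rewrite (vec_sum v) !linear_sum; apply: eq_bigr => s _; rewrite !linearZ /=.
by have := @transfer u w s s 1; rewrite !scale1r => -> //; apply: resp_aR.
Qed.
Local Notation gF := (ga (m := m) aF).
Lemma tr_root (g h : W) s t (e : int) :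
  ga (aR m) g (ev _ s) = e%:~R *: ga (aR m) h (ev _ t) ->
  gF g (ev _ s) = e%:~R *: gF h (ev _ t).
Proof. exact: transfer. Qed.
Definition trivF (x : W) := forall s, gF x (ev _ s) = ev _ s.
End Use.

Section Mx.
Variables (A : comNzRingType) (a : S -> S -> A).
Definition mxw (p : seq S) : 'M[A]_#|S| :=
  \matrix_(i, j) actw a p (ev A (enum_val j)) (enum_val i).
Lemma mxw_cat p q : mxw (p ++ q) = mxw p *m mxw q.
Proof.
apply/matrixP => i j; rewrite !mxE actw_cat [actw a q _]vec_sum linear_sum vecS.
rewrite (reindex (@enum_val S predT)) /=; last exact/onW_bij/enum_val_bij.
by apply: eq_bigr => k _; rewrite !mxE linearZ vecZ mulrC.
Qed.
Lemma mxw_id p : (forall s, actw a p (ev A s) = ev A s) <-> mxw p = 1%:M.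
Proof.
split=> [h|/matrixP h s].
  by apply/matrixP => i j; rewrite !mxE h ffunE (inj_eq enum_val_inj).
apply/ffunP => t; have := h (enum_rank t) (enum_rank s).
by rewrite !mxE !enum_rankK ffunE (inj_eq enum_rank_inj).
Qed.
Fixpoint wpow (p : seq S) n : seq S := if n is n'.+1 then p ++ wpow p n' else [::].
Lemma wd_wpow p n : wd m (wpow p n) = (wd m p ^+ n)%g.
Proof. by elim: n => [|n IH] //=; rewrite wdM IH expgS. Qed.
End Mx.
Lemma mxw_map (A A' : comNzRingType) (f : {rmorphism A -> A'}) a a' p :
  (forall s t, f (a s t) = a' s t) -> map_mx f (mxw a p) = mxw a' p.
Proof.
by move=> h; apply/matrixP => i j; rewrite !mxE -(mapv_ev f) -(mapv_actw h) !ffunE.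
Qed.

Lemma torsion (sp : spec) (x : W) (r : nat) : (x ^+ r)%g = 1%g -> r%:R != 0 :> sF sp ->
  trivF sp x -> x = 1%g.
Proof.
move=> xr r0 tx; pose p := wrep x; have px : wd m p = x := wd_repr x.
pose E : 'M[{poly int}]_#|S| := \sum_(i < r) mxw aP (wpow p i).
have pF i : mxw (aF sp) (wpow p i) = 1%:M.
  apply/mxw_id; elim: i => [|i IH] s //=; rewrite actw_cat IH; exact: tx.
have dF : evp (sx sp) (\det E) != 0.
  rewrite -det_map_mx /E map_mx_sum.
  have -> : \sum_(i < r) map_mx (evp (sx sp)) (mxw aP (wpow p i)) = (r%:R)%:M.
    rewrite (eq_bigr (fun _ => 1%:M)) => [|i _]; last by rewrite (mxw_map (a' := aF sp)) // pF.
    by rewrite sumr_const card_ord -scaler_nat scale_scalar_mx mulr1.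
  by rewrite det_scalar expf_neq0.
have dR : evp cc (\det E) != 0 by apply: contraNneq dF => /s_ok->.
pose ER := map_mx (evp cc) E; have uE : ER \in unitmx by rewrite unitmxE det_map_mx unitfE.
have EE : ER = \sum_(i < r) mxw (aR m) (wpow p i).
  by rewrite /ER /E map_mx_sum; apply: eq_bigr => i _; rewrite (mxw_map (a' := aR m)) //; exact: evp_aP.
(* Multiplication by [x] permutes the powers of [x] cyclically, since the r-th power is 1. *)
have XE : mxw (aR m) p *m ER = ER.
  rewrite EE mulmx_sumr; under eq_bigr => i _ do rewrite -mxw_cat -[p ++ _]/(wpow p i.+1).
  apply: (addrI (mxw (aR m) (wpow p 0))); rewrite -(big_ord_recl r (fun i => mxw (aR m) (wpow p i))).
  rewrite big_ord_recr /= addrC; congr (_ + _).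
  have -> : mxw (aR m) [::] = 1%:M by apply/mxw_id.
  apply/mxw_id => s; apply: (@resp_aR S m hm (wpow p r) [::]).
  by apply/wdP; rewrite wd_wpow px xr wd_nil.
have : mxw (aR m) p = 1%:M by rewrite -[LHS](mulmxK uE) XE mulmxV.
by move/mxw_id => h; exact: (@cox_faithful S m hm x h).
Qed.

Definition tfree (sp : spec) := forall x n, (0 < n)%N -> (x ^+ n)%g = 1%g -> trivF sp x -> x = 1%g.

(* If x has prime order p invertible in the field and acts trivially there, then 1 + x + ... + x^(p-1) has determinant p^n <> 0 over the field, hence is injective over R, so x = 1. *)
Lemma spec_ex (l : seq {poly int}) : (forall f, f \in l -> evp cc f != 0) ->
  exists sp : spec, [/\ tfree sp, 2%:R != 0 :> sF sp & forall f, f \in l -> evp (sx sp) f != 0].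
Proof.
move=> hl.
have h2 : forall f, f \in 2%:R :: l -> evp cc f != 0.
  by move=> f; rewrite inE => /predU1P[->|/hl//]; rewrite rmorph_nat pnatr_eq0.
(* The first field bounds the prime orders of torsion elements: such an order, if different from
   [p0], is at most the number of matrices over [F0], because by [torsion] the powers stay distinct
   there. The second field has characteristic beyond this bound. *)
have [F0 [g0 [p0 [_ _ p0F ok0 _]]]] := spec0 ch00 ch0c 0 h2.
pose sp0 := Spec ok0.
have [F [g [p [pp pb pF ok nz]]]] := spec0 ch00 ch0c (maxn p0 #|{: 'M[F0]_#|S|}|) h2.
pose sp := Spec ok; exists sp; split; last 2 first.
- by have := nz 2%:R (mem_head _ _); rewrite rmorph_nat.
- by move=> f fl; apply: nz; rewrite inE fl orbT.
move=> x n n0 xn tx; apply: contrapT => x1.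
have exn : exists k, (0 < k)%N && (x ^+ k == 1)%g by exists n; rewrite n0 xn eqxx.
case: (ex_minnP exn) => k /andP[k0 /eqP xk] kmin.
have k1 : (1 < k)%N.
  by rewrite ltn_neqAle k0 andbT; apply: contra_notN x1 => /eqP k1; rewrite -[x]expg1 k1.
pose r := pdiv k; have rp : prime r := pdiv_prime k1; have rk : (r %| k)%N := pdiv_dvd k.
pose y := (x ^+ (k %/ r))%g.
have yr : (y ^+ r)%g = 1%g by rewrite /y -expgnA divnK.
have y1 : y <> 1%g.
  move=> y1; have := kmin (k %/ r)%N; rewrite divn_gt0 ?prime_gt0 // dvdn_leq //= -/y y1 eqxx.
  by move=> /(_ erefl); rewrite leqNgt ltn_Pdiv // prime_gt1.
have tpow (s0 : spec) (z : W) i : trivF s0 z -> trivF s0 (z ^+ i)%g.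
  move=> tz; elim: i => [|i IH] s; first by rewrite expg0 ga1 //; exact: resp_aF.
  by rewrite expgS gaM ?IH //; exact: resp_aF.
have rle : (r <= maxn p0 #|{: 'M[F0]_#|S|}|)%N.
  have [rp0|rp0] := eqVneq r p0; first by rewrite rp0 leq_maxl.
  rewrite leq_max; apply/orP; right; rewrite -[r]card_ord.
  have r0 : r%:R != 0 :> F0.
    rewrite -(dvdn_pcharf p0F) dvdn_prime2 //; last by case/andP: p0F.
    by rewrite eq_sym.
  pose f (i : 'I_r) := mxw (aF sp0) (wpow (wrep y) i).
  apply: (@leq_card _ _ f); suff h : forall i j : 'I_r, (i < j)%N -> f i <> f j.
    move=> i j e; apply: val_inj => /=; case: (ltngtP i j) => // /h; first by case.
    by case.
  move=> i j ij e; have [d dE] : exists d, j = (i + d)%N :> nat /\ (0 < d)%N.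
    by exists (j - i)%N; rewrite subnKC ?(ltnW ij) // subn_gt0.
  case: dE => jE d0.
  have td : trivF sp0 (y ^+ d)%g.
    move=> s; have inj := @ga_inj _ _ _ _ (@resp_aF sp0) (y ^+ i)%g.
    apply: inj; rewrite -gaM ?(expgnDr, resp_aF) //; last exact: resp_aF.
    rewrite -expgnDr -jE; move/matrixP: e => e.
    apply/ffunP => t; have := e (enum_rank t) (enum_rank s); rewrite !mxE !enum_rankK.
    by rewrite -!(ga_wd (@resp_aF sp0)) !wd_wpow wd_repr.
  have yd : (y ^+ d)%g = 1%g.
    by apply: (@torsion sp0 _ r) => //; rewrite -expgnA mulnC expgnA yr expg1n.
  apply: y1; have cop : coprime d r.
    rewrite coprime_sym prime_coprime // gtnNdvd //.
    by apply: leq_ltn_trans (ltn_ord j); rewrite jE leq_addl.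
  have [u [v [e1 _]]] : exists u v, (u * d = v * r + 1)%N /\ true.
    by have := egcdnP r d0; case=> u v e1 _; exists u, v; rewrite e1 (eqP cop).
  have : (y ^+ (u * d) = 1)%g by rewrite mulnC expgnA yd expg1n.
  by rewrite e1 expgnDr mulnC expgnA yr expg1n mul1g expg1.
have r0 : r%:R != 0 :> F.
  by rewrite -(dvdn_pcharf pF) gtnNdvd ?prime_gt0 // (leq_ltn_trans rle pb).
by apply: y1; apply: (@torsion sp _ r) => //; apply: tpow.
Qed.
End SpecCox.

Notation spec_field := sF.

(** * Walls of a family of pairwise non-crossing roots *)

Section Family.
Variables (S : finType) (m : S -> S -> nat) (hm : is_cox_graph m).
Local Notation es := (ev RR).
Local Notation "g ** v" := (@ga S m _ (aR m) g v) (at level 40).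
Local Notation B := (bil (aR m)).
Local Notation W := (cox m).
Local Notation vv := (vec S RR).
Local Notation root := (@wroot S m).
Local Notation sg_pos := (@sg_pos S m).
Let aRs := aR_sym hm.
Let aRd := aR_diag m.
Let aRr := resp_aR hm.
Let root_ev := root_ev hm.
Let root_ga := root_ga hm.
Let root_B := root_B hm.
Let rootN := rootN hm.
Let ga_ev := ga_ev hm.
Let sg_posN := sg_posN hm.
#[local] Hint Resolve aRs aRd aRr root_ev root_ga rootN root_B hm : core.

Lemma sg_pos_mul (h g : W) b : sg_pos (h * g)%g (h ** b) = sg_pos g b.
Proof. by rewrite /sg_pos invMg gaM // gaK. Qed.
Lemma sg_pos_ev (w : W) s b : w^-1%g ** b = es s -> sg_pos w b.
Proof. by move=> e; apply/asboolP; rewrite e; apply: posv_ev. Qed.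
Lemma sg_flip (w : W) s b : root b -> w^-1%g ** b != es s -> w^-1%g ** b != - es s ->
  sg_pos (w * sg m s)%g b = sg_pos w b.
Proof.
move=> rb; rewrite /sg_pos invMg sgV gaM //; have : root (w^-1%g ** b) by apply: root_ga.
move: (w^-1%g ** b) => c rc c1 c2.
case: (root_sign hm rc) => p.
  by rewrite asboolT ?asboolT //; apply: pos_refl.
have h : posv (- (sg m s ** c)).
  by rewrite -gaN; apply: pos_refl => //; [exact: rootN|rewrite eqr_oppLR].
rewrite asboolF ?asboolF //.
  by move=> p2; apply: (posv_excl hm rc p2 p).
by move=> p2; apply: (posv_excl hm _ p2 h); apply: root_ga.
Qed.
Lemma sg_flip_ev (w : W) s b : root b -> w^-1%g ** b = es s ->
  sg_pos (w * sg m s)%g b = false.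
Proof.
move=> rb e; apply: negbTE; rewrite -sg_posN //; apply/asboolP.
by rewrite invMg sgV gaM // gaN e gaN ga_ev // opprK; apply: posv_ev.
Qed.

Variables (s0 : S) (G : W -> Prop).
Hypotheses (G1 : G 1%g) (GM : forall g h, G g -> G h -> G (g * h)%g)
  (GV : forall g, G g -> G g^-1%g) (Gs0 : G (sg m s0))
  (Gtf : forall g, G g -> [\/ g ** es s0 = es s0, g ** es s0 = - es s0 |
     2%:R <= `|B (es s0) (g ** es s0)|]).
Let al := es s0.
Definition FF (b : vv) := exists2 g, G g & b = g ** al.
Lemma FF_root b : FF b -> root b.
Proof. by case=> g _ ->; exact: root_ga _ (root_ev s0). Qed.
Lemma FF_al : FF al. Proof. by exists 1%g; rewrite ?ga1. Qed.
Lemma FF_ga g b : G g -> FF b -> FF (g ** b).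
Proof. by move=> Gg [h Gh ->]; exists (g * h)%g; [apply: GM|rewrite gaM]. Qed.
Lemma FFN b : FF b -> FF (- b).
Proof. by case=> g Gg ->; exists (g * sg m s0)%g; [apply: GM|rewrite gaM // ga_ev // gaN]. Qed.
Lemma FF_tf b c : FF b -> FF c -> [\/ c = b, c = - b | 2%:R <= `|B b c|].
Proof.
move=> [g Gg ->] [h Gh ->]; have := Gtf (GM (GV Gg) Gh).
have e v : h ** v = g ** ((g^-1 * h)%g ** v) by rewrite gaM // gaVK.
case=> [e1|e1|e1]; [apply: Or31|apply: Or32|apply: Or33].
- by rewrite e e1.
- by rewrite e e1 gaN.
- by rewrite e bil_ga.
Qed.
Lemma FF_refl b : FF b -> exists r, [/\ G r, (r * r = 1)%g & forall v, r ** v = rv (aR m) b v].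
Proof.
case=> g Gg ->; exists (g * sg m s0 * g^-1)%g; split.
- by apply: GM; [apply: GM|apply: GV].
- by rewrite -!mulgA mulKg [(sg m s0 * (sg m s0 * _))%g]mulgA sg_sq mul1g mulgV.
- by move=> v; rewrite ga_conj.
Qed.

(** The chambers lie in the same region of the complement of the walls of the family. *)
Definition sim (w w' : W) := forall b, FF b -> sg_pos w b = sg_pos w' b.
Lemma sim_trans w1 w2 w3 : sim w1 w2 -> sim w2 w3 -> sim w1 w3.
Proof. by move=> h1 h2 b fb; rewrite h1 ?h2. Qed.
Lemma sim_ga g w w' : G g -> sim w w' -> sim (g * w)%g (g * w')%g.
Proof.
move=> Gg h b fb; rewrite -[b](gaVK aRr g) !sg_pos_mul; apply: h.
by apply: FF_ga => //; apply: GV.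
Qed.
(** No wall of the family crosses that of [b]. A wall [c] separating the two chambers would,
    together with their neighbours across [b], make all four quadrants of [b] and [c] nonempty,
    against [quad]. *)
Lemma lemA b w s w' s' : FF b -> w^-1%g ** b = es s -> w'^-1%g ** b = es s' -> sim w w'.
Proof.
have main w1 s1 w2 s2 c : FF b -> FF c -> w1^-1%g ** b = es s1 -> w2^-1%g ** b = es s2 ->
    sg_pos w1 c -> sg_pos w2 c = false -> False.
  move=> fb fc e1 e2 p1 p2; have rb := FF_root fb; have rc := FF_root fc.
  have pb1 := sg_pos_ev e1; have pb2 := sg_pos_ev e2.
  case: (FF_tf fb fc) => [cb|cb|big].
  - by move: p2; rewrite cb pb2.
  - by move: p1; rewrite cb sg_posN // pb1.
  have cb : c != b by apply/eqP => cb; move: p2; rewrite cb pb2.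
  have cNb : c != - b by apply/eqP => cNb; move: p1; rewrite cNb sg_posN // pb1.
  have ne w3 s3 : w3^-1%g ** b = es s3 ->
      w3^-1%g ** c != es s3 /\ w3^-1%g ** c != - es s3.
    by move=> <-; rewrite -gaN !(inj_eq (ga_inj aRr (g := _))).
  have [n1 n1'] := ne _ _ e1; have [n2 n2'] := ne _ _ e2.
  apply: (quad hm (g1 := w1) (g2 := w2) (g3 := (w1 * sg m s1)%g) (g4 := (w2 * sg m s2)%g) rb rc big) => //.
  - by rewrite p2.
  - by rewrite sg_flip_ev.
  - by rewrite sg_flip.
  - by rewrite sg_flip_ev.
  - by rewrite sg_flip // p2.
move=> fb e e' c fc; have [p|p] := boolP (sg_pos w c); apply/esym.
  by apply: contrapT => /negP /negbTE; apply: (main w s w' s' c).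
apply/negbTE/negP => p'; apply: (main w' s' w s c) => //; exact: negbTE.
Qed.

(** The walls on the boundary of the region of the identity, oriented towards it. *)
Definition J (b : vv) := FF b /\ exists w s, sim 1%g w /\ w^-1%g ** b = es s.
Lemma J_al : J al.
Proof. by split; [exact: FF_al|exists 1%g, s0; rewrite invg1 ga1]. Qed.
Lemma J_pos b : J b -> sg_pos (1%g : W) b.
Proof. by case=> fb [w [s [h e]]]; rewrite (h _ fb); apply: sg_pos_ev e. Qed.
Lemma J_opp b c : J b -> J c -> c <> - b.
Proof.
move=> jb jc e; have := J_pos jc; rewrite e sg_posN ?J_pos //.
by apply: FF_root; case: jb.
Qed.
Lemma J_cross b c : J b -> FF c -> c <> b -> c <> - b ->
  exists w, sg_pos w b = false /\ sg_pos w c = sg_pos 1%g c.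
Proof.
case=> fb [w [s [h e]]] fc cb cb'; exists (w * sg m s)%g; split.
  by apply: sg_flip_ev => //; apply: FF_root.
rewrite (h _ fc); apply: sg_flip; first exact: FF_root.
  by rewrite -e (inj_eq (ga_inj aRr (g := _))); apply/eqP.
by rewrite -e -gaN (inj_eq (ga_inj aRr (g := _))); apply/eqP.
Qed.
(** By [J_cross] one can step over either boundary wall while staying on the inner side of the
    other, so three quadrants are occupied and [quad] empties the fourth. *)
Lemma J_disj b c g : J b -> J c -> b <> c -> sg_pos g b = false -> sg_pos g c = false -> False.
Proof.
move=> jb jc bc gb gc; have fb : FF b by case: jb. have fc : FF c by case: jc.
have rb := FF_root fb; have rc := FF_root fc.
case: (FF_tf fb fc) => [e|e|big]; first by case: bc.
  exact: J_opp jb jc e.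
have [w1 [h1 h2]] := J_cross jb fc (nesym bc) (J_opp jb jc).
have [w2 [h3 h4]] := J_cross jc fb bc (J_opp jc jb).
rewrite J_pos // in h2; rewrite J_pos // in h4.
apply: (quad hm (g1 := 1%g) (g2 := w2) (g3 := w1) (g4 := g) rb rc big) => //; rewrite ?J_pos //.
- by rewrite h3.
- by rewrite h1.
- by rewrite gb.
- by rewrite gc.
Qed.
Lemma J_B b c : J b -> J c -> b <> c -> B b c <= - 2%:R.
Proof.
move=> jb jc bc; have fb : FF b by case: jb. have fc : FF c by case: jc.
have rb := FF_root fb; have rc := FF_root fc.
case: (FF_tf fb fc) => [e|e|]; first by case: bc.
  by case: (J_opp jb jc e).
rewrite ler_normr => /orP[big|]; last by rewrite lerNr.
have [w1 [h1 h2]] := J_cross jb fc (nesym bc) (J_opp jb jc).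
have [w2 [h3 h4]] := J_cross jc fb bc (J_opp jc jb).
rewrite J_pos // in h2; rewrite J_pos // in h4.
by case: (nested hm rb rc big (asboolP _ h4) (sg_posF hm rc h3) (sg_posF hm rb h1) (asboolP _ h2)).
Qed.

Lemma cross_step w s : let c := w ** es s in
  (forall b, FF b -> b <> c /\ b <> - c) -> sim w (w * sg m s)%g.
Proof.
move=> c nc b fb; have [n1 n2] := nc b fb; apply/esym/sg_flip; first exact: FF_root.
  by apply/eqP => e; apply: n1; rewrite /c -e gaVK.
by apply/eqP => e; apply: n2; rewrite /c -gaN -e gaVK.
Qed.

(** The first wall of the family met by the gallery is a boundary wall of the region where the
    gallery starts. *)
Lemma first_wall p b : FF b -> sg_pos 1%g b != sg_pos (wd m p) b ->
  exists b', J b' /\ (b' \in proots m p \/ - b' \in proots m p).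
Proof.
elim/last_ind: p b => [|p s IH] b fb; first by rewrite eqxx.
rewrite -cats1 wdM proots_cat.
have [[c [fc ne]]|none] := pselect (exists c, FF c /\ sg_pos 1%g c != sg_pos (wd m p) c).
  by move=> _; have [b' [jb [h|h]]] := IH _ fc ne; exists b'; split=> //;
    [left|right]; rewrite mem_cat h.
have sm : sim 1%g (wd m p).
  by move=> c fc; apply: contrapT => h; apply: none; exists c; split=> //; apply/eqP.
rewrite (sm _ fb) => flip; set c := wd m p ** es s.
have cin : c \in map (actw (aR m) p) (proots m [:: s]).
  by rewrite /= inE /c ga_wd.
have bc : b = c \/ b = - c.
  have [|n] := pselect (b = c); first by left.
  have [|n'] := pselect (b = - c); first by right.
  case/eqP: flip; apply/esym/sg_flip; first exact: FF_root.
    by apply/eqP => e; apply: n; rewrite /c -e gaVK.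
  by apply/eqP => e; apply: n'; rewrite /c -gaN -e gaVK.
have fc : FF c by case: bc => e; [rewrite -e|rewrite -[c]opprK -e; apply: FFN].
exists c; split; last by left; rewrite mem_cat cin orbT.
by split=> //; exists (wd m p), s; split=> //; rewrite /c gaK.
Qed.

Inductive RJ : W -> Prop :=
| RJ1 : RJ 1%g
| RJS r b q : RJ r -> J b -> G q -> (forall v, q ** v = rv (aR m) b v) -> RJ (r * q)%g.
Lemma RJ_G r : RJ r -> G r.
Proof. by elim=> // {}r b q _ Gr _ Gq _; apply: GM. Qed.
(** Follow a gallery. When it leaves the region of [r] through a wall of the family, that wall is
    the image under [r] of a boundary wall of the base region, and [r] is multiplied on the right by
    the reflection in the latter. *)
Lemma J_gen w : exists r, RJ r /\ sim r w.
Proof.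
have [p ->] := wd_surj w; elim/last_ind: p => [|p s [r [rJ sm]]].
  by exists 1%g; split; [exact: RJ1|rewrite wd_nil].
rewrite -cats1 wdM; set c := wd m p ** es s.
have [[b [fb bc]]|none] := pselect (exists b, FF b /\ (b = c \/ b = - c)); last first.
  exists r; split=> //; apply: sim_trans sm _; apply: cross_step => b fb.
  by split=> e; apply: none; exists b; auto.
have fc : FF c by case: bc => e; [rewrite -e|rewrite -[c]opprK -e; apply: FFN].
have Gr := RJ_G rJ.
have jc : J (r^-1%g ** c).
  split; first by apply: FF_ga => //; apply: GV.
  exists (r^-1 * wd m p)%g, s; split.
    by have := sim_ga (GV Gr) sm; rewrite mulVg.
  by rewrite invMg invgK gaM // gaVK //; exact: (gaK aRr).
have [q [Gq qq qE]] := FF_refl (proj1 jc).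
exists (r * q)%g; split; first exact: RJS rJ jc Gq qE.
have -> : (wd m p * wd m [:: s] = r * q * (r^-1 * wd m p))%g.
  apply: (cox_faithful2 hm) => t; rewrite -/(sg m s) !gaM // qE ga_rv // !(gaVK aRr) ga_sg //.
  by rewrite refl_rv ga_rv.
by have := sim_ga (GM Gr Gq) (sim_ga (GV Gr) sm); rewrite mulVg mulg1.
Qed.
End Family.

(* Local notations shadow these names. *)
Notation FF_of := FF.
Notation J_of := J.

Section CompGraph.
Variables (S : finType) (m : S -> S -> nat) (hm : is_cox_graph m).
Lemma dadjC s t : dadj m s t = dadj m t s.
Proof. by rewrite /dadj eq_sym (proj1 hm). Qed.
Lemma comp_sym s t : (t \in comp m s) = (s \in comp m t).
Proof. by rewrite !inE; apply: sym_connect_sym => x y; apply: dadjC. Qed.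
Lemma comp_refl s : s \in comp m s. Proof. by rewrite inE connect0. Qed.
Lemma comp_trans s t r : t \in comp m s -> r \in comp m t -> r \in comp m s.
Proof. by rewrite !inE; apply: connect_trans. Qed.
Lemma comp_eq s t : t \in comp m s -> comp m t = comp m s.
Proof.
move=> ts; apply/setP => r; apply/idP/idP => h; first exact: comp_trans ts h.
by apply: comp_trans h; rewrite comp_sym.
Qed.
Lemma comp_adj s t r : t \in comp m s -> dadj m t r -> r \in comp m s.
Proof. by move=> ts tr; apply: comp_trans ts _; rewrite inE connect1. Qed.
Lemma comp_ind (P : S -> Prop) s : P s ->
  (forall t r, t \in comp m s -> P t -> dadj m t r -> P r) -> forall t, t \in comp m s -> P t.
Proof.
move=> P0 PS t; rewrite inE => /connectP [p pp ->] {t}.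
elim/last_ind: p pp => [|p r IH] //=.
rewrite rcons_path last_rcons => /andP[pp tr]; apply: PS tr; last exact: IH.
by rewrite inE; apply/connectP; exists p.
Qed.
Lemma comp_m2 s t r : t \in comp m s -> r \notin comp m s -> t != r /\ m t r = 2%N.
Proof.
move=> ts rs; have tr : t != r by apply: contraNneq rs => <-.
split=> //; apply/eqP; apply: contraNT rs => h; apply: comp_adj ts _.
by rewrite /dadj tr.
Qed.
Lemma aR_nadj s t : s != t -> m s t = 2%N -> aR m s t = 0.
Proof. by move=> st e; rewrite aR_off // e /xx /= cos_pihalf mulr0 oppr0. Qed.
Lemma aR_adj s t : dadj m s t -> aR m s t < 0.
Proof.
move=> /andP[st m2]; rewrite aR_off // oppr_lt0 /xx; case: eqP => [|/eqP m0]; first by rewrite ltr0n.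
have m3 : (2 < m s t)%N by rewrite ltn_neqAle eq_sym m2 m_ge2.
rewrite mulr_gt0 ?ltr0n // cos_gt0_pihalf //; apply/andP; split.
  by apply: (@lt_trans _ _ 0); rewrite ?oppr_lt0 ?divr_gt0 ?pi_gt0 ?ltr0n // (ltn_trans _ m3).
by rewrite ltr_pM2l ?pi_gt0 // ltf_pV2 ?posrE ?ltr0n ?ltr_nat // (ltn_trans _ m3).
Qed.
Lemma aR_le0 s t : s != t -> aR m s t <= 0.
Proof.
move=> st; case: (boolP (dadj m s t)) => [/aR_adj/ltW//|].
by rewrite /dadj st /= negbK => /eqP h; rewrite aR_nadj.
Qed.
Lemma aR_ge s t : -2%:R <= aR m s t.
Proof.
rewrite /aR /gram; case: ifP => _; first by lra.
case: ifP => _; first by lra.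
have /ler_normlP[h1 h2] := cos_max (pi / (m s t)%:R : RR); lra.
Qed.
Lemma aR_out s t r : t \in comp m s -> r \notin comp m s -> aR m t r = 0.
Proof. by move=> ts rs; have [a b] := comp_m2 ts rs; apply: aR_nadj. Qed.
End CompGraph.

(** * Stabilizers of a root over finite fields *)

Section SpecG.
Variables (S : finType) (m : S -> S -> nat) (hm : is_cox_graph m).
Local Notation W := (cox m).
Local Notation "g ** v" := (@ga S m _ (aR m) g v) (at level 40).
Local Notation B := (bil (aR m)).
Let aRs := aR_sym hm.
Let aRd := aR_diag m.
Let aRr := resp_aR hm.
#[local] Hint Resolve aRs aRd aRr hm : core.
Section One.
Variable sp : spec m.
Local Notation F := (sF sp).
Local Notation gF := (@ga S m F (aF sp)).
Let aFs := aF_sym hm sp.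
Let aFd := @aF_diag S m sp.
Let aFr := @resp_aF S m hm sp.
#[local] Hint Resolve aFs aFd aFr : core.
Definition eqF (x y : W) := forall v, gF x v = gF y v.
Lemma eqF_ev x y : (forall s, gF x (ev F s) = gF y (ev F s)) -> eqF x y.
Proof.
move=> h v; rewrite (vec_sum v) !linear_sum; apply: eq_bigr => s _.
by rewrite !linearZ /= h.
Qed.
Lemma eqF_fin : exists l : seq W, forall x, exists2 y, y \in l & eqF x y.
Proof.
pose f (x : W) := [ffun s => [ffun t => gF x (ev F s) t : F]].
have [l hl] := fin_list {ffun S -> {ffun S -> F}}.
pose g h := if pselect (exists y, f y = h) is left e then projT1 (cid e) else 1%g.
exists (map g l) => x; exists (g (f x)); first by apply: map_f; apply: hl.
have e : f (g (f x)) = f x.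
  by rewrite /g; case: pselect => [e|]; [case: cid|case; exists x].
apply: eqF_ev => s; apply/ffunP => t.
by have := congr1 (fun f : {ffun S -> {ffun S -> F}} => f s t) e; rewrite !ffunE.
Qed.
Definition Nsp : fincong m.
Proof.
refine (@mkfc S m eqF _ _ _ _ eqF_fin) => //.
- by move=> x y h v; rewrite h.
- by move=> x y z h1 h2 v; rewrite h1.
- by move=> a b c d h1 h2 v; rewrite !gaM // h1 h2.
Defined.
Lemma NspP x y : proj Nsp x = proj Nsp y <-> eqF x y. Proof. exact: mkfcP. Qed.
Definition pmF s (w : W) := gF w (ev F s) = ev F s \/ gF w (ev F s) = - ev F s.
Lemma pmFM s g h : pmF s g -> pmF s h -> pmF s (g * h)%g.
Proof.
rewrite /pmF gaM // => h1 [->|->]; rewrite ?gaN //.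
by case: h1 => ->; rewrite ?opprK; [right|left].
Qed.
Lemma pmFV s g : pmF s g -> pmF s g^-1%g.
Proof.
case=> e; [left|right]; first by rewrite -{1}e (gaK aFr).
have h : gF g^-1%g (gF g (ev F s)) = gF g^-1%g (- ev F s) by rewrite e.
by move: h; rewrite (gaK aFr) gaN => h; rewrite {2}h opprK.
Qed.
Lemma pmFs s : pmF s (sg m s).
Proof.
by right; rewrite ga_sg // refl_rv rv_self // ev2.
Qed.
Lemma pmF1 s : pmF s 1%g. Proof. by left; rewrite ga1. Qed.
Lemma pmF_sp s w : proj Nsp w = 1%g -> pmF s w.
Proof.
rewrite -(hom1 (@proj_hom _ m Nsp)) => /NspP h; left; by rewrite h ga1.
Qed.
(** The product of the reflections in [al] and [g al] is trivial over the field. If it has finite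
    order, it is trivial and the two roots agree up to sign; otherwise [inf_order] applies. *)
Lemma pmF_tf s g : tfree sp -> pmF s g -> let al := ev RR s in
  [\/ g ** al = al, g ** al = - al | 2%:R <= `|B al (g ** al)|].
Proof.
move=> tf pg al; set r := sg m s; set q := (g * r * g^-1)%g.
have rE v : r ** v = rv (aR m) al v by rewrite ga_sg // refl_rv.
have qE v : q ** v = rv (aR m) (g ** al) v by rewrite ga_conj.
have ral : @wroot S m al by apply: root_ev.
have rgal : @wroot S m (g ** al) by apply: root_ga.
have [inf|fin] := pselect (forall n, (0 < n)%N -> ((r * q) ^+ n)%g <> 1%g).
  by apply: Or33; apply: (inf_order hm ral rgal rE qE inf).
have [n [n0 e]] : exists n, (0 < n)%N /\ ((r * q) ^+ n)%g = 1%g.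
  by apply: contrapT => h; apply: fin => n n0 e; apply: h; exists n.
have /(tf _ _ n0 e) rq1 : trivF sp (r * q)%g.
  move=> t; rewrite gaM // /q ga_conj // /r ga_sg // !refl_rv.
  have -> v : rv (aF sp) (gF g (ev F s)) v = rv (aF sp) (ev F s) v.
    by case: pg => ->; rewrite ?rvN.
  by rewrite rvK // ev2.
have rq : r = q by rewrite -[q]mul1g -(sg_sq m s) -mulgA rq1 mulg1.
have := rE al; rewrite rq qE rv_self ?ev2 // /rv => e2.
set k := B (g ** al) al in e2.
have e3 : k *: (g ** al) = 2%:R *: al.
  by apply/ffunP => t; have /ffunP/(_ t) := e2; rewrite !vecE; lra.
have /(congr1 (fun v => B v v)) := e3.
rewrite !(bilZl, bilZr) (root_B hm rgal) (root_B hm ral) => e4.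
have /eqP : (k - 2%:R) * (k + 2%:R) = 0 by lra.
rewrite mulf_eq0 => /orP[h|h]; [apply: Or31|apply: Or32]; apply/ffunP => t;
 have /ffunP/(_ t) := e3; rewrite !vecE; move: h; rewrite ?subr_eq0 ?addr_eq0 => /eqP ->; lra.
Qed.
End One.

Section Two.
Variables (sp sp' : spec m) (s0 : S).
(** The second field serves to remove a chosen wall from the family given by the first. *)
Definition G2 (w : W) := pmF sp s0 w /\ pmF sp' s0 w.
Lemma G2M g h : G2 g -> G2 h -> G2 (g * h)%g.
Proof. by move=> [a b] [c d]; split; apply: pmFM. Qed.
Lemma G2V g : G2 g -> G2 g^-1%g.
Proof. by move=> [a b]; split; apply: pmFV. Qed.
Lemma G2s : G2 (sg m s0). Proof. by split; apply: pmFs. Qed.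
Lemma G21 : G2 1%g. Proof. by split; apply: pmF1. Qed.
Lemma G2_ker : exists N : fincong m, forall w, proj N w = 1%g -> G2 w.
Proof.
exists (fmeet (Nsp sp) (Nsp sp')) => w e.
have h1 : proj (fmeet (Nsp sp) (Nsp sp')) w = proj (fmeet (Nsp sp) (Nsp sp')) 1%g.
  by rewrite (hom1 (@proj_hom _ m _)).
by have /fmeetP [a b] := h1; split; apply: pmF_sp; rewrite ?a ?b (hom1 (@proj_hom _ m _)).
Qed.
End Two.
End SpecG.

(** * Inclusion of and retraction onto a union of components *)

Section IncRet.
Variables (S : finType) (m : S -> S -> nat) (hm : is_cox_graph m) (A : {set S}).
Definition sepA := forall s t, s \in A -> t \notin A -> m s t = 2%N.
Hypothesis hA : sepA.
Local Notation mA := (restrict m A).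
Lemma restrict_cox : is_cox_graph mA.
Proof. by case: hm => h1 [h2 h3]; split=> [x y|]; last split=> [x|x y]; [exact: h1|exact: h2|exact: h3]. Qed.
Definition incg (x : subV A) : cox m := sg m (val x).
Lemma incg_sq x : (incg x * incg x)%g = 1%g. Proof. exact: sg_sq. Qed.
Lemma incg_br x y : x != y -> mA x y != 0%N -> ((incg x * incg y) ^+ (mA x y))%g = 1%g.
Proof. by move=> xy h; apply: sg_rel. Qed.
Definition inc : cox mA -> cox m := clift incg.
Lemma inc_hom : hom inc. Proof. exact: clift_hom incg_sq incg_br. Qed.
Lemma inc_sg x : inc (sg mA x) = sg m (val x). Proof. exact: clift_sg incg_sq incg_br x. Qed.
Definition retg (s : S) : cox mA := if insub s is Some x then sg mA x else 1%g.
Lemma retg_in (x : subV A) : retg (val x) = sg mA x.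
Proof. by rewrite /retg valK. Qed.
Lemma retg_out s : s \notin A -> retg s = 1%g.
Proof. by move=> h; rewrite /retg insubF //; apply: negbTE. Qed.
Lemma retg_sq s : (retg s * retg s)%g = 1%g.
Proof. by rewrite /retg; case: insub => [x|]; rewrite ?sg_sq ?mulg1. Qed.
Lemma retg_br s t : s != t -> m s t != 0%N -> ((retg s * retg t) ^+ (m s t))%g = 1%g.
Proof.
move=> st h; have [sA|sA] := boolP (s \in A); have [tA|tA] := boolP (t \in A).
- have -> : s = val (Sub s sA : subV A) by []. have -> : t = val (Sub t tA : subV A) by [].
  by rewrite !retg_in; apply: (@sg_rel _ mA).
- by rewrite (retg_out tA) mulg1 hA // expgS expg1 retg_sq.
- by rewrite (retg_out sA) mul1g (proj1 hm) hA // expgS expg1 retg_sq.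
- by rewrite !retg_out // mulg1 expg1n.
Qed.
Definition ret : cox m -> cox mA := clift retg.
Lemma ret_hom : hom ret. Proof. exact: clift_hom retg_sq retg_br. Qed.
Lemma ret_sg s : ret (sg m s) = retg s. Proof. exact: clift_sg retg_sq retg_br s. Qed.
Lemma incK : cancel inc ret.
Proof.
apply: (@hom_ext _ _ _ (fun x => ret (inc x)) id) => //.
  by move=> x y; rewrite inc_hom ret_hom.
by move=> s; rewrite inc_sg ret_sg retg_in.
Qed.
End IncRet.

Lemma sepAC (S : finType) (m : S -> S -> nat) (hm : is_cox_graph m) A :
  sepA m A -> sepA m (~: A).
Proof. by move=> h s t; rewrite !inE negbK => sA tA; rewrite (proj1 hm); apply: h. Qed.
Lemma sepA_comp (S : finType) (m : S -> S -> nat) s : sepA m (comp m s).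
Proof. by move=> t r h1 h2; have [] := comp_m2 h1 h2. Qed.

Section Decomp.
Variables (S : finType) (m : S -> S -> nat) (hm : is_cox_graph m) (A : {set S}).
Hypothesis hA : sepA m A.
Lemma inc_comm x y : (inc (A := A) x * inc (A := ~: A) y)%g = (inc (A := ~: A) y * inc (A := A) x)%g :> cox m.
Proof.
elim/cox_ind: x => [|s x IH]; first by rewrite (hom1 (@inc_hom _ _ _)) mulg1 mul1g.
rewrite inc_hom -mulgA IH !mulgA; congr (_ * _)%g; rewrite inc_sg.
elim/cox_ind: y {IH} => [|t y IH]; first by rewrite (hom1 (@inc_hom _ _ _)) mulg1 mul1g.
rewrite inc_hom inc_sg -mulgA -IH !mulgA; congr (_ * _)%g.
have tA : val t \notin A by have := valP t; rewrite /= inE.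
have sA : val s \in A by exact: valP s.
have st : val s != val t by apply: contraNneq tA => <-.
have := @sg_rel _ m _ _ st; rewrite (hA sA tA) => /(_ isT).
rewrite expgS expg1 => e; apply: (mulIg (sg m (val s) * sg m (val t))%g).
rewrite e -!mulgA [(sg m (val s) * (_ * _))%g]mulgA sg_sq mul1g sg_sq //.
Qed.
Lemma decomp (w : cox m) : w = (inc (ret A w) * inc (ret (~: A) w))%g.
Proof.
have hC := sepAC hm hA.
apply: (@hom_ext _ _ _ id (fun w : cox m => inc (ret A w) * inc (ret (~: A) w))%g) => //.
  move=> x y; rewrite (ret_hom hm hA) (ret_hom hm hC) !inc_hom -!mulgA; congr (_ * _)%g.
  by rewrite !mulgA inc_comm.
move=> s; rewrite (ret_sg hm hA) (ret_sg hm hC).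
have [sA|sA] := boolP (s \in A).
  rewrite [retg m (~: A) s]retg_out ?inE ?sA // (hom1 (@inc_hom _ _ _)) mulg1.
  by rewrite (@retg_in _ m A (Sub s sA)) inc_sg.
rewrite [retg m A s]retg_out // (hom1 (@inc_hom _ _ _)) mul1g.
have sC : s \in ~: A by rewrite inE.
by rewrite (@retg_in _ m (~: A) (Sub s sC)) inc_sg.
Qed.
Lemma ret_inc_out (x : cox (restrict m A)) : ret (~: A) (inc (A := A) x) = 1%g.
Proof.
have hC := sepAC hm hA.
elim/cox_ind: x => [|s x IH]; first by rewrite (hom1 (@inc_hom _ _ _)) (hom1 (ret_hom hm hC)).
rewrite inc_hom (ret_hom hm hC) IH inc_sg (ret_sg hm hC) retg_out ?mulg1 //.
by rewrite inE negbK; exact: valP s.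
Qed.
End Decomp.

(** * The signature of the form on a generic component *)

Section Psd.
Variables (S : finType) (m : S -> S -> nat) (hm : is_cox_graph m) (s0 : S).
Local Notation es := (ev RR).
Local Notation "g ** v" := (@ga S m _ (aR m) g v) (at level 40).
Local Notation B := (bil (aR m)).
Local Notation W := (cox m).
Local Notation vv := (vec S RR).
Let aRs := aR_sym hm.
Let aRd := aR_diag m.
Let aRr := resp_aR hm.
#[local] Hint Resolve aRs aRd aRr hm : core.
Let I := comp m s0.
Definition inI (v : vv) := forall t, t \notin I -> v t = 0.
Lemma inI_sum v : inI v -> v = \sum_(s in I) v s *: es s.
Proof.
move=> h; rewrite {1}(vec_sum v) [RHS]big_mkcond; apply: eq_bigr => s _.
by case: ifPn => // sI; rewrite h // scale0r.
Qed.
Lemma inI_ev s : s \in I -> inI (es s).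
Proof. by move=> sI t tI; rewrite ffunE; case: eqP => // e; rewrite e sI in tI. Qed.
Lemma inI_out v t : inI v -> t \notin I -> B v (es t) = 0.
Proof.
move=> h tI; rewrite (inI_sum h) bil_suml big1 // => s sI.
by rewrite bilZl bil_evev (aR_out sI) // mulr0.
Qed.
Lemma inI_ga w v : inI v -> inI (w ** v).
Proof.
move=> h; elim/cox_ind: w => [|s w IH]; first by rewrite ga1.
rewrite gaM // ga_sg // refl_rv /rv => t tI; rewrite !vecE IH // ffunE.
case: eqP => [e|_]; last by rewrite mulr0 subr0.
by rewrite bilC // inI_out ?mul0r ?subr0 // -e.
Qed.

(* The sum of the squares of the finitely many functionals in the orbit is an invariant form, hence proportional to B. *)
Lemma qpsd (L : seq vv) :
  (forall w, exists2 x, x \in L & forall t, B (w ** es s0) (es t) = B x (es t)) ->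
  forall v, inI v -> 0 <= B v v.
Proof.
move=> hL; pose f (x : vv) : vv := [ffun t => B x (es t) : RR^o].
have fE x y : B x y = \sum_t f x t * y t.
  rewrite {1}(vec_sum y) bil_sumr; apply: eq_bigr => t _.
  by rewrite bilZr ffunE mulrC.
pose ok (p : vv) := `[< exists w, p = f (w ** es s0) >].
(* Functionals B(w e_s0, .) are collected instead of vectors, since the orbit may be finite only
   modulo the radical. *)
pose Lam := undup (filter ok (map f L)).
have LamP p : p \in Lam <-> exists w, p = f (w ** es s0).
  rewrite mem_undup mem_filter; split=> [/andP[/asboolP]//|[w e]].
  apply/andP; split; first by apply/asboolP; exists w.
  have [x xL h] := hL w; apply/mapP; exists x => //; rewrite e.
  by apply/ffunP => t; rewrite !ffunE h.
pose ap (p y : vv) : RR := \sum_t p t * y t.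
pose Q x y := \sum_(p <- Lam) ap p x * ap p y.
have Qadd z x y k : Q (k *: x + y) z = k * Q x z + Q y z.
  rewrite /Q mulr_sumr -big_split; apply: eq_bigr => p _ /=.
  have -> : ap p (k *: x + y) = k * ap p x + ap p y.
    by rewrite /ap mulr_sumr -big_split; apply: eq_bigr => t _; rewrite !vecE /=; ring.
  by ring.
have QC x y : Q x y = Q y x by apply: eq_bigr => p _; rewrite mulrC.
have Qinv s x y : Q (sg m s ** x) (sg m s ** y) = Q x y.
  pose sp (p : vv) : vv := [ffun t => ap p (sg m s ** es t) : RR^o].
  have spE p z : ap (sp p) z = ap p (sg m s ** z).
    rewrite {2}(vec_sum z) linear_sum /ap.
    under [RHS]eq_bigr => t _ do rewrite vecS mulr_sumr.
    rewrite exchange_big; apply: eq_bigr => r _; rewrite ffunE /ap mulr_suml.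
    by apply: eq_bigr => t _; rewrite linearZ vecZ /=; ring.
  have spf w : sp (f (w ** es s0)) = f ((sg m s * w)%g ** es s0).
    apply/ffunP => t; rewrite [LHS]ffunE [RHS]ffunE /ap -fE -[LHS](bil_ga aRs aRd (sg m s)).
    by rewrite -gaM // -gaM // sg_sq ga1.
  have sp2 p : p \in Lam -> sp (sp p) = p.
    move=> /LamP [w ->]; rewrite !spf; congr f; by rewrite mulgA sg_sq mul1g.
  have spL p : p \in Lam -> sp p \in Lam.
    by move=> /LamP [w ->]; apply/LamP; exists (sg m s * w)%g; rewrite spf.
  have pe : perm_eq (map sp Lam) Lam.
    apply: uniq_perm; rewrite ?undup_uniq //.
      by rewrite map_inj_in_uniq ?undup_uniq // => p q /sp2 e1 /sp2 e2 e; rewrite -e1 e e2.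
    move=> p; apply/mapP/idP => [[q qL ->]|pL]; first exact: spL.
    by exists (sp p); [exact: spL|rewrite sp2].
  rewrite [RHS]/Q -(perm_big _ pe) big_map; apply: eq_bigr => p _.
  by rewrite !spE.
have Q0 z : Q 0 z = 0.
  have := Qadd z 0 0 (-1); rewrite scaler0 addr0; lra.
have QZ x z k : Q (k *: x) z = k * Q x z by rewrite -[k *: x]addr0 Qadd Q0 addr0.
(* Invariance under the reflection in [e_s]. Comparing adjacent vertices then shows that the factor
   between Q and B is the same on the whole component. *)
have Qe s y : 2%:R * Q (es s) y = Q (es s) (es s) * B (es s) y.
  have := Qinv s (es s) y; rewrite ga_ev // ga_sg // refl_rv /rv.
  rewrite -[- es s]scaleN1r QZ QC [y - _]addrC -scaleNr Qadd [Q y _]QC.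
  by move=> e; lra.
have Qc t : t \in I -> Q (es t) (es t) = Q (es s0) (es s0).
  elim/comp_ind => {t} // t r tI IH tr; rewrite -IH.
  have := Qe t (es r); have := Qe r (es t); rewrite (QC (es r) (es t)) !bil_evev.
  rewrite (aRs r t) => -> /eqP; have := aR_adj hm tr => a0.
  by rewrite (inj_eq (mulIf _)) => [/eqP//|]; rewrite lt_eqF.
have lam : 0 < Q (es s0) (es s0).
  have f1 : f (1%g ** es s0) \in Lam by apply/LamP; exists 1%g.
  rewrite /Q (perm_big _ (perm_to_rem f1)) big_cons ltr_pwDl //.
    by rewrite /ap -fE ga1 // ev2 //; lra.
  by apply: sumr_ge0 => p _; rewrite -expr2 sqr_ge0.
move=> v vI; rewrite -(pmulr_rge0 _ lam).
have -> : Q (es s0) (es s0) * B v v = 2%:R * Q v v.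
  have Qs (J : seq S) z : Q (\sum_(s <- J | s \in I) v s *: es s) z = \sum_(s <- J | s \in I) v s * Q (es s) z.
    elim/big_rec2: _ => [|s y1 y2 _ <-]; first exact: Q0.
    by rewrite Qadd.
  rewrite {1 3}(inI_sum vI) Qs bil_suml !mulr_sumr; apply: eq_bigr => s sI.
  rewrite bilZl -[Q (es s0) (es s0)](Qc s sI).
  rewrite [RHS]mulrCA Qe; ring.
by rewrite mulr_ge0 // sumr_ge0 // => p _; rewrite -expr2 sqr_ge0.
Qed.
End Psd.

Section Generic.
Variables (S : finType) (m : S -> S -> nat) (hm : is_cox_graph m) (s0 : S).
Local Notation es := (ev RR).
Local Notation "g ** v" := (@ga S m _ (aR m) g v) (at level 40).
Local Notation B := (bil (aR m)).
Local Notation W := (cox m).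
Local Notation vv := (vec S RR).
Let aRs := aR_sym hm.
Let aRd := aR_diag m.
Let aRr := resp_aR hm.
#[local] Hint Resolve aRs aRd aRr hm : core.
Local Notation I := (comp m s0).
Local Notation inI := (@inI S m s0).

Lemma cosets (N : fincong m) : exists l : seq W, forall w, exists2 q, q \in l & proj N (q^-1 * w)%g = 1%g.
Proof.
have [l hl] : exists l : seq W, forall x, exists2 y, y \in l & proj N x = proj N y.
  by apply: ker_fin; have [l hl] := fin_list (fq N); exists l.
exists l => w; have [q ql e] := hl w; exists q => //.
by rewrite proj_hom (homV (@proj_hom _ m N)) -e mulVg.
Qed.
Lemma orb_fin N s : (forall u, proj N u = 1%g -> u ** es s = es s \/ u ** es s = - es s) ->
  exists l : seq vv, forall w, w ** es s \in l.
Proof.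
move=> h; have [l hl] := cosets N.
exists (map (fun q => q ** es s) l ++ map (fun q => - (q ** es s)) l) => w.
have [q ql /h e] := hl w; rewrite -[w](mulKVg q) gaM // mem_cat; apply/orP.
case: e => ->; [left|right]; last rewrite gaN; apply/mapP; by exists q.
Qed.
Lemma orb_finB N : (forall u, proj N u = 1%g -> (forall v, B (u ** es s0) v = B (es s0) v) \/
    (forall v, B (u ** es s0) v = - B (es s0) v)) ->
  exists l : seq vv, forall w, exists2 x, x \in l & forall t, B (w ** es s0) (es t) = B x (es t).
Proof.
move=> h; have [l hl] := cosets N.
exists (map (fun q => q ** es s0) l ++ map (fun q => - (q ** es s0)) l) => w.
have [q ql /h e] := hl w; rewrite -[w](mulKVg q) gaM //.
have e1 v : B (q ** ((q^-1 * w)%g ** es s0)) v = B ((q^-1 * w)%g ** es s0) (q^-1%g ** v).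
  by rewrite -bil_gaV // invgK.
have e2 v : B (q ** es s0) v = B (es s0) (q^-1%g ** v) by rewrite -bil_gaV // invgK.
case: e => e; [exists (q ** es s0)|exists (- (q ** es s0))].
- by rewrite mem_cat (map_f (fun q => q ** es s0)).
- by move=> t; rewrite e1 e e2.
- by rewrite mem_cat (map_f (fun q => - (q ** es s0))) ?orbT.
- by move=> t; rewrite e1 e bilNl e2.
Qed.
Lemma inc_fix (x : cox (restrict m I)) t : t \notin I -> inc x ** es t = es t.
Proof.
move=> tI; elim/cox_ind: x => [|s x IH]; first by rewrite (hom1 (@inc_hom _ _ _)) ga1.
rewrite inc_hom gaM // IH inc_sg ga_sg // refl_rv /rv bil_evev (aR_out (valP s) tI).
by rewrite scale0r subr0.
Qed.
(** The group of the component acts faithfully on its simple roots and fixes all the others. *)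
Lemma finW : (forall s, s \in I -> exists l : seq vv, forall w, w ** es s \in l) -> cox_finite (restrict m I).
Proof.
move=> h; have [l hl] : exists l : S -> seq vv, forall s, s \in I -> forall w, w ** es s \in l s.
  have /boolp.choice [l hl] : forall s, exists l : seq vv, s \in I -> forall w, w ** es s \in l.
    by move=> s; have [/h [l hl]|sI] := boolP (s \in I); [exists l|exists [::]].
  by exists l.
pose n := (\max_(s : S) size (l s))%N.
pose f (x : cox (restrict m I)) := [ffun s : subV I =>
  inord (index (inc x ** es (val s)) (l (val s))) : 'I_n.+1].
have fi : injective f.
  move=> x y e; apply: (can_inj (incK hm (@sepA_comp _ m s0))).
  apply: (cox_faithful2 hm) => t; have [tI|tI] := boolP (t \in I); last by rewrite !inc_fix.
  have xl := hl t tI (inc x); have yl := hl t tI (inc y).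
  have := congr1 (fun f : {ffun subV I -> 'I_n.+1} => val (f (Sub t tI))) e.
  have le w : w ** es t \in l t -> (index (w ** es t) (l t) < n.+1)%N.
    by move=> wl; rewrite ltnS (leq_trans (index_size _ _)) // (leq_bigmax t).
  rewrite /f !ffunE /= !inordK ?le // => ei.
  by rewrite -(nth_index 0 xl) ei nth_index.
have [L hL] := fin_list {ffun subV I -> 'I_n.+1}.
have [L' hL'] : exists l : seq (cox (restrict m I)), forall x, exists2 y, y \in l & f x = f y.
  pose g h := if pselect (exists y, f y = h) is left e then projT1 (cid e) else 1%g.
  exists (map g L) => x; exists (g (f x)); first by apply/map_f/hL.
  by rewrite /g; case: pselect => [e|[]]; [case: cid|exists x].
exists (map (@wrep _ _) L') => w; have [y yL /fi e] := hL' (wd _ w).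
by exists (wrep y); [exact: map_f|apply/wdP; rewrite wd_repr].
Qed.

Hypotheses (nfin : ~ cox_finite (restrict m I)) (naff : ~ cox_affine_on m I).

Lemma qformE (x : S -> RR) : let v : vv := [ffun s => (if s \in I then x s else 0) : RR^o] in
  B v v = 2%:R * qform m I x.
Proof.
move=> v; rewrite /bil /qform mulr_sumr [RHS]big_mkcond; apply: eq_bigr => s _.
rewrite ffunE; case: ifP => _; last by rewrite mul0r.
rewrite /pair !mulr_sumr [RHS]big_mkcond; apply: eq_bigr => t _.
rewrite ffunE; case: ifP => _; last by rewrite !mulr0.
by rewrite /aR; ring.
Qed.
(** Otherwise the form is positive definite on the component, which is not affine. Two roots of norm
    2 with |B| at least 2 then agree up to sign, so a subgroup of finite index fixes each simple
    root up to sign and the component is finite. *)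
Lemma neg_ex : exists v, inI v /\ B v v < 0.
Proof.
apply: contrapT => h.
have psd v : inI v -> 0 <= B v v.
  by move=> vI; rewrite leNgt; apply/negP => v0; apply: h; exists v.
have ani v : inI v -> B v v = 0 -> v = 0.
  move=> vI v0; apply: contrapT => n0; apply: naff; split=> [x|].
    have := psd _ (_ : inI [ffun s => (if s \in I then x s else 0) : RR^o]).
    rewrite qformE => h2; have := h2 _; rewrite pmulr_rge0 ?ltr0n //; apply.
    by move=> t tI; rewrite ffunE (negbTE tI).
  exists v; split.
    apply: contrapT => h2; apply: n0; apply/ffunP => s; rewrite ffunE.
    have [sI|/vI//] := boolP (s \in I); apply: contrapT => /eqP vs; apply: h2; by exists s.
  apply: (mulfI (_ : 2%:R != 0 :> RR)); first by rewrite pnatr_eq0.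
  rewrite -qformE mulr0 -{3}v0; congr (B _ _); apply/ffunP => s; rewrite ffunE;
    by case: ifPn => // /vI.
apply: nfin; apply: finW => s sI.
have [sp [tf _ _]] : exists sp : spec m, [/\ tfree sp, 2%:R != 0 :> sF sp & forall f, f \in [::] -> evp (sx sp) f != 0].
  exact: spec_ex.
apply: (@orb_fin (Nsp hm sp)) => u hu; have pu : pmF sp s u by apply: pmF_sp hu.
have esI : inI (es s) by apply: inI_ev.
have usI := inI_ga hm u esI.
have b1 : B (es s) (es s) = 2%:R by rewrite ev2.
have b2 : B (u ** es s) (u ** es s) = 2%:R by rewrite bil_ga.
have [h1|h1|] := pmF_tf hm tf pu; [by left|by right|].
have sum0 (x : RR) : (x = 1) \/ (x = -1) -> 0 <= 4%:R + x * 2%:R * B (es s) (u ** es s) /\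
    (4%:R + x * 2%:R * B (es s) (u ** es s) <= 0 -> u ** es s = - (x *: es s)).
  move=> x1; have e : B (u ** es s + x *: es s) (u ** es s + x *: es s) = 4%:R + x * 2%:R * B (es s) (u ** es s).
    rewrite !(bilDl, bilDr, bilZl, bilZr) b1 b2 (bilC aRs (u ** _)).
    by case: x1 => ->; ring.
  have vI : inI (u ** es s + x *: es s).
    by move=> t tI; rewrite !vecE usI // esI // mulr0 addr0.
  have := psd _ vI; rewrite e => p; split=> // n.
  by apply/eqP; rewrite -addr_eq0; apply/eqP/ani => //; rewrite e; apply/eqP; rewrite eq_le n p.
rewrite ler_normr => /orP[h1|h1].
  left; have [_ ->] := sum0 (-1) (or_intror erefl); last by lra.
  by rewrite scaleN1r opprK.
right; have [_ ->] := sum0 1 (or_introl erefl); last by lra.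
by rewrite scale1r.
Qed.

(** * A region of a generic component has at least three walls *)

Section ThreeWalls.
Variables (G : W -> Prop) (N : fincong m).
Hypotheses (G1 : G 1%g) (GM : forall g h, G g -> G h -> G (g * h)%g)
  (GV : forall g, G g -> G g^-1%g) (Gs0 : G (sg m s0))
  (Gtf : forall g, G g -> [\/ g ** es s0 = es s0, g ** es s0 = - es s0 |
     2%:R <= `|B (es s0) (g ** es s0)|])
  (GN : forall w, proj N w = 1%g -> G w).
Local Notation al := (es s0).
Local Notation J := (@J S m s0 G).
Local Notation FF := (@FF S m s0 G).
Let FFroot := @FF_root S m hm s0 G.
Let FFal := FF_al hm s0 G1.
Let FFga := @FF_ga S m hm s0 G GM.
Let FFneg := @FFN S m hm s0 G GM Gs0.
Let FFrefl := @FF_refl S m hm s0 G GM GV Gs0.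
Let simga := @sim_ga S m hm s0 G GM GV.

Section TwoWalls.
Variables (be : vv) (Jbe : J be) (Jall : forall b, J b -> b = al \/ b = be).
Definition inP (v : vv) := exists p q : RR, v = p *: al + q *: be.
Lemma inPD k u v : inP u -> inP v -> inP (k *: u + v).
Proof.
move=> [p [q ->]] [p' [q' ->]]; exists (k * p + p'), (k * q + q').
by apply/ffunP => t; rewrite !vecE; ring.
Qed.
Lemma inP_al : inP al. Proof. by exists 1, 0; rewrite scale1r scale0r addr0. Qed.
Lemma inP_be : inP be. Proof. by exists 0, 1; rewrite scale1r scale0r add0r. Qed.
Lemma inP0 : inP 0. Proof. by exists 0, 0; rewrite !scale0r addr0. Qed.
Lemma inPZ k u : inP u -> inP (k *: u).
Proof. by move=> h; rewrite -[_ *: _]addr0; apply: inPD inP0. Qed.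
Lemma inPB u v : inP u -> inP v -> inP (u - v).
Proof. by move=> hu hv; rewrite addrC -scaleN1r; apply: inPD. Qed.
Lemma inP_J b : J b -> inP b.
Proof. by move=> /Jall [->|->]; [apply: inP_al|apply: inP_be]. Qed.
(** Every wall of the family is the image of a boundary wall under a product of reflections in
    boundary walls, and these preserve the plane. *)
Lemma inP_FF b : FF b -> inP b.
Proof.
move=> [w Gw ->]; have [r [rJ sm]] := J_gen hm G1 GM GV Gs0 w.
have Gr := RJ_G G1 GM rJ.
have jb : J (r^-1%g ** (w ** al)).
  split; first by apply: FFga; [exact: GV|exists w].
  exists (r^-1 * w)%g, s0; split.
    by have := simga (GV Gr) sm; rewrite mulVg.
  by rewrite invMg invgK gaM // (gaVK aRr) (gaK aRr).
have := inP_J jb; move: (r^-1%g ** (w ** al)) (gaVK aRr r (w ** al)) => c <-.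
elim: rJ c {jb sm Gr} => [|{}r b' q _ IH jb _ qE] c; first by rewrite ga1.
move=> pc; rewrite gaM //; apply: IH; rewrite qE /rv addrC -scaleNr.
by apply: inPD => //; apply: inP_J.
Qed.
Lemma inP_G g v : G g -> inP v -> inP (g ** v).
Proof.
move=> Gg [p [q ->]]; rewrite gaD gaZ gaZ; apply: inPD; last apply: inPZ; apply: inP_FF; apply: FFga => //.
by case: Jbe.
Qed.
Lemma be_inI : inI be.
Proof. by case: Jbe => -[g Gg ->] _; apply: inI_ga => //; apply: inI_ev; apply: comp_refl. Qed.
Lemma root_be : B be be = 2%:R.
Proof. by apply: (root_B hm); apply: FFroot; case: Jbe. Qed.

Hypothesis ba : be <> al.
Let k := - B al be.
Lemma k_ge2 : 2%:R <= k.
Proof.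
rewrite /k lerNr; apply: (J_B hm GM GV Gtf) => //; last exact/nesym.
exact: J_al.
Qed.
Let Bab : B al be = - k. Proof. by rewrite /k opprK. Qed.
Let Bba : B be al = - k. Proof. by rewrite bilC. Qed.
Let Baa : B al al = 2%:R. Proof. exact: ev2. Qed.
Let Bbb := root_be.

(** A power of the product of the two reflections lies in the kernel of [N], so its conjugates by
    simple reflections still preserve the plane. *)
Lemma yex : exists (y : W) (K : nat) (z : W), [/\ (0 < K)%N, y = (z ^+ K)%g, proj N y = 1%g &
  forall v, z ** v = rv (aR m) al (rv (aR m) be v)].
Proof.
have [q [Gq _ qE]] := FFrefl (proj1 Jbe).
exists ((sg m s0 * q) ^+ #|[set: fq N]|)%g, #|[set: fq N]|, (sg m s0 * q)%g; split=> //.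
- by rewrite (homX (@proj_hom _ m N)) expg_cardG ?inE.
- by move=> v; rewrite gaM // qE ga_sg // refl_rv.
Qed.

Section Y.
Variables (y : W) (K : nat) (z : W) (K0 : (0 < K)%N) (yz : y = (z ^+ K)%g)
  (Ny : proj N y = 1%g) (zE : forall v, z ** v = rv (aR m) al (rv (aR m) be v)).
Lemma y_P v : inP (y ** v - v).
Proof.
rewrite yz; elim: (K) v => [|n IH] v; first by rewrite expg0 ga1 // subrr; apply: inP0.
rewrite expgS gaM //; set u := (z ^+ n)%g ** v.
have -> : z ** u - v = (z ** u - u) - (v - u).
  by apply/ffunP => t; rewrite !vecE; ring.
apply: inPB; last by rewrite -opprB -scaleN1r; apply: inPZ; apply: IH.
rewrite zE /rv; set x1 := bil _ _ _; set x2 := bil _ _ _.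
have -> : u - x1 *: be - x2 *: al - u = (- x1) *: be + (- x2) *: al.
  by apply/ffunP => t; rewrite !vecE; ring.
by apply: inPD; [exact: inP_be|apply: inPZ; exact: inP_al].
Qed.
Lemma z_lam (l : RR) : l ^+ 2 - k * l + 1 = 0 ->
  z ** (l *: al + be) = (l ^+ 2) *: (l *: al + be).
Proof.
move=> hl; rewrite zE /rv !(bilDr, bilZr, bilDl, bilZl, bilNr) Bab Bba Baa Bbb.
apply/ffunP => t; rewrite !vecE.
have e : l ^+ 2 = k * l - 1 by lra.
by ring: e.
Qed.

(** The conjugate of [y] by the reflection in [e_r] preserves the plane, so [y v] and its mirror
    image both lie in the plane; their difference is a multiple of [e_r], which does not. *)
Lemma e_perp r v : B (es r) v = 0 -> inP v -> ~ inP (es r) ->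
  B (es r) (y ** v) = 0.
Proof.
move=> rv0 vP rP; set u := (sg m r * y * sg m r)%g ** v.
have uP : inP u.
  apply: inP_G vP; apply: GN; rewrite !(@proj_hom _ m N) Ny mulg1 -(@proj_hom _ m N) sg_sq.
  exact: (hom1 (@proj_hom _ m N)).
have yu : y ** v = u - B (es r) u *: es r.
  rewrite -[RHS]/(rv (aR m) (es r) u) -refl_rv -(ga_sg aRr).
  rewrite /u -(gaM aRr) !mulgA sg_sq mul1g gaM // ga_sg // refl_rv /rv rv0.
  by rewrite scale0r subr0.
have yP : inP (y ** v) by rewrite -[y ** v](subrK v) addrC -[v]scale1r; apply: inPD => //; exact: y_P.
have c0 : B (es r) u = 0.
  apply: contrapT => /eqP c0; apply: rP; have -> : es r = (B (es r) u)^-1 *: (u - y ** v).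
    by rewrite yu opprD addrA subrr add0r opprK scalerA mulVf // scale1r.
  by apply: inPZ; apply: inPB.
by rewrite yu c0 scale0r subr0.
Qed.

(** The isotropic vector al + be turns out to lie in the radical. Modulo the radical the kernel of
    [N] then acts on [al] by signs, and [qpsd] contradicts the negative vector of [neg_ex]. *)
Lemma parab : k = 2%:R -> False.
Proof.
move=> k2; have [d dE] : exists d, d = al + be by exists (al + be).
have dal : B d al = 0 by rewrite dE bilDl Baa Bba k2; lra.
have dbe : B d be = 0 by rewrite dE bilDl Bbb Bab k2; lra.
have zd : z ** d = d by rewrite zE /rv (bilC aRs be) dbe scale0r subr0 (bilC aRs al) dal scale0r subr0.
have za : z ** al = al + 2%:R *: d.
  rewrite zE /rv !(bilDr, bilZr, bilNr) Bab Bba Baa k2 dE.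
  by apply/ffunP => t; rewrite !vecE; lra.
have yd : y ** d = d.
  by rewrite yz; elim: (K) => [|n IH]; rewrite ?expg0 ?ga1 // expgS gaM // IH.
have ya : y ** al = al + (2%:R * K%:R) *: d.
  rewrite yz; elim: (K) => [|n IH]; first by rewrite expg0 ga1 // mulr0 scale0r addr0.
  rewrite expgS gaM // IH gaD gaZ zd za -[in RHS]addn1 natrD.
  by apply/ffunP => t; rewrite !vecE; ring.
have dP v : inP v -> B d v = 0.
  by move=> [p [q ->]]; rewrite bilDr !bilZr dal dbe !mulr0 addr0.
have d_inP : inP d by rewrite dE -[al]scale1r; apply: inPD; [exact: inP_al|exact: inP_be].
have dI : inI d by move=> t tI; rewrite dE vecE be_inI // (inI_ev (comp_refl m s0)) // addr0.
have drad r : B d (es r) = 0.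
  have [rP|rP] := pselect (inP (es r)); first exact: dP.
  set a := B (es r) d; rewrite (bilC aRs) -/a; set a' := B (es r) al.
  (* This vector is orthogonal to [e_r]. Since [y] adds a nonzero multiple of [d] to [al], [e_perp]
     forces the square of [a] to vanish. *)
  have v0P : inP (a *: al - a' *: d).
    by apply: inPB; apply: inPZ => //; exact: inP_al.
  have := e_perp (r := r) _ v0P rP; rewrite gaB !gaZ ya yd !(bilDr, bilNr, bilZr) -/a -/a'.
  have -> : a * a' - a' * a = 0 by ring.
  move=> /(_ erefl) e; apply/eqP; rewrite -sqrf_eq0.
  have K1 : 0 < (K%:R : RR) by rewrite ltr0n.
  have /eqP : 2%:R * K%:R * a ^+ 2 = 0 by rewrite -e; ring.
  by rewrite mulf_eq0 mulf_eq0 pnatr_eq0 /= (gt_eqF K1).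
have dradv v : B d v = 0.
  by rewrite (vec_sum v) bil_sumr big1 // => t _; rewrite bilZr drad mulr0.
have wd w : w ** d = d.
  elim/cox_ind: w => [|s w IH]; first by rewrite ga1.
  by rewrite gaM // IH ga_sg // refl_rv /rv (bilC aRs) drad scale0r subr0.
have [L hL] : exists l : seq vv, forall w, exists2 x, x \in l & forall t, B (w ** es s0) (es t) = B x (es t).
  apply: (@orb_finB N) => u /GN Gu.
  have /inP_FF [p [q e]] : FF (u ** al) by exists u.
  have e2 v : B (u ** al) v = (p - q) * B al v.
    have -> : u ** al = (p - q) *: al + q *: d.
      by rewrite e dE; apply/ffunP => t; rewrite !vecE; ring.
    by rewrite bilDl !bilZl dradv mulr0 addr0.
  have : B (u ** al) (u ** al) = 2%:R by rewrite bil_ga.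
  rewrite e2 (bilC aRs) e2 Baa => e3.
  have /eqP : ((p - q) - 1) * ((p - q) + 1) = 0 by lra.
  rewrite mulf_eq0 subr_eq0 addr_eq0 => /orP[/eqP h|/eqP h]; [left|right] => v.
    by rewrite e2 h mul1r.
  by rewrite e2 h mulN1r.
have [v [vI]] := neg_ex; rewrite ltNge; apply/negP; rewrite negbK.
exact: qpsd hL _ vI.
Qed.

(** [y] has isotropic eigenvectors in the plane, with eigenvalues above and below 1. They force each
    simple root outside the plane to be orthogonal to it, so by connectedness the whole component
    lies in the plane. But two simple roots span a semidefinite plane, while al + be has negative
    norm. *)
Lemma hyperb : 2%:R < k -> False.
Proof.
move=> k2; pose D := Num.sqrt (k ^+ 2 - 4%:R).
have D2 : D ^+ 2 = k ^+ 2 - 4%:R by rewrite sqr_sqrtr //; nra.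
have D0 : 0 < D by rewrite sqrtr_gt0; nra.
pose l1 := (k + D) / 2%:R; pose l2 := (k - D) / 2%:R.
have q1 : l1 ^+ 2 - k * l1 + 1 = 0 by rewrite /l1; lra.
have q2 : l2 ^+ 2 - k * l2 + 1 = 0 by rewrite /l2; lra.
have l12 : l1 * l2 = 1 by rewrite /l1 /l2; lra.
have l1g : 1 < l1 by rewrite /l1; lra.
have l2g : 0 < l2 by rewrite -(pmulr_rgt0 _ (lt_trans ltr01 l1g)) l12.
have l2l : l2 < 1 by rewrite -l12 ltr_pMl.
set e1 := l1 *: al + be; set e2 := l2 *: al + be.
pose L1 := (l1 ^+ 2) ^+ K; pose L2 := (l2 ^+ 2) ^+ K.
have ye l (e := l *: al + be) : l ^+ 2 - k * l + 1 = 0 -> y ** e = ((l ^+ 2) ^+ K) *: e.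
  move=> q; rewrite yz; elim: (K) => [|n IH]; first by rewrite expg0 ga1 // scale1r.
  by rewrite expgSr gaM // (z_lam q) gaZ IH scalerA -exprS.
have L1g : 1 < L1 by rewrite exprn_egt1 -?lt0n // exprn_egt1.
have L2g : L2 < 1 by rewrite exprn_ilt1 -?lt0n // ?exprn_ge0 ?exprn_ilt1 // ltW.
have B12 : B e1 e2 != 0.
  rewrite /e1 /e2 !(bilDl, bilDr, bilZl, bilZr) Baa Bab Bba Bbb.
  have -> : l1 * (l2 * 2%:R) + l1 * - k + (l2 * - k + 2%:R) = 4%:R - k ^+ 2.
    by have -> : l1 * (l2 * 2%:R) = 2%:R * (l1 * l2); [ring|]; rewrite l12 /l1 /l2; lra.
  by rewrite lt_eqF //; nra.
have iso l : l ^+ 2 - k * l + 1 = 0 -> B (l *: al + be) (l *: al + be) = 0.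
  by move=> q; rewrite !(bilDl, bilDr, bilZl, bilZr) Baa Bab Bba Bbb; lra.
have eP l : inP (l *: al + be) by apply: inPD; [exact: inP_al|exact: inP_be].
have Pe v : inP v -> exists p q, v = p *: e1 + q *: e2.
  move=> [p [q ->]]; exists ((p - q * l2) / D), ((q * l1 - p) / D).
  have Dn : D != 0 by rewrite gt_eqF.
  have dl : l1 - l2 = D by rewrite /l1 /l2; lra.
  apply/ffunP => t; rewrite !vecE -dl; field.
  by rewrite dl.
(* A simple root orthogonal to only one eigenvector [f]: then [y] changes [x] by a multiple of [f],
   and invariance of B(x, f) forces the eigenvalue of [f] to be 1. *)
have contra r f f' L : ~ inP (es r) -> y ** f = L *: f -> L != 1 -> B f f = 0 -> B f' f != 0 ->
    inP f' -> B (es r) f = 0 -> B (es r) f' != 0 ->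
    (forall v, inP v -> exists p q, v = p *: f + q *: f') -> False.
  move=> rP yf L1n ff f'f f'P rf rf' dec.
  have rfE : sg m r ** f = f by rewrite ga_sg // refl_rv /rv rf scale0r subr0.
  set x := sg m r ** f'; set u := (sg m r * y * sg m r)%g ** f'.
  have uP : inP u.
    apply: inP_G f'P; apply: GN; rewrite !(@proj_hom _ m N) Ny mulg1 -(@proj_hom _ m N) sg_sq.
    exact: (hom1 (@proj_hom _ m N)).
  have yx : y ** x - x = (u - f') - B (es r) (u - f') *: es r.
    rewrite -[RHS]/(rv (aR m) (es r) (u - f')) -refl_rv -(ga_sg aRr) gaB -/x; congr (_ - _).
    by rewrite /u -(gaM aRr) !mulgA sg_sq mul1g gaM.
  have c0 : B (es r) (u - f') = 0.
    apply: contrapT => /eqP c0; apply: rP.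
    have -> : es r = (B (es r) (u - f'))^-1 *: ((u - f') - (y ** x - x)).
      by rewrite yx subKr scalerA mulVf // scale1r.
    by apply: inPZ; apply: inPB; [exact: inPB|exact: y_P].
  rewrite c0 scale0r subr0 in yx.
  have [p [q e]] : exists p q, u - f' = p *: f + q *: f' by apply: dec; apply: inPB.
  have q0 : q = 0.
    apply/eqP; move: c0; rewrite e bilDr !bilZr rf mulr0 add0r => /eqP.
    by rewrite mulf_eq0 (negbTE rf') orbF.
  have yx2 : y ** x = x + p *: f.
    by rewrite -[LHS](subrK x) yx e q0 scale0r addr0 addrC.
  have xf : B x f = B f' f by rewrite -[in LHS]rfE bil_ga.
  have := bil_ga aRs aRd y x f; rewrite yx2 yf bilDl !(bilZr, bilZl) ff !mulr0 addr0 xf => /eqP.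
  by rewrite -subr_eq0 -{2}[B f' f]mul1r -mulrBl mulf_eq0 (negbTE f'f) orbF subr_eq0 (negbTE L1n).
have perp r : ~ inP (es r) -> forall v, inP v -> B (es r) v = 0.
  move=> rP; set a1 := B (es r) e1; set a2 := B (es r) e2.
  have Pe' v : inP v -> exists p q, v = p *: e2 + q *: e1.
    by move=> /Pe [p [q ->]]; exists q, p; rewrite addrC.
  have v0P : inP (a2 *: e1 - a1 *: e2) by apply: inPB; apply: inPZ; exact: eP.
  have prem : B (es r) (a2 *: e1 - a1 *: e2) = 0 by rewrite bilDr bilNr !bilZr -/a1 -/a2; ring.
  have := e_perp prem v0P rP; rewrite gaB !gaZ (ye _ q1) (ye _ q2) -/e1 -/e2 -/L1 -/L2.
  rewrite bilDr bilNr !bilZr -/a1 -/a2 => h.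
  have /eqP : a1 * a2 * (L1 - L2) = 0 by rewrite -[RHS]h; ring.
  rewrite !mulf_eq0 [L1 - L2 == 0]gt_eqF ?orbF; last by lra.
  have [a10|a10] := eqVneq a1 0; have [a20|a20] := eqVneq a2 0 => //= _.
  - by move=> v /Pe [p [q ->]]; rewrite bilDr !bilZr -/a1 -/a2 a10 a20 !mulr0 addr0.
  - case: (contra r e1 e2 L1) => //; [exact: ye|by rewrite gt_eqF|exact: iso|by rewrite bilC|exact: eP].
  - case: (contra r e2 e1 L2) => //; [exact: ye|by rewrite lt_eqF|exact: iso|exact: eP].
have allP t : t \in I -> inP (es t).
  elim/comp_ind => {t} [|t r tI IH tr]; first exact: inP_al.
  apply: contrapT => /perp /(_ _ IH); rewrite bil_evev (aRs r t) => e.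
  by have := aR_adj hm tr; rewrite e ltxx.
have [[t [tI ts]]|none] := pselect (exists t, t \in I /\ t != s0); last first.
  have [v [vI]] := neg_ex; rewrite (inI_sum vI) (bigD1 s0) ?comp_refl //= big1.
    by rewrite addr0 bilZl bilZr Baa => h; have := sqr_ge0 (v s0); rewrite expr2; lra.
  by move=> t /andP[tI ts]; case: none; exists t.
have [p [q e]] := allP t tI.
have q0 : q != 0.
  apply/eqP => q0; have /ffunP/(_ t) := e; rewrite q0 scale0r addr0 !vecE !ffunE eqxx (negbTE ts) mulr0.
  by move/eqP; rewrite oner_eq0.
have ab : al + be = (1 - p / q) *: al + q^-1 *: es t.
  rewrite e; apply/ffunP => r; rewrite !vecE; field. exact: q0.
have : B (al + be) (al + be) < 0 by rewrite !(bilDl, bilDr) Baa Bab Bba Bbb; lra.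
rewrite ab !(bilDl, bilDr, bilZl, bilZr) !bil_evev !aRd (aRs t s0).
set a := aR m s0 t; have a1 : a <= 0 by apply: aR_le0; rewrite // eq_sym.
have a2 : -2%:R <= a by apply: aR_ge.
set X := 1 - p / q; set Y := q^-1.
have : 0 <= 2%:R * X * X + 2%:R * a * X * Y + 2%:R * Y * Y.
  have -> : 2%:R * X * X + 2%:R * a * X * Y + 2%:R * Y * Y =
    (2%:R + a) / 2%:R * (X + Y) ^+ 2 + (2%:R - a) / 2%:R * (X - Y) ^+ 2 by field.
  by rewrite addr_ge0 // mulr_ge0 ?sqr_ge0 //; lra.
by lra.
Qed.
End Y.
Lemma two_walls : False.
Proof.
have [y [K [z [K0 yz Ny zE]]]] := yex.
have := k_ge2; rewrite le_eqVlt => /orP[/eqP/esym k2|k2].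
  exact: parab K0 yz Ny zE k2.
exact: hyperb K0 yz Ny zE k2.
Qed.
End TwoWalls.

(** With a single wall the plane shrinks to a line on which the kernel of [N] acts by signs, and
    [qpsd] applies again; exactly two walls are excluded by [two_walls]. *)
Lemma three_walls : exists b c, [/\ J b, J c & [/\ b <> es s0, c <> es s0 & b <> c]].
Proof.
apply: contrapT => h.
have [be [jb nb]] : exists be, J be /\ be <> al.
  apply: contrapT => h2.
  have Jall b : J b -> b = al \/ b = al.
    by move=> jb; left; apply: contrapT => e; apply: h2; exists b.
  have ja := J_al hm s0 G1.
  have [L hL] : exists l : seq vv, forall w, exists2 x, x \in l & forall t, B (w ** es s0) (es t) = B x (es t).
    apply: (@orb_finB N) => u /GN Gu.
    have [p [q]] : inP al (u ** al) by apply: (inP_FF Jall); exists u.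
    rewrite -scalerDl => e; have : B (u ** al) (u ** al) = 2%:R by rewrite bil_ga // ev2.
    rewrite e bilZl bilZr ev2 // => e3.
    have /eqP : ((p + q) - 1) * ((p + q) + 1) = 0 by lra.
    rewrite mulf_eq0 subr_eq0 addr_eq0 => /orP[/eqP ->|/eqP ->]; [left|right] => v.
      by rewrite scale1r.
    by rewrite scaleN1r bilNl.
  have [v [vI]] := neg_ex; rewrite ltNge; apply/negP; rewrite negbK.
  exact: qpsd hL _ vI.
apply: (two_walls jb _ nb) => b jb'; have [|n] := pselect (b = al); first by left.
right; apply: contrapT => n2; apply: h; exists be, b; split=> //; split=> //.
exact/nesym.
Qed.
End ThreeWalls.
End Generic.

(** * Ping-pong and four walls after refining the family *)

Section HalfSpaces.
Variables (S : finType) (m : S -> S -> nat) (hm : is_cox_graph m) (s0 : S).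
Local Notation es := (ev RR).
Local Notation "g ** v" := (@ga S m _ (aR m) g v) (at level 40).
Local Notation B := (bil (aR m)).
Local Notation W := (cox m).
Local Notation vv := (vec S RR).
Local Notation sg_pos := (@sg_pos S m).
Let aRs := aR_sym hm.
Let aRd := aR_diag m.
Let aRr := resp_aR hm.
#[local] Hint Resolve aRs aRd aRr hm : core.
Local Notation al := (es s0).

(** Distinct real vectors differ in some coordinate, and the difference is a polynomial in [cc]; any
    field where it does not vanish keeps them apart. *)
Lemma sepF w s w' s' (e : int) : w ** es s <> e%:~R *: (w' ** es s') ->
  exists f, evp (cc m) f != 0 /\ forall sp : spec m, evp (sx sp) f != 0 ->
    ga (aF sp) w (ev (sF sp) s) <> e%:~R *: ga (aF sp) w' (ev (sF sp) s').
Proof.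
move=> /(dpolyR (p := wrep w) (q := wrep w')) [r hr].
by exists (dpoly m (wrep w) (wrep w') s s' e r); split=> // sp /dpolyF h.
Qed.

Section Fam.
Variable (G : W -> Prop).
Hypotheses (G1 : G 1%g) (GM : forall g h, G g -> G h -> G (g * h)%g)
  (GV : forall g, G g -> G g^-1%g) (Gs0 : G (sg m s0))
  (Gtf : forall g, G g -> [\/ g ** es s0 = es s0, g ** es s0 = - es s0 |
     2%:R <= `|B (es s0) (g ** es s0)|]).
Local Notation J := (@J S m s0 G).
Local Notation FF := (@FF S m s0 G).
Let FFroot := @FF_root S m hm s0 G.
Let FFal := FF_al hm s0 G1.
Let FFga := @FF_ga S m hm s0 G GM.
Let FFneg := @FFN S m hm s0 G GM Gs0.
Let FFrefl := @FF_refl S m hm s0 G GM GV Gs0.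
Let Jdisj := @J_disj S m hm s0 G GM GV Gtf.
Definition isrefl (q : W) (b : vv) := (q * q = 1)%g /\ forall v, q ** v = rv (aR m) b v.
Lemma refl_self q b : wroot m b -> isrefl q b -> q ** b = - b.
Proof. by move=> rb [_ ->]; rewrite rv_self // (root_B hm). Qed.
Lemma refl_sgpos q b w : wroot m b -> isrefl q b -> sg_pos (q * w)%g b = ~~ sg_pos w b.
Proof.
move=> rb qb; rewrite -[in LHS](opprK b) -(refl_self rb qb) -gaN sg_pos_mul //.
by rewrite (sg_posN hm).
Qed.
Lemma sgpos_refl q b c w : isrefl q b -> sg_pos (q * w)%g c = sg_pos w (q ** c).
Proof. by move=> [qq _]; rewrite -[in LHS](ga1 aRr c) -qq gaM // sg_pos_mul. Qed.
(** Ping-pong: the reflection in [y] sends its positive side to the negative one, which lies on the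
    positive side of [x]; the reflection in [x] then leads to the negative side of [x]. *)
Lemma pp_step x y qx qy w n : J x -> J y -> x <> y -> isrefl qx x -> isrefl qy y ->
  sg_pos w y -> (0 < n)%N -> sg_pos ((qx * qy) ^+ n * w)%g x = false.
Proof.
move=> jx jy xy rx ry; have rtx := FFroot (proj1 jx); have rty := FFroot (proj1 jy).
case: n => // n wy _; elim: n w wy => [|n IH] w wy; last first.
  rewrite expgSr -mulgA; apply: IH; apply: contrapT => /negP/negbTE hy.
  apply: (Jdisj jx jy xy _ hy); rewrite -mulgA (refl_sgpos _ rtx rx).
  apply/negbF; apply: contrapT => /negP/negbTE h2; apply: (Jdisj jx jy xy h2).
  by rewrite (refl_sgpos _ rty ry) wy.
rewrite expg1 -mulgA (refl_sgpos _ rtx rx); apply/negbF.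
apply: contrapT => /negP/negbTE h2; apply: (Jdisj jx jy xy h2).
by rewrite (refl_sgpos _ rty ry) wy.
Qed.
Lemma pingpong a b c qa qb qc n : J a -> J b -> J c -> a <> b -> c <> b -> a <> c ->
  isrefl qa a -> isrefl qb b -> isrefl qc c -> (0 < n)%N ->
  ((qa * qb) ^+ n * (qc * qb) ^+ n)%g <> ((qc * qb) ^+ n * (qa * qb) ^+ n)%g.
Proof.
move=> ja jb jc ab cb ac ra rb rc n0 e.
have p1 : sg_pos 1%g b by apply: J_pos jb.
have hc : sg_pos ((qc * qb) ^+ n * 1)%g c = false by apply: (pp_step jc jb cb rc rb p1 n0).
have ha : sg_pos ((qa * qb) ^+ n * 1)%g a = false by apply: (pp_step ja jb ab ra rb p1 n0).
rewrite mulg1 in ha; rewrite mulg1 in hc.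
have h1 : sg_pos ((qa * qb) ^+ n * (qc * qb) ^+ n)%g a = false.
  apply: (pp_step ja jb ab ra rb _ n0); apply: contrapT => /negP/negbTE h.
  exact: (Jdisj jc jb cb hc h).
have h2 : sg_pos ((qc * qb) ^+ n * (qa * qb) ^+ n)%g c = false.
  apply: (pp_step jc jb cb rc rb _ n0); apply: contrapT => /negP/negbTE h.
  exact: (Jdisj ja jb ab ha h).
rewrite -e in h2; exact: (Jdisj ja jc ac h1 h2).
Qed.

Lemma J_wit b : J b -> exists w, sg_pos w b = false /\
  forall c, FF c -> c <> b -> c <> - b -> sg_pos w c = sg_pos 1%g c.
Proof.
case=> fb [w [s [h e]]]; exists (w * sg m s)%g; split.
  by apply: sg_flip_ev => //; apply: FFroot.
move=> c fc cb cb'; rewrite (h _ fc); apply: sg_flip => //; first exact: FFroot.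
  by rewrite -e (inj_eq (ga_inj aRr (g := _))); apply/eqP.
by rewrite -e -gaN (inj_eq (ga_inj aRr (g := _))); apply/eqP.
Qed.
(** The region behind the wall [a] is the mirror image of the base region, and only this wall
    separates the two. *)
Lemma J_refl1 a qa c : J a -> G qa -> isrefl qa a -> FF c -> c <> a -> c <> - a ->
  sg_pos qa c = sg_pos 1%g c.
Proof.
case=> fa [w [s [h e]]] Gq ra fc ca ca'.
have fqc : FF (qa ** c) by apply: FFga.
rewrite -[qa]mulg1 (sgpos_refl _ _ ra) (h _ fqc) (h _ fc).
have -> : sg_pos w (qa ** c) = sg_pos (w * sg m s)%g c.
  rewrite /pos_at invMg sgV gaM // ga_sg // refl_rv -e -ga_rv //.
  by case: ra => _ ->.
apply: sg_flip => //; first exact: FFroot.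
  by rewrite -e (inj_eq (ga_inj aRr (g := _))); apply/eqP.
by rewrite -e -gaN (inj_eq (ga_inj aRr (g := _))); apply/eqP.
Qed.

Section Sub.
Variables (G' : W -> Prop) (N : fincong m).
Hypotheses (G1' : G' 1%g) (GM' : forall g h, G' g -> G' h -> G' (g * h)%g)
  (GV' : forall g, G' g -> G' g^-1%g) (Gs0' : G' (sg m s0))
  (Gsub : forall g, G' g -> G g) (GN : forall w, proj N w = 1%g -> G' w).
Local Notation J' := (@J_of S m s0 G').
Local Notation FF' := (@FF_of S m s0 G').
Lemma FFsub b : FF' b -> FF b. Proof. by case=> g /Gsub Gg ->; exists g. Qed.
(** Conditions under which the finer family has a boundary wall beyond [b]: [h_in] places both
    chambers at a panel of the wall [g al] beyond [b], and [h_wit] gives a chamber beyond [b] that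
    no wall of the finer family, except possibly [b] itself, separates from the identity. *)
Record half (b : vv) : Prop := Half {
  h_FF : FF b;
  h_one : sg_pos 1%g b;
  h_wit : exists w, sg_pos w b = false /\
    forall c, FF' c -> c <> b -> c <> - b -> sg_pos w c = sg_pos 1%g c;
  h_in : exists g, [/\ proj N g = 1%g, sg_pos g b = false & sg_pos (g * sg m s0)%g b = false] }.
(** One of the two chambers at the wall [g al] is separated from the identity by it, and the first
    wall of the finer family on the way there bounds the base region. *)
Lemma half_wall b : half b -> exists c x, [/\ J' c, sg_pos x c = false & sg_pos x b = false].
Proof.
case=> _ _ _ [g [gN g1 g2]]; have Gg := GN gN.
have fg : FF' (g ** al) by exists g.
have [x [x1 x2]] : exists x, sg_pos x b = false /\ sg_pos 1%g (g ** al) != sg_pos x (g ** al).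
  have e1 : sg_pos g (g ** al) by rewrite -{1}[g]mulg1 sg_pos_mul //; apply: sg_pos_ev; rewrite invg1 ga1.
  have e2 : sg_pos (g * sg m s0)%g (g ** al) = false.
    rewrite sg_pos_mul // -[sg m s0]mul1g; apply: sg_flip_ev => //; first exact: root_ev.
    by rewrite invg1 ga1.
  case e3 : (sg_pos 1%g (g ** al)); [exists (g * sg m s0)%g|exists g]; by rewrite ?e1 ?e2.
have [p [ps xp]] := lenP x; rewrite xp in x1 x2.
have [c [jc hc]] := first_wall hm GM' Gs0' fg x2.
exists c, x; rewrite xp; split=> //.
have rc : wroot m c by apply: FFroot (FFsub (proj1 jc)).
rewrite xp in ps; case: hc => /(reduced_sep hm ps) [_ p1 p2]; first exact: negbTE.
by rewrite (sg_posN hm) // (J_pos jc) in p1.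
Qed.
(** A boundary wall [c] met beyond two disjoint half-spaces would have to cross the wall of the
    first one; the four occupied quadrants contradict [quad]. *)
Lemma half_distinct b1 b2 c x1 x2 : half b1 -> FF b2 ->
  (forall w, sg_pos w b1 = false -> sg_pos w b2 = false -> False) -> J' c ->
  sg_pos x1 c = false -> sg_pos x1 b1 = false -> sg_pos x2 c = false -> sg_pos x2 b2 = false -> False.
Proof.
move=> [f1 o1 [w [w1 wc]] _] f2 disj jc x1c x1b x2c x2b.
have fc' := proj1 jc; have fc := FFsub fc'; have p1 := J_pos jc.
have x2b1 : sg_pos x2 b1 by apply: contrapT => /negP/negbTE h; apply: (disj x2).
case: (FF_tf hm GM GV Gtf f1 fc) => [e|e|big].
- by rewrite e x2b1 in x2c.
- by rewrite e (sg_posN hm) ?o1 // in p1; apply: FFroot.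
have rc := FFroot fc; have rb := FFroot f1.
have cb : c <> b1 by move=> e; rewrite e x2b1 in x2c.
have cb' : c <> - b1 by move=> e; rewrite e (sg_posN hm) ?o1 in p1.
apply: (quad hm (g1 := 1%g) (g2 := x2) (g3 := w) (g4 := x1) rb rc big) => //.
- by rewrite x2c.
- by rewrite w1.
- by rewrite wc.
- by rewrite x1b.
- by rewrite x1c.
Qed.

Variables (a b c : vv) (qa qb qc : W).
Hypotheses (ja : J a) (jb : J b) (jc : J c) (ab : a <> b) (ac : a <> c) (bc : b <> c)
  (aal : a <> al) (ra : isrefl qa a) (rb : isrefl qb b) (rc : isrefl qc c) (Gqa : G qa)
  (aF' : ~ FF' a).
Let aF'n : ~ FF' (- a).
Proof. by move=> h; apply: aF'; rewrite -[a]opprK; apply: (FFN hm GM' Gs0'). Qed.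
Let Npow (y : W) : exists n, (0 < n)%N /\ proj N (y ^+ n)%g = 1%g.
Proof.
exists #|[set: fq N]|; split; first exact: (cardG_gt0 [set: fq N]%G).
by rewrite (homX (@proj_hom _ m N)) expg_cardG ?inE.
Qed.
Let sa : sg_pos (sg m s0) a.
Proof.
rewrite -[sg m s0]mul1g sg_flip ?(J_pos ja) //; first exact: FFroot (proj1 ja).
  by rewrite invg1 ga1 //; apply/eqP.
rewrite invg1 ga1 //; apply/eqP => e; apply: (J_opp hm (J_al hm s0 G1) ja e).
Qed.
Lemma half_near x qx : J x -> x <> a -> isrefl qx x -> half x.
Proof.
move=> jx xa rx; split; [exact: (proj1 jx)|exact: J_pos jx| |].
  have [w [w1 w2]] := J_wit jx; exists w; split=> // d fd; apply: w2; exact: FFsub.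
have [n [n0 nN]] := Npow (qx * qa)%g; exists ((qx * qa) ^+ n)%g; split=> //.
  by rewrite -[((qx * qa) ^+ n)%g]mulg1; apply: (pp_step jx ja xa rx ra (J_pos ja) n0).
exact: pp_step jx ja xa rx ra sa n0.
Qed.
(** The witnesses for [x] are reflected in [a]. As [a] is not a wall of the finer family, that
    family does not notice the crossing of [a]. *)
Lemma half_far x y qx qy : J x -> J y -> x <> a -> y <> a -> x <> y -> isrefl qx x -> isrefl qy y ->
  half (qa ** x).
Proof.
move=> jx jy xa ya xy rx ry; have fa := proj1 ja; have fx := proj1 jx.
have rta := FFroot fa; have rtx := FFroot fx.
have xa' : x <> - a by exact: (J_opp hm ja jx).
split.
- exact: FFga.
- by rewrite -(sgpos_refl _ _ ra) mulg1 (J_refl1 ja Gqa ra) // (J_pos jx).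
- have [w [w1 w2]] := J_wit jx; exists (qa * w)%g; split; first by rewrite sg_pos_mul.
  move=> d fd' dx dx'; have fd := FFsub fd'.
  have qq v : qa ** (qa ** v) = v by rewrite -(gaM aRr) (proj1 ra) ga1.
  rewrite (sgpos_refl _ _ ra) w2; first last.
  + by move=> e; apply: dx'; rewrite -[d]qq e gaN.
  + by move=> e; apply: dx; rewrite -[d]qq e.
  + exact: FFga.
  rewrite -(sgpos_refl _ _ ra) mulg1 (J_refl1 ja Gqa ra) // => e; first by apply: aF'; rewrite -e.
  by apply: aF'n; rewrite -e.
have [n [n0 nN]] := Npow (qx * qy)%g; exists (qa * (qx * qy) ^+ n * qa)%g.
have posy w : sg_pos w a -> sg_pos (qa * w)%g y.
  move=> wa; apply: contrapT => /negP/negbTE h; apply: (Jdisj ja jy (nesym ya) _ h).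
  by rewrite (refl_sgpos _ rta ra) wa.
split.
- by rewrite !(@proj_hom _ m N) nN mulg1 -(@proj_hom _ m N) (proj1 ra) (hom1 (@proj_hom _ m N)).
- rewrite -mulgA sg_pos_mul //; apply: (pp_step jx jy xy rx ry _ n0).
  by rewrite -[qa]mulg1; apply: posy; apply: J_pos ja.
- rewrite -!mulgA sg_pos_mul //; apply: (pp_step jx jy xy rx ry _ n0).
  exact: posy sa.
Qed.
Lemma disj_far x y w : J x -> J y -> x <> a -> y <> a ->
  sg_pos w x = false -> sg_pos w (qa ** y) = false -> False.
Proof.
move=> jx jy xa ya wx; rewrite -(sgpos_refl _ _ ra) => wy.
have h1 : sg_pos (qa * w)%g a by apply: contrapT => /negP/negbTE h; apply: (Jdisj jy ja ya wy h).
have h2 : sg_pos w a = false.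
  by apply: negbTE; rewrite -(refl_sgpos _ (FFroot (proj1 ja)) ra).
exact: (Jdisj jx ja xa wx h2).
Qed.
(* The half-spaces of b, c, s b and s c not containing the base region are disjoint, and each contains a wall of the finer family. *)
Lemma four_J : exists f : 'I_4 -> vv, (forall i, J' (f i)) /\ injective f.
Proof.
pose bt (i : 'I_4) : vv := nth 0 [:: b; c; qa ** b; qa ** c] i.
have hb : half b by apply: half_near rb; [|exact/nesym].
have hc : half c by apply: half_near rc; [|exact/nesym].
have hqb : half (qa ** b) by apply: (half_far jb jc _ _ bc rb rc); exact/nesym.
have hqc : half (qa ** c) by apply: (half_far jc jb _ _ _ rc rb); exact/nesym.
have hbt i : half (bt i) by rewrite /bt; case: i => -[|[|[|[|//]]]] h /=.
have dsj i j w : i != j -> sg_pos w (bt i) = false -> sg_pos w (bt j) = false -> False.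
  have ba := nesym ab; have ca := nesym ac.
  rewrite /bt; case: i => -[|[|[|[|//]]]] hi; case: j => -[|[|[|[|//]]]] hj //= _ h1 h2.
  - exact: (Jdisj jb jc bc h1 h2).
  - exact: (disj_far jb jb ba ba h1 h2).
  - exact: (disj_far jb jc ba ca h1 h2).
  - exact: (Jdisj jb jc bc h2 h1).
  - exact: (disj_far jc jb ca ba h1 h2).
  - exact: (disj_far jc jc ca ca h1 h2).
  - exact: (disj_far jb jb ba ba h2 h1).
  - exact: (disj_far jc jb ca ba h2 h1).
  - by move: h1 h2; rewrite -!(sgpos_refl _ _ ra) => h1 h2; exact: (Jdisj jb jc bc h1 h2).
  - exact: (disj_far jb jc ba ca h2 h1).
  - exact: (disj_far jc jc ca ca h2 h1).
  - by move: h1 h2; rewrite -!(sgpos_refl _ _ ra) => h1 h2; exact: (Jdisj jb jc bc h2 h1).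
have /boolp.choice [f hf] : forall i, exists d, exists x, [/\ J' d, sg_pos x d = false & sg_pos x (bt i) = false].
  by move=> i; apply: half_wall.
exists f; split; first by move=> i; have [x []] := hf i.
move=> i j e; apply: contrapT => /eqP ij; have [x [jx x1 x2]] := hf i; have [x' [jx' x1' x2']] := hf j.
rewrite e in x1; apply: (half_distinct (hbt i) (h_FF (hbt j)) _ jx' x1 x2 x1' x2') => w.
exact: dsj ij.
Qed.
End Sub.
End Fam.
End HalfSpaces.

Section FourEx.
Variables (S : finType) (m : S -> S -> nat) (hm : is_cox_graph m) (s0 : S).
Local Notation es := (ev RR).
Local Notation "g ** v" := (@ga S m _ (aR m) g v) (at level 40).
Local Notation B := (bil (aR m)).
Local Notation W := (cox m).
Local Notation vv := (vec S RR).
Let aRs := aR_sym hm.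
Let aRd := aR_diag m.
Let aRr := resp_aR hm.
#[local] Hint Resolve aRs aRd aRr hm : core.
Local Notation I := (comp m s0).
Local Notation al := (es s0).
Hypotheses (nfin : ~ cox_finite (restrict m I)) (naff : ~ cox_affine_on m I).

Definition good (l : seq {poly int}) (sp : spec m) :=
  [/\ tfree sp, 2%:R != 0 :> sF sp & forall f, f \in l -> evp (sx sp) f != 0].

Lemma G2_tf sp sp' g : tfree sp -> G2 sp sp' s0 g -> 
  [\/ g ** es s0 = es s0, g ** es s0 = - es s0 | 2%:R <= `|B (es s0) (g ** es s0)|].
Proof. by move=> tf [h _]; apply: pmF_tf h. Qed.

(** Products of reflections in three boundary walls play ping-pong, and they fix the simple roots
    outside the component, so their powers fail to commute inside it. This will exclude that a
    virtually abelian factor accounts for the whole action. *)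
Lemma noncomm_ex : exists g h : W, forall n, (0 < n)%N -> exists2 t, t \in I &
  (g ^+ n * h ^+ n)%g ** es t <> (h ^+ n * g ^+ n)%g ** es t.
Proof.
have [sp [tf _ _]] : exists sp : spec m, [/\ tfree sp, 2%:R != 0 :> sF sp & forall f, f \in [::] -> evp (sx sp) f != 0].
  exact: spec_ex.
pose G := G2 sp sp s0; have [N GN] := G2_ker hm sp sp s0.
have GM := @G2M _ _ hm sp sp s0; have GV := @G2V _ _ hm sp sp s0; have Gs := G2s hm sp sp s0.
have G1 := G21 hm sp sp s0; have Gtf g := @G2_tf sp sp g tf.
have [b [c [jb jc [ba ca bc]]]] := three_walls hm nfin naff G1 GM GV Gs Gtf GN.
have ja := J_al hm s0 G1.
have [qa [_ qa1 qa2]] := FF_refl hm GM GV Gs (proj1 ja).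
have [qb [_ qb1 qb2]] := FF_refl hm GM GV Gs (proj1 jb).
have [qc [_ qc1 qc2]] := FF_refl hm GM GV Gs (proj1 jc).
exists (qa * qb)%g, (qc * qb)%g => n n0; apply: contrapT => none.
have FI x : FF s0 G x -> inI m s0 x.
  by case=> g _ ->; apply: inI_ga => //; apply: inI_ev; apply: comp_refl.
apply: (pingpong hm GM GV Gtf ja jb jc (nesym ba) (nesym bc) (nesym ca)
  (conj qa1 qa2) (conj qb1 qb2) (conj qc1 qc2) n0).
apply: (cox_faithful2 hm) => t; apply: contrapT => h.
have [tI|tI] := boolP (t \in I); first by apply: none; exists t.
have fx q x : FF s0 G x -> (forall v, q ** v = rv (aR m) x v) -> q ** es t = es t.
  by move=> /FI xI ->; rewrite /rv (inI_out xI tI) scale0r subr0.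
have pw q k : q ** es t = es t -> (q ^+ k)%g ** es t = es t.
  by move=> e; elim: k => [|k IH]; rewrite ?expg0 ?ga1 // expgS gaM // IH.
have ea := fx _ _ (proj1 ja) qa2; have eb := fx _ _ (proj1 jb) qb2; have ec := fx _ _ (proj1 jc) qc2.
have e1 : (qa * qb)%g ** es t = es t by rewrite gaM // eb.
have e2 : (qc * qb)%g ** es t = es t by rewrite gaM // eb.
by apply: h; rewrite gaM // [in RHS]gaM // !(pw _ _ e1) !(pw _ _ e2) (pw _ _ e1).
Qed.

(** [sp] gives three boundary walls, [sp'] is chosen so that one of them, [a], leaves the family,
    and [sp''] keeps apart the four roots found in the refined family. *)
Lemma four_ex l : (forall f, f \in l -> evp (cc m) f != 0) ->
  exists sp sp' sp'' : spec m, [/\ good l sp, good l sp' & exists g : 'I_4 -> W,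
    [/\ forall i, G2 sp sp' s0 (g i), forall i, sim s0 (G2 sp sp' s0) 1%g (g i) &
      forall i j, i != j -> ga (aF sp'') (g i) (ev _ s0) <> ga (aF sp'') (g j) (ev _ s0)]].
Proof.
move=> hl; have [sp gsp] : exists sp : spec m, good l sp by exact: spec_ex.
have [tf _ _] := gsp; have [N GN] := G2_ker hm sp sp s0.
have GM := @G2M _ _ hm sp sp s0; have GV := @G2V _ _ hm sp sp s0; have Gs := G2s hm sp sp s0.
have G1 := G21 hm sp sp s0; have Gtf g := @G2_tf sp sp g tf.
have [a [c [ja jc [aal cal ac]]]] := three_walls hm nfin naff G1 GM GV Gs Gtf GN.
have jal := J_al hm s0 G1.
have aNal : a <> - al := J_opp hm jal ja.
have [[w Gw aE] _] := ja.
have ne1 : w ** es s0 <> 1%:~R *: (1%g ** es s0) by rewrite ga1 // scale1r -aE.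
have [f1 [f1c f1F]] := sepF ne1.
have ne2 : w ** es s0 <> (-1)%:~R *: (1%g ** es s0) by rewrite ga1 // mulrN1z scaleN1r -aE.
have [f2 [f2c f2F]] := sepF ne2.
have [sp' [tf' two' l']] : exists sp : spec m, good (f1 :: f2 :: l) sp.
  by apply: spec_ex => // f; rewrite !inE => /or3P[/eqP->|/eqP->|/hl].
have gsp' : good l sp' by split=> // f fl; apply: l'; rewrite !inE fl !orbT.
pose G' := G2 sp sp' s0; have [N' GN'] := G2_ker hm sp sp' s0.
have GM' := @G2M _ _ hm sp sp' s0; have GV' := @G2V _ _ hm sp sp' s0; have Gs' := G2s hm sp sp' s0.
have G1' := G21 hm sp sp' s0.
have Gsub g : G' g -> G2 sp sp s0 g by case.
have aFr := @resp_aF _ _ hm sp'.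
have aF' : ~ FF s0 G' a.
  case=> g [_ pg]; rewrite aE => e.
  have /(tr_root sp') : w ** es s0 = 1%:~R *: (g ** es s0) by rewrite scale1r.
  have := f1F sp' (l' f1 _); have := f2F sp' (l' f2 _); rewrite !inE !eqxx orbT !ga1 //.
  by rewrite !scale1r mulrN1z scaleN1r => /(_ isT) h2 /(_ isT) h1; case: pg => ->.
have [qa [Gqa qa1 qa2]] := FF_refl hm GM GV Gs (proj1 ja).
have [qb [_ qb1 qb2]] := FF_refl hm GM GV Gs (proj1 jal).
have [qc [_ qc1 qc2]] := FF_refl hm GM GV Gs (proj1 jc).
have [f [fJ finj]] := four_J hm G1 GM GV Gtf GM' Gs' Gsub GN' ja jal jc aal ac (nesym cal)
  aal (conj qa1 qa2) (conj qb1 qb2) (conj qc1 qc2) Gqa aF'.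
have Gtf' g : G' g -> [\/ g ** es s0 = es s0, g ** es s0 = - es s0 |
     2%:R <= `|B (es s0) (g ** es s0)|] by move=> /Gsub; apply: Gtf.
(* The chamber [g] touches the wall of [f i] from its positive side, so by [lemA] it lies in the
   base region. *)
have /boolp.choice [g hg] : forall i, exists g, [/\ G' g, sim s0 G' 1%g g & f i = g ** al].
  move=> i; have [[g Gg e] [u [s [su us]]]] := fJ i; exists g; split=> //.
  apply: sim_trans su _; have ff : FF s0 G' (f i) by exists g.
  by apply: (lemA hm GM' GV' Gtf' ff us); rewrite e gaK.
have [l2 [l2c l2F]] : exists l2 : seq {poly int}, (forall p, p \in l2 -> evp (cc m) p != 0) /\
    forall sp : spec m, (forall p, p \in l2 -> evp (sx sp) p != 0) -> forall i j, i != j ->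
    ga (aF sp) (g i) (ev _ s0) <> ga (aF sp) (g j) (ev _ s0).
  have /boolp.choice [p hp] : forall ij : 'I_4 * 'I_4, exists p, evp (cc m) p != 0 /\
      (ij.1 != ij.2 -> forall sp : spec m, evp (sx sp) p != 0 ->
      ga (aF sp) (g ij.1) (ev _ s0) <> ga (aF sp) (g ij.2) (ev _ s0)).
    move=> [i j] /=; have [->|ij] := eqVneq i j; first by exists 1; rewrite rmorph1 oner_eq0.
    have ne : g i ** es s0 <> 1%:~R *: (g j ** es s0).
      rewrite scale1r; have [_ _ <-] := hg i; have [_ _ <-] := hg j.
      by move=> /finj e; rewrite e eqxx in ij.
    have [p [p1 p2]] := sepF ne.
    by exists p; split=> // _ sp1 /p2; rewrite scale1r.
  exists (map p (enum {: 'I_4 * 'I_4})); split=> [q /mapP [ij _ ->]|sp1 h i j ij]; first by have [] := hp ij.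
  have [_ h2] := hp (i, j); apply: h2 => //; apply: h; apply: map_f; exact: mem_enum.
have [sp'' [_ _ l2'']] : exists sp : spec m, [/\ tfree sp, 2%:R != 0 :> sF sp & forall f, f \in l2 -> evp (sx sp) f != 0].
  exact: spec_ex.
exists sp, sp', sp''; split=> //; exists g; split=> [i|i|i j ij]; try by have [] := hg i.
exact: l2F.
Qed.
End FourEx.

(** * A cocycle with values in Z/4 *)

Section Cocycle.
Variables (S : finType) (m : S -> S -> nat) (hm : is_cox_graph m).
Local Notation es := (ev RR).
Local Notation "g ** v" := (@ga S m _ (aR m) g v) (at level 40).
Local Notation B := (bil (aR m)).
Local Notation W := (cox m).
Local Notation vv := (vec S RR).
Local Notation sg_pos := (@sg_pos S m).
Let aRs := aR_sym hm.
Let aRd := aR_diag m.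
Let aRr := resp_aR hm.
#[local] Hint Resolve aRs aRd aRr hm : core.
Implicit Types (chi : vv -> 'Z_4).

Definition oddf chi := forall v, chi (- v) = - chi v.
Definition cw chi p := \sum_(b <- proots m p) chi b.
Lemma cw_cat chi p q : cw chi (p ++ q) = cw chi p + cw (fun v => chi (actw (aR m) p v)) q.
Proof. by rewrite /cw proots_cat big_cat big_map. Qed.
Lemma alt_cat n (s t : S) : alt n s t ++ [:: s; t] = alt n.+1 s t.
Proof. by elim: n => //= n ->. Qed.
Lemma alt_set n s t : s != t ->
  actw (aR m) (alt n s t) (refl (aR m) s (es t)) =
  un (xx (m s t)) n.*2.+2 *: es s + un (xx (m s t)) n.*2.+1 *: es t.
Proof.
move=> st; have ts : t != s by rewrite eq_sym.
have ast := aR_off m st; have ats : aR m t s = - xx (m s t) by rewrite aRs.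
set x := xx (m s t) in ast ats *.
have rs p q : refl (aR m) s (p *: es s + q *: es t) = (x * q - p) *: es s + q *: es t.
  exact: (refl_s (aRd s) ast).
have rt p q : refl (aR m) t (p *: es s + q *: es t) = p *: es s + (x * p - q) *: es t.
  by rewrite addrC (refl_s (aRd t) ats) addrC.
elim: n => [|n IH] /=.
  have := rs 0 1; rewrite scale0r add0r scale1r => ->.
  by rewrite !unSS un1 un0 subr0 mulr1.
by rewrite IH rt rs -!unSS doubleS.
Qed.
Lemma cw_alt chi n s t : s != t -> cw chi (alt n s t) =
  \sum_(0 <= j < n.*2) chi (un (xx (m s t)) j.+1 *: es s + un (xx (m s t)) j *: es t).
Proof.
move=> st; elim: n => [|n IH]; first by rewrite big_geq //= /cw big_nil.
rewrite -alt_cat cw_cat IH doubleS !big_nat_recr //= -addrA; congr (_ + _).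
by rewrite /cw /= !big_cons big_nil addr0 alt_ev // mul2n alt_set.
Qed.
Lemma un_shift k n : (2 <= k)%N -> un (2%:R * cos (pi / k%:R) : RR) (n + k) = - un (2%:R * cos (pi / k%:R) : RR) n.
Proof.
move=> k2; apply: (mulIf (lt0r_neq0 (sin_th1 k2))); rewrite mulNr !un_sin // natrD mulrDl k_th //.
by rewrite trigo.sinD sinpi cospi mulr0 addr0 mulrN1.
Qed.
(** The roots along a braid word run once around the dihedral root system; those half a turn apart
    are opposite and their values cancel. In a square the same wall is crossed forth and back. *)
Lemma cw_coxeq chi u w : oddf chi -> coxeq m u w -> cw chi u = cw chi w.
Proof.
move=> ho h; elim: h chi ho => {u w} //.
- by move=> u w _ IH chi ho; rewrite IH.
- by move=> u v w _ h1 _ h2 chi ho; rewrite h1 ?h2.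
- move=> a b u w uw IH chi ho; rewrite !cw_cat; congr (_ + (_ + _)).
    by apply: IH => v; rewrite linearN ho.
  by apply: eq_bigr => v _; rewrite (aRr _ uw).
- move=> s chi ho; rewrite /cw /= !big_cons !big_nil refl_rv rv_self ?ho ?ev2 //.
  by rewrite addr0 subrr.
move=> s t st mst chi ho; rewrite cw_alt // xxP //; set k := m s t in mst *.
have k2 : (2 <= k)%N := m_ge2 hm mst.
pose f j := chi (un (2%:R * cos (pi / k%:R)) j.+1 *: es s + un (2%:R * cos (pi / k%:R)) j *: es t).
have ->  : \sum_(0 <= j < k.*2) chi (un (2%:R * cos (pi / k%:R)) j.+1 *: es s + un (2%:R * cos (pi / k%:R)) j *: es t) = \sum_(0 <= j < k) (f j + f (j + k)%N).
  rewrite -/(f _) -addnn (@big_cat_nat _ _ _ k) ?leq_addr //= big_split; congr (_ + _).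
  by rewrite -{1}[k]add0n big_addn addnK.
rewrite big1 /cw ?big_nil // => j _; rewrite /f -addSn !un_shift // !scaleNr -opprD ho.
exact: subrr.
Qed.
Definition cz chi (g : W) := cw chi (wrep g).
Lemma cz_wd chi p : oddf chi -> cz chi (wd m p) = cw chi p.
Proof. by move=> ho; apply: cw_coxeq => //; apply/wdP; rewrite wd_repr. Qed.
Lemma czM chi g h : oddf chi -> cz chi (g * h)%g = cz chi g + cz (fun v => chi (g ** v)) h.
Proof.
by move=> ho; rewrite -{1}(wd_repr g) -{1}(wd_repr h) -wdM cz_wd // cw_cat.
Qed.
Lemma cz_ext chi chi' g : (forall v, chi v = chi' v) -> cz chi g = cz chi' g.
Proof. by move=> h; apply: eq_bigr => v _; rewrite h. Qed.
Lemma cz_sep chi g : oddf chi ->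
  (forall b, wroot m b -> sg_pos 1%g b -> sg_pos g b = false -> chi b = 0) -> cz chi g = 0.
Proof.
move=> ho h; have [p [ps gp]] := lenP g; rewrite gp cz_wd //; apply: big1_seq => b /andP[_ bp].
rewrite gp in ps; have [h1 h2 h3] := reduced_sep hm ps bp.
by apply: h => //; rewrite gp; apply: negbTE.
Qed.

Variable U : fincong m.
Definition orbU (v0 v : vv) : bool := `[< exists2 u, proj U u = 1%g & v = u ** v0 >].
(** With this function the cocycle counts signed crossings of walls in the orbit of [v0]; counting
    modulo 4 makes it factor through a finite quotient. *)
Definition chiU v0 v : 'Z_4 := (orbU v0 v)%:R - (orbU v0 (- v))%:R.
Lemma orbUN v0 v : orbU v0 (- v) = orbU (- v0) v.
Proof.
apply/asboolP/asboolP => -[u hu e]; exists u => //; first by rewrite gaN -e opprK.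
by rewrite e gaN opprK.
Qed.
Lemma chiU_odd v0 : oddf (chiU v0).
Proof. by move=> v; rewrite /chiU opprK opprB. Qed.
Lemma proj1V u : proj U u = 1%g -> proj U (u^-1)%g = 1%g.
Proof. by move=> e; rewrite (homV (@proj_hom _ m U)) e invg1. Qed.
Lemma proj1J g u : proj U u = 1%g -> proj U (g * u * g^-1)%g = 1%g.
Proof.
by move=> e; rewrite !(@proj_hom _ m U) e mulg1 -(@proj_hom _ m U) mulgV (hom1 (@proj_hom _ m U)).
Qed.
Lemma orbU_ga g v0 v : orbU v0 (g ** v) = orbU (g^-1%g ** v0) v.
Proof.
apply/asboolP/asboolP => -[u hu e].
  exists (g^-1 * u * g)%g; first by have := proj1J g^-1%g hu; rewrite invgK.
  by rewrite -(gaK aRr g v) e -!(gaM aRr) mulgK.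
exists (g * u * g^-1)%g; first exact: proj1J.
by rewrite e -!(gaM aRr).
Qed.
Lemma orbU_class u v0 v : proj U u = 1%g -> orbU (u ** v0) v = orbU v0 v.
Proof.
move=> hu; apply/asboolP/asboolP => -[x hx ->].
  by exists (x * u)%g; rewrite ?(gaM aRr) // (@proj_hom _ m U) hx hu mulg1.
exists (x * u^-1)%g; last by rewrite -(gaM aRr) mulgKV.
by rewrite (@proj_hom _ m U) hx proj1V // mulg1.
Qed.
Definition cU v0 g := cz (chiU v0) g.
Lemma cUM v0 g h : cU v0 (g * h)%g = cU v0 g + cU (g^-1%g ** v0) h.
Proof.
rewrite /cU czM; last exact: chiU_odd.
by congr (_ + _); apply: cz_ext => v; rewrite /chiU -gaN !orbU_ga.
Qed.
Lemma cU_class u v0 g : proj U u = 1%g -> cU (u ** v0) g = cU v0 g.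
Proof. by move=> hu; apply: cz_ext => v; rewrite /chiU !orbU_class. Qed.
Lemma cUN v0 g : cU (- v0) g = - cU v0 g.
Proof.
rewrite /cU /cz /cw -sumrN; apply: eq_bigr => v _.
by rewrite /chiU -!orbUN opprK opprB.
Qed.
Lemma cU_sg v0 s : cU v0 (sg m s) = chiU v0 (es s).
Proof. by rewrite /cU cz_wd; [rewrite /cw /= big_cons big_nil addr0|exact: chiU_odd]. Qed.
(** A reduced gallery inside one region crosses no wall of the family, and the orbit of [v0] belongs
    to the family. *)
Lemma cU_sim s0 (G : W -> Prop) v0 g : (forall x y, G x -> G y -> G (x * y)%g) -> 
  G (sg m s0) -> (forall u, proj U u = 1%g -> G u) ->
  FF s0 G v0 -> sim s0 G 1%g g -> cU v0 g = 0.
Proof.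
move=> GM Gs GU fv sm; apply: cz_sep; first exact: chiU_odd.
move=> b rb b1 bg; have nF : ~ FF s0 G b by move=> fb; rewrite (sm _ fb) bg in b1.
have f0 c : orbU v0 c -> FF s0 G c.
  by move=> /asboolP [u hu ->]; apply: FF_ga => //; apply: GU.
rewrite /chiU; case: (boolP (orbU v0 b)) => [/f0 //|_].
case: (boolP (orbU v0 (- b))) => [/f0 h|_]; last by rewrite subrr.
by case: nF; rewrite -[b]opprK; apply: FFN.
Qed.
End Cocycle.

(** * Normal subgroups acting by signs *)

Section Count.
Variables (gT : finGroupType) (Gb P : {group gT}) (T : {set {set gT}}) (f : {set gT} -> gT -> bool).
Hypotheses
  (fP : forall e g p, e \in T -> g \in Gb -> p \in P -> f e (g * p)%g = f e g)
  (f1 : forall e, e \in T -> f e 1%g = false)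
  (fs : forall e, e \in T -> exists g g', [/\ g \in Gb, g' \in Gb &
     forall e', e' \in T -> f e' g' (+) f e' g = (e' == e)]).
(* The functions f_e are independent modulo 2 on the connected coset graph, and they are invariant under P. *)
Lemma count_lt : (#|T| < #|Gb : P|%g)%N.
Proof.
pose h (A : {set {set gT}}) g := \big[addb/false]_(e in A) f e g.
have hP (A : {set {set gT}}) g p : A \subset T -> g \in Gb -> p \in P -> h A (g * p)%g = h A g.
  by move=> AT gG pP; apply: eq_bigr => e eA; rewrite fP // (subsetP AT).
have h1 (A : {set {set gT}}) : A \subset T -> h A 1%g = false.
  by move=> AT; rewrite /h big1 // => e eA; rewrite f1 // (subsetP AT).
(* The sum over [A] is a function on cosets of [P] that vanishes on [P] itself; its support
   therefore lies among the remaining cosets. *)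
pose phi (A : {set {set gT}}) := [set x in lcosets P Gb :\ (P : {set gT}) | h A (repr x)].
have phiE (A : {set {set gT}}) g : A \subset T -> g \in Gb -> h A g = ((g *: P)%g \in phi A).
  move=> AT gG; rewrite !inE; have [p pP e] : exists2 p, p \in P & repr (g *: P)%g = (g * p)%g.
    by have := mem_repr g (lcoset_refl P g); rewrite mem_lcoset => h2; exists (g^-1 * repr (g *: P)%g)%g; rewrite ?mulKVg.
  rewrite e hP //; have -> : (g *: P)%g \in lcosets P Gb by apply/lcosetsP; exists g.
  rewrite andbT; case: eqP => //= gP; have gp : g \in P by rewrite -gP lcoset_refl.
  by rewrite -[g]mul1g hP ?h1.
have inj : {in powerset T &, injective phi}.
  suff sub (A A' : {set {set gT}}) : A \subset T -> A' \subset T -> phi A = phi A' -> A \subset A'.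
    move=> A A'; rewrite !powersetE => h2 h3 e; apply/eqP; rewrite eqEsubset.
    by apply/andP; split; apply: sub.
  move=> AT AT' e; apply/subsetP => x xA; have xT := subsetP AT x xA.
  have [g [g' [gG gG' hx]]] := fs xT.
  have dif (D : {set {set gT}}) : D \subset T -> h D g' (+) h D g = (x \in D).
    move=> DT; rewrite /h -big_split /=.
    rewrite (eq_bigr (fun e' => e' == x)) => [|e' eD]; last by apply: hx; apply: (subsetP DT).
    have [xD|xD] := boolP (x \in D).
      by rewrite (bigD1 x) //= eqxx big1 // => i /andP[_ /negbTE].
    by rewrite big1 // => i iD; apply/negbTE; apply: contraNneq xD => <-.
  by rewrite -dif // !phiE // -e -!phiE // dif.
have : (#|phi @: powerset T| <= #|powerset (lcosets P Gb :\ (P : {set gT}))|)%N.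
  apply: subset_leq_card; apply/subsetP => _ /imsetP [A _ ->].
  by rewrite inE; apply/subsetP => x; rewrite inE => /andP[].
rewrite card_in_imset // !card_powerset leq_exp2l // => le.
have PL : (P : {set gT}) \in lcosets P Gb by apply/lcosetsP; exists 1%g; rewrite ?lcoset1.
by rewrite -card_lcosets (cardsD1 (P : {set gT})) PL add1n ltnS.
Qed.
End Count.

Definition par (x : 'Z_4) : bool := odd x.
Lemma parD (x y : 'Z_4) : par (x + y) = par x (+) par y.
Proof. by case: x y => [[|[|[|[|//]]]] hx] [[|[|[|[|//]]]] hy]. Qed.
Lemma parN (x : 'Z_4) : par (- x) = par x.
Proof. by case: x => [[|[|[|[|//]]]] hx]. Qed.
(** Twice [x] vanishes modulo 4. With coefficients modulo 2 the hypothesis would hold for every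
    [x]. *)
Lemma par_even (x : 'Z_4) : x = - x -> par x = false.
Proof. by case: x => [[|[|[|[|//]]]] hx] // /(congr1 val). Qed.

(** * Elements of the completion that fix a root in every finite quotient *)

Section LemmaK.
Variables (S : finType) (m : S -> S -> nat) (hm : is_cox_graph m) (s0 : S).
Local Notation es := (ev RR).
Local Notation "g ** v" := (@ga S m _ (aR m) g v) (at level 40).
Local Notation W := (cox m).
Local Notation vv := (vec S RR).
Let aRs := aR_sym hm.
Let aRd := aR_diag m.
Let aRr := resp_aR hm.
#[local] Hint Resolve aRs aRd aRr hm : core.
Local Notation al := (es s0).
Variables (sp sp' sp'' : spec m) (two : 2%:R != 0 :> sF sp) (g4 : 'I_4 -> W).
Local Notation G := (G2 sp sp' s0).
Hypotheses (gG : forall i, G (g4 i)) (gsim : forall i, sim s0 G 1%g (g4 i))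
  (gsep : forall i j, i != j -> ga (aF sp'') (g4 i) (ev _ s0) <> ga (aF sp'') (g4 j) (ev _ s0)).
Hypothesis tf : tfree sp.
Variable Nn : prof m -> Prop.
Hypotheses (N1 : Nn 1%g) (NM : forall x y, Nn x -> Nn y -> Nn (x * y)%g)
  (NJ : forall x w, Nn x -> Nn (iota w * x * (iota w)^-1)%g)
  (NG : forall x w, Nn x -> pv x (Nsp hm sp) = proj (Nsp hm sp) w -> pmF sp s0 w)
  (NG' : forall x w, Nn x -> pv x (Nsp hm sp') = proj (Nsp hm sp') w -> pmF sp' s0 w).

Section Deep.
Variable U : fincong m.
Hypotheses (Usp : projsub U (Nsp hm sp)) (Usp' : projsub U (Nsp hm sp')) (Usp'' : projsub U (Nsp hm sp''))
  (UN : forall x u, Nn x -> proj U u = 1%g -> (x * iota u = iota u * x)%g).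
Local Notation pj := (proj U).
Let pjM : hom pj := @proj_hom _ m U.
Let pj1 : pj 1%g = 1%g := hom1 pjM.
Let GM := @G2M _ _ hm sp sp' s0.
Let GV := @G2V _ _ hm sp sp' s0.
Let Gs := G2s hm sp sp' s0.
Let G1 := G21 hm sp sp' s0.
Lemma U_eqF (sq : spec m) u : projsub U (Nsp hm sq) -> pj u = 1%g -> eqF sq u 1%g.
Proof. by move=> h e; apply/(NspP hm); apply: ((projsubP _ _).1 h); rewrite e. Qed.
Lemma UG u : pj u = 1%g -> G u.
Proof.
move=> hu; split; left; first by rewrite (U_eqF Usp hu) ga1 //; apply: resp_aF.
by rewrite (U_eqF Usp' hu) ga1 //; apply: resp_aF.
Qed.
(** Over the field [sp] the element [u] acts trivially, and 2 is not zero there. *)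
Lemma noflip u (v : vv) : wroot m v -> pj u = 1%g -> u ** v <> - v.
Proof.
move=> [g [s ->]] hu e; have aFr := @resp_aF _ _ hm sp.
have : (u * g)%g ** es s = (-1)%:~R *: (g ** es s) by rewrite gaM // e mulrN1z scaleN1r.
move=> /(tr_root sp); rewrite gaM // (U_eqF Usp hu) ga1 // mulrN1z scaleN1r => e2.
have : ga (aF sp) g (2%:R *: ev _ s) = 0.
  by rewrite gaZ scaler_nat mulr2n {1}e2 addNr.
rewrite -(linear0 (ga (aF sp) g)) => /(ga_inj aFr) /ffunP/(_ s).
by rewrite !vecE !ffunE eqxx mulr1 => /eqP; rewrite (negbTE two).
Qed.
Definition rp (q : fq U) : W := wd m (wrep q).
Lemma rpK q : pj (rp q) = q.
Proof. by rewrite /rp proj_wd; exact: cls_repr. Qed.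
Lemma pjE x y : pj x = pj y -> exists2 u, pj u = 1%g & x = (u * y)%g.
Proof. by move=> e; exists (x * y^-1)%g; rewrite ?mulgKV // pjM (homV pjM) e mulgV. Qed.

(** Elements on which the cocycles of all roots agree. There are finitely many orbits of roots under
    the kernel of [U], and the coefficients are finite, so this is a finite quotient through which
    the cocycles reach the completion. *)
Definition Up_rel (x y : W) := pj x = pj y /\ forall g s, cU U (g ** es s) x = cU U (g ** es s) y.
Lemma cU_near x y v z : pj x = pj y -> cU U (x ** v) z = cU U (y ** v) z.
Proof. by move=> /pjE [u hu ->]; rewrite gaM // cU_class. Qed.
Definition Up : fincong m.
Proof.
refine (@mkfc S m Up_rel _ _ _ _ _).
- by [].
- by move=> x y [h1 h2]; split.
- by move=> x y z [h1 h2] [h3 h4]; split=> [|g s]; rewrite ?h1 ?h2.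
- move=> a b c d [h1 h2] [h3 h4]; split=> [|g s]; first by rewrite !pjM h1 h3.
  rewrite !cUM // h2; congr (_ + _); rewrite -!(gaM aRr) -h4 !(gaM aRr).
  by apply: cU_near; rewrite !(homV pjM) h1.
pose f (x : W) : (fq U * {ffun fq U * S -> 'Z_4})%type := (pj x, [ffun p => cU U (rp p.1 ** es p.2) x]).
have [l hl] : exists l : seq W, forall x, exists2 y, y \in l & f x = f y.
  by apply: ker_fin; have [l hl] := fin_list (fq U * {ffun fq U * S -> 'Z_4})%type; exists l.
exists l => x; have [y yl exy] := hl x; exists y => //.
have e1 : pj x = pj y := congr1 fst exy; have e2 := congr1 snd exy; split=> // g s.
have /ffunP/(_ (pj g, s)) := e2; rewrite !ffunE /= => e.
by rewrite -(@cU_near (rp (pj g)) g) ?rpK // e; apply: cU_near; rewrite rpK.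
Defined.
(** The products [w u] and [u w] agree at level [Up]. Expanding the cocycle on both, the terms with
    the approximation of [x] cancel because [u] preserves the orbits. *)
Lemma cU_comm x w v u : Nn x -> pv x U = pj w -> wroot m v -> pj u = 1%g ->
  cU U (w ** v) u = cU U v u.
Proof.
move=> nx xw rv hu; have [w1 [h1 h2]] := approx2 x Up U.
have rwv : wroot m (w ** v) by apply: root_ga.
have e : proj Up (w1 * u)%g = proj Up (u * w1)%g.
  by rewrite !(@proj_hom _ m Up) -h1 -!pv_iota -!pvM UN.
have [_ e2] := (mkfcP _ _ _ _ _ _ _).1 e.
have [g [s gs]] := rwv; have := e2 g s; rewrite -gs !cUM //.
rewrite addrC => /(congr1 (fun z => z - cU U (w ** v) w1)); rewrite addrK.
have -> : cU U (u^-1%g ** (w ** v)) w1 = cU U (w ** v) w1 by apply: (cU_class hm); apply: proj1V.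
rewrite addrK => <-; rewrite -(gaM aRr) -[in RHS](ga1 aRr v); apply: cU_near.
by rewrite pjM (homV pjM) -h2 xw mulVg pj1.
Qed.

(** Images in the finite quotient of the stabilizer of [al], of its stabilizer up to sign, of the
    part of [G] that preserves the base region, of [G], and of the given normal subgroup. Cosets of
    [Cb] in [Gb] stand for walls and cosets of [Pb] for regions. *)
Definition Cp : {set fq U} := [set q | `[< exists2 g, pj g = q & g ** al = al >]].
Definition Cb : {set fq U} := [set q | `[< exists2 g, pj g = q & g ** al = al \/ g ** al = - al >]].
Definition Pb : {set fq U} := [set q | `[< exists g, [/\ pj g = q, G g & sim s0 G 1%g g] >]].
Definition Gb : {set fq U} := [set q | `[< exists2 g, pj g = q & G g >]].
Definition Nb : {set fq U} := [set q | `[< exists2 x, Nn x & pv x U = q >]].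
Lemma Cp_group : group_set Cp.
Proof.
apply/group_setP; split; first by rewrite inE; apply/asboolP; exists 1%g; rewrite ?ga1.
move=> x y; rewrite !inE => /asboolP [g <- ge] /asboolP [h <- he]; apply/asboolP.
by exists (g * h)%g; rewrite ?pjM // gaM // he.
Qed.
Lemma Cb_group : group_set Cb.
Proof.
apply/group_setP; split; first by rewrite inE; apply/asboolP; exists 1%g; [exact: pj1|left; rewrite ga1].
move=> x y; rewrite !inE => /asboolP [g <- ge] /asboolP [h <- he]; apply/asboolP.
exists (g * h)%g; rewrite ?pjM // gaM //.
by case: he => ->; rewrite ?gaN; case: ge => ->; rewrite ?opprK; auto.
Qed.
Lemma Gb_group : group_set Gb.
Proof.
apply/group_setP; split; first by rewrite inE; apply/asboolP; exists 1%g.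
move=> x y; rewrite !inE => /asboolP [g <- ge] /asboolP [h <- he]; apply/asboolP.
by exists (g * h)%g; rewrite ?pjM //; apply: GM.
Qed.
Lemma Pb_group : group_set Pb.
Proof.
apply/group_setP; split; first by rewrite inE; apply/asboolP; exists 1%g.
move=> x y; rewrite !inE => /asboolP [g [<- Gg gs]] /asboolP [h [<- Gh hs]]; apply/asboolP.
exists (g * h)%g; split; [by rewrite pjM|exact: GM|].
by apply: sim_trans gs _; have := sim_ga hm GM GV Gg hs; rewrite mulg1.
Qed.
Lemma Nb_group : group_set Nb.
Proof.
apply/group_setP; split; first by rewrite inE; apply/asboolP; exists 1%g.
move=> x y; rewrite !inE => /asboolP [g Ng <-] /asboolP [h Nh <-]; apply/asboolP.
by exists (g * h)%g => //; apply: NM.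
Qed.
Canonical Cp_g := Group Cp_group.
Canonical Cb_g := Group Cb_group.
Canonical Gb_g := Group Gb_group.
Canonical Pb_g := Group Pb_group.
Canonical Nb_g := Group Nb_group.
Lemma GbP g : (pj g \in Gb) = `[< G g >].
Proof.
rewrite inE; apply/asboolP/asboolP => [[h /esym/pjE [u hu ->] Gh]|Gg]; last by exists g.
by apply: GM => //; exact: UG.
Qed.
Lemma PG : Pb \subset Gb.
Proof. by apply/subsetP => q; rewrite !inE => /asboolP [g [e Gg _]]; apply/asboolP; exists g. Qed.
Lemma CpP : Cp \subset Pb.
Proof.
apply/subsetP => q; rewrite !inE => /asboolP [g e ge]; apply/asboolP; exists g.
have Gg : G g.
  have h : g ** al = 1%:~R *: (1%g ** al) by rewrite ga1 // scale1r.
  have aFr := @resp_aF _ _ hm sp; have aFr' := @resp_aF _ _ hm sp'.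
  by split; left; have := tr_root _ h => /(_ _) ->; rewrite ga1 // scale1r.
split=> //; apply: (lemA hm GM GV (fun g => @G2_tf _ _ hm s0 sp sp' g tf) (FF_al hm s0 G1) (s := s0) (s' := s0)).
  by rewrite invg1 ga1.
by rewrite -{1}ge gaK.
Qed.
Lemma CpE x y : orbU U (x ** al) (y ** al) = (pj (x^-1 * y)%g \in Cp).
Proof.
rewrite inE; apply/asboolP/asboolP => [[u hu e]|[g e ge]].
  exists (x^-1 * u^-1 * y)%g; first by rewrite !pjM (proj1V hu) mulg1.
  by rewrite !gaM // e (gaK aRr) (gaK aRr).
exists (y * g^-1 * x^-1)%g; first by rewrite !pjM !(homV pjM) e pjM (homV pjM) invMg invgK !mulgA mulgK mulgV.
by rewrite !gaM // (gaK aRr) -{2}ge (gaK aRr).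
Qed.
Lemma CbE x y : par (chiU U (x ** al) (y ** al)) = (pj (x^-1 * y)%g \in Cb).
Proof.
have ys : - (y ** al) = (y * sg m s0)%g ** al by rewrite gaM // ga_ev // gaN.
have e : (pj (x^-1 * y)%g \in Cb) = orbU U (x ** al) (y ** al) || orbU U (x ** al) (- (y ** al)).
  rewrite ys !CpE !inE; apply/asboolP/idP.
    move=> [g e [h|h]]; apply/orP; [left|right]; apply/asboolP; first by exists g.
    exists (g * sg m s0)%g; first by rewrite mulgA !pjM e pjM.
    by rewrite gaM // ga_ev // gaN h opprK.
  case/orP => /asboolP [g e h]; first by exists g; auto.
  exists (g * sg m s0)%g; first by rewrite pjM e -pjM !mulgA mulgg.
  by right; rewrite gaM // ga_ev // gaN h.
rewrite e /chiU; case: (boolP (orbU U (x ** al) (y ** al))) => [/asboolP [u hu e1]|_];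
  case: (boolP (orbU U (x ** al) (- (y ** al)))) => [/asboolP [u' hu' e2]|_] //.
have : (u' * u^-1)%g ** (y ** al) = - (y ** al) by rewrite e2 e1 gaM // (gaK aRr).
move/noflip => []; first by apply: root_ga => //; apply: root_ev.
by rewrite pjM (proj1V hu) hu' mulg1.
Qed.

Local Notation Cpg := Cp_g. Local Notation Cbg := Cb_g.
Local Notation Gbg := Gb_g. Local Notation Pbg := Pb_g. Local Notation Nbg := Nb_g.
Lemma CpCb : Cp \subset Cb.
Proof. by apply/subsetP => q; rewrite !inE => /asboolP [g e h]; apply/asboolP; exists g; auto. Qed.
Lemma CbG : Cb \subset Gb.
Proof.
apply/subsetP => q; rewrite [q \in Cb]inE => /asboolP [g <- [h|h]].
  by apply: (subsetP PG); apply: (subsetP CpP); rewrite inE; apply/asboolP; exists g.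
have : pj (g * sg m s0)%g \in Gb.
  apply: (subsetP PG); apply: (subsetP CpP); rewrite inE; apply/asboolP; exists (g * sg m s0)%g => //.
  by rewrite gaM // ga_ev // gaN h opprK.
rewrite GbP => /asboolP Gg; rewrite GbP; apply/asboolP.
by rewrite -[g](mulgg g s0); apply: GM.
Qed.
Lemma idx_Cb : (#|Cbg : Cpg|%g <= 2)%N.
Proof.
rewrite -card_lcosets; apply: (@leq_trans #|[set (Cp : {set fq U}); (pj (sg m s0) *: Cp)%g]|).
  apply: subset_leq_card; apply/subsetP => _ /lcosetsP [x xC ->]; rewrite !inE.
  have := xC; rewrite inE => /asboolP [g ge [h|h]]; apply/orP; [left|right]; apply/eqP.
    by apply: lcoset_id; rewrite inE; apply/asboolP; exists g.
  apply/lcoset_eqP; rewrite mem_lcoset inE; apply/asboolP.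
  exists (sg m s0 * g)%g; first by rewrite pjM -ge -(homV pjM) sgV.
  by rewrite gaM // h gaN ga_ev // opprK.
by rewrite cards2; case: (_ != _).
Qed.
(** The four elements [g4] preserve the base region and move [al] to roots that [sp''] keeps
    distinct modulo the kernel of [U]. *)
Lemma idx_P : (4 <= #|Pbg : Cpg|%g)%N.
Proof.
have aFr := @resp_aF _ _ hm sp''.
have pP i : pj (g4 i) \in Pb by rewrite inE; apply/asboolP; exists (g4 i).
have inj : injective (fun i : 'I_4 => (pj (g4 i) *: Cp)%g).
  move=> i j e; apply: contrapT => /eqP ij; have := lcoset_refl Cpg (pj (g4 i)).
  rewrite e mem_lcoset -(homV pjM) -pjM -CpE => /asboolP [u hu e2].
  case: (gsep ij); have : g4 i ** al = 1%:~R *: ((u * g4 j)%g ** al) by rewrite gaM // scale1r.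
  by move=> /(tr_root sp''); rewrite scale1r gaM // (U_eqF Usp'' hu) ga1.
rewrite -card_lcosets -[4%N]card_ord -(card_imset _ inj).
by apply: subset_leq_card; apply/subsetP => _ /imsetP [i _ ->]; apply/lcosetsP; exists (pj (g4 i)).
Qed.
(** Double counting of incident pairs: at least four walls per region and at most two regions per
    wall. *)
Lemma idx_main : (2 * #|Gbg : Pbg|%g <= #|Gbg : Cbg|%g)%N.
Proof.
have e1 := @Lagrange_index _ Gbg Pbg Cpg PG CpP; have e2 := @Lagrange_index _ Gbg Cbg Cpg CbG CpCb.
have := idx_Cb; have := idx_P; nia.
Qed.
Lemma lc_repr (H K : {group fq U}) (e : {set fq U}) : K \subset H -> e \in lcosets K H -> repr e \in H /\ e = (repr e *: K)%g.
Proof.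
move=> KH /lcosetsP [x xH ->]; have h := mem_repr x (lcoset_refl K x); split; last exact/esym/lcoset_eqP.
by move: h; rewrite mem_lcoset => /(subsetP KH) h; rewrite -[repr _](mulKVg x) groupM.
Qed.
Lemma lc_eq e e' : e \in lcosets Cbg Gbg -> e' \in lcosets Cbg Gbg ->
  ((repr e')^-1 * repr e \in Cb)%g = (e' == e).
Proof.
move=> /(lc_repr CbG) [_ he] /(lc_repr CbG) [_ he'].
rewrite [RHS]eq_sym {2}he {2}he' -mem_lcoset; apply/idP/eqP => [/lcoset_eqP //|<-].
exact: lcoset_refl.
Qed.
Definition ve (e : {set fq U}) : vv := rp (repr e) ** al.
Lemma ve_FF e : e \in lcosets Cbg Gbg -> FF s0 G (ve e).
Proof.
by move=> /(lc_repr CbG) [h _]; exists (rp (repr e)) => //; apply/asboolP; rewrite -GbP rpK.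
Qed.
Lemma cUu v u g : pj u = 1%g -> cU U v (u * g)%g = cU U v u + cU U v g.
Proof. by move=> hu; rewrite cUM // cU_class // proj1V. Qed.
Lemma rpP q p : p \in Pb -> q \in Gb -> exists2 u, pj u = 1%g &
  forall v, FF s0 G v -> cU U v (rp (q * p)%g) = cU U v u + cU U v (rp q).
Proof.
rewrite inE => /asboolP [g [<- Gg gs]] qG.
have [u hu e] : exists2 u, pj u = 1%g & rp (q * pj g)%g = (u * (rp q * g))%g.
  by apply: pjE; rewrite pjM !rpK.
exists u => // v fv; rewrite e cUu // cUM //.
rewrite [X in _ + (_ + X)](cU_sim hm (s0 := s0) (G := G)) ?addr0 //; first exact: UG.
by apply: FF_ga => //; apply: GV; apply/asboolP; rewrite -GbP rpK.
Qed.
Lemma rpS q : exists2 u, pj u = 1%g & forall x,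
  par (cU U (x ** al) (rp (q * pj (sg m s0))%g)) =
  par (cU U (x ** al) u) (+) par (cU U (x ** al) (rp q)) (+) (pj x^-1 * q \in Cb)%g.
Proof.
have [u hu e] : exists2 u, pj u = 1%g & rp (q * pj (sg m s0))%g = (u * (rp q * sg m s0))%g.
  by apply: pjE; rewrite pjM !rpK.
exists u => // x; rewrite e cUu // cUM // !parD addbA; congr (_ (+) _).
rewrite cU_sg // -(gaM aRr) -[X in chiU _ _ X](ga1 aRr) CbE mulg1 invMg invgK pjM rpK.
by [].
Qed.
(** If [w] flips [al], the cocycle of every wall of the family is even on the kernel of [U], and
    parities give one independent function on regions per wall: too many by [idx_main]. If [w] moves
    the wall, the same count is applied to differences between a wall and the representative of its
    class under the normal subgroup; at most half of the walls are representatives. *)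
Lemma kdeep x w : Nn x -> pv x U = pj w -> pj w \in Cp.
Proof.
move=> nx xw; apply: contrapT => /negP wC.
have rtv y : wroot m (y ** al) by apply: root_ga => //; apply: root_ev.
have [wb|wb] := boolP (pj w \in Cb).
  have ev0 (e : {set fq U}) u : pj u = 1%g -> par (cU U (ve e) u) = false.
    move=> hu; apply: par_even; rewrite -cUN //.
    have [g ge gN] : exists2 g, pj g = pj w & g ** al = - al.
      move: wb; rewrite inE => /asboolP [g ge [h|h]]; last by exists g.
      by case/negP: wC; rewrite inE; apply/asboolP; exists g.
    rewrite -(cU_comm (w := (rp (repr e) * g * (rp (repr e))^-1)%g) (NJ (rp (repr e)) nx) _ (rtv _) hu).
      by rewrite /ve -(gaM aRr) mulgKV gaM // gN gaN.
    by rewrite !pvM xw -ge !pjM (homV pjM) pvV.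
  have := @count_lt _ Gbg Pbg (lcosets Cbg Gbg) (fun e q => par (cU U (ve e) (rp q))) _ _ _.
  rewrite card_lcosets => h; have := idx_main; rewrite leqNgt => /negP; apply.
  apply: (leq_trans (h _ _ _)); last by have := indexg_gt0 Gbg Pbg; lia.
  - move=> e g p eT gGb pP; have [u hu ->] := rpP pP gGb; last exact: ve_FF.
    by rewrite parD ev0.
  - by move=> e eT; rewrite ev0 // rpK.
  move=> e eT; have [rG _] := lc_repr CbG eT; exists (repr e), (repr e * pj (sg m s0))%g; split=> //.
    by rewrite groupM // GbP; apply/asboolP.
  move=> e' eT'; have [u hu uE] := rpS (repr e); rewrite /ve uE -/(ve e') (ev0 e' u hu).
  by rewrite (homV pjM) rpK lc_eq //; case: par; case: (_ == _).
have NbG : Nb \subset Gb.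
  apply/subsetP => q; rewrite inE => /asboolP [y ny <-]; have [z yz] := approx y U.
  rewrite yz GbP; apply/asboolP; split; [apply: (NG ny)|apply: (NG' ny)]; exact: pvP yz.
have normN : (Cb \subset 'N(Nbg))%g.
  apply/subsetP => q _; rewrite inE; apply/subsetP => _ /imsetP [n nN ->].
  move: nN; rewrite inE => /asboolP [y ny <-]; rewrite inE; apply/asboolP.
  exists (iota (rp q)^-1 * y * (iota (rp q)^-1)^-1)%g; first exact: NJ.
  by rewrite !pvM pvV !pv_iota (homV pjM) rpK invgK conjgE mulgA.
pose D := (Nbg <*> Cbg)%G.
have DE : D = (Nb * Cb)%g :> {set _} by apply: norm_joinEr.
have DG : D \subset Gb by rewrite join_subG NbG CbG.
have CD : Cb \subset D by apply: joing_subr.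
(* The chosen representative among the walls equivalent to [e] under the normal subgroup. *)
pose r (e : {set fq U}) := (repr (repr e *: D)%g *: Cb)%g.
have rz (e : {set fq U}) : ((repr e)^-1 * repr (repr e *: D)%g \in D)%g.
  by rewrite -mem_lcoset; apply: mem_repr; apply: lcoset_refl.
have rT e : e \in lcosets Cbg Gbg -> r e \in lcosets Cbg Gbg.
  move=> /(lc_repr CbG) [h _]; apply/lcosetsP; exists (repr (repr e *: D)%g) => //.
  by rewrite -[repr (_ *: _)%g](mulKVg (repr e)) groupM // (subsetP DG) // rz.
have rD e : (repr (r e) *: D = repr e *: D)%g.
  apply/lcoset_eqP; rewrite mem_lcoset; have h := mem_repr _ (lcoset_refl Cbg (repr (repr e *: D)%g)).
  rewrite -[repr (r e)](mulKVg (repr (repr e *: D)%g)) mulgA groupM ?rz //.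
  by apply: (subsetP CD); move: h; rewrite mem_lcoset.
have rr e : r (r e) = r e by rewrite {1}/r rD.
(* Equivalent walls differ by an element of the normal subgroup and a sign; [cU_comm] handles the
   former, and parity ignores the latter. *)
have pe (e : {set fq U}) u : pj u = 1%g -> par (cU U (ve (r e)) u) = par (cU U (ve e) u).
  move=> hu; have : ((repr e)^-1 * repr (repr e *: D)%g \in Nb * Cb)%g by rewrite -DE; exact: rz.
  move=> /mulsgP [n c nN cC ec].
  have h := mem_repr _ (lcoset_refl Cbg (repr (repr e *: D)%g)).
  move: h; rewrite mem_lcoset -/(r e) => c'C.
  have : (c * ((repr (repr e *: D)%g)^-1 * repr (r e)) \in Cb)%g by rewrite groupM.
  rewrite inE => /asboolP [g ge gE]; move: nN; rewrite inE => /asboolP [y ny yn].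
  have [z yz] := approx y U; set y0 := rp (repr e).
  have e1 : pj (rp (repr (r e))) = pj (y0 * z * g)%g.
    rewrite !pjM !rpK ge -yz yn; set R := repr (r e); set z' := repr (repr e *: D)%g in ec *.
    have -> : (repr e * n * (c * (z'^-1 * R)) = repr e * (n * c) * (z'^-1 * R))%g by rewrite !mulgA.
    by rewrite -ec !mulKVg.
  have e2 : par (cU U (ve (r e)) u) = par (cU U ((y0 * z * y0^-1)%g ** ve e) u).
    rewrite (cU_near _ _ e1) /ve -(gaM aRr) mulgKV [X in cU U X _](gaM aRr).
    by case: gE => ->; rewrite ?gaN ?cUN ?parN.
  have hv : pv (iota y0 * y * (iota y0)^-1)%g U = pj (y0 * z * y0^-1)%g by rewrite !pvM yz !pjM (homV pjM) pvV.
  by rewrite e2 (cU_comm (NJ y0 ny) hv (rtv _) hu).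
pose T := [set e in lcosets Cbg Gbg | r e != e].
have lt : (#|T| < #|Gbg : Pbg|%g)%N.
  apply: (@count_lt _ Gbg Pbg T (fun e q => par (cU U (ve e) (rp q)) (+) par (cU U (ve (r e)) (rp q)))).
  - move=> e g p; rewrite inE => /andP[eT _] gGb pP; have [u hu uE] := rpP pP gGb.
    rewrite (uE _ (ve_FF eT)) (uE _ (ve_FF (rT _ eT))) !parD (pe e u hu); by case: par; case: par; case: par.
  - by move=> e _; rewrite pe ?addbb // rpK.
  move=> e; rewrite inE => /andP[eT re]; have [rG _] := lc_repr CbG eT.
  exists (repr e), (repr e * pj (sg m s0))%g; split=> //.
    by rewrite groupM // GbP; apply/asboolP.
  move=> e'; rewrite inE => /andP[eT' re']; have [u hu uE] := rpS (repr e).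
  rewrite /ve !uE -!/(ve _) (pe e' u hu) !(homV pjM) !rpK !lc_eq ?rT //.
  have -> : (r e' == e) = false by apply: contraNF re => /eqP <-; rewrite rr.
  by case: par; case: par; case: par; case: (_ == _).
have le1 : (#|lcosets Cbg Gbg| <= #|T| + #|Gbg : D|%g)%N.
  rewrite -(cardsID T (lcosets Cbg Gbg)) leq_add //.
    by apply: subset_leq_card; apply: subsetIr.
  have inj : {in lcosets Cbg Gbg :\: T &, injective (fun e : {set fq U} => (repr e *: D)%g)}.
    move=> e e'; rewrite !inE => /andP[h1 h2] /andP[h3 h4] ee.
    move: h1 h3; rewrite h2 h4 /= !negbK => /eqP <- /eqP <-; by rewrite /r ee.
  rewrite -(card_in_imset inj) -card_lcosets; apply: subset_leq_card.
  apply/subsetP => _ /imsetP [e eT ->]; move: eT; rewrite inE => /andP[_ /(lc_repr CbG) [h _]].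
  by apply/lcosetsP; exists (repr e).
have le2 : (2 * #|Gbg : D|%g <= #|Gbg : Cbg|%g)%N.
  have e1 := @Lagrange_index _ Gbg D Cbg DG CD; rewrite -e1 mulnC leq_mul2l; apply/orP; right.
  rewrite indexg_gt1; apply: contra wb => /subsetP; apply.
  by apply: (subsetP (joing_subl _ _)); rewrite inE; apply/asboolP; exists x.
have := idx_main; rewrite card_lcosets in le1; lia.
Qed.
End Deep.

Theorem lemmaK (U1 : fincong m) :
  (forall x u, Nn x -> proj U1 u = 1%g -> (x * iota u = iota u * x)%g) ->
  forall U x w, Nn x -> pv x U = proj U w -> orbU U al (w ** al).
Proof.
move=> hU1 U x w nx xw.
pose U2 := fmeet (fmeet (fmeet U U1) (Nsp hm sp)) (fmeet (Nsp hm sp') (Nsp hm sp'')).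
have tr (A B C : fincong m) : projsub A B -> projsub B C -> projsub A C by move=> h1 h2 u v /h1 /h2.
have s1 : projsub U2 (fmeet (fmeet U U1) (Nsp hm sp)) by exact: fmeetl.
have s2 : projsub U2 (fmeet (Nsp hm sp') (Nsp hm sp'')) by exact: fmeetr.
have sU : projsub U2 U by exact: (tr _ _ _ s1 (tr _ _ _ (@fmeetl _ _ _ _) (@fmeetl _ _ _ _))).
have sU1 : projsub U2 U1 by exact: (tr _ _ _ s1 (tr _ _ _ (@fmeetl _ _ _ _) (@fmeetr _ _ _ _))).
have ssp : projsub U2 (Nsp hm sp) by exact: (tr _ _ _ s1 (@fmeetr _ _ _ _)).
have ssp' : projsub U2 (Nsp hm sp') by exact: (tr _ _ _ s2 (@fmeetl _ _ _ _)).
have ssp'' : projsub U2 (Nsp hm sp'') by exact: (tr _ _ _ s2 (@fmeetr _ _ _ _)).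
have UN y u : Nn y -> proj U2 u = 1%g -> (y * iota u = iota u * y)%g.
  move=> ny hu; apply: hU1 => //; rewrite -(hom1 (@proj_hom _ m U1)).
  by apply: ((projsubP _ _).1 sU1); rewrite hu (hom1 (@proj_hom _ m U2)).
have [w2 [h1 h2]] := approx2 x U2 U.
have := kdeep ssp ssp' ssp'' UN nx h1; rewrite inE => /asboolP [g ge gal].
have e : proj U w = proj U g.
  by rewrite -xw h2; apply: ((projsubP _ _).1 sU); rewrite ge.
apply/asboolP; exists (w * g^-1)%g; last by rewrite gaM // -{2}gal (gaK aRr).
by rewrite (@proj_hom _ m U) (homV (@proj_hom _ m U)) e mulgV.
Qed.
End LemmaK.

(** * Commuting factors acting on a generic component over a finite field *)

Section Path3.
Variables (S : finType) (m : S -> S -> nat) (hm : is_cox_graph m) (s0 : S).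
Local Notation I := (comp m s0).
Hypotheses (nfin : ~ cox_finite (restrict m I)) (naff : ~ cox_affine_on m I).
(** Without such a path the component has at most two vertices, and then the form is semidefinite
    because its off-diagonal entries are at least -2; this contradicts [neg_ex]. *)
Lemma path3 : exists s t r, [/\ s \in I, t \in I & r \in I] /\ [/\ dadj m s t, dadj m t r & s != r].
Proof.
have [v [vI]] := neg_ex hm nfin naff; rewrite ltNge => /negP; apply: contra_notP => none.
have aRs := aR_sym hm; have aRd := aR_diag m.
have nb s t r : s \in I -> dadj m s t -> dadj m t r -> s = r.
  move=> sI st tr; apply/eqP; apply: contrapT => /negP sr; apply: none; exists s, t, r.
  have tI : t \in I by apply: comp_adj st.
  by split; split=> //; apply: comp_adj tr.
have [[t st]|no] := pselect (exists t, dadj m s0 t); last first.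
  have I1 r : r \in I -> r = s0.
    by elim/comp_ind => {r} // t r tI -> tr; case: no; exists r.
  rewrite (inI_sum vI) (bigD1 s0) ?comp_refl //= big1; last first.
    by move=> t /andP[/I1 -> ]; rewrite eqxx.
  by rewrite addr0 bilZl bilZr ev2 // mulrA mulr_ge0 // -expr2 sqr_ge0.
have ts : t != s0 by case/andP: st; rewrite eq_sym.
have tI : t \in I by apply: comp_adj st; apply: comp_refl.
have I2 r : r \in I -> r = s0 \/ r = t.
  elim/comp_ind => {r} [|r q rI [->|->] rq]; [by left| |left].
    by right; apply: (nb q s0 t) => //; [apply: comp_adj rq; apply: comp_refl|rewrite dadjC].
  by symmetry; apply: (nb s0 t q) => //; apply: comp_refl.
rewrite (inI_sum vI) (bigD1 s0) ?comp_refl //= (bigD1 t) /=; last by rewrite tI.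
rewrite big1 => [|r /andP[/andP[/I2 [->|->]]]]; rewrite ?eqxx // addr0.
rewrite !(bilDl, bilDr, bilZl, bilZr) !bil_evev !aRd (aRs t s0).
have a1 : aR m s0 t <= 0 by apply: aR_le0; rewrite // eq_sym.
have a2 : -2%:R <= aR m s0 t := aR_ge m s0 t.
set a := aR m s0 t in a1 a2 *; set X := v s0; set Y := v t.
have : 0 <= (2%:R + a) / 2%:R * (X + Y) ^+ 2 + (2%:R - a) / 2%:R * (X - Y) ^+ 2.
  by rewrite addr_ge0 // mulr_ge0 ?sqr_ge0 //; lra.
by have -> : (2%:R + a) / 2%:R * (X + Y) ^+ 2 + (2%:R - a) / 2%:R * (X - Y) ^+ 2 =
  2%:R * X * X + 2%:R * a * X * Y + 2%:R * Y * Y; [field|lra].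
Qed.
Lemma two_more : exists t r, [/\ t \in I, r \in I & [/\ t != s0, r != s0 & t != r]].
Proof.
have [s [t [r [[sI tI rI] [/andP[st _] /andP[tr _] sr]]]]] := path3.
have [e|ts] := eqVneq t s0; first by exists s, r; split=> //; split=> //; rewrite -e // eq_sym.
have [e|rs] := eqVneq r s0; last by exists t, r.
by exists s, t; split=> //; split=> //; rewrite -e.
Qed.
End Path3.

Section Scal.
Variables (S : finType) (m : S -> S -> nat) (hm : is_cox_graph m) (s0 : S).
Local Notation I := (comp m s0).
Hypotheses (nfin : ~ cox_finite (restrict m I)) (naff : ~ cox_affine_on m I).
(** Edge entries are needed to move along the diagram, and the quadratic expressions decide the
    contradiction in [not_scalar]; those nonzero over the reals must stay nonzero over the field. *)
Definition l0 : seq {poly int} :=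
  [seq f <- [seq aP m p.1 p.2 | p : S * S] ++
    [seq 2%:R * aP m p.1.1 p.2 - aP m p.1.1 p.1.2 * aP m p.1.2 p.2 | p : S * S * S] |
  evp (cc m) f != 0].
Variable sp : spec m.
Hypotheses (two : 2%:R != 0 :> sF sp) (good0 : forall f, f \in l0 -> evp (sx sp) f != 0).
Local Notation F := (sF sp).
Local Notation W := (cox m).
Local Notation vF := (vec S F).
Local Notation ef := (ev F).
Local Notation B := (bil (aF sp)).
Local Notation "g ** v" := (@ga S m F (aF sp) g v) (at level 40).
Let aFs := aF_sym hm sp.
Let aFd := @aF_diag S m sp.
Let aFr := @resp_aF S m hm sp.
#[local] Hint Resolve aFs aFd aFr hm : core.
Local Notation al := (ef s0).

Lemma aF_adj s t : dadj m s t -> aF sp s t != 0.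
Proof.
move=> /(aR_adj hm) h; apply: good0; rewrite mem_filter evp_aP lt_eqF //= mem_cat.
by apply/orP; left; apply/mapP; exists (s, t); rewrite ?mem_enum.
Qed.
Lemma aF_path s t r : dadj m s t -> dadj m t r -> s != r ->
  2%:R * aF sp s r - aF sp s t * aF sp t r != 0.
Proof.
move=> /(aR_adj hm) h1 /(aR_adj hm) h2 sr.
have e A (x : A) : True by []. 
have : 2%:R * aP m s r - aP m s t * aP m t r \in l0.
  rewrite mem_filter mem_cat; apply/andP; split; last first.
    by apply/orP; right; apply/mapP; exists ((s, t), r); rewrite ?mem_enum.
  rewrite rmorphB !rmorphM rmorph_nat /= !evp_aP lt_eqF //.
  by have := aR_le0 hm sr; nra.
by move=> /good0; rewrite rmorphB !rmorphM rmorph_nat.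
Qed.
Definition inrad (v : vF) := forall t, B v (ef t) = 0.
Lemma inradD k u v : inrad u -> inrad v -> inrad (k *: u + v).
Proof. by move=> h1 h2 t; rewrite bilDl bilZl h1 h2 mulr0 addr0. Qed.
Lemma inrad0 : inrad 0. Proof. by move=> t; rewrite bil0l. Qed.
Lemma inradZ k u : inrad u -> inrad (k *: u).
Proof. by move=> h; rewrite -[_ *: _]addr0; apply: inradD inrad0. Qed.
Lemma inrad_B u v : inrad u -> B u v = 0.
Proof. by move=> h; rewrite (vec_sum v) bil_sumr big1 // => t _; rewrite bilZr h mulr0. Qed.
Lemma inrad_ga w u : inrad u -> w ** u = u.
Proof.
move=> h; elim/cox_ind: w => [|s w IH]; first by rewrite ga1.
by rewrite gaM // IH ga_sg // refl_rv /rv bilC // h scale0r subr0.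
Qed.
Lemma inrad_ev k t : inrad (k *: ef t) -> k = 0.
Proof.
by move=> /(_ t); rewrite bilZl ev2 // => /eqP; rewrite mulf_eq0 (negbTE two) orbF => /eqP.
Qed.
Lemma sq_pm k : k * k * 2%:R = 2%:R :> F -> k = 1 \/ k = -1.
Proof.
move=> h; have /eqP : (k - 1) * (k + 1) * 2%:R = 0 by rewrite -[0](subrr (2%:R : F)) -{2}h; ring.
rewrite !mulf_eq0 (negbTE two) orbF subr_eq0 addr_eq0 => /orP[/eqP->|/eqP->]; auto.
Qed.

Definition commF (X Y : W -> Prop) := forall x y, X x -> Y y -> eqF sp (x * y)%g (y * x)%g.
Definition genF (X Y : W -> Prop) := forall w, exists x y, [/\ X x, Y y & eqF sp w (x * y)%g].

Section Pair.
Variables (X Y : W -> Prop) (cXY : commF X Y) (gXY : genF X Y).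
Lemma comV x y v : X x -> Y y -> y ** (x^-1%g ** v) = x^-1%g ** (y ** v).
Proof.
move=> hx hy; apply: (ga_inj aFr (g := x)).
by rewrite (gaVK aFr) -(gaM aFr) cXY // (gaM aFr) (gaVK aFr).
Qed.
(* On V_F the commutator of x with a reflection is the commutator of x with the
   X-part of that reflection, so it commutes with Y. *)
Lemma comm_refl x t y v : X x -> Y y ->
  y ** ((x * sg m t * x^-1 * sg m t)%g ** v) = (x * sg m t * x^-1 * sg m t)%g ** (y ** v).
Proof.
move=> hx hy; have [b [c [hb hc e]]] := gXY (sg m t).
have eV u : sg m t ** u = c^-1%g ** (b^-1%g ** u).
  by rewrite -{1}[sg m t]sgV -(gaM aFr) -invMg; apply: (ga_inj aFr (g := sg m t)); rewrite (gaVK aFr) e (gaVK aFr).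
have E u : (x * sg m t * x^-1 * sg m t)%g ** u = x ** (b ** (x^-1%g ** (b^-1%g ** u))).
  by rewrite !gaM // (eV u) e gaM // (comV _ hx hc) (gaVK aFr).
have com1 z u : X z -> y ** (z ** u) = z ** (y ** u) by move=> hz; rewrite -!(gaM aFr) (cXY hz hy).
by rewrite !E (com1 _ _ hx) (com1 _ _ hb) (comV _ hx hy) (comV _ hb hy).
Qed.
Definition ind (x : W) := forall k, ~ inrad (x ** al - k *: al).
Definition span (a b v : vF) := exists p q, v = p *: a + q *: b.
Lemma spanD a b k u v : span a b u -> span a b v -> span a b (k *: u + v).
Proof.
move=> [p [q ->]] [p' [q' ->]]; exists (k * p + p'), (k * q + q').
by apply/ffunP => t; rewrite !vecE; ring.
Qed.
Lemma spanl a b : span a b a. Proof. by exists 1, 0; rewrite scale1r scale0r addr0. Qed.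
Lemma spanr a b : span a b b. Proof. by exists 0, 1; rewrite scale1r scale0r add0r. Qed.
Lemma spanZ a b k u : span a b u -> span a b (k *: u).
Proof. by move=> [p [q ->]]; exists (k * p), (k * q); rewrite scalerDr !scalerA. Qed.
(** The product of the reflections in [x al] and [al] is a commutator of [x] with a reflection, so
    by [comm_refl] it commutes with [y]. Its displacements lie in the plane of [al] and [x al], and
    suitable ones recover the images of both vectors under [y]. *)
Lemma ind_span x y : X x -> ind x -> Y y ->
  span al (x ** al) (y ** al) /\ span al (x ** al) (y ** (x ** al)).
Proof.
move=> hx ix hy; set a := x ** al; pose k := B a al / 2%:R.
have [t ht] : exists t, B (a - k *: al) (ef t) != 0.
  by apply: contrapT => h; apply: (ix k) => t; apply/eqP; apply: contrapT => /negP h2; apply: h; exists t.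
pose f := (x * sg m s0 * x^-1 * sg m s0)%g.
have fE v : f ** v = rv (aF sp) a (rv (aF sp) al v).
  by rewrite /f (gaM aFr) (ga_conj aFr aFs aFd) (ga_sg aFr) refl_rv.
have fy v : y ** (f ** v) = f ** (y ** v) by exact: comm_refl.
have f1 v : span al a (f ** v - v).
  rewrite fE /rv; set c1 := B al v; set c2 := B a _.
  have -> : v - c1 *: al - c2 *: a - v = (- c1) *: al + (- c2) *: a.
    by apply/ffunP => r; rewrite !vecE; ring.
  by apply: spanD; [exact: spanl|apply: spanZ; exact: spanr].
have Baa : B al al = 2%:R by rewrite ev2.
(* [v] is orthogonal to [al] but not to [a], so its displacement is a nonzero multiple of [a]. *)
pose v := ef t - (B al (ef t) / 2%:R) *: al.
have v1 : B al v = 0 by rewrite /v bilDr bilNr bilZr Baa mulfVK // subrr.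
have v2 : B a v != 0.
  have -> : B a v = B (a - k *: al) (ef t); last exact: ht.
  by rewrite /v /k bilDr bilNr bilZr bilDl bilNl bilZl; ring.
have fv : f ** v = v - B a v *: a by rewrite fE /rv v1 scale0r subr0.
have ya : span al a (y ** a).
  have := f1 (y ** v); rewrite -fy fv gaB gaZ => h.
  have -> : y ** a = (- (B a v)^-1) *: (y ** v - B a v *: (y ** a) - y ** v).
    rewrite addrAC subrr add0r scalerN scaleNr opprK scalerA mulVf // scale1r //.
  exact: spanZ.
split=> //; have := f1 (y ** al); rewrite -fy fE.
rewrite [rv (aF sp) al al]rv_self // /rv bilNr gaB gaN gaZ scaleNr opprK => h.
have -> : y ** al = (- 2%:R^-1) *: ((- (y ** al) + B a al *: (y ** a) - y ** al) + (- B a al) *: (y ** a)).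
  by apply/ffunP => r; rewrite !vecE; field.
apply: spanZ; rewrite addrC; apply: spanD => //.
Qed.
End Pair.

Lemma commF_sym X Y : commF X Y -> commF Y X.
Proof. by move=> h x y hx hy v; symmetry; apply: h. Qed.
Lemma genF_sym X Y : commF X Y -> genF X Y -> genF Y X.
Proof.
move=> c h w; have [x [y [hx hy e]]] := h w; exists y, x; split=> // v.
by rewrite e; apply: c.
Qed.
(** The planes spanned by [al] with [x al] and with [y al] coincide. This plane is stable under X
    and Y, hence under W, and so contains every simple root of a component with at least three
    vertices. *)
Lemma not_both X Y x y : commF X Y -> genF X Y -> X x -> Y y -> ind x -> ind y -> False.
Proof.
move=> cXY gXY hx hy ix iy; have cYX := commF_sym cXY; have gYX := genF_sym cXY gXY.
have [[p [q e]] _] := ind_span cXY gXY hx ix hy.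
have q0 : q != 0.
  apply/eqP => q0; apply: (iy p); rewrite e q0 scale0r addr0 subrr; exact: inrad0.
have e' : x ** al = (- (p / q)) *: al + q^-1 *: (y ** al).
  by rewrite e; apply/ffunP => r; rewrite !vecE; field.
pose P := span al (y ** al).
have xP : P (x ** al) by rewrite e'; apply: spanD; [exact: spanl|apply: spanZ; exact: spanr].
have sub v : span al (x ** al) v -> P v.
  by move=> [p' [q' ->]]; apply: spanD; [exact: spanl|apply: spanZ].
have invX z v : X z -> P v -> P (z ** v).
  move=> hz [p' [q' ->]]; have [h1 h2] := ind_span cYX gYX hy iy hz.
  by rewrite gaD !gaZ; apply: spanD => //; apply: spanZ.
have invY z v : Y z -> P v -> P (z ** v).
  move=> hz [p' [q' ->]]; have [h1 h2] := ind_span cXY gXY hx ix hz.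
  rewrite gaD !gaZ; apply: spanD; first exact: (sub _ h1).
  have -> : z ** (y ** al) = p *: (z ** al) + q *: (z ** (x ** al)) by rewrite e gaD !gaZ.
  by apply: spanZ; apply: spanD; [exact: (sub _ h1)|apply: spanZ; exact: (sub _ h2)].
have inv w v : P v -> P (w ** v).
  by move=> h; have [a [b [ha hb ->]]] := gXY w; rewrite gaM //; apply: invX ha _; apply: invY.
have allP t : t \in I -> P (ef t).
  elim/comp_ind => {t} [|t r tI IH tr]; first exact: spanl.
  have := inv (sg m r) _ IH; rewrite ga_sg // refl_rv /rv bil_evev (aFs r t) => h.
  have -> : ef r = (- (aF sp t r)^-1) *: ((ef t - aF sp t r *: ef r) + (-1) *: ef t).
    by apply/ffunP => q'; rewrite !vecE; field; apply: aF_adj.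
  by apply: spanZ; rewrite addrC; apply: spanD.
have [t [r [tI rI [ts rs tr]]]] := two_more hm nfin naff.
have [p1 [q1 e1]] := allP t tI; have [p2 [q2 e2]] := allP r rI.
have q10 : q1 != 0.
  apply/eqP => q10; have /ffunP/(_ t) := e1; rewrite q10 scale0r addr0 !vecE !ffunE eqxx (negbTE ts).
  by rewrite mulr0 => /eqP; rewrite oner_eq0.
have e3 : ef r = (p2 - q2 * p1 / q1) *: al + (q2 / q1) *: ef t.
  by rewrite {1}e2 e1; apply/ffunP => q'; rewrite !vecE; field.
have /ffunP/(_ r) := e3; rewrite !vecE !ffunE eqxx (negbTE rs) [r == t]eq_sym (negbTE tr) !mulr0 addr0.
by move/eqP; rewrite oner_eq0.
Qed.

Definition pmI (x : W) := exists2 e : F, e = 1 \/ e = -1 & forall t, t \in I -> x ** ef t = e *: ef t.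
(** For adjacent [r] and [q], the vector [g e_q] is a combination of [g e_r] and [g s_q e_r], since
    the form does not vanish on edges. *)
Lemma spread (w : W) (e : F) t : t \in I -> (forall g, inrad (w ** (g ** ef t) - e *: (g ** ef t))) ->
  forall r, r \in I -> inrad (w ** ef r - e *: ef r).
Proof.
move=> tI h r; rewrite -(comp_eq hm tI) => rI.
suff H : forall g, inrad (w ** (g ** ef r) - e *: (g ** ef r)) by have := H 1%g; rewrite ga1.
elim/comp_ind: rI => {r} [|r q rI IH rq] g; first exact: h.
have rs : (g * sg m q)%g ** ef r = g ** ef r - aF sp q r *: (g ** ef q).
  by rewrite gaM // ga_sg // refl_rv /rv bil_evev gaB gaZ.
have a0 : aF sp q r != 0 by apply: aF_adj; rewrite dadjC.
have h1 := IH (g * sg m q)%g; have h2 := IH g; rewrite rs in h1.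
have -> : w ** (g ** ef q) - e *: (g ** ef q) = (- (aF sp q r)^-1) *:
   ((-1) *: (w ** (g ** ef r) - e *: (g ** ef r)) +
    (w ** (g ** ef r - aF sp q r *: (g ** ef q)) - e *: (g ** ef r - aF sp q r *: (g ** ef q)))).
  rewrite gaB gaZ; move: (w ** (g ** ef r)) (w ** (g ** ef q)) (g ** ef r) (g ** ef q) => u1 u2 u3 u4.
  by apply/ffunP => i; rewrite !vecE; field.
by apply: inradZ; apply: inradD.
Qed.
(** On a path s - q - r the reflection in [e_q] would act by -1 modulo the radical. Pairing its
    value at [e_s] with [e_r] gives 2 a_sr = a_sq a_qr, which [aF_path] excludes. *)
Lemma not_scalar t : t \in I ->
  ~ (forall w, exists2 e : F, e = 1 \/ e = -1 & inrad (w ** ef t - e *: ef t)).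
Proof.
move=> tI h.
have H w : exists2 e : F, e = 1 \/ e = -1 & forall r, r \in I -> inrad (w ** ef r - e *: ef r).
  have [e e1 he] := h w; exists e; [exact: e1|apply: (spread tI) => g].
  have [e' _ he'] := h g.
  have -> : w ** (g ** ef t) - e *: (g ** ef t) =
     e' *: (w ** ef t - e *: ef t) + ((1 - e) *: (g ** ef t - e' *: ef t)).
    have {1}-> : g ** ef t = e' *: ef t + (g ** ef t - e' *: ef t) by rewrite addrC subrK.
    rewrite gaD gaZ (inrad_ga w he'); move: (w ** ef t) (g ** ef t) (ef t) => u1 u2 u3.
    by apply/ffunP => i; rewrite !vecE; ring.
  by apply: inradD; [exact: he|apply: inradZ; exact: he'].
have [s [q [r [[sI qI rI] [sq qr sr]]]]] := path3 hm nfin naff.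
have [e e1 he] := H (sg m q).
have e2 : e = -1.
  have := he q qI; rewrite ga_sg // refl_rv rv_self ?ev2 // -scaleN1r -scalerBl => /inrad_ev.
  by move/eqP; rewrite subr_eq0 eq_sym => /eqP.
have := he s sI; rewrite ga_sg // refl_rv /rv bil_evev e2 => /(_ r).
rewrite !(bilDl, bilNl, bilZl) !bil_evev => e3.
have /eqP := aF_path sq qr sr; apply; rewrite -[RHS]e3 (aFs q s); ring.
Qed.

(** The action is first found to be by signs modulo the radical. A nonzero remainder r in the
    radical turns the commutator of x with the reflection in [e_t] into a transvection v -> v + e
    B(e_t, v) r. Commuting with it, Y preserves B(e_t, .), so all of W acts on [e_t] by signs modulo
    the radical, against [not_scalar]. *)
Lemma exact_scalar X Y : commF X Y -> genF X Y -> (forall x, X x -> ~ ind x) -> forall x, X x -> pmI x.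
Proof.
move=> cXY gXY nX.
have K x : X x -> exists2 e : F, e = 1 \/ e = -1 & inrad (x ** al - e *: al).
  move=> /nX /existsNP [e /contrapT h]; exists e => //; apply: sq_pm.
  have [r hr e1] : exists2 r, inrad r & x ** al = e *: al + r by exists (x ** al - e *: al); rewrite // addrC subrK.
  have := bil_ga aFs aFd x al al; rewrite e1 !(bilDl, bilDr) !(inrad_B _ hr) (bilC aFs _ r).
  by rewrite (inrad_B _ hr) !addr0 bilZl bilZr (ev2 aFd) mulrA => ->.
have com1 x y u : X x -> Y y -> y ** (x ** u) = x ** (y ** u) by move=> hx hy; rewrite -!(gaM aFr) (cXY _ _ hx hy).
have K2 x : X x -> exists2 e : F, e = 1 \/ e = -1 & forall t, t \in I -> inrad (x ** ef t - e *: ef t).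
  move=> hx; have [e e1 he] := K x hx; exists e; [exact: e1|move=> t].
  apply: (spread (comp_refl m s0)) => w; have [x' [y' [hx' hy' E]]] := gXY w.
  have [e' _ he'] := K x' hx'; rewrite !E !gaM //.
  have e3 : x' ** (y' ** al) = e' *: (y' ** al) + (x' ** al - e' *: al).
    rewrite -(com1 _ _ _ hx' hy'); have {1}-> : x' ** al = e' *: al + (x' ** al - e' *: al) by rewrite addrC subrK.
    by rewrite gaD gaZ (inrad_ga _ he').
  have e4 : x ** (y' ** al) = e *: (y' ** al) + (x ** al - e *: al).
    rewrite -(com1 _ _ _ hx hy'); have {1}-> : x ** al = e *: al + (x ** al - e *: al) by rewrite addrC subrK.
    by rewrite gaD gaZ (inrad_ga _ he).
  rewrite e3 gaD gaZ e4 (inrad_ga _ he').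
  move: (y' ** al) (x ** al - e *: al) (x' ** al - e' *: al) he he' => u r1 r2 he he'.
  have -> : e' *: (e *: u + r1) + r2 - e *: (e' *: u + r2) = e' *: r1 + ((1 - e) *: r2).
    by apply/ffunP => i; rewrite !vecE; ring.
  by apply: inradD; [exact: he|apply: inradZ; exact: he'].
move=> x hx; have [e e1 he2] := K2 x hx; exists e; first exact: e1.
move=> t tI; set r := x ** ef t - e *: ef t; have hr : inrad r := he2 t tI.
have [r0|/eqP r0] := pselect (r = 0); first by apply/eqP; rewrite -subr_eq0 -/r r0.
exfalso; apply: (not_scalar tI).
have xt : x ** ef t = e *: ef t + r by rewrite /r addrC subrK.
pose f := (x * sg m t * x^-1 * sg m t)%g.
have fE v : f ** v = v + (e * B (ef t) v) *: r.
  rewrite /f gaM // ga_conj // ga_sg // refl_rv xt /rv bilDl bilZl (inrad_B _ hr) addr0.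
  rewrite bilDr bilNr bilZr (ev2 aFd); move: (B (ef t) v) (ef t) => c u.
  by case: e1 => ->; apply/ffunP => i; rewrite !vecE; ring.
have Yt y v : Y y -> B (ef t) (y ** v) = B (ef t) v.
  move=> hy; have := comm_refl cXY gXY t v hx hy; rewrite -/f !fE gaD gaZ (inrad_ga y hr).
  move/addrI/esym/eqP; rewrite -subr_eq0 -scalerBl scaler_eq0 (negbTE r0) orbF subr_eq0 => /eqP.
  by apply: mulfI; case: e1 => ->; rewrite ?oppr_eq0 oner_eq0.
move=> w; have [x' [y' [hx' hy' E]]] := gXY w; have [e' e'1 he'] := K2 x' hx'.
exists e' => //; rewrite E gaM //.
have hy : inrad (y' ** ef t - ef t).
  move=> q; rewrite bilDl bilNl -[ef q in X in X - _](gaVK aFr y') bil_ga //.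
  by rewrite -(Yt y' _ hy') (gaVK aFr) subrr.
have {1}-> : y' ** ef t = ef t + (y' ** ef t - ef t) by rewrite addrC subrK.
rewrite gaD (inrad_ga _ hy) addrAC.
by rewrite -[X in X + _]scale1r; apply: inradD => //; apply: he'.
Qed.

Theorem scal X Y : commF X Y -> genF X Y -> (forall x, X x -> pmI x) \/ (forall y, Y y -> pmI y).
Proof.
move=> c g; have [h|h] := pselect (forall x, X x -> ~ ind x); first by left; apply: exact_scalar c g h.
right; apply: (exact_scalar (commF_sym c) (genF_sym c g)) => y hy iy.
by apply: h => x hx ix; apply: (not_both c g hx hy).
Qed.
End Scal.

(** * Images of virtually abelian factors *)

Section HatDecomp.
Variables (S : finType) (m : S -> S -> nat) (hm : is_cox_graph m) (A : {set S}) (hA : sepA m A).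
Definition hinc (B : {set S}) : prof (restrict m B) -> prof m := phat (@inc_hom _ m B).
Lemma hinc_hom B : hom (@hinc B). Proof. exact: phat_hom. Qed.
Lemma hinc_cts B : cts (@hinc B). Proof. exact: phat_cts. Qed.
Definition hret : prof m -> prof (restrict m A) := phat (ret_hom hm hA).
Lemma hret_hom : hom hret. Proof. exact: phat_hom. Qed.
Lemma hret_cts : cts hret. Proof. exact: phat_cts. Qed.
Lemma hret_iota w : hret (iota w) = iota (ret A w). Proof. exact: phat_iota. Qed.
Lemma hinc_iota B w : @hinc B (iota w) = iota (inc w). Proof. exact: phat_iota. Qed.
Lemma hincK : cancel (@hinc A) hret.
Proof.
apply: (@cts_ext _ _ _ _ (hret \o @hinc A) id).
- by move=> x y /=; rewrite hinc_hom hret_hom.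
- by [].
- by apply: cts_comp; [exact: hinc_cts|exact: hret_cts].
- by move=> N; exists N.
by move=> s /=; rewrite hinc_iota hret_iota (incK hm hA).
Qed.
Lemma hinc_comm a c : (@hinc A a * @hinc (~: A) c = @hinc (~: A) c * @hinc A a)%g.
Proof.
apply: pv_ext => N; rewrite !pvM.
have [u hu] := approx a (fpull (@inc_hom _ m A) N); have [w hw] := approx c (fpull (@inc_hom _ m (~: A)) N).
by rewrite /hinc (pv_phat hu) (pv_phat hw) -!proj_hom (inc_comm hA).
Qed.
End HatDecomp.

Section HatDecomp2.
Variables (S : finType) (m : S -> S -> nat) (hm : is_cox_graph m) (A : {set S}) (hA : sepA m A).
Let hC := sepAC hm hA.
Lemma hat_decomp x : x = (hinc (hret hm hA x) * hinc (hret hm hC x))%g.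
Proof.
apply: (@cts_ext _ _ _ _ id (fun x => hinc (hret hm hA x) * hinc (hret hm hC x))%g) => //.
- move=> y z; rewrite !hret_hom !hinc_hom -!mulgA; congr (_ * _)%g.
  by rewrite !mulgA (hinc_comm hA).
- by move=> N; exists N.
- move=> N; have [N1 h1] := cts_comp (@hret_cts _ _ hm _ hA) (@hinc_cts _ m A) N.
  have [N2 h2] := cts_comp (@hret_cts _ _ hm _ hC) (@hinc_cts _ m (~: A)) N.
  exists (fmeet N1 N2) => y e; rewrite pvM (h1 y) ?(h2 y) ?mulg1 //.
    by apply: etrans (pv1 N2); apply: pv_sub (@fmeetr _ _ N1 N2) _; rewrite e pv1.
  by apply: etrans (pv1 N1); apply: pv_sub (@fmeetl _ _ N1 N2) _; rewrite e pv1.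
by move=> s; rewrite !hret_iota !hinc_iota -iota_hom -(decomp hm hA).
Qed.
Lemma hinc_dense (x : prof m) : exists a c, x = (@hinc _ m A a * @hinc _ m (~: A) c)%g.
Proof. by exists (hret hm hA x), (hret hm hC x); apply: hat_decomp. Qed.
Lemma hret_out c : hret hm hA (@hinc _ m (~: A) c) = 1%g.
Proof.
apply: (@cts_ext _ _ _ _ (hret hm hA \o @hinc _ m (~: A)) (fun _ => 1%g)).
- by move=> x y /=; rewrite hinc_hom hret_hom.
- by move=> x y; rewrite mulg1.
- by apply: cts_comp; [exact: hinc_cts|exact: hret_cts].
- move=> N; have [N1 _] := cts_comp (@hinc_cts _ m (~: A)) (@hret_cts _ _ hm _ hA) N.
  by exists N1 => z _; rewrite pv1.
move=> s /=; rewrite hinc_iota hret_iota inc_sg (ret_sg hm hA) retg_out //.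
by have := valP s; rewrite /= inE.
Qed.
End HatDecomp2.

Section EvenProd.
Variables (T : eqType) (X : groupType) (tau : T -> X) (r : rel T).
Hypotheses (tc : forall x y, (tau x * tau y = tau y * tau x)%g) (t2 : forall x, (tau x * tau x = 1)%g).
Definition lprod (L : seq T) : X := foldr (fun x y => tau x * y)%g 1%g L.
Lemma lprod_comm x L : (tau x * lprod L = lprod L * tau x)%g.
Proof.
elim: L => [|y L IH] /=; first by rewrite mulg1 mul1g.
by rewrite mulgA tc -!mulgA IH.
Qed.
Lemma lprod_cat L L' : lprod (L ++ L') = (lprod L * lprod L')%g.
Proof. by elim: L => [|y L IH] /=; rewrite ?mul1g // IH mulgA. Qed.
(** Equivalent factors are equal involutions, and all factors commute, so they cancel in pairs. *)
Lemma even_prod L : (forall x, x \in L -> r x x) ->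
  (forall x y z, x \in L -> y \in L -> z \in L -> r x y -> r x z = r y z /\ r z x = r z y) ->
  (forall x y, x \in L -> y \in L -> r x y -> tau x = tau y) ->
  (forall x, x \in L -> ~~ odd (count (r x) L)) -> lprod L = 1%g.
Proof.
have [n] := ubnP (size L); elim: n L => // n IH [|x L] //= sz rr re rt ev.
have xL : x \in x :: L by rewrite mem_head.
have : has (r x) L.
  by have := ev x xL; rewrite rr // add1n /= negbK has_count; case: (count _ _).
case/hasP => y yL rxy; case/splitPr: yL sz rr re rt ev xL => L1 L2 sz rr re rt ev xL.
have yL : y \in x :: L1 ++ y :: L2 by rewrite inE mem_cat mem_head !orbT.
have sub z : z \in L1 ++ L2 -> z \in x :: L1 ++ y :: L2.
  by rewrite inE !mem_cat inE => /orP[->|->]; rewrite !orbT.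
have txy := rt x y xL yL rxy.
rewrite lprod_cat /= -txy.
have -> : (tau x * (lprod L1 * (tau x * lprod L2)) = lprod (L1 ++ L2))%g.
  by rewrite lprod_cat !mulgA lprod_comm -[(_ * tau x * tau x)%g]mulgA t2 mulg1.
apply: IH => [|z /sub|z1 z2 z3 /sub h1 /sub h2 /sub h3|z1 z2 /sub h1 /sub h2|z zL].
- by move: sz; rewrite !size_cat /=; lia.
- exact: rr.
- exact: re.
- exact: rt.
have zL2 := sub z zL; have := ev z zL2; have [_ e] := re x y z xL yL zL2 rxy.
by rewrite !count_cat /= e !oddD; case: (r z y); rewrite /= ?negbK //; case: odd; case: odd.
Qed.
End EvenProd.

(** * The virtually abelian factor becomes central and dies in abelian quotients *)

Section Star.
Variables (V1 S : finType) (m1 : V1 -> V1 -> nat) (m : S -> S -> nat).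
Hypotheses (hm1 : is_cox_graph m1) (hm : is_cox_graph m).
Variables (A : {set V1}) (hA : sepA m1 A) (NT : fincong (restrict m1 A)).
Hypothesis NTab : forall x y : cox (restrict m1 A), proj NT x = 1%g -> proj NT y = 1%g -> (x * y = y * x)%g.
Hypotheses (nfin : forall s, ~ cox_finite (restrict m (comp m s)))
  (naff : forall s, ~ cox_affine_on m (comp m s)).
Variables (F : prof m1 -> prof m) (hF : hom F) (cF : cts F) (surF : forall y, exists x, F x = y).
Local Notation H := (prof (restrict m1 A)).
Local Notation K := (prof (restrict m1 (~: A))).
Local Notation W := (cox m).
Local Notation es := (ev RR).
Local Notation "g ** v" := (@ga S m _ (aR m) g v) (at level 40).
Let aRs := aR_sym hm.
Let aRd := aR_diag m.
Let aRr := resp_aR hm.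
#[local] Hint Resolve aRs aRd aRr hm : core.
Definition fA (a : H) : prof m := F (hinc a).
Definition fC (c : K) : prof m := F (hinc c).
Lemma fAM : hom fA. Proof. by move=> x y; rewrite /fA hinc_hom hF. Qed.
Lemma fCM : hom fC. Proof. by move=> x y; rewrite /fC hinc_hom hF. Qed.
Lemma fAC a c : (fA a * fC c = fC c * fA a)%g.
Proof. by rewrite /fA /fC -!hF (hinc_comm hA). Qed.
Lemma f_dense y : exists a c, y = (fA a * fC c)%g.
Proof.
have [x <-] := surF y; have [a [c ->]] := hinc_dense hm1 hA x.
by exists a, c; rewrite hF.
Qed.
Lemma T_ab (x y : H) : pv x NT = 1%g -> pv y NT = 1%g -> (x * y = y * x)%g.
Proof.
move=> hx hy; apply: pv_ext => N; rewrite !pvM.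
have [u [u1 u2]] := approx2 x N NT; have [w [w1 w2]] := approx2 y N NT.
by rewrite u1 w1 -!proj_hom NTab // -?u2 -?w2.
Qed.
Lemma commute_all (n : prof m) : (forall s, n * iota (sg m s) = iota (sg m s) * n)%g -> forall y, (n * y = y * n)%g.
Proof.
move=> h.
have hw w : (n * iota w = iota w * n)%g.
  elim/cox_ind: w => [|s w IH]; first by rewrite (hom1 (@iota_hom _ m)) mulg1 mul1g.
  by rewrite iota_hom mulgA h -!mulgA IH.
move=> y; apply: pv_ext => N; have [w e] := approx y N.
by rewrite !pvM e -!pv_iota -!pvM hw.
Qed.

Section Scalars.
Variables (s0 : S) (sp : spec m) (two : 2%:R != 0 :> sF sp).
Local Notation gF := (@ga S m _ (aF sp)).
Hypothesis good0 : forall f, f \in l0 m -> evp (sx sp) f != 0.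
Variables (g h : W) (n : nat).
Hypotheses (n2 : ~~ odd n) (nT : forall q : fq NT, (q ^+ n)%g = 1%g)
  (gh : exists2 t, t \in comp m s0 & gF (g ^+ n * h ^+ n)%g (ev _ t) <> gF (h ^+ n * g ^+ n)%g (ev _ t)).
Let aFr := @resp_aF S m hm sp.
Local Notation Ns := (Nsp hm sp).
Definition XA (w : W) := exists a, pv (fA a) Ns = proj Ns w.
Definition XC (w : W) := exists c, pv (fC c) Ns = proj Ns w.
Lemma XAC : commF sp XA XC.
Proof.
move=> x y [a ha] [c hc]; apply/(NspP hm sp).
by rewrite !(@proj_hom _ m Ns) -ha -hc -!pvM fAC.
Qed.
Lemma XAC_gen : genF sp XA XC.
Proof.
move=> w; have [a [c e]] := f_dense (iota w).
have [x hx] := approx (fA a) Ns; have [y hy] := approx (fC c) Ns.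
exists x, y; split; [by exists a|by exists c|].
by apply/(NspP hm sp); rewrite (@proj_hom _ m Ns) -hx -hy -pvM -e.
Qed.
(** [scal] makes one of the factors act by signs. If it were the complementary one, n-th powers of
    its elements would act trivially, while n-th powers from the virtually abelian factor commute;
    then the n-th powers of [g] and [h] would commute on the component. *)
Lemma XA_pm x : XA x -> pmI s0 sp x.
Proof.
move: x; have [//|hC] := scal hm (@nfin s0) (@naff s0) two good0 XAC XAC_gen.
case: gh => t tI []; have [xg [yg [[a ha] cg eg]]] := XAC_gen g; have [xh [yh [[b hb] ch eh]]] := XAC_gen h.
have XCX y k : XC y -> XC (y ^+ k)%g.
  move=> [c hc]; exists (c ^+ k)%g; rewrite (homX fCM) (homX (@pvM _ m Ns)) hc.
  by rewrite (homX (@proj_hom _ m Ns)).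
have XAX y k : XA y -> XA (y ^+ k)%g.
  move=> [c hc]; exists (c ^+ k)%g; rewrite (homX fAM) (homX (@pvM _ m Ns)) hc.
  by rewrite (homX (@proj_hom _ m Ns)).
have fixy y : XC y -> gF (y ^+ n)%g (ev _ t) = ev _ t.
  move=> /hC [e e1 he]; have h1 k : gF (y ^+ k)%g (ev _ t) = (e ^+ k) *: ev _ t.
    elim: k => [|k IH]; first by rewrite expg0 (ga1 aFr) scale1r.
    by rewrite expgSr (gaM aFr) (he _ tI) gaZ IH scalerA -exprS.
  rewrite h1; case: e1 => ->; first by rewrite expr1n scale1r.
  by rewrite -signr_odd (negbTE n2) scale1r.
have powE u x y k : eqF sp u (x * y)%g -> XA x -> XC y -> eqF sp (u ^+ k)%g (x ^+ k * y ^+ k)%g.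
  move=> E hx hy; elim: k => [|k IH] v; first by rewrite !expg0 mulg1.
  rewrite expgS (gaM aFr) E (gaM aFr) IH.
  have h1 : eqF sp (y * x ^+ k)%g (x ^+ k * y)%g.
    by move=> z; symmetry; apply: XAC => //; apply: XAX.
  rewrite [gF (x ^+ k * y ^+ k)%g v](gaM aFr) -[gF y (gF _ _)](gaM aFr) h1.
  by rewrite !expgS !(gaM aFr).
have xy_fix x y x' y' : XC y -> XC y' -> XA x' ->
    gF (x * y ^+ n)%g (gF (x' * y' ^+ n)%g (ev _ t)) = gF (x * x')%g (ev _ t).
  move=> hy hy' hx'; rewrite [gF (x' * _)%g _](gaM aFr) fixy // (gaM aFr).
  have h1 : eqF sp (y ^+ n * x')%g (x' * y ^+ n)%g.
    by move=> z; symmetry; apply: XAC => //; apply: XCX.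
  by rewrite -[gF (y ^+ n)%g _](gaM aFr) h1 (gaM aFr) fixy // -(gaM aFr).
have Xg : XA xg by exists a. have Xh : XA xh by exists b.
have pg := powE _ _ _ n eg Xg cg; have ph := powE _ _ _ n eh Xh ch.
rewrite (gaM aFr) pg ph xy_fix //; last exact: XAX.
rewrite [RHS](gaM aFr) ph pg xy_fix //; last exact: XAX.
suff E : eqF sp (xg ^+ n * xh ^+ n)%g (xh ^+ n * xg ^+ n)%g by rewrite E.
apply/(NspP hm sp); rewrite !(@proj_hom _ m Ns) !(homX (@proj_hom _ m Ns)) -ha -hb -!pvX -!pvM -!(homX fAM) -!fAM.
by rewrite T_ab // pvX nT.
Qed.
End Scalars.

(** Simple roots do not live in the completion; fixing them is expressed through orbits under every
    kernel of a finite quotient. *)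
Definition stabs (n : prof m) := forall s U w, pv n U = proj U w -> orbU U (es s) (w ** es s).
Lemma stabs_comm n : stabs n -> forall y, (n * y = y * n)%g.
Proof.
move=> h; apply: commute_all => s; apply: pv_ext => U; rewrite !pvM pv_iota.
have [w e] := approx n U; have /asboolP [u hu wu] := h s U w e.
have e2 : (w * sg m s * w^-1 = u * sg m s * u^-1)%g.
  by apply: (cox_faithful2 hm) => t; rewrite !(ga_conj aRr aRs aRd) wu.
have : proj U (w * sg m s * w^-1)%g = proj U (sg m s).
  by rewrite e2 !(@proj_hom _ m U) (homV (@proj_hom _ m U)) hu invg1 mulg1 mul1g.
rewrite !(@proj_hom _ m U) (homV (@proj_hom _ m U)) => h2.
by rewrite e -{2}h2 mulgKV.
Qed.

Lemma two_spec s0 : exists sp sp' sp'' : spec m, [/\ [/\ tfree sp, 2%:R != 0 :> spec_field sp &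
   (forall a x, pv (fA a) (Nsp hm sp) = proj (Nsp hm sp) x -> pmI s0 sp x)],
   (forall a x, pv (fA a) (Nsp hm sp') = proj (Nsp hm sp') x -> pmI s0 sp' x) & exists g : 'I_4 -> W,
    [/\ forall i, G2 sp sp' s0 (g i), forall i, sim s0 (G2 sp sp' s0) 1%g (g i) &
      forall i j, i != j -> ga (aF sp'') (g i) (ev _ s0) <> ga (aF sp'') (g j) (ev _ s0)]].
Proof.
have [g [h gh]] := noncomm_ex hm (@nfin s0) (@naff s0).
(* The factor 2 kills signs, and the group order sends every element of [fq NT] to 1. *)
pose n := (2 * #|[set: fq NT]|)%N.
have n0 : (0 < n)%N by rewrite /n muln_gt0 /= (cardG_gt0 [set: fq NT]%G).
have [t tI ght] := gh n n0.
have ne : (g ^+ n * h ^+ n)%g ** es t <> 1%:~R *: ((h ^+ n * g ^+ n)%g ** es t) by rewrite scale1r.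
have [f [f1 f2]] := sepF ne.
have hl p : p \in f :: l0 m -> evp (cc m) p != 0.
  by rewrite inE => /predU1P[->//|]; rewrite mem_filter => /andP[].
have [sp [sp' [sp'' [[tf two gd] [tf' two' gd'] ex]]]] := four_ex hm (@nfin s0) (@naff s0) hl.
have key (sq : spec m) : 2%:R != 0 :> spec_field sq -> (forall p, p \in f :: l0 m -> evp (sx sq) p != 0) ->
    forall a x, pv (fA a) (Nsp hm sq) = proj (Nsp hm sq) x -> pmI s0 sq x.
  move=> tw gq a x e; apply: (@XA_pm s0 sq tw _ g h n).
  - by move=> p pl; apply: gq; rewrite inE pl orbT.
  - by rewrite /n oddM.
  - by move=> q; rewrite /n mulnC expgM expg_cardG ?inE // expg1n.
  - exists t => //; have := f2 sq; rewrite scale1r; apply; apply: gq; exact: mem_head.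
  - by exists a.
exists sp, sp', sp''; split=> //; last exact: key two' gd'.
by split=> //; exact: key two gd.
Qed.

Section StepK.
Variable P : H -> Prop.
Hypotheses (P1 : P 1%g) (PM : forall a b, P a -> P b -> P (a * b)%g)
  (PJ : forall a b, P a -> P (b * a * b^-1)%g) (U1 : fincong m)
  (PU : forall a u, P a -> proj U1 u = 1%g -> (fA a * iota u = iota u * fA a)%g).
(** The image of [P] is normalized by W because the complementary factor commutes with it; it acts
    by signs over both fields and is centralized by an open subgroup, as [lemmaK] requires. *)
Lemma stepK a : P a -> stabs (fA a).
Proof.
move=> Pa s U w e.
have [sp [sp' [sp'' [[tf two pm] pm' [g [g1 g2 g3]]]]]] := two_spec s.
have sI := comp_refl m s.
pose Nn (x : prof m) := exists2 b, P b & x = fA b.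
apply: (@lemmaK S m hm s sp sp' sp'' two g g1 g2 g3 tf Nn _ _ _ _ _ U1 _ U (fA a)) => //.
- by exists 1%g; rewrite ?(hom1 fAM).
- by move=> x y [b Pb ->] [c Pc ->]; exists (b * c)%g; [exact: PM|rewrite fAM].
- move=> x z [b Pb ->]; have [a' [c' ->]] := f_dense (iota z).
  exists (a' * b * a'^-1)%g; first exact: PJ.
  rewrite !fAM (homV fAM) invMg -!mulgA; congr (_ * _)%g.
  by rewrite mulgA -fAC -mulgA mulKVg.
- move=> x z [b _ ->] /pm [d d1 /(_ s sI) dE]; rewrite /pmF dE.
  by case: d1 => ->; [left; rewrite scale1r|right; rewrite scaleN1r].
- move=> x z [b _ ->] /pm' [d d1 /(_ s sI) dE]; rewrite /pmF dE.
  by case: d1 => ->; [left; rewrite scale1r|right; rewrite scaleN1r].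
- by move=> x u [b Pb ->]; apply: PU.
by exists a.
Qed.
End StepK.

Lemma AC_mul a c b d : (fA a * fC c * (fA b * fC d) = fA (a * b) * fC (c * d))%g.
Proof. by rewrite fAM fCM -!mulgA; congr (_ * _)%g; rewrite !mulgA fAC. Qed.
(** The image of the abelian open part of the first factor times that of the whole second factor; it
    has finite index because [fq NT] is finite. *)
Definition N0 (x : prof m) := exists a c, pv a NT = 1%g /\ x = (fA a * fC c)%g.
Lemma N0M x y : N0 x -> N0 y -> N0 (x * y)%g.
Proof.
move=> [a [c [ha ->]]] [b [d [hb ->]]]; exists (a * b)%g, (c * d)%g.
by rewrite AC_mul pvM ha hb mulg1.
Qed.
Lemma N0_1 : N0 1%g.
Proof. by exists 1%g, 1%g; rewrite pv1 (hom1 fAM) (hom1 fCM) mulg1. Qed.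
Lemma N0V x : N0 x -> N0 x^-1%g.
Proof.
move=> [a [c [ha ->]]]; exists a^-1%g, c^-1%g; split; first by rewrite pvV ha invg1.
by apply: mulg1_eq; rewrite AC_mul !mulgV (hom1 fAM) (hom1 fCM) mulg1.
Qed.
Lemma N0J x y : N0 x -> N0 (y * x * y^-1)%g.
Proof.
move=> [a [c [ha ->]]]; have [b [d ->]] := f_dense y.
exists (b * a * b^-1)%g, (d * c * d^-1)%g; split; first by rewrite !pvM ha mulg1 pvV mulgV.
by apply: (mulIg (fA b * fC d)%g); rewrite mulgKV !AC_mul !mulgKV.
Qed.
Definition rT (u v : W) := N0 (iota u * (iota v)^-1)%g.
Lemma rT_fin : exists l : seq W, forall u, exists2 v, v \in l & rT u v.
Proof.
have /boolp.choice [a ha] : forall u : W, exists a : H, exists c, iota u = (fA a * fC c)%g.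
  by move=> u; have [a [c e]] := f_dense (iota u); exists a, c.
have [l hl] : exists l : seq W, forall u, exists2 v, v \in l & pv (a u) NT = pv (a v) NT.
  by apply: ker_fin; have [l hl] := fin_list (fq NT); exists l.
exists l => u; have [v vl e] := hl u; exists v => //.
have [c hc] := ha u; have [d hd] := ha v.
exists (a u * (a v)^-1)%g, (c * d^-1)%g; split; first by rewrite pvM pvV e mulgV.
apply: (mulIg (iota v)); rewrite mulgKV hd AC_mul !mulgKV; exact: hc.
Qed.
Definition UT : fincong m.
Proof.
refine (@mkfc S m rT _ _ _ _ rT_fin).
- by move=> x; rewrite /rT mulgV; apply: N0_1.
- by move=> x y /N0V; rewrite /rT invMg invgK.
- by move=> x y z h1 h2; have := N0M h1 h2; rewrite /rT mulgA mulgKV.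
- move=> a b c d h1 h2; have := N0M h1 (N0J (iota b) h2).
  by rewrite /rT !iota_hom invMg !mulgA mulgKV.
Defined.
Lemma UTP u : proj UT u = 1%g -> N0 (iota u).
Proof.
rewrite -(hom1 (@proj_hom _ m UT)) => /(mkfcP _ _ _ _ _ _ _).1.
by rewrite /rT (hom1 (@iota_hom _ m)) invg1 mulg1.
Qed.
(** The abelian part commutes with itself and with the second factor, hence with [N0]. *)
Lemma fT_central a : pv a NT = 1%g -> forall y, (fA a * y = y * fA a)%g.
Proof.
move=> ha; apply: stabs_comm.
apply: (@stepK (fun a => pv a NT = 1%g) _ _ _ UT) ha.
- exact: pv1.
- by move=> x y hx hy; rewrite pvM hx hy mulg1.
- by move=> x y hx; rewrite !pvM hx mulg1 pvV mulgV.
move=> x u hx /UTP [b [c [hb ->]]].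
by rewrite mulgA -fAM (T_ab hx hb) fAM -!mulgA fAC.
Qed.
(** With the abelian part already central, every element of the first factor commutes with [N0], and
    [stepK] can be applied to all of them. *)
Theorem fA_stabs a : stabs (fA a).
Proof.
apply: (@stepK (fun _ => True) _ _ _ UT) => //.
move=> x u _ /UTP [b [c [hb ->]]].
by rewrite mulgA -(fT_central hb) -!mulgA fAC.
Qed.
Lemma fA_central a y : (fA a * y = y * fA a)%g.
Proof. exact: (stabs_comm (@fA_stabs a)). Qed.

Section Kill.
Variables (V3 : finType) (m3 : V3 -> V3 -> nat) (th : prof m -> prof m3).
Hypotheses (hth : hom th) (cth : cts th) (ab : forall x y, (th x * th y = th y * th x)%g).
(** Approximate the central element by a word. Invariance under conjugation makes its crossings of
    each orbit of walls even in number. In an abelian target the image of the word is the product of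
    the images of the crossed reflections, which depend only on the orbit, so they cancel. *)
Lemma fA_kill a : th (fA a) = 1%g.
Proof.
set b := fA a; have sb := @fA_stabs a; rewrite -/b in sb.
have cb y : (b * y = y * b)%g by apply: fA_central.
apply: pv_ext => N; have [N1 h1] := cts_eq hth cth N; rewrite pv1.
have [sp [_ two _]] : exists sp : spec m, [/\ tfree sp, 2%:R != 0 :> spec_field sp & forall f, f \in [::] -> evp (sx sp) f != 0].
  exact: spec_ex.
pose U := Nsp hm sp; have UU : projsub U (Nsp hm sp) by [].
have [w [w1 w23]] := approx2 b N1 (fmeet (Up hm U) U).
have wUp : pv b (Up hm U) = proj (Up hm U) w by apply: pvP w23; apply: fmeetl.
have wU : pv b U = proj U w by apply: pvP w23; apply: fmeetr.
rewrite (h1 b (iota w)) ?w1 //.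
have near v : wroot m v -> exists2 u, proj U u = 1%g & w ** v = u ** v.
  move=> [g [s ->]]; have e : pv b U = proj U (g^-1 * w * g)%g.
    rewrite !(@proj_hom _ m U) -wU -!pv_iota -!pvM -mulgA cb mulgA -iota_hom mulVg.
    by rewrite (hom1 (@iota_hom _ m)) mul1g.
  have /asboolP [u hu e2] := sb s U _ e; exists (g * u * g^-1)%g; first exact: proj1J.
  rewrite !gaM // (gaK aRr) -e2 !gaM // (gaVK aRr) //.
have cinv v g : wroot m v -> cU U v w = cU U (g^-1%g ** v) w.
  move=> rtv; have [h [s e]] := rtv.
  have e2 : proj (Up hm U) (w * g)%g = proj (Up hm U) (g * w)%g.
    by rewrite !(@proj_hom _ m (Up hm U)) -wUp -!pv_iota -!pvM cb.
  have [_ /(_ h s)] := (mkfcP _ _ _ _ _ _ _).1 e2; rewrite -e !cUM //.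
  have [u hu eu] := near v rtv.
  have -> : cU U (w^-1%g ** v) g = cU U v g.
    have -> : w^-1%g ** v = (w^-1 * u^-1 * w)%g ** v.
      by rewrite !gaM // eu (gaK aRr).
    apply: (cU_class hm); have := proj1J w^-1%g (proj1V hu); by rewrite invgK.
  by rewrite addrC => /addrI.
(* Conjugation by the reflection in [v] replaces [v] by its negative, and then Z/4 gives
   evenness. *)
have par0 v : wroot m v -> par (cU U v w) = false.
  move=> rtv; have [h [s e]] := rtv; apply: par_even.
  rewrite -cUN (cinv v (h * sg m s * h^-1)%g rtv); congr cU.
  rewrite !invMg sgV !invgK mulgA ga_conj // e rv_self //.
  by rewrite bil_ga // ev2.
have wE := wd_repr w; set p := wrep w in wE.
have wE2 : w = wd m p by rewrite wE.
rewrite wE2; clear wE; rewrite wE2 in par0.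
(* The image of the reflection in [v]; 1 is a default value for vectors that are not roots. *)
pose tau (v : vec S RR) : prof m3 := if pselect (exists r : W, wroot m v /\ forall x, r ** x = rv (aR m) v x) is left e
  then th (iota (projT1 (cid e))) else 1%g.
have tauE v (r : W) : wroot m v -> (forall x, r ** x = rv (aR m) v x) -> tau v = th (iota r).
  move=> rtv rE; rewrite /tau; case: pselect => [e|[]]; last by exists r.
  case: cid => r' [_ r'E] /=; congr (th (iota _)); apply: (cox_faithful2 hm) => t.
  by rewrite r'E rE.
have tau_g v g : wroot m v -> tau (g ** v) = tau v.
  move=> rtv; have [h [s e]] := rtv; have rgv : wroot m (g ** v) by apply: root_ga.
  rewrite (tauE _ (h * sg m s * h^-1)%g rtv); last by move=> x; rewrite (ga_conj aRr aRs aRd) e.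
  rewrite (tauE _ (g * (h * sg m s * h^-1) * g^-1)%g rgv).
    set x := (h * sg m s * h^-1)%g; rewrite (iota_hom (g * x)%g) hth (iota_hom g x) hth ab -mulgA.
    by rewrite -hth -iota_hom mulgV (hom1 (@iota_hom _ m)) (hom1 hth) mulg1.
  have -> : (g * (h * sg m s * h^-1) * g^-1 = (g * h) * sg m s * (g * h)^-1)%g by rewrite invMg !mulgA.
  by move=> x; rewrite (ga_conj aRr aRs aRd) gaM // e.
have tauN v : wroot m v -> tau (- v) = tau v.
  move=> rtv; have [h [s e]] := rtv.
  have rE x : (h * sg m s * h^-1)%g ** x = rv (aR m) v x by rewrite (ga_conj aRr aRs aRd) e.
  by rewrite (tauE v _ rtv rE) (tauE (- v) (h * sg m s * h^-1)%g) //; [apply: rootN|move=> x; rewrite rvN].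
have tau_s s : tau (es s) = th (iota (sg m s)).
  by apply: tauE => [|x]; [exact: root_ev|rewrite ga_sg // refl_rv].
have rp q v : v \in proots m q -> wroot m v.
  elim: q v => //= s q IH v; rewrite inE => /predU1P[->|/mapP [v' /IH rv' ->]]; first exact: root_ev.
  by rewrite -(ga_sg aRr); apply: root_ga.
have prodE q : th (iota (wd m q)) = lprod tau (proots m q).
  elim: q => [|s q IH]; first by rewrite wd_nil (hom1 (@iota_hom _ m)) (hom1 hth).
  rewrite wd_cons iota_hom hth IH /= tau_s; congr (_ * _)%g.
  have : forall v, v \in proots m q -> wroot m v by move=> v; apply: rp.
  elim: (proots m q) => //= v L IH2 hL; rewrite -(ga_sg aRr) tau_g ?IH2 //; last by apply: hL; rewrite mem_head.
  by move=> v' h; apply: hL; rewrite inE h orbT.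
rewrite prodE.
have -> : lprod tau (proots m p) = 1%g; last by rewrite pv1.
have orbP v v' : orbU U v v' -> exists2 u, proj U u = 1%g & v' = u ** v by move=> /asboolP.
have orb_sym v v' : orbU U v v' -> orbU U v' v.
  move=> /orbP [u hu ->]; apply/asboolP; exists u^-1%g; first exact: proj1V.
  by rewrite (gaK aRr).
have orb_tr v1 v2 v3 : orbU U v1 v2 -> orbU U v2 v3 -> orbU U v1 v3.
  move=> /orbP [u hu ->] /orbP [u' hu' ->]; apply/asboolP; exists (u' * u)%g.
    by rewrite (@proj_hom _ m U) hu hu' mulg1.
  by rewrite gaM.
have orbNN v v' : orbU U (- v) (- v') = orbU U v v' by rewrite -orbUN opprK.
pose rel v v' := orbU U v v' || orbU U v (- v').
have rel_sym v v' : rel v v' = rel v' v.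
  have h x y : rel x y -> rel y x.
    case/orP => [/orb_sym h|/orb_sym h]; apply/orP; [by left|right].
    by rewrite -[y]opprK orbNN.
  by apply/idP/idP; apply: h.
have rel_tr v1 v2 v3 : rel v1 v2 -> rel v2 v3 -> rel v1 v3.
  rewrite /rel => /orP[k1|k1] /orP[k2|k2]; apply/orP.
  - by left; apply: orb_tr k1 k2.
  - by right; apply: orb_tr k1 k2.
  - by right; apply: orb_tr k1 _; rewrite orbNN.
  - by left; apply: orb_tr k1 _; rewrite -[v3]opprK orbNN.
apply: (@even_prod _ _ tau rel).
- by move=> x y; rewrite /tau; case: pselect => e; case: pselect => e'; rewrite ?mulg1 ?mul1g.
- move=> v; rewrite /tau; case: pselect => e; last by rewrite mulg1.
  case: cid => r [rtv rE] /=; rewrite -hth -iota_hom.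
  have -> : (r * r = 1)%g; last by rewrite (hom1 (@iota_hom _ m)) (hom1 hth).
  by apply: (cox_faithful hm) => t; rewrite gaM // !rE rvK // (root_B hm rtv).
- by move=> v /rp _; apply/orP; left; apply/asboolP; exists 1%g; rewrite ?ga1 // (hom1 (@proj_hom _ m U)).
- move=> x y z _ _ _ xy; have yx : rel y x by rewrite rel_sym.
  split; [apply/idP/idP => h|apply/idP/idP => h].
  + exact: rel_tr yx h.
  + exact: rel_tr xy h.
  + exact: rel_tr h xy.
  + exact: rel_tr h yx.
- move=> x y /rp rx /rp ry /orP[] /orbP [u hu e].
    by rewrite e tau_g.
  by rewrite -[y]opprK e tauN ?tau_g //; exact: root_ga.
move=> v vp; have rtv := rp _ _ vp; have := par0 v rtv.
rewrite /cU (cz_wd hm) ; last exact: chiU_odd.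
rewrite /cw => par0'; apply/negP => od; move: par0'.
have -> : forall L : seq (vec S RR), (forall v, v \in L -> wroot m v) ->
  par (\sum_(b0 <- L) chiU U v b0) = odd (count (rel v) L).
  elim=> [|x L IH] hL; first by rewrite big_nil.
  rewrite big_cons parD /= oddD IH; last by move=> y yL; apply: hL; rewrite inE yL orbT.
  congr (_ (+) _); rewrite /rel /chiU.
  case: (boolP (orbU U v x)) => [/orbP [u hu e1]|_];
    case: (boolP (orbU U v (- x))) => [/orbP [u' hu' e2]|_] //.
  case: (@noflip _ m hm sp two U UU (u' * u^-1)%g x).
  - by apply: hL; rewrite mem_head.
  - by rewrite (@proj_hom _ m U) (proj1V hu) hu' mulg1.
  - by rewrite gaM // e1 (gaK aRr) -e2 e1.
- by rewrite od.
by move=> x; apply: rp.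
Qed.
End Kill.
End Star.

(** * Compactness *)

Lemma ultra_ex (T : Type) (F : (T -> Prop) -> Prop) :
  F (fun _ => True) -> (forall P Q, F P -> F Q -> F (fun x => P x /\ Q x)) ->
  (forall P Q : T -> Prop, (forall x, P x -> Q x) -> F P -> F Q) -> ~ F (fun _ => False) ->
  exists G : (T -> Prop) -> Prop, [/\ forall P, F P -> G P,
    forall P Q, G P -> G Q -> G (fun x => P x /\ Q x),
    forall P Q : T -> Prop, (forall x, P x -> Q x) -> G P -> G Q, ~ G (fun _ => False) &
    forall P, G P \/ G (fun x => ~ P x)].
Proof.
move=> FT FI FS F0.
have [G [UG FG]] := @filter.ultraFilterLemma T F
  (@filter.Build_ProperFilter _ F F0 (@filter.Build_Filter _ F FT FI FS)).
have PG := @filter.ultra_proper _ G UG; have fG := @filter.filter_filter _ G PG.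
exists G; split=> //.
- by move=> P Q hP hQ; apply: (@filter.filterI _ _ fG).
- by move=> P Q; apply: (@filter.filterS _ _ fG).
- exact: (@filter.filter_not_empty _ G PG).
- by move=> P; apply: filter.in_ultra_setVsetC.
Qed.

Section Compact.
Variables (V : finType) (m : V -> V -> nat).
(* The profinite completion is compact: a family of approximate solutions indexed by a
   directed set of finite quotients has a limit point along an ultrafilter. *)
Lemma compact_lim (T : Type) (G : (T -> Prop) -> Prop) (x : T -> prof m) :
  (forall P Q, G P -> G Q -> G (fun i => P i /\ Q i)) ->
  (forall P Q : T -> Prop, (forall i, P i -> Q i) -> G P -> G Q) -> ~ G (fun _ => False) ->
  (forall P, G P \/ G (fun i => ~ P i)) ->
  exists y : prof m, forall N, G (fun i => pv (x i) N = pv y N).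
Proof.
move=> GI GS G0 GU.
have ex N : exists q : fq N, G (fun i => pv (x i) N = q).
  apply: contrapT => none.
  have : forall s : seq (fq N), G (fun i => forall q, q \in s -> pv (x i) N <> q).
    elim=> [|q s IH].
      have [h|h] := GU (fun _ => True); first by apply: GS h.
      by case: G0; apply: GS h => i; apply.
    have [h|h] := GU (fun i => pv (x i) N = q); first by case: none; exists q.
    apply: GS (GI _ _ h IH) => i [h1 h2] q'; rewrite inE => /predU1P[->//|]; exact: h2.
  have [l hl] := fin_list (fq N); move=> /(_ l) h; apply: G0; apply: GS h => i /(_ (pv (x i) N)).
  by apply; [exact: hl|].
pose y N := projT1 (cid (ex N)).
have yE N : G (fun i => pv (x i) N = y N) by rewrite /y; case: cid.
have Gex P : G P -> exists i, P i.
  by move=> h; apply: contrapT => n; apply: G0; apply: GS h => i hi; apply: n; exists i.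
have yP N M w : projsub N M -> y N = proj N w -> y M = proj M w.
  move=> NM e; have [i [h1 h2]] := Gex _ (GI _ _ (yE N) (yE M)).
  by rewrite -h2; apply: pvP NM _; rewrite h1.
by exists (Prof yP).
Qed.
End Compact.

Section InvCts.
Variables (V1 V2 : finType) (m1 : V1 -> V1 -> nat) (m2 : V2 -> V2 -> nat).
Variables (F : prof m1 -> prof m2) (F' : prof m2 -> prof m1).
Hypotheses (hF : hom F) (cF : cts F) (FK : cancel F F') (FK' : cancel F' F).
Lemma inv_hom : hom F'.
Proof. by move=> x y; rewrite -{1}[x]FK' -{1}[y]FK' -hF FK. Qed.
(** The preimages found at the various levels have a limit point; by continuity its image is [y],
    and its coordinate at [N1] is trivial. *)
Lemma closed_img N1 (y : prof m2) :
  (forall M, exists x, pv x N1 = 1%g /\ pv (F x) M = pv y M) -> pv (F' y) N1 = 1%g.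
Proof.
move=> /boolp.choice [x hx].
pose cone (P : fincong m2 -> Prop) := exists M, forall M', projsub M' M -> P M'.
have tr (A B C : fincong m2) : projsub A B -> projsub B C -> projsub A C by move=> h1 h2 u v /h1 /h2.
have [G [cG GI GS G0 GU]] : exists G : (fincong m2 -> Prop) -> Prop, [/\ forall P, cone P -> G P,
    forall P Q, G P -> G Q -> G (fun x => P x /\ Q x),
    forall P Q : fincong m2 -> Prop, (forall x, P x -> Q x) -> G P -> G Q, ~ G (fun _ => False) &
    forall P, G P \/ G (fun x => ~ P x)].
  have [M0] : exists M0 : fincong m2, True.
    have [l hl] : exists l : seq (cox m2), forall z : cox m2, exists2 y, y \in l & True by exists [:: 1%g] => z; exists 1%g; rewrite ?mem_head.
    by exists (@mkfc _ m2 (fun _ _ => True) (fun _ => I) (fun _ _ _ => I) (fun _ _ _ _ _ => I) (fun _ _ _ _ _ _ => I) (ex_intro _ l hl)).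
  move=> _; apply: ultra_ex.
  - by exists M0.
  - move=> P Q [M hM] [M' hM']; exists (fmeet M M') => K KM; split.
      by apply: hM; apply: tr KM _; apply: fmeetl.
    by apply: hM'; apply: tr KM _; apply: fmeetr.
  - by move=> P Q PQ [M hM]; exists M => K /hM /PQ.
  - by move=> [M /(_ M)]; apply.
have [z hz] := compact_lim x GI GS G0 GU.
have Gex P : G P -> exists i, P i.
  by move=> h; apply: contrapT => n; apply: G0; apply: GS h => i hi; apply: n; exists i.
suff -> : F' y = z.
  have [i e] := Gex _ (hz N1); rewrite -e; by have [] := hx i.
rewrite -[z]FK; congr F'; apply: pv_ext => N.
have [N1' h1] := cts_eq hF cF N.
have cN : G (fun M => pv (F (x M)) N = pv y N).
  apply: cG; exists N => M MN; apply: pv_sub MN _; by have [] := hx M.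
by have [i [e1 e2]] := Gex _ (GI _ _ cN (hz N1')); rewrite -e1; apply: h1.
Qed.
(** On W the map [F'] followed by reduction at [N1] has finite image, and its kernel gives the level
    [N2]. General elements are approximated by W, and [closed_img] passes to the limit. *)
Lemma inv_cts : cts F'.
Proof.
move=> N1; pose L (u v : cox m2) := pv (F' (iota u * (iota v)^-1)%g) N1 = 1%g.
have F'M := inv_hom.
have LE u v : L u v <-> pv (F' (iota u)) N1 = pv (F' (iota v)) N1.
  rewrite /L F'M (homV F'M) pvM pvV; split=> [/eqP|->]; last by rewrite mulgV.
  by rewrite divg_eq1 => /eqP.
have hf : hom (fun u : cox m2 => pv (F' (iota u)) N1) by move=> u v; rewrite iota_hom F'M pvM.
have ffin : exists l : seq (fq N1), forall u : cox m2, pv (F' (iota u)) N1 \in l.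
  by have [l hl] := fin_list (fq N1); exists l.
pose N2 := kfc hf ffin; exists N2 => y yN2; apply: closed_img => M.
have [w [w1 w2]] := approx2 y N2 M.
exists (F' (iota w)); rewrite FK' w2 pv_iota; split=> //.
have : proj N2 w = proj N2 1%g by rewrite -w1 yN2 (hom1 (@proj_hom _ m2 N2)).
by move=> /kfcP ->; rewrite (hom1 (@iota_hom _ m2)) (hom1 F'M) pv1.
Qed.
End InvCts.

(** Residual finiteness: a nontrivial element moves a simple root, and some finite field still sees
    the difference. *)
Lemma iota_inj (V : finType) (m : V -> V -> nat) (hm : is_cox_graph m) : injective (@iota V m).
Proof.
have aRr := resp_aR hm.
suff h x : iota x = 1%g :> prof m -> x = 1%g.
  move=> x y e; apply/eqP; rewrite -divg_eq1; apply/eqP/h.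
  by rewrite iota_hom (homV (@iota_hom _ m)) e mulgV.
move=> x1; apply: (cox_faithful hm) => s; apply: contrapT => ne.
have ne2 : ga (aR m) x (ev RR s) <> 1%:~R *: ga (aR m) (1%g : cox m) (ev RR s) by rewrite ga1 // scale1r.
have [f [f1 f2]] := sepF ne2.
have [sp [_ _ fs]] : exists sp : spec m, [/\ tfree sp, 2%:R != 0 :> sF sp & forall g, g \in [:: f] -> evp (sx sp) g != 0].
  by apply: spec_ex => // g; rewrite inE => /eqP->.
apply: (f2 sp); first by apply: fs; rewrite mem_head.
rewrite scale1r; have : proj (Nsp hm sp) x = proj (Nsp hm sp) 1%g.
  by rewrite -!pv_iota x1 (hom1 (@iota_hom _ m)).
by move=> /NspP ->.
Qed.

Section Twist.
Variables (G : groupType) (N E : G -> G).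
Hypotheses (hN : hom N) (EN : forall x, (E x * N x = x)%g) (cN : forall x y, (N x * y = y * N x)%g) (NN : forall x, N (N x) = 1%g).
Lemma twist_inj x y : E x = E y -> x = y.
Proof.
move=> e; have e1 : N x = N y.
  have := congr1 N (EN x); have := congr1 N (EN y); rewrite !hN !NN !mulg1 e => -> //.
by rewrite -(EN x) e e1 EN.
Qed.
Lemma twist_surj y : exists x, E x = y.
Proof.
exists (y * N y)%g; apply: (mulIg (N (y * N y)%g)); rewrite EN hN NN mulg1 //.
Qed.
End Twist.

(** * From words to homomorphisms *)

Section Translate.
Variables (V1 V2 : finType) (m1 : V1 -> V1 -> nat) (m2 : V2 -> V2 -> nat).
Lemma cox_iso_hom : cox_iso m1 m2 <->
  exists f : cox m1 -> cox m2, [/\ hom f, injective f & forall y, exists x, f x = y].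
Proof.
split=> [[f [f1 f2 f3 f4]]|[f [hf fi fs]]].
  pose g (x : cox m1) := wd m2 (f (wrep x)).
  have gE w : g (wd m1 w) = wd m2 (f w).
    by apply/wdP/f1/wdP; rewrite wd_repr.
  exists g; split.
  - move=> x y; have [u ->] := wd_surj x; have [w ->] := wd_surj y.
    by rewrite -wdM !gE -wdM; apply/wdP/f2.
  - move=> x y; have [u ->] := wd_surj x; have [w ->] := wd_surj y.
    by rewrite !gE => /wdP /f3 h; apply/wdP.
  by move=> y; have [w ->] := wd_surj y; have [x h] := f4 w; exists (wd m1 x); rewrite gE; apply/wdP.
exists (fun w => wrep (f (wd m1 w))); split=> [u w /wdP ->|u w|u w h|y]; first exact: cx_refl.
- by apply/wdP; rewrite [in RHS]wdM !wd_repr wdM hf.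
- by apply/wdP/fi; move/wdP: h; rewrite !wd_repr.
by have [x e] := fs (wd m2 y); exists (wrep x); apply/wdP; rewrite wd_repr wd_repr.
Qed.

Definition toE (V : finType) (m : V -> V -> nat) (x : prof m) : prof_elt m := fun N => wrep (pv x N).
Lemma toE_fwd (V : finType) (m : V -> V -> nat) (x : prof m) N : fwd N (toE x N) = pv x N.
Proof. exact: cls_repr. Qed.
Lemma toE_prof (V : finType) (m : V -> V -> nat) (x : prof m) : is_prof (toE x).
Proof.
move=> N M h; apply/fwdP; rewrite toE_fwd -(proj_wd M (toE x N)); symmetry.
by apply: pvP h _; rewrite proj_wd toE_fwd.
Qed.
Lemma ofE_ex (V : finType) (m : V -> V -> nat) (x : prof_elt m) (h : is_prof x) :
  exists y : prof m, forall N, pv y N = fwd N (x N).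
Proof.
have P N M w : projsub N M -> fwd N (x N) = proj N w -> fwd M (x M) = proj M w.
  move=> NM e; have e2 : fwd M (x N) = proj M w.
    by rewrite -(proj_wd M); apply: ((projsubP N M).1 NM); rewrite proj_wd.
  by rewrite -e2; symmetry; apply/fwdP; apply: h.
by exists (Prof P).
Qed.
Lemma prof_eqP (V : finType) (m : V -> V -> nat) (x y : prof_elt m) :
  prof_eq x y <-> forall N, fwd N (x N) = fwd N (y N).
Proof. by split=> h N; apply/fwdP. Qed.
Lemma is_prof_mul (V : finType) (m : V -> V -> nat) (x y : prof_elt m) :
  is_prof x -> is_prof y -> is_prof (prof_mul x y).
Proof. by move=> hx hy N M h; apply: fc_cong; [apply: hx|apply: hy]. Qed.

Lemma prof_iso_hom : prof_iso m1 m2 <-> exists (F : prof m1 -> prof m2) (F' : prof m2 -> prof m1),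
  [/\ hom F, cts F, cancel F F' & cancel F' F].
Proof.
split=> [[F0 [F0p [Fe FM Fi Fs Fc]]]|[F [F' [hF cF FK FK']]]].
  have /boolp.choice [F hF] : forall x : prof m1, exists y : prof m2, forall N, pv y N = fwd N (F0 (toE x) N).
    by move=> x; apply: ofE_ex; apply/F0p/toE_prof.
  have tp := @toE_prof.
  have FhM : hom F.
    move=> x y; apply: pv_ext => N; rewrite pvM !hF -fwdM.
    have /prof_eqP -> : prof_eq (F0 (toE (x * y)%g)) (F0 (prof_mul (toE x) (toE y))).
      apply: Fe; [exact: tp|by apply: is_prof_mul; exact: tp|].
      by apply/prof_eqP => M; rewrite fwdM !toE_fwd.
    by have /prof_eqP -> := FM _ _ (tp _ _ x) (tp _ _ y).
  have Finj : injective F.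
    move=> x y e; apply: pv_ext => N; rewrite -!toE_fwd.
    suff /prof_eqP -> : prof_eq (toE x) (toE y) by [].
    by apply: Fi; [exact: tp|exact: tp|apply/prof_eqP => M; rewrite -!hF e].
  have Fsurj y : exists x, F x = y.
    have [x px e] := Fs (toE y) (tp _ _ y); have [z hz] := ofE_ex px.
    exists z; apply: pv_ext => N; rewrite hF -[RHS]toE_fwd.
    have /prof_eqP <- := e; have /prof_eqP -> // : prof_eq (F0 (toE z)) (F0 x).
    by apply: Fe => //; apply/prof_eqP => M; rewrite toE_fwd.
  have /boolp.choice [F' hF'] := Fsurj.
  exists F, F'; split=> //.
    move=> N2; have [N1 h] := Fc N2; exists N1 => x e.
    rewrite -(pv1 N2) -(hom1 FhM) !hF; apply/fwdP; apply: (h _ _ (@tp _ _ x) (@tp _ _ 1%g)).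
    by apply/fwdP; rewrite !toE_fwd e pv1.
  by move=> x; apply: Finj.
have /boolp.choice [o ho] : forall x : prof_elt m1, exists y : prof m1, is_prof x -> forall N, pv y N = fwd N (x N).
  by move=> x; have [/ofE_ex [y hy]|n] := pselect (is_prof x); [exists y|exists 1%g].
have oE x y : is_prof x -> is_prof y -> prof_eq x y -> o x = o y.
  by move=> hx hy /prof_eqP e; apply: pv_ext => N; rewrite !ho.
exists (fun x => toE (F (o x))); split=> [x hx|]; first exact: toE_prof.
split.
- by move=> x y hx hy e; rewrite (oE x y) //; apply/prof_eqP.
- move=> x y hx hy; apply/prof_eqP => N; rewrite fwdM !toE_fwd -pvM -hF; congr (pv (F _) N).
  apply: pv_ext => M; rewrite pvM !ho //; first by rewrite -fwdM.
  exact: is_prof_mul.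
- move=> x y hx hy /prof_eqP e; apply/prof_eqP => N; rewrite -!ho //.
  suff -> : o x = o y by [].
  by apply: (can_inj FK); apply: pv_ext => M; rewrite -!toE_fwd.
- move=> y hy; have [z hz] := ofE_ex hy; exists (toE (F' z)); first exact: toE_prof.
  apply/prof_eqP => N; rewrite toE_fwd -hz; congr (pv _ N); rewrite -[z in RHS]FK'; congr F.
  by apply: pv_ext => M; rewrite ho ?toE_fwd //; exact: toE_prof.
move=> N2; have [N1 h] := cts_eq hF cF N2; exists N1 => x y hx hy /fwdP e.
by apply/fwdP; rewrite !toE_fwd; apply: h; rewrite !ho.
Qed.
End Translate.

Section Relabel.
Variables (V V' : finType) (m : V -> V -> nat) (m' : V' -> V' -> nat).
Hypotheses (hm : is_cox_graph m) (hm' : is_cox_graph m').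
Variables (e : V -> V') (ei : injective e) (em : forall x y, m' (e x) (e y) = m x y).
Lemma map_alt n s t : map e (alt n s t) = alt n (e s) (e t).
Proof. by elim: n => //= n ->. Qed.
Lemma map_coxeq u w : coxeq m u w -> coxeq m' (map e u) (map e w).
Proof.
elim=> {u w} [w|u w _ IH|u v w _ h1 _ h2|a b u w _ IH|s|s t st h].
- exact: cx_refl.
- exact: cx_sym.
- exact: cx_trans h1 h2.
- by rewrite !map_cat; apply: cx_ctx.
- exact: cx_sq.
by rewrite map_alt -em; apply: cx_braid; rewrite ?(inj_eq ei) ?em.
Qed.
Lemma relabel_finite : (forall y, exists x, e x = y) -> cox_finite m -> cox_finite m'.
Proof.
move=> /boolp.choice [e' he'] [l hl]; exists (map (map e) l) => w.
have [u ul h] := hl (map e' w); exists (map e u); first exact: map_f.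
have -> : w = map e (map e' w) by rewrite -map_comp map_id_in // => x _ /=.
exact: map_coxeq.
Qed.
Definition relab : cox m -> cox m' := clift (fun s => sg m' (e s)).
Let rsq s : (sg m' (e s) * sg m' (e s))%g = 1%g. Proof. exact: sg_sq. Qed.
Let rbr s t : s != t -> m s t != 0%N -> ((sg m' (e s) * sg m' (e t)) ^+ m s t)%g = 1%g.
Proof. by move=> st h; rewrite -em sg_rel ?(inj_eq ei) ?em. Qed.
Lemma relab_hom : hom relab. Proof. exact: clift_hom rsq rbr. Qed.
Lemma relab_sg s : relab (sg m s) = sg m' (e s). Proof. exact: clift_sg rsq rbr s. Qed.
End Relabel.

Section RelabelComp.
Variables (V V' : finType) (m : V -> V -> nat) (m' : V' -> V' -> nat).
Hypotheses (hm : is_cox_graph m) (hm' : is_cox_graph m').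
Variables (e : V -> V') (ei : injective e) (em : forall x y, m' (e x) (e y) = m x y).
Hypothesis ecl : forall x y', dadj m' (e x) y' -> exists y, y' = e y.
Lemma dadj_e x y : dadj m' (e x) (e y) = dadj m x y.
Proof. by rewrite /dadj (inj_eq ei) em. Qed.
Lemma comp_e x y : (e y \in comp m' (e x)) = (y \in comp m x).
Proof.
apply/idP/idP => h.
  suff H : forall y', y' \in comp m' (e x) -> exists2 z, z \in comp m x & y' = e z.
    by have [z zx /ei ->] := H _ h.
  move=> y'; elim/comp_ind => {y'} [|t r tI [z zx ->] tr]; first by exists x; rewrite ?comp_refl.
  have [q qE] := ecl tr; exists q => //; rewrite qE dadj_e in tr; exact: comp_adj zx tr.
elim/comp_ind: h => {y} [|t r _ IH tr]; first exact: comp_refl.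
by apply: comp_adj IH _; rewrite dadj_e.
Qed.
Lemma comp_e_surj x y' : y' \in comp m' (e x) -> exists2 z, z \in comp m x & y' = e z.
Proof.
elim/comp_ind => {y'} [|t r tI [z zx ->] tr]; first by exists x; rewrite ?comp_refl.
have [q qE] := ecl tr; exists q => //; rewrite qE dadj_e in tr; exact: comp_adj zx tr.
Qed.
Lemma fin_e x : cox_finite (restrict m (comp m x)) -> cox_finite (restrict m' (comp m' (e x))).
Proof.
have pr (z : subV (comp m x)) : e (val z) \in comp m' (e x) by rewrite comp_e; exact: valP z.
pose f (z : subV (comp m x)) : subV (comp m' (e x)) := Sub (e (val z)) (pr z).
apply: (@relabel_finite _ _ _ _ f).
- by move=> z z' /(congr1 val) /= /ei /val_inj.
- by move=> z z'; rewrite /restrict /= em.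
move=> y; have [z zx ez] := comp_e_surj (valP y); exists (Sub z zx).
by apply: val_inj; rewrite /= -ez.
Qed.
Lemma gram_e x y : gram m' (e x) (e y) = gram m x y.
Proof. by rewrite /gram (inj_eq ei) em. Qed.
Lemma qform_e x (f : V' -> RR) : qform m' (comp m' (e x)) f = qform m (comp m x) (f \o e).
Proof.
have imE : comp m' (e x) = e @: comp m x.
  apply/setP => y; apply/idP/imsetP => [/comp_e_surj [z zx ->]|[z zx ->]]; first by exists z.
  by rewrite comp_e.
rewrite /qform imE big_imset /=; last by move=> a b _ _ /ei.
apply: eq_bigr => s _; rewrite big_imset /=; last by move=> a b _ _ /ei.
by apply: eq_bigr => t _; rewrite gram_e.
Qed.
Lemma aff_e x : cox_affine_on m (comp m x) -> cox_affine_on m' (comp m' (e x)).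
Proof.
case=> [psd [f [[s sx fs] f0]]]; split=> [g|]; first by rewrite qform_e.
pose f' (y : V') : RR := if [pick z | e z == y] is Some z then f z else 0.
have f'E z : f' (e z) = f z.
  by rewrite /f'; case: pickP => [w /eqP /ei ->//|/(_ z)]; rewrite eqxx.
exists f'; split; first by exists (e s); rewrite ?comp_e ?f'E.
rewrite qform_e -f0; apply: eq_bigr => a _; apply: eq_bigr => b _; by rewrite /= !f'E.
Qed.
Definition allgen (V0 : finType) (m0 : V0 -> V0 -> nat) := forall x,
  ~ cox_finite (restrict m0 (comp m0 x)) /\ ~ cox_affine_on m0 (comp m0 x).
Lemma allgen_e : (forall x, ~ cox_finite (restrict m' (comp m' (e x))) /\ ~ cox_affine_on m' (comp m' (e x))) -> allgen m.
Proof. by move=> h x; have [h1 h2] := h x; split=> [/fin_e|/aff_e]. Qed.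
End RelabelComp.

Lemma sep_adj (V : finType) (m : V -> V -> nat) (A : {set V}) s t :
  sepA m A -> s \in A -> dadj m s t -> t \in A.
Proof.
move=> h sA /andP[st m2]; apply: contraNT m2 => tA; apply/eqP; exact: h.
Qed.
Lemma allgen_restrict (V : finType) (m : V -> V -> nat) (hm : is_cox_graph m) (A : {set V}) :
  sepA m A -> (forall x, x \in A -> ~ cox_finite (restrict m (comp m x)) /\ ~ cox_affine_on m (comp m x)) ->
  allgen (restrict m A).
Proof.
move=> hA h; apply: (@allgen_e _ _ (restrict m A) m (fun x => val x)) => //.
- exact: val_inj.
- move=> x y' xy; have yA : y' \in A := sep_adj hA (valP x) xy.
  by exists (Sub y' yA).
by move=> x; apply: h; exact: valP x.
Qed.

(** * Splitting off the generic part *)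

Definition vab (V : finType) (m : V -> V -> nat) := exists NT : fincong m,
  forall x y : cox m, proj NT x = 1%g -> proj NT y = 1%g -> (x * y = y * x)%g.

Record split_graph (V : finType) (m : V -> V -> nat) (A : {set V}) : Prop := SplitGraph {
  sg_cox : is_cox_graph m;
  sg_sep : sepA m A;
  sg_vab : vab (restrict m A);
  sg_gen : allgen (restrict m (~: A)) }.

Section KS1.
Variables (V1 V2 : finType) (m1 : V1 -> V1 -> nat) (m2 : V2 -> V2 -> nat) (A1 : {set V1}) (A2 : {set V2}).
Hypotheses (s1 : split_graph m1 A1) (s2 : split_graph m2 A2).
Variables (F : prof m1 -> prof m2) (hF : hom F) (cF : cts F) (surF : forall y, exists x, F x = y).
Let hm1 := sg_cox s1. Let hm2 := sg_cox s2.
Let hA1 := sg_sep s1. Let hA2 := sg_sep s2. Let hC2 := sepAC hm2 hA2.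
(** The blocks of [F] for the two product decompositions, with H for the virtually abelian factor
    and G for the generic one. *)
Definition cHH (x : prof (restrict m1 A1)) := hret hm2 hA2 (F (hinc x)).
Definition cHG (x : prof (restrict m1 A1)) := hret hm2 hC2 (F (hinc x)).
Definition cGH (x : prof (restrict m1 (~: A1))) := hret hm2 hA2 (F (hinc x)).
Definition cGG (x : prof (restrict m1 (~: A1))) := hret hm2 hC2 (F (hinc x)).
Lemma cHH_hom : hom cHH. Proof. by move=> x y; rewrite /cHH hinc_hom hF hret_hom. Qed.
Lemma cHG_hom : hom cHG. Proof. by move=> x y; rewrite /cHG hinc_hom hF hret_hom. Qed.
Lemma cGH_hom : hom cGH. Proof. by move=> x y; rewrite /cGH hinc_hom hF hret_hom. Qed.
Lemma cGG_hom : hom cGG. Proof. by move=> x y; rewrite /cGG hinc_hom hF hret_hom. Qed.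
Lemma cHH_cts : cts cHH.
Proof. exact: cts_comp (cts_comp (@hinc_cts _ m1 A1) cF) (@hret_cts _ _ hm2 _ hA2). Qed.
Lemma cHG_cts : cts cHG.
Proof. exact: cts_comp (cts_comp (@hinc_cts _ m1 A1) cF) (@hret_cts _ _ hm2 _ hC2). Qed.
Lemma cGH_cts : cts cGH.
Proof. exact: cts_comp (cts_comp (@hinc_cts _ m1 (~: A1)) cF) (@hret_cts _ _ hm2 _ hA2). Qed.
Lemma cGG_cts : cts cGG.
Proof. exact: cts_comp (cts_comp (@hinc_cts _ m1 (~: A1)) cF) (@hret_cts _ _ hm2 _ hC2). Qed.
Lemma F_H x : F (hinc x) = (hinc (cHH x) * hinc (cHG x))%g.
Proof. exact: hat_decomp. Qed.
Lemma F_G x : F (hinc x) = (hinc (cGH x) * hinc (cGG x))%g.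
Proof. exact: hat_decomp. Qed.
Let psi x := hret hm2 hC2 (F x).
Let psi_hom : hom psi. Proof. by move=> x y; rewrite /psi hF hret_hom. Qed.
Let psi_surj y : exists x, psi x = y.
Proof. by have [x e] := surF (hinc y); exists x; rewrite /psi e hincK. Qed.
Lemma cHG_central x y : (cHG x * y = y * cHG x)%g.
Proof.
have [NT NTab] := sg_vab s1.
exact: (@fA_central _ _ m1 _ hm1 (restrict_cox hm2 _) A1 hA1 NT NTab
  (fun s => proj1 (sg_gen s2 s)) (fun s => proj2 (sg_gen s2 s)) psi psi_hom psi_surj x y).
Qed.
Lemma cHG_kill (V3 : finType) (m3 : V3 -> V3 -> nat) (th : prof (restrict m2 (~: A2)) -> prof m3) x :
  hom th -> cts th -> (forall x y, (th x * th y = th y * th x)%g) -> th (cHG x) = 1%g.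
Proof.
move=> h1 h2 h3; have [NT NTab] := sg_vab s1.
exact: (@fA_kill _ _ m1 _ hm1 (restrict_cox hm2 _) A1 hA1 NT NTab
  (fun s => proj1 (sg_gen s2 s)) (fun s => proj2 (sg_gen s2 s)) psi psi_hom psi_surj _ m3 th h1 h2 h3 x).
Qed.
End KS1.

Section KS.
Variables (V1 V2 : finType) (m1 : V1 -> V1 -> nat) (m2 : V2 -> V2 -> nat) (A1 : {set V1}) (A2 : {set V2}).
Hypotheses (s1 : split_graph m1 A1) (s2 : split_graph m2 A2).
Variables (F : prof m1 -> prof m2) (F' : prof m2 -> prof m1).
Hypotheses (hF : hom F) (cF : cts F) (hF' : hom F') (cF' : cts F') (FK : cancel F F') (FK' : cancel F' F).
Let surF y : exists x, F x = y. Proof. by exists (F' y). Qed.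
Let surF' y : exists x, F' x = y. Proof. by exists (F y). Qed.
Let hm1 := sg_cox s1. Let hA1 := sg_sep s1. Let hC1 := sepAC hm1 hA1.
Let HH := @cHH V1 V2 m1 m2 A1 A2 s2 F. Let HG := @cHG V1 V2 m1 m2 A1 A2 s2 F. Let GH := @cGH V1 V2 m1 m2 A1 A2 s2 F. Let GG := @cGG V1 V2 m1 m2 A1 A2 s2 F.
Let HH' := @cHH V2 V1 m2 m1 A2 A1 s1 F'. Let HG' := @cHG V2 V1 m2 m1 A2 A1 s1 F'. Let GH' := @cGH V2 V1 m2 m1 A2 A1 s1 F'. Let GG' := @cGG V2 V1 m2 m1 A2 A1 s1 F'.
(** The contribution to the diagonal of F' F = 1 that passes through the other factor. *)
Definition twN x := GH' (HG x).
Definition twM y := HG' (GH y).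
Lemma twN_eq x : (HH' (HH x) * twN x = x)%g.
Proof.
have := FK (hinc x); rewrite (F_H s2) hF' => /(congr1 (hret hm1 hA1)).
by rewrite hret_hom hincK.
Qed.
Lemma twM_eq y : (GG' (GG y) * twM y = y)%g.
Proof.
have := FK (hinc y); rewrite (F_G s2) hF' => /(congr1 (hret hm1 hC1)).
rewrite hret_hom hincK => e; rewrite -[RHS]e; symmetry; exact: (cHG_central s2 s1 hF' surF').
Qed.
Lemma twM_central x y : (twM x * y = y * twM x)%g.
Proof. exact: (cHG_central s2 s1 hF' surF'). Qed.
Lemma twM_hom : hom twM.
Proof. by move=> x y; rewrite /twM /HG' /GH (cGH_hom s2 hF) (cHG_hom s1 hF'). Qed.
(** The inner value comes out of the virtually abelian factor through an off-diagonal block, and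
    [twM] has commuting values, so [cHG_kill] applies. *)
Lemma twM2 y : twM (twM y) = 1%g.
Proof.
apply: (cHG_kill s2 s1 hF' surF' (th := twM)); first exact: twM_hom.
  exact: (cts_comp (@cGH_cts V1 V2 m1 m2 A1 A2 s2 F cF) (@cHG_cts V2 V1 m2 m1 A2 A1 s1 F' cF')).
by move=> a b; apply: twM_central.
Qed.
Lemma twN_hom : hom twN.
Proof. by move=> x y; rewrite /twN /GH' /HG (cHG_hom s2 hF) (cGH_hom s1 hF'). Qed.
Lemma twN2 x : twN (twN x) = 1%g.
Proof.
rewrite /twN; have -> : HG (GH' (HG x)) = 1%g; last exact: hom1 (cGH_hom s1 hF').
apply: (cHG_kill s1 s2 hF surF (th := fun z => HG (GH' z))).
- by move=> a b; rewrite /GH' /HG (cGH_hom s1 hF') (cHG_hom s2 hF).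
- exact: (cts_comp (@cGH_cts V2 V1 m2 m1 A2 A1 s1 F' cF') (@cHG_cts V1 V2 m1 m2 A1 A2 s2 F cF)).
by move=> a b; apply: (cHG_central s1 s2 hF surF).
Qed.
Lemma HH_inj_half x y : HH' (HH x) = HH' (HH y) -> x = y.
Proof. exact: (twist_inj (E := fun x => HH' (HH x)) twN_hom twN_eq twN2). Qed.
Lemma HH_surj_half x : exists y, HH' (HH y) = x.
Proof. exact: (twist_surj (E := fun x => HH' (HH x)) twN_hom twN_eq twN2). Qed.
Lemma GG_inj_half x y : GG' (GG x) = GG' (GG y) -> x = y.
Proof. exact: (twist_inj (E := fun x => GG' (GG x)) twM_hom twM_eq twM2). Qed.
Lemma GG_surj_half x : exists y, GG' (GG y) = x.
Proof. exact: (twist_surj (E := fun x => GG' (GG x)) twM_hom twM_eq twM2). Qed.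
End KS.

Section KS2.
Variables (V1 V2 : finType) (m1 : V1 -> V1 -> nat) (m2 : V2 -> V2 -> nat) (A1 : {set V1}) (A2 : {set V2}).

Hypotheses (s1 : split_graph m1 A1) (s2 : split_graph m2 A2).
Lemma hom_iso_inv (G H : groupType) (f : G -> H) : injective f -> (forall y, exists x, f x = y) ->
  exists g, cancel f g /\ cancel g f.
Proof.
move=> fi /boolp.choice [g gK]; exists g; split=> // x; exact: fi.
Qed.
Lemma split_hat : prof_iso m1 m2 ->
  prof_iso (restrict m1 A1) (restrict m2 A2) /\ prof_iso (restrict m1 (~: A1)) (restrict m2 (~: A2)).
Proof.
case/prof_iso_hom => F [F' [hF cF FK FK']].
have hF' := inv_hom hF FK FK'; have cF' := inv_cts hF cF FK FK'.
split; apply/prof_iso_hom.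
  have [||g [gK gK']] := @hom_iso_inv _ _ (@cHH V1 V2 m1 m2 A1 A2 s2 F).
  - by move=> x y e; apply: (HH_inj_half (s1 := s1) (s2 := s2) hF cF hF' cF' FK FK'); rewrite e.
  - by move=> y; have [x <-] := HH_surj_half s2 s1 hF' cF' hF cF FK' FK y; eexists.
  by exists (@cHH V1 V2 m1 m2 A1 A2 s2 F), g; split=> //; [exact: cHH_hom|exact: cHH_cts].
have [||g [gK gK']] := @hom_iso_inv _ _ (@cGG V1 V2 m1 m2 A1 A2 s2 F).
- by move=> x y e; apply: (GG_inj_half (s1 := s1) (s2 := s2) hF cF hF' cF' FK); rewrite e.
- by move=> y; have [x <-] := GG_surj_half s2 s1 hF' cF' hF cF FK' y; eexists.
by exists (@cGG V1 V2 m1 m2 A1 A2 s2 F), g; split=> //; [exact: cGG_hom|exact: cGG_cts].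
Qed.

(** The blocks of the completed isomorphism restrict to the discrete groups, and so does the twist;
    hence the inverse of the twist stays inside W, and [iota_inj] brings identities back from the
    completion. *)
Lemma split_disc : cox_iso m1 m2 -> cox_iso (restrict m1 (~: A1)) (restrict m2 (~: A2)).
Proof.
case/cox_iso_hom => f [hf fi fs].
have [f' [fK fK']] := hom_iso_inv fi fs.
have hf' : hom f' by move=> x y; apply: fi; rewrite hf !fK'.
pose F := phat hf; pose F' := phat hf'.
have FK : cancel F F'.
  apply: (@cts_ext _ _ _ _ (F' \o F) id) => //.
  - by move=> x y /=; rewrite /F /F' !phat_hom.
  - by apply: cts_comp; exact: phat_cts.
  - by move=> N; exists N.
  by move=> s /=; rewrite /F /F' !phat_iota fK.
have FK' : cancel F' F.
  apply: (@cts_ext _ _ _ _ (F \o F') id) => //.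
  - by move=> x y /=; rewrite /F /F' !phat_hom.
  - by apply: cts_comp; exact: phat_cts.
  - by move=> N; exists N.
  by move=> s /=; rewrite /F /F' !phat_iota fK'.
have hF : hom F := phat_hom hf; have hF' : hom F' := phat_hom hf'.
have cF : cts F := @phat_cts _ _ _ _ _ hf; have cF' : cts F' := @phat_cts _ _ _ _ _ hf'.
have hm1 := sg_cox s1; have hm2 := sg_cox s2.
have hC1 := sepAC hm1 (sg_sep s1); have hC2 := sepAC hm2 (sg_sep s2).
have hA1 := sg_sep s1; have hA2 := sg_sep s2.
pose g (x : cox (restrict m1 (~: A1))) := ret (m := m2) (~: A2) (f (inc x)).
pose g' (y : cox (restrict m2 (~: A2))) := ret (m := m1) (~: A1) (f' (inc y)).
have gE x : @cGG V1 V2 m1 m2 A1 A2 s2 F (iota x) = iota (g x).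
  by rewrite /cGG hinc_iota /F phat_iota hret_iota.
have gE' y : @cGG V2 V1 m2 m1 A2 A1 s1 F' (iota y) = iota (g' y).
  by rewrite /cGG hinc_iota /F' phat_iota hret_iota.
have hm1C : is_cox_graph (restrict m1 (~: A1)) := restrict_cox hm1 _.
have hm2C : is_cox_graph (restrict m2 (~: A2)) := restrict_cox hm2 _.
have hg : hom g by move=> x y; rewrite /g inc_hom hf ret_hom.
have hg' : hom g' by move=> x y; rewrite /g' inc_hom hf' ret_hom.
apply/cox_iso_hom; exists g; split=> //.
  move=> x y e; apply: (iota_inj hm1C).
  by apply: (GG_inj_half (s1 := s1) (s2 := s2) hF cF hF' cF' FK); rewrite !gE e.
move=> y.
(* The discrete value of the twist at [y]. *)
pose z : cox (restrict m2 (~: A2)) := ret (~: A2) (f (inc (ret A1 (f' (inc y))))).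
pose M := @twM V2 V1 m2 m1 A2 A1 s2 s1 F' F.
have Mz : M (iota y) = iota z.
  by rewrite /M /twM /cGH /cHG hinc_iota /F' phat_iota hret_iota hinc_iota /F phat_iota hret_iota.
have Mh : hom M := twM_hom s2 s1 hF' hF.
exists (g' (y * z)%g); apply: (iota_inj hm2C); rewrite -gE -gE'.
have := twM_eq s2 s1 hF FK' (iota (y * z)%g).
rewrite -/M iota_hom Mh Mz.
have -> : M (iota z) = 1%g by rewrite -Mz; apply: (twM2 s2 s1 hF' cF' hF cF FK').
rewrite mulg1 => /(congr1 (fun x => x * (iota z)^-1)%g); by rewrite !mulgK.
Qed.
End KS2.

(** * Equivariant lattices *)

Definition cmod (N : nat) p q (A B : 'M[int]_(p, q)) := exists C, A = B + N%:Z *: C.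
Lemma zscaleI p q (k : int) (A B : 'M[int]_(p, q)) : k != 0 -> k *: A = k *: B -> A = B.
Proof. by move=> k0 /matrixP e; apply/matrixP => i j; move: (e i j); rewrite !mxE => /(mulfI k0). Qed.
Lemma cmod0P N p q (A : 'M[int]_(p, q)) : cmod N A 0 <-> forall i j, (N%:Z %| A i j)%Z.
Proof.
split=> [[C ->] i j|h]; first by rewrite !mxE add0r dvdz_mulr.
exists (\matrix_(i, j) (A i j %/ N)%Z); apply/matrixP => i j; rewrite !mxE add0r.
by rewrite mulrC divzK.
Qed.

Lemma bezout_row k (v : 'cV[int]_k) : exists (u : 'rV[int]_k) (z : int),
  (u *m v = z%:M) /\ (forall i, (z %| v i 0%R)%Z).
Proof.
elim: k v => [|k IH] v; first by exists 0, 0; split=> [|[]//]; rewrite mul0mx raddf0.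
have [u [z [uz hz]]] := IH (dsubmx (v : 'cV_(1 + k))).
have [a [b e]] := Bezoutz (v 0 0) z.
exists (row_mx a%:M (b *: u) : 'rV_(1 + k)), (gcdz (v 0 0) z); split.
  rewrite -{1}[v](@vsubmxK _ 1 k) (@mul_row_col _ 1 1 k) mul_scalar_mx -scalemxAl uz -e.
  apply/matrixP => i j; rewrite !mxE !ord1 /= !mulr1n; congr (_ * v _ _ + _).
  exact: val_inj.
move=> i; have [->|] := eqVneq i 0; first exact: dvdz_gcdl.
case: (unliftP 0 i) => [j ->|->]; last by rewrite eqxx.
move=> _; apply: dvdz_trans (dvdz_gcdr _ _) _; have := hz j; rewrite mxE.
by congr (dvdz _ (v _ _)); apply: val_inj.
Qed.

Lemma primitive_col k (v : 'cV[int]_k) : v != 0 ->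
  exists (z : int) (t : 'cV[int]_k) (u : 'rV[int]_k), [/\ z != 0, v = z *: t & u *m t = 1%:M].
Proof.
move=> v0; have [u [z [uz hz]]] := bezout_row v.
have vE : v = z *: \col_i (v i 0%R %/ z)%Z.
  by apply/matrixP => i j; rewrite !mxE !ord1 mulrC divzK.
have z0 : z != 0 by apply: contraNneq v0 => z0; rewrite vE z0 scale0r.
exists z, (\col_i (v i 0%R %/ z)%Z), u; split=> //.
by apply: (zscaleI z0); rewrite scalemxAr -vE uz scale_scalar_mx mulr1.
Qed.

Section LA.
Variables (l l' : nat) (G : finGroupType) (R1 : G -> 'M[int]_l) (R2 : G -> 'M[int]_l').
Hypotheses (R1M : forall g h, R1 (g * h)%g = R1 g *m R1 h) (R11 : R1 1%g = 1%:M).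
Hypotheses (R2M : forall g h, R2 (g * h)%g = R2 g *m R2 h) (R21 : R2 1%g = 1%:M).
Variables (r : 'I_l -> G) (n : 'I_l -> 'I_l -> int).
Local Notation ee i := (delta_mx i 0 : 'cV[int]_l).
Hypothesis R1r : forall j i, R1 (r j) *m ee i = ee i - n j i *: ee j.
Hypotheses (n2 : forall i, n i i = 2) (n0 : forall i j, n i j = 0 -> n j i = 0).
Hypothesis HX : forall N, (0 < N)%N -> exists X : 'M[int]_(l', l),
  [/\ forall g, cmod N (R2 g *m X) (X *m R1 g),
      forall v : 'cV_l, cmod N (X *m v) 0 -> cmod N v 0 &
      forall v' : 'cV_l', exists v, cmod N v' (X *m v)].

(* Averaging an intertwiner mod [#|G| * M] over [G] and dividing by [#|G|] leaves it unchanged mod [M]. *)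
Lemma avg M : (0 < M)%N -> exists Z : 'M[int]_(l', l),
  [/\ forall g, R2 g *m Z = Z *m R1 g,
      forall v : 'cV_l, cmod M (Z *m v) 0 -> cmod M v 0 &
      forall v' : 'cV_l', exists v, cmod M v' (Z *m v)].
Proof.
move=> M0; have G0 : (0 < #|G|)%N by apply/card_gt0P; exists 1%g.
have [|X [eqv inj sur]] := @HX (#|G| * M)%N; first by rewrite muln_gt0 G0.
have /fin_all_exists [C CE] : forall g, exists C, R2 g *m X = X *m R1 g + (#|G| * M)%N%:Z *: C by [].
pose U := \sum_g C g *m R1 g^-1%g; pose Y := \sum_g R2 g *m X *m R1 g^-1%g.
pose Z := X + M%:Z *: U.
have YE : Y = #|G|%:Z *: Z.
  rewrite /Y /Z scalerDr scalerA -PoszM /U scaler_sumr.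
  under eq_bigr => g _.
    rewrite CE mulmxDl -mulmxA -R1M mulgV R11 mulmx1 -scalemxAl. over.
  by rewrite big_split /= sumr_const -scaler_nat natz.
have GZ : (#|G|%:Z : int) != 0 by rewrite eqz_nat -lt0n.
exists Z; split=> [h|v [A e]|v'].
- apply: (zscaleI GZ); rewrite scalemxAr [RHS]scalemxAl -YE /Y mulmx_sumr mulmx_suml.
  rewrite [RHS](reindex_inj (mulgI h)); apply: eq_bigr => g _ /=.
  by rewrite R2M invMg -!mulmxA -R1M mulgVK.
- have [|B e2] := inj (#|G|%:Z *: v).
    exists (A - U *m v); rewrite add0r -scalemxAr.
    have -> : X = Z - M%:Z *: U by rewrite /Z addrK.
    by rewrite mulmxBl e add0r -scalemxAl -scalerBr scalerA PoszM.
  exists B; rewrite add0r; apply: (zscaleI GZ); rewrite e2 add0r scalerA PoszM //.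
have [v [A e]] := sur v'; exists v, (#|G|%:Z *: A - U *m v).
by rewrite e /Z mulmxDl -scalemxAl scalerBr scalerA PoszM -addrA; congr (_ + _); rewrite addrCA subrr addr0 mulrC.
Qed.

(** A vector of the kernel is M times another one; descent on the sum of absolute values. *)
Lemma la_inj M (Z : 'M[int]_(l', l)) : (1 < M)%N ->
  (forall v : 'cV_l, cmod M (Z *m v) 0 -> cmod M v 0) -> forall v : 'cV_l, Z *m v = 0 -> v = 0.
Proof.
move=> M1 inj v; have [k] := ubnP (\sum_i absz (v i 0%R))%N; elim: k v => // k IH v hk e.
have [|A vA] := inj v; first by rewrite e; exists 0; rewrite scaler0 addr0.
rewrite add0r in vA; have M0 : (M%:Z : int) != 0 by rewrite eqz_nat; lia.
have ZA : Z *m A = 0 by apply: (zscaleI M0); rewrite scalemxAr -vA e scaler0.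
have [A0|An] := eqVneq A 0; first by rewrite vA A0 scaler0.
suff A0 : A = 0 by rewrite vA A0 scaler0.
apply: IH => //; rewrite ltnS in hk; apply: leq_trans hk; rewrite vA.
have [i Ai] : exists i, A i 0 != 0.
  apply/existsP; apply: contraNT An; rewrite negb_exists => /forallP h.
  by apply/eqP/matrixP => i j; rewrite ord1 mxE; apply/eqP; move: (h i); rewrite negbK.
rewrite (bigD1 i) //= [X in (_ < X)%N](bigD1 i) //= -addSn leq_add //.
  by rewrite !mxE abszM absz_nat ltn_Pmull ?absz_gt0.
by apply: leq_sum => j _; rewrite !mxE abszM absz_nat leq_pmull // ltnW.
Qed.

(** Surjectivity modulo M gives a right inverse up to an error M A. The determinant of 1 - M A is 1
    modulo M, hence nonzero, and the adjugate clears it. *)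
Lemma la_index M (Z : 'M[int]_(l', l)) : (1 < M)%N ->
  (forall v' : 'cV_l', exists v, cmod M v' (Z *m v)) ->
  exists (d : int) (D : 'M[int]_(l, l')), d != 0 /\ Z *m D = d%:M.
Proof.
move=> M1 sur.
have /fin_all_exists [V hV] : forall i, exists v, cmod M (delta_mx i 0 : 'cV_l') (Z *m v) by [].
have /fin_all_exists [A0 hA] : forall i, exists A, (delta_mx i 0 : 'cV_l') = Z *m V i + M%:Z *: A by [].
pose D0 : 'M[int]_(l, l') := \matrix_(a, i) V i a 0.
pose A : 'M[int]_l' := \matrix_(a, i) A0 i a 0.
have E : 1%:M = Z *m D0 + M%:Z *: A.
  apply/matrixP => a i; move/matrixP/(_ a 0): (hA i); rewrite !mxE andbT => ->.
  by congr (_ + _); apply: eq_bigr => j _; rewrite mxE.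
have E2 : Z *m D0 = 1%:M - M%:Z *: A by rewrite E addrK.
exists (\det (1%:M - M%:Z *: A)), (D0 *m \adj (1%:M - M%:Z *: A)); split; last first.
  by rewrite mulmxA E2 mul_mx_adj.
apply/eqP => /(congr1 (intr : int -> 'Z_M)) /eqP; rewrite -det_map_mx.
have -> : map_mx (intr : int -> 'Z_M) (1%:M - M%:Z *: A) = 1%:M.
  have M0 : (M%:Z)%:~R = 0 :> 'Z_M by rewrite -pmulrn pchar_Zp.
  apply/matrixP => a b; rewrite !mxE rmorphB rmorphM /= M0 mul0r subr0.
  by case: eqP.
by rewrite det1 oner_eq0.
Qed.

Lemma coprime_dvd (a b c : int) (M : nat) : coprimez a M%:Z -> c != 0 -> (c %| M%:Z)%Z -> (a %| c * b)%Z -> (a %| b)%Z.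
Proof. by move=> co _ cM; rewrite Gauss_dvdzr //; apply: coprimez_dvdr cM co. Qed.

Lemma R1rE j (x : 'cV[int]_l) : R1 (r j) *m x = x - (\sum_i n j i * x i 0) *: ee j.
Proof.
have {1}-> : x = \sum_i x i 0 *: ee i.
  by apply/matrixP => a b; rewrite ord1 summxE (bigD1 a) //= big1 => [|i ia]; rewrite !mxE ?eqxx ?mulr1 ?addr0 // eq_sym (negPf ia) mulr0.
rewrite mulmx_sumr; under eq_bigr => i _ do rewrite -scalemxAr R1r scalerBr scalerA.
rewrite sumrB -scaler_suml; congr (_ - _ *: _).
  by apply/matrixP => a b; rewrite ord1 summxE (bigD1 a) //= big1 => [|i ia]; rewrite !mxE ?eqxx ?mulr1 ?addr0 // eq_sym (negPf ia) mulr0.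
by apply: eq_bigr => i _; rewrite mulrC.
Qed.

Theorem lattice_iso : exists (X : 'M[int]_(l', l)) (X' : 'M[int]_(l, l')),
  [/\ forall j, R2 (r j) *m X = X *m R1 (r j), X' *m X = 1%:M & X *m X' = 1%:M].
Proof.
(* Divisible by every nonzero [n i j], so that these can be cancelled against the [z i], which are
   prime to [M1]; the factor 2 ensures that [M1] exceeds 1. *)
pose M1 := (2 * \prod_i \prod_j (if n i j == 0 then 1 else `|n i j|))%N.
have dM1 i j : n i j != 0 -> (n i j %| M1%:Z)%Z.
  move=> nij; rewrite dvdzE absz_nat /M1 (bigD1 i) //= (bigD1 j) //= (negPf nij).
  by rewrite mulnCA -!mulnA dvdn_mulr.
have M1g : (1 < M1)%N.
  have : (0 < \prod_i \prod_j (if n i j == 0 then 1 else `|n i j|))%N.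
    by apply/prodn_gt0 => i; apply/prodn_gt0 => j; case: eqP => // /eqP; rewrite absz_gt0.
  by rewrite /M1; lia.
have [|Z [Ze Zi Zs]] := @avg M1; first by lia.
have Zinj := la_inj M1g Zi; have [d [D [d0 ZD]]] := la_index M1g Zs.
have ee0 i : ee i != 0.
  by apply/eqP => /matrixP /(_ i 0); rewrite !mxE !eqxx.
have prim i : exists w : int * 'cV[int]_l' * 'rV[int]_l',
   [/\ w.1.1 != 0, Z *m ee i = w.1.1 *: w.1.2 & w.2 *m w.1.2 = 1%:M].
  have [|z [t [u [z0 e ut]]]] := @primitive_col _ (Z *m ee i); last by exists (z, t, u).
  by apply: contraNneq (ee0 i) => /Zinj ->.
have /fin_all_exists [w hw] := prim.
pose z i := (w i).1.1; pose t i := (w i).1.2; pose u i := (w i).2.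
have z0 i : z i != 0 by case: (hw i).
have Zt i : Z *m ee i = z i *: t i by case: (hw i).
have ut i : u i *m t i = 1%:M by case: (hw i).
(* For a common divisor k, the vector (M1/k) e_i has image zero modulo [M1], so injectivity leaves k
   = 1. *)
have co i : coprimez (z i) M1%:Z.
  pose k := gcdz (z i) M1%:Z; have kM : (k %| M1%:Z)%Z := dvdz_gcdr _ _; have kz : (k %| z i)%Z := dvdz_gcdl _ _.
  have [q qE] := dvdzP kM; have [y yE] := dvdzP kz.
  have /Zi /cmod0P /(_ i 0) : cmod M1 (Z *m (q *: ee i)) 0.
    by exists (y *: t i); rewrite add0r -scalemxAr Zt !scalerA yE qE; congr (_ *: _); ring.
  rewrite !mxE !eqxx mulr1 => h; rewrite /coprimez -/k; rewrite {1}qE in h.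
  have q0 : q != 0 by apply/eqP => q0; move: qE; rewrite q0 mul0r; lia.
  have : (q * k %| q * 1)%Z by rewrite mulr1.
  rewrite dvdz_mul2l // dvdz1 => /eqP hk; rewrite /k /gcdz in hk *; rewrite absz_nat in hk.
  by rewrite hk.
have rt j i : z i *: (t i - R2 (r j) *m t i) = (n j i * z j) *: t j.
  rewrite scalerBr scalemxAr -Zt mulmxA Ze -mulmxA R1r mulmxBr -scalemxAr !Zt scalerA.
  by rewrite opprB addrC subrK.
have dv j i : n j i != 0 -> (z i %| z j)%Z.
  move=> nz; apply: (coprime_dvd (co i) nz (dM1 _ _ nz)).
  apply/dvdzP; exists ((u j *m (t i - R2 (r j) *m t i)) 0 0).
  move/(congr1 (fun v => (u j *m v) 0 0)): (rt j i).
  by rewrite -!scalemxAr ut !mxE eqxx mulr1 mulrC.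
have az j i : n j i != 0 -> `|z i|%N = `|z j|%N.
  move=> nz; have nz' : n i j != 0 by apply: contra nz => /eqP /n0 ->.
  by apply/eqP; rewrite eqn_dvd -!dvdzE dv // dv.
pose s i := sgz (z i).
have sz i : z i = s i * `|z i|%N%:Z by rewrite /s -intEsg.
have ss i : s i * s i = 1 by rewrite /s; case: sgzP (z0 i).
pose X : 'M[int]_(l', l) := \matrix_(a, i) (s i * t i a 0).
have Xe i : X *m ee i = s i *: t i.
  by apply/matrixP => a b; rewrite -colE !mxE ord1.
have XR j : R2 (r j) *m X = X *m R1 (r j).
  have h i : R2 (r j) *m X *m ee i = X *m R1 (r j) *m ee i.
    rewrite -!mulmxA R1r mulmxBr -scalemxAr !Xe -scalemxAr scalerA.
    have [nz|nz] := eqVneq (n j i) 0.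
      have /(zscaleI (z0 i)) /eqP : z i *: (t i - R2 (r j) *m t i) = z i *: 0.
        by rewrite rt nz mul0r !scale0r scaler0.
      by rewrite nz mul0r scale0r subr0 subr_eq0 => /eqP <-.
    have e : t i - R2 (r j) *m t i = (n j i * s j * s i) *: t j.
      apply: (zscaleI (z0 i)); rewrite rt scalerA (sz j) -(az j i nz) {2}(sz i); congr (_ *: _).
      by rewrite [in RHS]mulrACA; move: (ss i) => e; rewrite -[LHS]mulr1 -e; ring.
    rewrite -[R2 (r j) *m t i](subKr (t i)) e scalerBr scalerA; congr (_ - _ *: _).
    by move: (ss i) => e1; rewrite -[RHS]mulr1 -e1; ring.
  apply/matrixP => a i; move/matrixP/(_ a 0): (h i); by rewrite -!colE !mxE.
(* After multiplication by [d] a vector negated by the reflection comes from the line of [e_i];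
   primitivity of [t i] removes [d] again. *)
have Ki (k : 'cV_l') i : R2 (r i) *m k = - k -> exists c : int, k = c *: t i.
  move=> hk; have [x dk] : exists x, d *: k = Z *m x by exists (D *m k); rewrite mulmxA ZD mul_scalar_mx.
  have /eqP : R1 (r i) *m x = - x.
    apply/eqP; rewrite -subr_eq0; apply/eqP/Zinj.
    by rewrite mulmxBr mulmxA -Ze -mulmxA -dk mulmxN -dk -scalemxAr hk scalerN opprK addNr.
  rewrite R1rE; move/eqP/matrixP => e.
  have xj j : j != i -> x j 0 = 0.
    move=> ji; move: (e j 0); rewrite !mxE (negPf ji) mulr0 subr0 => /eqP.
    by rewrite -addr_eq0 -mulr2n mulrn_eq0 => /eqP.
  have xE : x = x i 0 *: ee i.
    apply/matrixP => a b; rewrite !mxE ord1; case: (eqVneq a i) => [->|/xj ->]; by rewrite ?mulr1 ?mulr0.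
  exists ((u i *m k) 0 0); apply: (zscaleI d0).
  have dk2 : d *: k = (x i 0 * z i) *: t i by rewrite dk xE -scalemxAr Zt scalerA -xE.
  rewrite dk2 scalerA; congr (_ *: _).
  have := congr1 (fun v => (u i *m v) 0 0) dk2; rewrite -!scalemxAr ut !mxE eqxx mulr1 => <-.
  by congr (_ * _); rewrite mxE.
(* A second intertwiner, surjective modulo [d]. Both intertwiners factor through [X], and multiples
   of [d] lie in the image of [Z], so [X] is surjective. *)
have [|Z2 [Ze2 _ Zs2]] := @avg `|d|%N; first by rewrite absz_gt0.
have imZ (Y : 'M[int]_(l', l)) : (forall g, R2 g *m Y = Y *m R1 g) -> exists E, Y = X *m E.
  move=> Ye; have /fin_all_exists [c hc] : forall i, exists c : int, Y *m ee i = c *: t i.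
    move=> i; apply: Ki; rewrite mulmxA Ye -mulmxA R1r n2 mulmxBr -scalemxAr.
    by rewrite scaler_nat mulr2n opprD addrA subrr sub0r.
  exists (diag_mx (\row_i (s i * c i))); apply/matrixP => a i.
  move/matrixP/(_ a 0): (hc i); rewrite -colE mul_mx_diag !mxE => ->.
  by rewrite mulrACA ss mul1r mulrC.
have [E2 Z2E] := imZ Z2 Ze2.
pose E1 : 'M[int]_l := diag_mx (\row_i `|z i|%N%:Z).
have Z1E : Z = X *m E1.
  apply/matrixP => a i; move/matrixP/(_ a 0): (Zt i); rewrite -colE mul_mx_diag !mxE => ->.
  by rewrite {1}(sz i); ring.
have /fin_all_exists [V hV] : forall i, exists v : 'cV_l, delta_mx i 0 = X *m v :> 'cV_l'.
  move=> i; have [v [A ->]] := Zs2 (delta_mx i 0).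
  have -> : `|d|%N%:Z = d * sgz d by rewrite mulrC -abszEsg.
  exists (E2 *m v + E1 *m (sgz d *: (D *m A))).
  rewrite mulmxDr !mulmxA -Z2E -Z1E -scalemxAr mulmxA ZD mul_scalar_mx scalerA.
  by rewrite mulrC.
pose X' : 'M[int]_(l, l') := \matrix_(a, i) V i a 0.
have XX' : X *m X' = 1%:M.
  apply/matrixP => a i; move/matrixP/(_ a 0): (hV i); rewrite !mxE andbT => ->.
  by apply: eq_bigr => j _; rewrite [X' _ _]mxE.
have Xinj (x : 'cV_l) : X *m x = 0 -> x = 0.
  move=> e; have dE : \det E1 != 0.
    by rewrite det_diag; apply/prodf_neq0 => i _; rewrite mxE eqz_nat absz_eq0.
  have /Zinj h : Z *m (\adj E1 *m x) = 0.
    by rewrite Z1E !mulmxA -[_ *m E1 *m _]mulmxA mul_mx_adj -mulmxA mul_scalar_mx -scalemxAr e scaler0.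
  apply: (zscaleI dE); by rewrite scaler0 -mul_scalar_mx -mul_mx_adj -mulmxA h mulmx0.
exists X, X'; split=> //.
apply/matrixP => a i; apply/eqP; rewrite -subr_eq0; apply/eqP.
have := Xinj ((X' *m X - 1%:M) *m ee i); rewrite mulmxA mulmxBr mulmxA XX' mul1mx mulmx1 subrr mul0mx => /(_ erefl).
by rewrite -colE => /matrixP /(_ a 0); rewrite !mxE.
Qed.
End LA.

(** * Affine components *)

Section AffComp.
Variables (S : finType) (m : S -> S -> nat) (hm : is_cox_graph m).
Local Notation es := (ev RR).
Local Notation "g ** v" := (@ga S m _ (aR m) g v) (at level 40).
Local Notation B := (bil (aR m)).
Local Notation W := (cox m).
Local Notation vv := (vec S RR).
Let aRs := aR_sym hm.
Let aRd := aR_diag m.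
Let aRr := resp_aR hm.
#[local] Hint Resolve aRs aRd aRr hm : core.
Definition rad (v : vv) := forall u, B v u = 0.
Lemma radZ x v : rad v -> rad (x *: v).
Proof. by move=> h u; rewrite bilZl h mulr0. Qed.
Lemma radD u v : rad u -> rad v -> rad (u + v).
Proof. by move=> h k w; rewrite bilDl h k addr0. Qed.
Lemma ga_rad v (w : W) : rad v -> w ** v = v.
Proof.
move=> h; elim/cox_ind: w => [|s x IH]; first by rewrite ga1.
by rewrite gaM // IH ga_sg // /refl -bil_ev // bilC // h scale0r subr0.
Qed.

Section One.
Variable s0 : S.
Let I := comp m s0.
Hypothesis haff : cox_affine_on m I.
Local Notation inI := (@inI S m s0).
Lemma psdI v : inI v -> 0 <= B v v.
Proof.
move=> vI; have e : v = [ffun s => (if s \in comp m s0 then v s else 0) : RR^o].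
  by apply/ffunP => s; rewrite ffunE; case: ifPn => // /vI.
by rewrite e qformE mulr_ge0 //; case: haff => h _; apply: h.
Qed.
(** Semidefiniteness tested on 3 v - c e_s, whose norm is -4 c^2. *)
Lemma isotropicI v : inI v -> B v v = 0 -> rad v.
Proof.
move=> vI v0; have h s : s \in I -> B v (es s) = 0.
  move=> sI; have eI : inI (es s) := inI_ev sI; set c := B v _; have := @psdI (3%:R *: v - c *: es s).
  have -> : B (3%:R *: v - c *: es s) (3%:R *: v - c *: es s) = - 4%:R * c ^+ 2.
    by rewrite !(bilDl, bilDr, bilNl, bilNr, bilZl, bilZr) v0 (bilC aRs (es s) v) -/c bil_evev // aRd; ring.
  move=> k; have : 0 <= - 4%:R * c ^+ 2.
    by apply: k => t tI; rewrite !vecE vI // eI // !mulr0 subr0.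
  by move=> k2; apply/eqP; rewrite -sqrf_eq0; apply/eqP; have := sqr_ge0 c; lra.
move=> u; rewrite (vec_sum u) bil_sumr // big1 // => s _; rewrite bilZr.
by have [/h ->|/(inI_out vI) ->] := boolP (s \in I); rewrite mulr0.
Qed.
(** A Perron-Frobenius argument: at a zero of [w] the radical equation is a sum of terms of one
    sign, so all neighbours are zeros too. *)
Lemma zero_prop w : posv w -> rad w -> inI w -> forall t, t \in I -> w t = 0 -> w = 0.
Proof.
move=> wp wr wI t tI wt; suff h r : r \in comp m t -> w r = 0.
  apply/ffunP => r; rewrite ffunE; have [rI|/wI//] := boolP (r \in I).
  by apply: h; rewrite (comp_eq hm tI).
elim/comp_ind => {r} [//|q r qt wq qr].
have := wr (es q); rewrite bilC // bil_ev // /pair => e.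
have ter p : true -> 0 <= - (aR m q p * w p).
  move=> _; have [<-|qp] := eqVneq q p; first by rewrite wq mulr0 oppr0.
  by rewrite oppr_ge0 mulr_le0_ge0 // aR_le0.
have : \sum_p - (aR m q p * w p) = 0 by rewrite sumrN e oppr0.
move/(psumr_eq0P ter)/(_ r isT)/eqP; rewrite oppr_eq0 mulf_eq0 => /orP[/eqP h|/eqP//].
by have := aR_adj hm qr; rewrite h ltxx.
Qed.
(** Off-diagonal entries are nonpositive, so passing to absolute values cannot raise the norm. *)
Lemma abs_rad v : inI v -> rad v -> rad [ffun s => `|v s| : RR^o].
Proof.
move=> vI vr; set w : vv := [ffun s => _]; have wI : inI w by move=> t tI; rewrite ffunE vI // normr0.
apply: isotropicI => //; apply/eqP; rewrite eq_le psdI // andbT -(vr v).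
rewrite /bil; apply: ler_sum => s _; rewrite /pair !mulr_sumr; apply: ler_sum => t _; rewrite !ffunE.
have [<-|st] := eqVneq s t; first by rewrite ![_ * (aR m s s * _)]mulrCA -!expr2 real_normK ?num_real.
rewrite mulrCA [leRHS]mulrCA -normrM; apply: ler_wnM2l; [exact: aR_le0|exact: ler_norm].
Qed.
Lemma delta_ex : exists d : vv, [/\ inI d, rad d & forall t, t \in I -> 0 < d t].
Proof.
case: (haff) => psd [x [[s sI xs] x0]].
pose v : vv := [ffun s => (if s \in comp m s0 then x s else 0) : RR^o].
have vI : inI v by move=> t tI; rewrite ffunE (negPf tI).
have v0 : B v v = 0 by rewrite qformE x0 mulr0.
have vr := isotropicI vI v0; have wr := abs_rad vI vr.
set w : vv := [ffun s => _] in wr; have wI : inI w by move=> t tI; rewrite ffunE vI // normr0.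
exists w; split=> // t tI; rewrite lt0r ffunE normr_ge0 andbT; apply/eqP => wt.
have := @zero_prop w _ wr wI t tI; rewrite ffunE wt => /(_ _ erefl) w0.
have /ffunP /(_ s) : w = 0 by apply: w0 => r; rewrite ffunE.
by rewrite !ffunE sI => /eqP; rewrite normr_eq0 (negPf xs).
Qed.
(** Subtract the multiple of [d] that cancels the coordinate at [s0] and apply [zero_prop] to the
    absolute value. *)
Lemma rad_line d r : inI d -> rad d -> (forall t, t \in I -> 0 < d t) -> inI r -> rad r ->
  exists x, r = x *: d.
Proof.
move=> dI dr dp rI rr; exists (r s0 / d s0).
pose u := r - (r s0 / d s0) *: d.
have s0I : s0 \in I by rewrite comp_refl.
have uI : inI u by move=> t tI; rewrite /u !vecE (rI t tI) (dI t tI) ?mulr0 ?scaler0 ?oppr0 ?addr0 ?subr0.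
have ur : rad u by rewrite /u -scaleNr; apply: radD => //; apply: radZ.
have /ffunP h : [ffun s => `|u s| : RR^o] = 0 :> vv.
  apply: (zero_prop _ _ _ s0I) => [t|||]; first by rewrite ffunE.
  - exact: abs_rad.
  - by move=> t tI; rewrite ffunE uI // normr0.
  by rewrite ffunE /u !vecE divfK ?subrr ?normr0 // gt_eqF // dp.
apply/eqP; rewrite -subr_eq0; apply/eqP/ffunP => t; rewrite -/u [RHS]ffunE.
by apply/eqP; rewrite -normr_eq0; move: (h t); rewrite ffunE => ->; rewrite ffunE.
Qed.
(* In a finite group the longest element maps every simple root to a negative one, but it fixes [d]. *)
Lemma affine_infinite : ~ cox_finite (restrict m I).
Proof.
case=> l hl; have [d [dI dr dp]] := delta_ex.
pose P n := `[< exists x : cox (restrict m I), len (inc x) = n >].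
have ex : exists n, P n by exists (len (inc (1%g : cox (restrict m I)))); apply/asboolP; exists 1%g.
pose N := (\sum_(w <- l) len (inc (wd (restrict m I) w)))%N.
have ub n : P n -> (n <= N)%N.
  move/asboolP => [x <-]; have [w wE] := wd_surj x; have [u ul uw] := hl w.
  have -> : x = wd _ u by rewrite wE; apply/wdP.
  by rewrite /N (big_rem _ ul) /= leq_addr.
case: (ex_maxnP ex ub) => n /asboolP [x xE] mx.
have neg t : t \in I -> posv (- (inc x ** es t)).
  move=> tI; pose st := sg (restrict m I) (Sub t tI).
  have e : inc (x * st)%g = (inc x * sg m t)%g by rewrite inc_hom inc_sg.
  have -> : - (inc x ** es t) = (inc x * sg m t)%g ** es t.
    by rewrite gaM // ga_ev // linearN.
  apply: tits_pos => //; rewrite mulgg xE -e; apply: mx; apply/asboolP; by exists (x * st)%g.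
have s0I : s0 \in I by rewrite comp_refl.
have : d s0 <= 0.
  rewrite -(ga_rad (inc x) dr) (inI_sum dI) linear_sum vecS; apply: sumr_le0 => t tI.
  rewrite linearZ vecE mulr_ge0_le0 //; first by apply/ltW/dp.
  by have := neg t tI s0; rewrite vecE oppr_ge0.
by rewrite leNgt dp.
Qed.
End One.
End AffComp.

Section AffAll.
Variables (S : finType) (m : S -> S -> nat) (hm : is_cox_graph m).
Local Notation es := (ev RR).
Local Notation "g ** v" := (@ga S m _ (aR m) g v) (at level 40).
Local Notation B := (bil (aR m)).
Local Notation W := (cox m).
Local Notation vv := (vec S RR).
Let aRs := aR_sym hm.
Let aRd := aR_diag m.
Let aRr := resp_aR hm.
#[local] Hint Resolve aRs aRd aRr hm : core.
Hypothesis haff : forall s, cox_affine_on m (comp m s).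
Local Notation rad := (@rad S m).
Local Notation wroot := (@wroot S m).

(** The form is an orthogonal sum over components. Averaging over the vertices of each component
    avoids the choice of one representative per component. *)
Lemma psd v : 0 <= B v v.
Proof.
pose F t : RR := v t * pair (aR m) t v.
have -> : B v v = \sum_s (#|comp m s|%:R^-1 * \sum_(t in comp m s) F t).
  rewrite /bil; under [RHS]eq_bigr => s _ do rewrite mulr_sumr.
  rewrite (exchange_big_dep xpredT) //=; apply: eq_bigr => t _; rewrite -/(F t).
  rewrite (eq_bigr (fun=> #|comp m t|%:R^-1 * F t)); last first.
    by move=> s st; rewrite (comp_eq hm st).
  rewrite (eq_bigl (fun s => s \in comp m t)); last by move=> s; rewrite /= comp_sym.
  rewrite sumr_const -[RHS]mulr_natl mulrA mulfV ?mul1r // pnatr_eq0 -lt0n.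
  by apply/card_gt0P; exists t; rewrite comp_refl.
apply: sumr_ge0 => s _; rewrite mulr_ge0 ?invr_ge0 ?ler0n //.
pose w : vv := [ffun t => (if t \in comp m s then v t else 0) : RR^o].
have wI : inI m s w by move=> t tI; rewrite ffunE (negPf tI).
suff -> : \sum_(t in comp m s) F t = B w w by apply: (psdI (haff s)).
rewrite /bil big_mkcond; apply: eq_bigr => t _; rewrite ffunE; case: ifP => tI; last by rewrite mul0r.
rewrite /F; congr (_ * _); apply: eq_bigr => r _; rewrite ffunE; case: ifPn => // rI.
by rewrite (aR_out tI rI) !mul0r.
Qed.
Lemma isotropic v : B v v = 0 -> rad v.
Proof.
move=> v0 u; set c := B v u; set b := B u u; have b0 : 0 <= b := psd u.
have := psd ((b + 1) *: v - c *: u).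
have -> : B ((b + 1) *: v - c *: u) ((b + 1) *: v - c *: u) = c ^+ 2 * (- b - 2%:R).
  by rewrite !(bilDl, bilDr, bilNl, bilNr, bilZl, bilZr) v0 (bilC aRs u v) -/c -/b; ring.
move=> h; apply/eqP; rewrite -sqrf_eq0; apply/eqP; have := sqr_ge0 c; nra.
Qed.
Lemma root_mod_rad b c : wroot b -> wroot c -> 2%:R <= `|B b c| -> rad (b - c) \/ rad (b + c).
Proof.
move=> rb rc; have bb := root_B hm rb; have cc := root_B hm rc.
have p1 := psd (b - c); have p2 := psd (b + c).
have e1 : B (b - c) (b - c) = 4%:R - 2%:R * B b c.
  by rewrite !(bilDl, bilDr, bilNl, bilNr) bb cc (bilC aRs c b); ring.
have e2 : B (b + c) (b + c) = 4%:R + 2%:R * B b c.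
  by rewrite !(bilDl, bilDr, bilNl, bilNr) bb cc (bilC aRs c b); ring.
rewrite ler_normr => /orP[h|h]; [left|right]; apply: isotropic; lra.
Qed.
(** Semidefiniteness turns |B| at least 2 into equality up to sign modulo the radical, so a subgroup
    of finite index acts there on each simple root by signs. *)
Lemma roots_mod_rad : exists L : seq vv, (forall b, b \in L -> wroot b) /\
  forall b, wroot b -> exists2 c, c \in L & rad (b - c).
Proof.
have [sp [tf _ _]] : exists sp : spec m, [/\ tfree sp, 2%:R != 0 :> sF sp & forall f, f \in [::] -> evp (sx sp) f != 0].
  exact: spec_ex.
have fin s : exists l : seq vv, forall w, exists2 x, x \in l & rad (w ** es s - x).
  have [|l hl] := @orb_finB S m hm s (Nsp hm sp).
    move=> u hu; have pu : pmF sp s u by apply: pmF_sp hu.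
    have [->|->|h] := pmF_tf hm tf pu; [by left|by right => v; rewrite bilNl|].
    have [k|k] := root_mod_rad (root_ev hm s) (root_ga hm u (root_ev hm s)) h; [left|right] => v.
      by apply/eqP; rewrite eq_sym -subr_eq0 -bilNl -bilDl k.
    by apply/eqP; rewrite -addr_eq0 -bilDl addrC k.
  exists l => w; have [x xl e] := hl w; exists x => // v.
  rewrite (vec_sum v) bil_sumr // big1 // => t _; rewrite bilZr bilDl bilNl e //.
  by rewrite subrr mulr0.
have /boolp.choice [l hl] := fin.
pose L0 := flatten [seq l s | s <- enum S].
have L0P b : wroot b -> exists2 c, c \in L0 & rad (b - c).
  case=> g [s ->]; have [x xl r] := hl s g; exists x => //.
  by apply/flattenP; exists (l s) => //; apply: map_f; rewrite mem_enum.
have pick c : exists b, (exists2 b, wroot b & rad (b - c)) -> wroot b /\ rad (b - c).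
  by have [[b rb r]|n] := pselect (exists2 b, wroot b & rad (b - c)); [exists b|exists 0].
have /boolp.choice [p hp] := pick.
exists [seq p c | c <- L0 & `[< exists2 b, wroot b & rad (b - c) >]]; split.
  by move=> b /mapP [c]; rewrite mem_filter => /andP[/asboolP h _] ->; case: (hp c h).
move=> b rb; have [c cL r] := L0P b rb; have ec : exists2 b, wroot b & rad (b - c) by exists b.
exists (p c); first by apply: map_f; rewrite mem_filter cL andbT; apply/asboolP.
have [_ r2] := hp c ec.
have -> : b - p c = (b - c) + (-1) *: (p c - c) by rewrite scaleN1r opprB addrA subrK.
by apply: radD => //; apply: radZ.
Qed.

(* [Dg b] is the group of vectors [rho] such that [v |-> v + B(b, v) rho] is in [W]. *)
Definition Dg (b r : vv) := rad r /\ exists w : W, forall v, w ** v = v + B b v *: r.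
Lemma DgD b r r' : Dg b r -> Dg b r' -> Dg b (r + r').
Proof.
case=> rr [w hw] [rr' [w' hw']]; split; first exact: radD.
exists (w * w')%g => v; rewrite gaM // hw hw'.
by rewrite bilDr bilZr (bilC aRs b r') rr' mulr0 addr0 -addrA -scalerDr [r' + r]addrC.
Qed.
Lemma Dg0 b : Dg b 0.
Proof.
by split=> [u|]; [rewrite bil0l|exists 1%g => v; rewrite ga1 // scaler0 addr0].
Qed.
Lemma DgN b r : Dg b r -> Dg b (- r).
Proof.
case=> rr [w hw]; split; first by rewrite -scaleN1r; apply: radZ.
exists w^-1%g => v; apply: (can_inj (gaK aRr w)); rewrite gaVK // hw.
by rewrite bilDr bilZr bilNr (bilC aRs b r) rr oppr0 mulr0 addr0 scalerN subrK.
Qed.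
Lemma DgMn b r n : Dg b r -> Dg b (r *+ n).
Proof. by move=> h; elim: n => [|n IH]; [rewrite mulr0n; apply: Dg0|rewrite mulrS; apply: DgD]. Qed.
Lemma DgMz b r (n : int) : Dg b r -> Dg b (n%:~R *: r).
Proof.
case: n => n h; first by rewrite -pmulrn scaler_nat; apply: DgMn.
by rewrite NegzE mulrNz -pmulrn scaleNr scaler_nat; apply: DgN; apply: DgMn.
Qed.
(* The product of the reflections in [b + r] and [b] is the translation. *)
Lemma Dg_root b r : wroot b -> rad r -> wroot (b + r) -> Dg b r.
Proof.
move=> rb rr rbr; split=> //; have [p [_ hp]] := root_refl hm rb; have [q [_ hq]] := root_refl hm rbr.
exists (q * p)%g => v; rewrite gaM // hp hq /rv !(bilDl, bilDr, bilNr, bilZr) !rr (root_B hm rb).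
rewrite !mulr0 !addr0; set x := B b v; have -> : x - x * 2%:R = - x by ring.
by rewrite scaleNr opprK scalerDr addrA subrK.
Qed.
Lemma Dg_move b c r : wroot c -> Dg b r -> Dg c (B b c *: r).
Proof.
move=> rc [rr [w hw]]; apply: Dg_root => //; first exact: radZ.
by rewrite -hw; apply: root_ga.
Qed.
Lemma posvN_root b : wroot b -> 1 <= `|cs b|.
Proof.
move=> rb; rewrite ler_normr; have [p|p] := root_sign hm rb; first by rewrite (cs_ge1 hm rb).
by rewrite -csN (cs_ge1 hm (rootN hm rb)) ?orbT.
Qed.
(* The real numbers [cs b + 2 n cs r] avoid the interval (-1, 1). *)
Lemma Dg_gap b r : wroot b -> Dg b r -> cs r = 0 \/ 1 <= `|cs r|.
Proof.
move=> rb h; have [->|n0] := eqVneq (cs r) 0; [by left|right; rewrite leNgt; apply/negP => lt1].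
have av (n : int) : 1 <= `|cs b + n%:~R * (2%:R * cs r)|.
  have [rr [w hw]] := DgMz n h; have := posvN_root (root_ga hm w rb).
  rewrite hw (root_B hm rb) csD !csZ; congr (_ <= `|_ + _|); ring.
pose y := 2%:R * cs r; pose n := Num.floor (- cs b / y + 1 / 2%:R).
have y0 : y != 0 by rewrite mulf_neq0 // pnatr_eq0.
have := av n; rewrite -/y leNgt => /negP; apply.
have h1 := ge_floor (- cs b / y + 1 / 2%:R); have h2 := lt_succ_floor (- cs b / y + 1 / 2%:R).
rewrite -/n in h1 h2; have -> : cs b + n%:~R * y = y * (n%:~R - (- cs b / y)).
  by field.
move: h1 h2; rewrite intrD; set t := - cs b / y; set k := n%:~R => h1 h2.
have yl : `|y| < 2%:R by rewrite /y normrM ger0_norm ?ler0n // -[ltRHS]mulr1 ltr_pM2l ?ltr0n.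
have tl : `|k - t| <= 1 / 2%:R by rewrite ler_norml; apply/andP; split; lra.
rewrite normrM; have := normr_ge0 y; have := normr_ge0 (k - t); nra.
Qed.
End AffAll.

(** * Discreteness of translations and simple roots modulo the radical *)

Section Simple.
Variables (S : finType) (m : S -> S -> nat) (hm : is_cox_graph m).
Local Notation es := (ev RR).
Local Notation "g ** v" := (@ga S m _ (aR m) g v) (at level 40).
Local Notation B := (bil (aR m)).
Local Notation W := (cox m).
Local Notation vv := (vec S RR).
Let aRs := aR_sym hm.
Let aRd := aR_diag m.
Let aRr := resp_aR hm.
#[local] Hint Resolve aRs aRd aRr hm : core.
Hypothesis haff : forall s, cox_affine_on m (comp m s).
Local Notation rad := (@rad S m).
Local Notation wroot := (@wroot S m).
Local Notation Dg := (@Dg S m).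

Lemma radN v : rad v -> rad (- v).
Proof. by move=> h; rewrite -scaleN1r; apply: radZ. Qed.
Lemma radB u v : rad u -> rad v -> rad (u - v).
Proof. by move=> h k; apply: radD => //; apply: radN. Qed.
Lemma rad_trans u v w : rad (u - v) -> rad (v - w) -> rad (u - w).
Proof. by move=> h k; have := radD h k; rewrite addrA subrK. Qed.
Lemma rad_sym u v : rad (u - v) -> rad (v - u).
Proof. by move=> h; rewrite -opprB; apply: radN. Qed.
Lemma rad_B u v w : rad (u - v) -> B u w = B v w.
Proof. by move=> h; apply/eqP; rewrite -subr_eq0 -bilNl -bilDl h. Qed.

Lemma root_inI b : wroot b -> exists s, inI m s b.
Proof. by case=> g [s ->]; exists s; apply: inI_ga => //; apply: inI_ev; rewrite comp_refl. Qed.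
Lemma Dg_inI b r s : wroot b -> inI m s b -> Dg b r -> inI m s r.
Proof.
move=> rb bI [rr [w hw]]; have := inI_ga hm w bI.
rewrite hw (root_B hm rb) => h t tI; have := h t tI; rewrite !vecE bI // add0r => /eqP.
by rewrite mulf_eq0 pnatr_eq0 => /eqP.
Qed.
Lemma Dg_cs0 b r : wroot b -> Dg b r -> cs r = 0 -> r = 0.
Proof.
move=> rb h; have [s bI] := root_inI rb; have rI := Dg_inI rb bI h.
have [d [dI dr dp]] := delta_ex hm (haff s); have [x ->] := rad_line hm (haff s) dI dr dp rI (proj1 h).
rewrite csZ => /eqP; rewrite mulf_eq0 => /orP[/eqP ->|]; first by rewrite scale0r.
suff : 0 < cs d by move/gt_eqF ->.
have sI : s \in comp m s by rewrite comp_refl.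
rewrite /cs (bigD1 s) //= ltr_wpDr ?dp //; apply: sumr_ge0 => t _.
by have [tI|/dI ->//] := boolP (t \in comp m s); apply/ltW/dp.
Qed.
Lemma DgZN b r (n : int) r' : Dg b r -> Dg b r' -> Dg b (r' - n%:~R *: r).
Proof. by move=> h h'; apply: DgD => //; apply: DgN => //; apply: DgMz. Qed.
(** The coordinate sum is injective on this group and avoids the open interval from 0 to 1, so
    division with remainder yields a generator. *)
Lemma Dg_cyclic b : wroot b -> exists2 r, Dg b r & forall r', Dg b r' -> exists n : int, r' = n%:~R *: r.
Proof.
move=> rb; have [[r0 [D0 c0]]|no] := pselect (exists r, Dg b r /\ 0 < cs r); last first.
  exists 0; first exact: Dg0.
  move=> r h; exists 0; rewrite scaler0; apply: (Dg_cs0 rb h); apply: contrapT => /eqP; rewrite neq_lt => /orP[k|k].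
    by apply: no; exists (- r); split; [apply: DgN|rewrite csN oppr_gt0].
  by apply: no; exists r.
(* The integer part of the positive sum is minimized: by the gap, subtracting a nonzero remainder
   lowers the sum by at least 1. *)
pose P n := `[< exists r, Dg b r /\ 0 < cs r < n.+1%:R >].
have ex : exists n, P n.
  exists (Num.truncn (cs r0)); apply/asboolP; exists r0; split=> //; rewrite c0 /=.
  by have := truncnS_gt (cs r0).
case: (ex_minnP ex) => n /asboolP [r [Dr /andP[cp cn]]] mn.
exists r => // r' Dr'; pose k := Num.floor (cs r' / cs r); exists k.
have D2 := DgZN k Dr Dr'; set q := r' - _ in D2.
have cq : cs q = cs r' - k%:~R * cs r by rewrite /q csD csN csZ.
have k1 : k%:~R * cs r <= cs r' by rewrite -ler_pdivlMr //; apply: ge_floor.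
have k2 : cs r' < (k + 1)%:~R * cs r by rewrite -ltr_pdivrMr //; apply: lt_succ_floor.
rewrite intrD mulrDl mul1r in k2.
have [q0|q1] := Dg_gap hm rb D2; first by apply/eqP; rewrite -subr_eq0; apply/eqP/(Dg_cs0 rb D2).
rewrite ger0_norm in q1; last by rewrite cq; lra.
have D3 : Dg b (r - q) by apply: DgD => //; apply: DgN.
have c3 : cs (r - q) = cs r - cs q by rewrite csD csN.
case: n cn mn => [|n] cn mn; first by exfalso; lra.
have /mn : P n; last by rewrite ltnn.
apply/asboolP; exists (r - q); split=> //; rewrite c3; move: cn; rewrite -[n.+2]addn1 natrD => cn.
by apply/andP; split; lra.
Qed.
(** Triviality would spread over the component by [Dg_move], so roots in the orbit of a simple root
    would be determined by their classes modulo the radical. Orbits would be finite, against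
    [affine_infinite]. *)
Lemma Dg_neq0 b : wroot b -> exists2 r, Dg b r & r <> 0.
Proof.
move=> rb; apply: contrapT => no; have N0 r : Dg b r -> r = 0.
  by move=> h; apply: contrapT => n; apply: no; exists r.
have prop b1 c : (forall r, Dg b1 r -> r = 0) -> wroot b1 -> B c b1 != 0 -> forall r, Dg c r -> r = 0.
  move=> N1 rb1 n0 r h; have /N1/eqP := Dg_move hm rb1 h.
  by rewrite scaler_eq0 (negPf n0) => /eqP.
have [s bI] := root_inI rb.
have [t tI bt] : exists2 t, t \in comp m s & B (es t) b != 0.
  apply: contrapT => h; have := root_B hm rb; rewrite {1}(inI_sum bI) bil_suml big1 => [/eqP|t tI].
    by rewrite eq_sym pnatr_eq0.
  rewrite bilZl; suff -> : B (es t) b = 0 by rewrite mulr0.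
  by apply: contrapT => /eqP n; apply: h; exists t.
have Nt q : q \in comp m t -> forall r, Dg (es q) r -> r = 0.
  elim/comp_ind => {q} [|p q _ IH pq]; first exact: (prop b).
  apply: (prop (es p)) => //; first exact: root_ev.
  by rewrite bil_evev // aRs lt_eqF // aR_adj.
have [L [Lr hL]] := roots_mod_rad hm haff.
apply: (affine_infinite hm (haff s)); apply: finW => // q qI.
have pick c : exists x : vv, (exists w : W, rad (w ** es q - c)) -> exists2 w : W, x = w ** es q & rad (x - c).
  by have [[w h]|n] := pselect (exists w : W, rad (w ** es q - c)); [exists (w ** es q) => _; exists w|exists 0].
have /boolp.choice [h hh] := pick.
exists [seq h c | c <- L] => w; have [c cL rc] := hL _ (root_ga hm w (root_ev hm q)).
have [w' e rc'] := hh c (ex_intro _ w rc); apply/mapP; exists c => //; rewrite e.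
have r1 : rad (w ** es q - w' ** es q) by rewrite -e; apply: rad_trans rc (rad_sym rc').
apply/eqP; rewrite -subr_eq0; apply/eqP.
have r2 := ga_rad hm w'^-1%g r1; rewrite linearB /= gaK // -gaM // in r2.
apply: (Nt q); first by rewrite (comp_eq hm tI).
rewrite -r2; apply: (Dg_root hm (root_ev hm q)); first by rewrite r2.
by rewrite addrC subrK; apply: root_ga => //; apply: root_ev.
Qed.

(** A real vector space is not a finite union of hyperplanes: the vector is corrected along one root
    after the other by a multiple that avoids finitely many bad values. *)
Lemma generic_ex : exists om, forall b, wroot b -> B b om != 0.
Proof.
have [L [Lr hL]] := roots_mod_rad hm haff.
suff [om h] : exists om, forall b, b \in L -> B b om != 0.
  by exists om => b rb; have [c cL r] := hL b rb; rewrite (rad_B _ r) h.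
elim: {hL} L Lr => [|b L IH] Lr; first by exists 0.
have [|om h] := IH; first by move=> c cL; apply: Lr; rewrite inE cL orbT.
have bb : B b b = 2%:R by apply: root_B => //; apply: Lr; rewrite mem_head.
have [b0|b0] := eqVneq (B b om) 0; last first.
  by exists om => c; rewrite inE => /predU1P[->|/h].
pose bad := (0 : RR) :: [seq - B c om / B c b | c <- L].
have [n nb] : exists n : nat, n%:R \notin bad.
  apply: contrapT => no; apply: (@inj_unbounded _ (fun n : nat => n%:R : RR) bad).
    by move=> i j /eqP; rewrite eqr_nat => /eqP.
  by move=> n; apply: contrapT => /negP k; apply: no; exists n.
exists (om + n%:R *: b) => c; rewrite inE bilDr bilZr => /predU1P[->|cL].
  rewrite b0 add0r bb mulf_neq0 ?pnatr_eq0 //; apply: contraNneq nb => ->; exact: mem_head.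
apply: contraNneq nb => e; rewrite inE; apply/orP; right; apply/mapP; exists c => //.
have c0 : B c b != 0 by apply: contraNneq (h c cL) => c0; rewrite c0 mulr0 addr0 in e; rewrite e.
by apply: (mulIf c0); rewrite divfK //; apply/eqP; rewrite -addr_eq0 addrC e.
Qed.

Section Sys.
Variable om : vv.
(** A system of least size consists of the simple roots of the finite root system modulo the
    radical. *)
Definition Sys l (a : 'I_l -> vv) := (forall i, wroot (a i) /\ 0 < B (a i) om) /\
  forall b, wroot b -> 0 < B b om -> exists c : 'I_l -> RR, (forall i, 0 <= c i) /\ rad (b - \sum_i c i *: a i).
Lemma Sys_ex : exists l (a : 'I_l -> vv), Sys a.
Proof.
have [L [Lr hL]] := roots_mod_rad hm haff; pose Lp := [seq b <- L | 0 < B b om].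
exists (size Lp), (fun i => nth 0 Lp i); split.
  by move=> i; have := mem_nth 0 (ltn_ord i); rewrite mem_filter => /andP[h /Lr].
move=> b rb pb; have [c cL r] := hL b rb.
have cp : c \in Lp by rewrite mem_filter cL andbT -(rad_B _ r).
have ci : (index c Lp < size Lp)%N by rewrite index_mem.
exists (fun i => (i == Ordinal ci)%:R); split; first by move=> i; rewrite ler0n.
rewrite (bigD1 (Ordinal ci)) //= eqxx scale1r nth_index // big1 ?addr0 // => i /negPf ->.
by rewrite scale0r.
Qed.
Lemma Sys_remove l (a : 'I_l.+1 -> vv) i (c : 'I_l.+1 -> RR) : Sys a ->
  (forall j, 0 <= c j) -> c i = 0 -> rad (a i - \sum_j c j *: a j) -> exists a' : 'I_l -> vv, Sys a'.
Proof.
move=> [ar asp] c0 ci r; exists (fun j => a (lift i j)); split=> [j|b rb pb]; first exact: ar.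
have [e [e0 re]] := asp b rb pb.
exists (fun j => e i * c (lift i j) + e (lift i j)); split; first by move=> j; rewrite addr_ge0 ?mulr_ge0.
apply: rad_trans re _; rewrite (bigD1_ord i) //=; move: r; rewrite (bigD1_ord i) //= ci scale0r add0r => r.
under [X in _ - X]eq_bigr => j _ do rewrite scalerDl -scalerA.
rewrite big_split /= -scaler_sumr opprD addrACA subrr addr0 -scalerBr; exact: radZ.
Qed.
End Sys.

(** In a system of least size the angles are obtuse: otherwise reflecting one member in another
    gives a relation that makes a member redundant. Obtuse vectors on one side of a hyperplane are
    independent. *)
Lemma simple_system : exists (om : vv) l (a : 'I_l -> vv), [/\ forall b, wroot b -> B b om != 0, Sys om a &
  forall e : 'I_l -> RR, rad (\sum_i e i *: a i) -> forall i, e i = 0].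
Proof.
have [om omn] := generic_ex; exists om.
have ex : exists l, `[< exists a : 'I_l -> vv, Sys om a >].
  by have [l [a h]] := Sys_ex om; exists l; apply/asboolP; exists a.
case: (ex_minnP ex) => l /asboolP [a sa] mn; exists l, a; split=> //.
have [ar asp] := sa.
have f_sum (e : 'I_l -> RR) : B (\sum_i e i *: a i) om = \sum_i e i * B (a i) om.
  by rewrite bil_suml; apply: eq_bigr => i _; rewrite bilZl.
have nonneg (e : 'I_l -> RR) : (forall k, 0 <= e k) -> rad (\sum_i e i *: a i) -> forall i, e i = 0.
  move=> e0 re i; have := re om; rewrite f_sum => /psumr_eq0P h.
  have /eqP := h (fun j _ => mulr_ge0 (e0 j) (ltW (proj2 (ar j)))) i isT.
  by rewrite mulf_eq0 (gt_eqF (proj2 (ar i))) orbF => /eqP.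
(* A negative coefficient would express the root [a i] through the others, which could then be used
   alone. *)
have one_neg i (e : 'I_l -> RR) : (forall k, k != i -> 0 <= e k) -> rad (\sum_i e i *: a i) -> forall k, e k = 0.
  move=> e0 re; have [ei|ei] := leP 0 (e i).
    by apply: nonneg re => k; have [->//|/e0] := eqVneq k i.
  exfalso; case: l a sa {ex asp f_sum nonneg ar} mn i e e0 re ei => [|l] a sa mn i e e0 re ei; first by case: i {e0 ei}.
  have [|||a' sa'] := @Sys_remove om l a i (fun j => if j == i then 0 else e j / - e i) sa.
  - by move=> j; case: eqVneq => // /e0 h; rewrite divr_ge0 // oppr_ge0 ltW.
  - by rewrite eqxx.
  - move: re; rewrite (bigD1_ord i) //= => /(radZ (- (- e i)^-1)).
    rewrite [X in _ -> rad (_ - X)](bigD1_ord i) //= eqxx scale0r add0r scalerDr scalerA.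
    rewrite mulNr -mulrN mulVf ?oppr_eq0 ?lt_eqF // scale1r scaleNr scaler_sumr.
    congr (rad (_ - _)); apply: eq_bigr => j _; rewrite [lift i j == i]eq_sym (negPf (neq_lift _ _)) scalerA.
    by rewrite mulrC.
  - have : (l.+1 <= l)%N by apply: mn; apply/asboolP; exists a'.
    by rewrite ltnn.
have sumD (e e' : 'I_l -> RR) : \sum_i (e i + e' i) *: a i = \sum_i e i *: a i + \sum_i e' i *: a i.
  by rewrite -big_split; apply: eq_bigr => i _; rewrite scalerDl.
have sum1 x i : \sum_k (x * (k == i)%:R) *: a k = x *: a i.
  by rewrite (bigD1 i) //= eqxx mulr1 big1 ?addr0 // => k /negPf ->; rewrite mulr0 scale0r.
have obt i j : i != j -> B (a i) (a j) <= 0.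
  move=> ij; rewrite leNgt; apply/negP => x0; set x := B _ _ in x0.
  have [ri _] := ar i; have [rj _] := ar j; have [p [_ hp]] := root_refl hm ri.
  pose b := a j - x *: a i; have rb : wroot b by rewrite /b /x -/(rv (aR m) (a i) (a j)) -hp; apply: root_ga.
  have := omn b rb; rewrite neq_lt => /orP[bn|bp].
    have [|e [e0 re]] := asp (- b) (rootN hm rb); first by rewrite bilNl oppr_gt0.
    have h : rad (\sum_k (e k + (- x * (k == i)%:R + 1 * (k == j)%:R)) *: a k).
      rewrite !sumD !sum1 scale1r scaleNr.
      by move/radN: re; rewrite opprB opprK /b [_ - x *: _]addrC.
    have := one_neg i _ _ h j; rewrite eqxx [j == i]eq_sym (negPf ij) mulr0 add0r mulr1 => k.
    have := k _; have := e0 j => e0j k2; have : e j + 1 = 0; last by lra.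
    by apply: k2 => q /negPf ->; rewrite mulr0 add0r mul1r addr_ge0.
  have [e [e0 re]] := asp b rb bp.
  have h : rad (\sum_k (e k + (x * (k == i)%:R + (-1) * (k == j)%:R)) *: a k).
    rewrite !sumD !sum1 scaleN1r.
    by move/radN: re; rewrite opprB /b opprB.
  have k := one_neg j _ _ h i; have e0i := e0 i; have : e i + x = 0; last by lra.
  move: k; rewrite eqxx (negPf ij) mulr0 addr0 mulr1; apply.
  by move=> q /negPf ->; rewrite mulr0 addr0 addr_ge0 // mulr_ge0 // ltW.
move=> e re; pose p i : RR := if 0 <= e i then e i else 0; pose n i : RR := if 0 <= e i then 0 else - e i.
have pE i : e i = p i - n i by rewrite /p /n; case: ifP => _; rewrite ?subr0 // opprK add0r.
have pn i : p i * n i = 0 by rewrite /p /n; case: ifP => _; rewrite ?mul0r ?mulr0.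
have p0 i : 0 <= p i by rewrite /p; case: ifP.
have n0 i : 0 <= n i by rewrite /n; case: ifPn => //; rewrite -ltNge oppr_ge0 => /ltW.
have reE : \sum_i e i *: a i = \sum_i p i *: a i - \sum_i n i *: a i.
  by rewrite -sumrB; apply: eq_bigr => i _; rewrite pE scalerBl.
rewrite reE in re.
have rp : rad (\sum_i p i *: a i).
  apply: (isotropic hm haff); apply/eqP; rewrite eq_le (psd hm haff) andbT.
  rewrite (rad_B _ re) bil_suml; apply: sumr_le0 => i _; rewrite bilZl bil_sumr // mulr_sumr.
  apply: sumr_le0 => j _; rewrite bilZr; have [<-|ij] := eqVneq i j.
    by rewrite mulrA [n i * p i]mulrC pn mul0r.
  by rewrite mulr_ge0_le0 // mulr_ge0_le0 // obt.
have rn : rad (\sum_i n i *: a i) by have := radB rp re; rewrite opprB addrC subrK.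
by move=> i; rewrite pE (nonneg p p0 rp) (nonneg n n0 rn) subr0.
Qed.
End Simple.

(** * The translation lattice of an affine group *)

Definition word (V : finType) (m : V -> V -> nat) l (r : 'I_l -> cox m) (p : seq 'I_l) : cox m :=
  foldr (fun i x => r i * x)%g 1%g p.
(** A semidirect decomposition of W as a lattice by a finite point group: [sec] is the projection
    onto the latter, seen as an endomorphism of W, and [n] consists of Cartan-type integers. *)
Record lattice (V : finType) (m : V -> V -> nat) l (th : 'cV[int]_l -> cox m) (sec : cox m -> cox m)
    (r : 'I_l -> cox m) (n : 'I_l -> 'I_l -> int) : Prop := Lattice {
  lt_hom : forall x y, th (x + y) = (th x * th y)%g;
  lt_inj : injective th;
  lt_sec : hom sec;
  lt_dec : forall w, exists x, w = (th x * sec w)%g;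
  lt_secth : forall x, sec (th x) = 1%g;
  lt_fin : exists L : seq (cox m), forall w, sec w \in L;
  lt_self : forall w, (forall x, (w * th x = th x * w)%g) -> exists y, w = th y;
  lt_r : forall j i, (r j * th (delta_mx i 0) * (r j)^-1)%g = th (delta_mx i 0 - n j i *: delta_mx j 0);
  lt_gen : forall w, exists p, sec w = word r p;
  lt_n2 : forall i, n i i = 2;
  lt_n0 : forall i j, n i j = 0 -> n j i = 0 }.

Section Aff.
Variables (S : finType) (m : S -> S -> nat) (hm : is_cox_graph m).
Local Notation es := (ev RR).
Local Notation "g ** v" := (@ga S m _ (aR m) g v) (at level 40).
Local Notation B := (bil (aR m)).
Local Notation W := (cox m).
Local Notation vv := (vec S RR).
Let aRs := aR_sym hm.
Let aRd := aR_diag m.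
Let aRr := resp_aR hm.
#[local] Hint Resolve aRs aRd aRr hm : core.
Hypothesis haff : forall s, cox_affine_on m (comp m s).
Local Notation rad := (@rad S m).
Local Notation wroot := (@wroot S m).
Local Notation Dg := (@Dg S m).
Variables (om : vv) (l : nat) (a : 'I_l -> vv).
Hypotheses (omn : forall b, wroot b -> B b om != 0) (sa : Sys m om a)
  (ind : forall e : 'I_l -> RR, rad (\sum_i e i *: a i) -> forall i, e i = 0).
Variables (r : 'I_l -> W) (rho : 'I_l -> vv).
Hypotheses (r2 : forall i, (r i * r i = 1)%g) (hr : forall i v, r i ** v = rv (aR m) (a i) v).
Hypotheses (rhoD : forall i, Dg (a i) (rho i)) (rho_gen : forall i r', Dg (a i) r' -> exists n : int, r' = n%:~R *: rho i)
  (rho0 : forall i, rho i <> 0).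
Variable n : 'I_l -> 'I_l -> int.
Hypothesis hn : forall j i, B (a i) (a j) *: rho i = (n j i)%:~R *: rho j.
Let ra i : wroot (a i) := proj1 (proj1 sa i).
Let rhor i : rad (rho i) := proj1 (@rhoD i).
Let Baa i : B (a i) (a i) = 2%:R. Proof. exact: root_B. Qed.
Let eqact (g h : W) : (forall v, g ** v = h ** v) -> g = h.
Proof. by move=> e; apply: (cox_faithful2 hm) => s. Qed.
Let rV i : ((r i)^-1)%g = r i. Proof. by apply: (mulgI (r i)); rewrite mulgV r2. Qed.
Let B_rho u i : B u (rho i) = 0. Proof. by rewrite bilC // rhor. Qed.

Lemma n_diag i : n i i = 2.
Proof.
have /eqP := hn i i; rewrite Baa -subr_eq0 -scalerBl scaler_eq0 => /orP[|/eqP/rho0//].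
by rewrite subr_eq0 (_ : 2%:R = 2%:Z%:~R) // eqr_int => /eqP <-.
Qed.
Lemma n_sym0 i j : n i j = 0 -> n j i = 0.
Proof.
move=> nij; have /eqP := hn i j; rewrite nij scale0r scaler_eq0 => /orP[/eqP b0|/eqP/rho0//].
have /eqP := hn j i; rewrite bilC // b0 scale0r eq_sym scaler_eq0 intr_eq0 => /orP[/eqP//|/eqP/rho0//].
Qed.

Definition tact (x : 'cV[int]_l) (v : vv) : vv := v + \sum_i ((x i 0)%:~R * B (a i) v) *: rho i.
Lemma rad_sum (c : 'I_l -> RR) : rad (\sum_i c i *: rho i).
Proof. by move=> u; rewrite bil_suml big1 // => i _; rewrite bilZl rhor mulr0. Qed.
Lemma th_ex x : exists w : W, forall v, w ** v = tact x v.
Proof.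
suff h (s : seq 'I_l) : exists w : W, forall v, w ** v = v + \sum_(i <- s) ((x i 0)%:~R * B (a i) v) *: rho i.
  by have [w hw] := h (index_enum 'I_l); exists w.
elim: s => [|i s [w hw]]; first by exists 1%g => v; rewrite ga1 // big_nil addr0.
have [_ [w' hw']] := DgMz hm (x i 0) (rhoD i); exists (w * w')%g => v.
rewrite gaM // hw' hw big_cons -addrA; congr (_ + (_ + _)); first by rewrite scalerA mulrC.
by apply: eq_bigr => j _; rewrite bilDr !bilZr B_rho !mulr0 addr0.
Qed.
Definition th x : W := projT1 (cid (th_ex x)).
Lemma thE x v : th x ** v = tact x v. Proof. by rewrite /th; case: cid. Qed.
Lemma th_rad x v : rad (th x ** v - v).
Proof. by rewrite thE /tact addrC addKr; apply: rad_sum. Qed.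
Lemma B_th i x v : B (a i) (th x ** v) = B (a i) v.
Proof. by apply/eqP; rewrite bilC // [B (a i) v]bilC // (rad_B (v := v)) //; apply: th_rad. Qed.
Lemma th_hom x y : th (x + y) = (th x * th y)%g.
Proof.
apply: eqact => v; rewrite gaM // [th x ** _]thE /tact; under [in RHS]eq_bigr => i _ do rewrite B_th.
rewrite !thE /tact -addrA -big_split /=; congr (_ + _); apply: eq_bigr => i _.
by rewrite -scalerDl mxE intrD mulrDl addrC.
Qed.
Lemma th_ker x : th x = 1%g -> x = 0.
Proof.
move=> e; apply/matrixP => i j; rewrite ord1 mxE.
have h t : rad (\sum_i ((x i 0)%:~R * rho i t) *: a i).
  move=> v; rewrite bil_suml; have := thE x v; rewrite e ga1 // /tact => /eqP.
  rewrite eq_sym addrC -subr_eq0 addrK => /eqP /ffunP /(_ t); rewrite vecS ffunE => k.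
  by rewrite -[RHS]k; apply: eq_bigr => k0 _; rewrite bilZl vecE; ring.
have [t rt] : exists t, rho i t != 0.
  apply: contrapT => no; apply: (@rho0 i); apply/ffunP => t; rewrite ffunE.
  by apply: contrapT => /eqP k; apply: no; exists t.
by have /eqP := ind (h t) i; rewrite mulf_eq0 (negPf rt) orbF intr_eq0 => /eqP.
Qed.
Lemma th0 : th 0 = 1%g.
Proof. by have /eqP := th_hom 0 0; rewrite addr0 -{1}[th 0]mulg1 => /eqP /mulgI. Qed.
Lemma th_inj : injective th.
Proof.
move=> x y e; apply/eqP; rewrite -subr_eq0; apply/eqP/th_ker.
by rewrite th_hom e -th_hom subrr th0.
Qed.
Lemma r_th j x : (r j * th x * r j)%g = th (x - (\sum_i n j i * x i 0) *: delta_mx j 0).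
Proof.
apply: eqact => v; rewrite !gaM // !thE /tact linearD /= -gaM // r2 ga1 //.
rewrite (ga_rad hm) //; last exact: rad_sum.
congr (_ + _).
transitivity (\sum_i (((x i 0)%:~R * B (a i) v) *: rho i - ((x i 0)%:~R * B (a j) v * (n j i)%:~R) *: rho j)).
  apply: eq_bigr => i _; rewrite hr /rv bilDr bilNr bilZr mulrBr scalerBl; congr (_ - _).
  by rewrite mulrA -scalerA hn scalerA.
rewrite sumrB -scaler_suml; under [RHS]eq_bigr => i _ do
  rewrite !mxE eqxx andbT intrB mulrBl scalerBl.
rewrite sumrB; congr (_ - _); rewrite [RHS](bigD1 j) //= [in RHS]eqxx mulr1 [X in _ = _ + X]big1 ?addr0; last first.
  by move=> i /negPf ->; rewrite mulr0 mul0r scale0r.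
congr (_ *: _); rewrite rmorph_sum mulr_suml; apply: eq_bigr => i _.
by rewrite rmorphM /=; ring.
Qed.
Lemma word_cat p q : word r (p ++ q) = (word r p * word r q)%g.
Proof. by elim: p => [|i p IH] /=; rewrite ?mul1g // IH mulgA. Qed.
Lemma word_rev p : word r (rev p) = ((word r p)^-1)%g.
Proof.
elim: p => [|i p IH] /=; first by rewrite invg1.
by rewrite rev_cons -cats1 word_cat IH /= mulg1 invMg rV.
Qed.
Lemma word_span p i : exists c : 'I_l -> RR, word r p ** a i = \sum_k c k *: a k.
Proof.
elim: p => [|j p [c IH]] /=.
  exists (fun k => (k == i)%:R); rewrite ga1 // (bigD1 i) //= eqxx scale1r big1 ?addr0 // => k /negPf ->.
  by rewrite scale0r.
exists (fun k => c k - (B (a j) (word r p ** a i)) * (k == j)%:R).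
rewrite gaM // hr /rv {1}IH; under [RHS]eq_bigr => k _ do rewrite scalerBl.
rewrite sumrB; congr (_ - _); rewrite (bigD1 j) //= eqxx mulr1 big1 ?addr0 // => k /negPf ->.
by rewrite mulr0 scale0r.
Qed.
Lemma span_all v : exists c : 'I_l -> RR, rad (v - \sum_k c k *: a k).
Proof.
have h s : exists c : 'I_l -> RR, rad (es s - \sum_k c k *: a k).
  have rs := root_ev hm s; have [_ asp] := sa.
  have := omn rs; rewrite neq_lt => /orP[sn|/(asp _ rs) [c [_ hc]]]; last by exists c.
  have [|c [_ hc]] := asp (- es s) (rootN hm rs); first by rewrite bilNl oppr_gt0.
  exists (fun k => - c k); move/radN: hc; rewrite opprB opprK addrC.
  by under [in X in _ -> rad (_ - X)]eq_bigr => k _ do rewrite scaleNr; rewrite sumrN opprK.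
have /boolp.choice [c hc] := h.
exists (fun k => \sum_s v s * c s k).
have -> : v - \sum_k (\sum_s v s * c s k) *: a k = \sum_s v s *: (es s - \sum_k c s k *: a k).
  rewrite {1}(vec_sum v); under [RHS]eq_bigr => s _ do rewrite scalerBr scaler_sumr.
  rewrite sumrB exchange_big /=; congr (_ - _); apply: eq_bigr => k _.
  by rewrite scaler_suml; apply: eq_bigr => s _; rewrite scalerA.
by move=> u; rewrite bil_suml big1 // => s _; rewrite bilZl hc mulr0.
Qed.
Lemma triv_all (g h : W) : (forall i, rad (g ** a i - h ** a i)) -> forall v, rad (g ** v - h ** v).
Proof.
move=> e v; have [c hc] := span_all v.
have E (k : W) : k ** v = \sum_i c i *: (k ** a i) + (v - \sum_k c k *: a k).
  rewrite -[in LHS](subrK (\sum_k c k *: a k) v) linearD /= (ga_rad hm _ hc) addrC linear_sum.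
  by congr (_ + _); apply: eq_bigr => i _; rewrite linearZ.
rewrite (E g) (E h) opprD addrACA subrr addr0 -sumrB => u.
by rewrite bil_suml big1 // => i _; rewrite -scalerBr bilZl e mulr0.
Qed.
(** A word moves [a i] within the span of the simple roots, where independence modulo the radical
    turns congruence into equality. *)
Lemma word_triv p : (forall i, rad (word r p ** a i - a i)) -> word r p = 1%g.
Proof.
move=> h; have fx i : word r p ** a i = a i.
  have [c hc] := word_span p i; have := h i.
  have -> : word r p ** a i - a i = \sum_k (c k - (k == i)%:R) *: a k.
    under eq_bigr => k _ do rewrite scalerBl; rewrite sumrB -hc; congr (_ - _).
    by rewrite (bigD1 i) //= eqxx scale1r big1 ?addr0 // => k /negPf ->; rewrite scale0r.
  move/ind => z; rewrite hc (bigD1 i) //= big1 ?addr0 => [|k ki].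
    by move: (z i); rewrite eqxx => /eqP; rewrite subr_eq0 => /eqP ->; rewrite scale1r.
  by move: (z k); rewrite (negPf ki) subr0 => ->; rewrite scale0r.
apply: eqact => v; rewrite ga1 //; have [c hc] := span_all v.
rewrite -[v](subrK (\sum_k c k *: a k)) linearD /= (ga_rad hm _ hc); congr (_ + _).
by rewrite linear_sum; apply: eq_bigr => i _; rewrite linearZ /= fx.
Qed.
Lemma word_eq p q : (forall v, rad (word r p ** v - word r q ** v)) -> word r p = word r q.
Proof.
move=> h; apply: (mulgI ((word r q)^-1)%g); rewrite mulVg -word_rev -word_cat; apply: word_triv => i.
rewrite word_cat word_rev gaM //; have := h (a i) => k.
rewrite -{2}[a i](gaK aRr (word r q)) -linearB /= (ga_rad hm _ k); exact: k.
Qed.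
(** Induction on the number of root classes of smaller height. A simple reflection lowers the height
    of a positive root or makes it negative, and in the latter case the root was simple modulo the
    radical. *)
Lemma conj_simple b : wroot b -> exists p i, rad (b - word r p ** a i).
Proof.
have [L [Lr hL]] := roots_mod_rad hm haff.
suff pos c : wroot c -> 0 < B c om -> exists p i, rad (c - word r p ** a i).
  move=> rb; have := omn rb; rewrite neq_lt => /orP[bn|/pos]; last by apply.
  have [||p [i h]] := pos (- b); [exact: rootN|by rewrite bilNl oppr_gt0|].
  exists (p ++ [:: i]), i; rewrite word_cat /= mulg1 gaM // hr rv_self // linearN opprK.
  by move/radN: h; rewrite opprB opprK addrC.
have [k] := ubnP (count (fun x => B x om < B c om) L); elim: k c => // k IH c hk rc cp.
have [c0 [c0p hc]] := proj2 sa c rc cp.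
have cc := root_B hm rc.
have [i bi] : exists i, 0 < B (a i) c.
  apply: contrapT => no; have : B c c <= 0; last by rewrite cc; lra.
  rewrite {1}(rad_B _ hc) bil_suml; apply: sumr_le0 => i _; rewrite bilZl mulr_ge0_le0 //.
  by rewrite leNgt; apply/negP => k0; apply: no; exists i.
have rc' : wroot (r i ** c) by apply: root_ga.
have rE : r i ** c = c - B (a i) c *: a i by rewrite hr.
have fa := proj2 (proj1 sa i).
have := omn rc'; rewrite neq_lt => /orP[cn|cp'].
  have [|e [ep he]] := proj2 sa (- (r i ** c)) (rootN hm rc'); first by rewrite bilNl oppr_gt0.
  have rs : rad (\sum_j (c0 j + e j - B (a i) c * (j == i)%:R) *: a j).
    under eq_bigr => j _ do rewrite scalerBl scalerDl.
    rewrite sumrB big_split /= [X in _ - X](bigD1 i) //= eqxx mulr1 [X in _ - (_ + X)]big1 ?addr0; last first.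
      by move=> j /negPf ->; rewrite mulr0 scale0r.
    move/radN: (radD hc he); rewrite rE !opprD !opprK => h.
    move: h; set A := \sum_i _; set E := \sum_i _; set q := _ *: a i.
    by rewrite (_ : - c + A + (c - q + E) = A + E - q) // [- c + A]addrC -!addrA addKr [- q + E]addrC.
  have z := ind rs; exists [::], i; rewrite /= ga1 //.
  have cj j : j != i -> c0 j = 0.
    by move=> /negPf ji; have := z j; rewrite ji mulr0 subr0 => h; have := c0p j; have := ep j; lra.
  have hc' : rad (c - c0 i *: a i) by move: hc; rewrite (bigD1 i) //= big1 ?addr0 // => j /cj ->; rewrite scale0r.
  have e1 : c0 i ^+ 2 = 1.
    have := cc; rewrite (rad_B _ hc') bilZl bilC // (rad_B _ hc') bilZl Baa => h.
    by apply: (mulIf (x := 2%:R)); rewrite ?pnatr_eq0 // mul1r -[RHS]h; ring.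
  have : c0 i = 1 by have := c0p i; move: e1; set x := c0 i; nra.
  by move=> e2; rewrite e2 scale1r in hc'.
have [|p [j h]] := IH (r i ** c) _ rc' cp'.
  rewrite ltnS in hk; apply: leq_trans hk.
  have [d' dL' rd'] := hL _ rc'.
  have lt : B (r i ** c) om < B c om by rewrite rE bilDl bilNl bilZl gtrDl oppr_lt0 mulr_gt0.
  apply: (@leq_trans (count (fun x => B x om < B (r i ** c) om) L + count (pred1 d') L)).
    by rewrite -addn1 leq_add2l -has_count has_pred1.
  rewrite -count_predUI (_ : count (predI _ _) _ = 0%N) ?addn0.
    apply: sub_count => x /= /orP[|/eqP ->]; first by move/lt_trans; apply.
    by rewrite -(rad_B _ rd').
  apply/eqP; rewrite -leqn0 leqNgt -has_count; apply/hasPn => x _ /=.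
  by rewrite negb_and orbC; have [->|//] := eqVneq x d'; rewrite -(rad_B _ rd') ltxx.
exists (i :: p), j; rewrite /= gaM //; have -> : c = r i ** (r i ** c) by rewrite -gaM // r2 ga1.
by rewrite -linearB /= (ga_rad hm _ h).
Qed.

Local Notation rw := (word r).
Definition thr (w : W) := exists x p, w = (th x * rw p)%g.
Lemma thr_th x w : thr w -> thr (th x * w)%g.
Proof. by case=> y [p ->]; exists (x + y), p; rewrite th_hom mulgA. Qed.
Lemma thr_r j w : thr w -> thr (r j * w)%g.
Proof.
case=> y [p ->]; exists (y - (\sum_i n j i * y i 0) *: delta_mx j 0), (j :: p); rewrite -r_th /= !mulgA.
by rewrite -[(_ * r j * r j)%g]mulgA r2 mulg1.
Qed.
Lemma thr_word p w : thr w -> thr (rw p * w)%g.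
Proof.
move=> h; elim: p => [|i p IH] /=; first by rewrite mul1g.
by rewrite -mulgA; apply: thr_r.
Qed.
(* [q^-1] moves the simple root [e_s] to [a_i] plus a radical vector, so [s] is conjugate to a translation times [r_i]. *)
Lemma thr_all w : thr w.
Proof.
elim/cox_ind: w => [|s w IH]; first by exists 0, [::]; rewrite th0 mul1g.
have [q [i h]] := conj_simple (root_ev hm s).
set rh := es s - _ in h; have rw_inv := ga_rad hm ((rw q)^-1)%g h.
have Dr : Dg (a i) rh.
  apply: (Dg_root hm (ra i) h); have := root_ga hm ((rw q)^-1)%g (root_ev hm s).
  have -> : es s = rw q ** a i + rh by rewrite /rh addrC subrK.
  by rewrite linearD /= gaK // rw_inv.
have [k kE] := rho_gen Dr.
suff -> : sg m s = (rw q * (th (k *: delta_mx i 0) * (r i * rw (rev q))))%g.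
  by rewrite -!mulgA; apply/thr_word/thr_th/thr_r/thr_word.
rewrite word_rev; apply: eqact => v; rewrite ga_sg // refl_rv // !gaM // hr.
set u := (rw q)^-1%g ** v; have -> : v = rw q ** u by rewrite /u gaVK.
have -> : es s = rw q ** (a i + rh) by rewrite linearD /= (ga_rad hm _ h) /rh addrC subrK.
rewrite -ga_rv //; congr (_ ** _); rewrite thE /tact (bigD1 i) //= big1 ?addr0; last first.
  by move=> j /negPf ji; rewrite !mxE ji mulr0 mul0r scale0r.
rewrite !mxE !eqxx mulr1 /rv bilDl h addr0 -addrA; congr (_ + _).
rewrite bilDr bilNr bilZr Baa; set x := B (a i) u.
rewrite (_ : k%:~R * (x - x * 2%:R) = - x * k%:~R); last by ring.
by rewrite -scalerA -kE scaleNr scalerDr opprD.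
Qed.
Lemma sec_ex w : exists p, exists x, w = (th x * rw p)%g.
Proof. by have [x [p e]] := thr_all w; exists p, x. Qed.
Definition secw w := projT1 (cid (sec_ex w)).
Definition sec w := rw (secw w).
Lemma sec_dec w : exists x, w = (th x * sec w)%g.
Proof. by rewrite /sec /secw; case: cid. Qed.
Lemma sec_rad w v : rad (sec w ** v - w ** v).
Proof. by have [x {2}->] := sec_dec w; rewrite gaM // -opprB; apply/radN/th_rad. Qed.
Lemma rad_ga (w : W) u v : rad (u - v) -> rad (w ** u - w ** v).
Proof. by move=> h; rewrite -linearB /= (ga_rad hm _ h). Qed.
Lemma sec_uniq w p : (forall i, rad (w ** a i - rw p ** a i)) -> sec w = rw p.
Proof.
move=> h; apply: word_eq => v; apply: (rad_trans (sec_rad w v)); exact: triv_all.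
Qed.
Lemma sec_hom : hom sec.
Proof.
move=> w w'; rewrite {2 3}/sec -word_cat; apply: sec_uniq => i; rewrite word_cat !gaM //.
rewrite -/(sec w) -/(sec w'); apply: (rad_trans (v := w ** (sec w' ** a i))).
  by apply: rad_ga; apply/rad_sym/sec_rad.
by apply/rad_sym/sec_rad.
Qed.
Lemma sec_th x : sec (th x) = 1%g.
Proof. by apply: (sec_uniq (p := [::])) => i; rewrite /= ga1 //; apply: th_rad. Qed.
Lemma sec_fin : exists L : seq W, forall w, sec w \in L.
Proof.
have [L [Lr hL]] := roots_mod_rad hm haff.
have ex w i : exists c : 'I_(size L), rad (w ** a i - nth 0 L c).
  have [c cL rc] := hL _ (root_ga hm w (ra i)).
  have ci : (index c L < size L)%N by rewrite index_mem.
  by exists (Ordinal ci); rewrite /= nth_index.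
pose P w (f : {ffun 'I_l -> 'I_(size L)}) := forall i, rad (w ** a i - nth 0 L (f i)).
have exf w : exists f, P w f.
  have /fin_all_exists [f hf] := ex w; exists [ffun i => f i] => i; by rewrite ffunE.
have pick f : exists g : W, forall w, P w f -> P g f.
  by have [[w h]|no] := pselect (exists w, P w f); [exists w|exists 1%g => w h; case: no; exists w].
have /fin_all_exists [g hg] := pick.
exists [seq sec (g f) | f <- enum {: {ffun 'I_l -> 'I_(size L)}}] => w; have [f hf] := exf w.
apply/mapP; exists f; first by rewrite mem_enum.
apply: sec_uniq => i; apply: (rad_trans (v := g f ** a i)); last exact/rad_sym/sec_rad.
exact: (rad_trans (hf i) (rad_sym (hg f w hf i))).
Qed.
(** Commuting with the translation along [a i] means that [w] preserves the functional B(a_i, .), so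
    it fixes [a i] modulo the radical. *)
Lemma sec_self w : (forall x, (w * th x = th x * w)%g) -> exists y, w = th y.
Proof.
move=> h; have [x xE] := sec_dec w; exists x.
suff e : sec w = 1%g by rewrite {1}xE e mulg1.
apply: (sec_uniq (p := [::])) => i; rewrite /= ga1 // => v.
have /(congr1 (fun g => g ** (w^-1%g ** v))) := h (delta_mx i 0).
rewrite !gaM // gaVK // !thE /tact (bigD1 i) //= big1 ?addr0; last first.
  by move=> j /negPf ji; rewrite !mxE ji mul0r scale0r.
rewrite [in RHS](bigD1 i) //= [in RHS]big1 ?addr0; last first.
  by move=> j /negPf ji; rewrite !mxE ji mul0r scale0r.
rewrite linearD /= gaVK // linearZ /= (ga_rad hm _ (rhor i)) => /addrI.
rewrite mxE !eqxx !mul1r => /eqP; rewrite -subr_eq0 -scalerBl scaler_eq0 => /orP[|/eqP/rho0//].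
rewrite subr_eq0 => /eqP e; rewrite bilDl bilNl -e -(bil_ga aRs aRd w (a i)) gaVK // subrr.
by [].
Qed.
Lemma lattice_th : lattice th sec r n.
Proof.
split.
- exact: th_hom.
- exact: th_inj.
- exact: sec_hom.
- exact: sec_dec.
- exact: sec_th.
- exact: sec_fin.
- exact: sec_self.
- move=> j i; rewrite rV r_th; congr (th (_ - _ *: _)); rewrite (bigD1 i) //= big1 ?addr0.
    by rewrite mxE !eqxx mulr1.
  by move=> k /negPf ki; rewrite mxE ki mulr0.
- by move=> w; exists (secw w).
- exact: n_diag.
- exact: n_sym0.
Qed.
End Aff.

Section AffLattice.
Variables (S : finType) (m : S -> S -> nat) (hm : is_cox_graph m).
Hypothesis haff : forall s, cox_affine_on m (comp m s).
Theorem aff_lattice : exists l (th : 'cV[int]_l -> cox m) sec (r : 'I_l -> cox m) n, lattice th sec r n.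
Proof.
have [om [l [a [omn sa ind]]]] := simple_system hm haff.
have ra i := proj1 (proj1 sa i).
have /fin_all_exists [r hr] i := root_refl hm (ra i).
have h i : exists rho, [/\ Dg m (a i) rho, rho <> 0 & forall r', Dg m (a i) r' -> exists n : int, r' = n%:~R *: rho].
  have [rho D g] := Dg_cyclic hm haff (ra i); exists rho; split=> // r0.
  have [r1 D1 n1] := Dg_neq0 hm haff (ra i); apply: n1; have [k ->] := g _ D1.
  by rewrite r0 scaler0.
have /fin_all_exists [rho hrho] := h.
have hn j i : exists k : int, bil (aR m) (a i) (a j) *: rho i = k%:~R *: rho j.
  have [D _ _] := hrho i; have [_ _ g] := hrho j; apply: g; exact: Dg_move.
have /fin_all_exists [n nE] : forall j, exists n, forall i, bil (aR m) (a i) (a j) *: rho i = (n i)%:~R *: rho j.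
  by move=> j; have /fin_all_exists [n hn'] := hn j; exists n.
have D i : Dg m (a i) (rho i) by case: (hrho i).
have r0 i : rho i <> 0 by case: (hrho i).
have g i r' : Dg m (a i) r' -> exists n : int, r' = n%:~R *: rho i by case: (hrho i) => _ _; apply.
eexists; eexists; eexists; eexists; eexists.
exact: (@lattice_th S m hm haff om l a omn sa ind r rho (fun i => proj1 (hr i)) (fun i => proj2 (hr i)) D g r0 n nE).
Qed.
End AffLattice.

(** * Profinite isomorphisms between affine groups *)

Section ColExt.
Variables (l : nat) (H : groupType) (f g : 'cV[int]_l -> H).
Hypotheses (fD : forall x y, f (x + y) = (f x * f y)%g) (gD : forall x y, g (x + y) = (g x * g y)%g).
Hypothesis fg : forall i, f (delta_mx i 0) = g (delta_mx i 0).
Lemma col_sum (x : 'cV[int]_l) : x = \sum_i x i 0 *: delta_mx i 0.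
Proof.
apply/matrixP => a b; rewrite ord1 summxE (bigD1 a) //= big1 => [|i ia].
  by rewrite !mxE !eqxx mulr1 addr0.
by rewrite !mxE eq_sym (negPf ia) mulr0.
Qed.
Lemma col_ext x : f x = g x.
Proof.
have f0 (h : 'cV[int]_l -> H) : (forall x y, h (x + y) = (h x * h y)%g) -> h 0 = 1%g.
  by move=> hD; apply: (mulgI (h 0)); rewrite -hD addr0 mulg1.
have fN (h : 'cV[int]_l -> H) y : (forall x y, h (x + y) = (h x * h y)%g) -> h (- y) = ((h y)^-1)%g.
  by move=> hD; apply: (mulgI (h y)); rewrite -hD subrr f0 // mulgV.
rewrite (col_sum x); elim/big_ind: _ => [|y z hy hz|i _]; first by rewrite !f0.
  by rewrite fD gD hy hz.
have nat_case (k : nat) : f (k%:Z *: delta_mx i 0) = g (k%:Z *: delta_mx i 0).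
  elim: k => [|k IH]; first by rewrite scale0r !f0.
  have -> : k.+1%:Z = k%:Z + 1 by rewrite -addn1 PoszD.
  by rewrite scalerDl scale1r fD gD IH fg.
case: (x i 0) => k; first exact: nat_case.
by rewrite NegzE scaleNr !fN // nat_case.
Qed.
End ColExt.

Section HatLat.
Variables (V : finType) (m : V -> V -> nat).
Variables (l : nat) (th : 'cV[int]_l -> cox m) (sec : cox m -> cox m)
    (r : 'I_l -> cox m) (n : 'I_l -> 'I_l -> int).
Hypothesis L : lattice th sec r n.
Let thD := lt_hom L.
Lemma lth0 : th 0 = 1%g.
Proof. by apply: (mulgI (th 0)); rewrite -thD addr0 mulg1. Qed.
Lemma lthN x : th (- x) = ((th x)^-1)%g.
Proof. by apply: (mulgI (th x)); rewrite -thD subrr lth0 mulgV. Qed.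
Lemma lthZ (k : nat) x : th (k%:Z *: x) = (th x ^+ k)%g.
Proof.
elim: k => [|k IH]; first by rewrite scale0r lth0 expg0.
have -> : k.+1%:Z = k%:Z + 1 by rewrite -addn1 PoszD.
by rewrite scalerDl scale1r thD IH expgSr.
Qed.
Lemma lsec1 : sec 1%g = 1%g. Proof. exact: hom1 (lt_sec L). Qed.
Lemma lsec_th w : sec w = 1%g -> exists x, w = th x.
Proof. by move=> e; have [x ->] := lt_dec L w; exists x; rewrite e mulg1. Qed.
Lemma lsec_idem w : sec (sec w) = sec w.
Proof. by have [x {2}->] := lt_dec L w; rewrite (lt_sec L) (lt_secth L) mul1g. Qed.
Lemma conj_ex w x : exists y, (w * th x * w^-1)%g = th y.
Proof. by apply: lsec_th; rewrite !(lt_sec L) (lt_secth L) mulg1 -(lt_sec L) mulgV lsec1. Qed.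
Definition cj w x := projT1 (cid (conj_ex w x)).
Lemma cjE w x : (w * th x * w^-1)%g = th (cj w x). Proof. by rewrite /cj; case: cid. Qed.
Definition Rm w : 'M[int]_l := \matrix_(a, i) cj w (delta_mx i 0) a 0.
Lemma RmE w x : (w * th x * w^-1)%g = th (Rm w *m x).
Proof.
apply: (@col_ext l (cox m) (fun x => w * th x * w^-1)%g (fun x => th (Rm w *m x))).
- by move=> y z; rewrite thD !mulgA mulgVK.
- by move=> y z; rewrite mulmxDr thD.
move=> i; rewrite cjE; congr (th _); apply/matrixP => a b.
by rewrite -colE !mxE ord1.
Qed.
Lemma RmU w (A : 'M[int]_l) : (forall x, (w * th x * w^-1)%g = th (A *m x)) -> Rm w = A.
Proof.
move=> h; apply/matrixP => a i.
have /(lt_inj L) /matrixP /(_ a 0) := etrans (esym (RmE w (delta_mx i 0))) (h _).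
by rewrite -!colE !mxE.
Qed.
Lemma RmM w w' : Rm (w * w')%g = Rm w *m Rm w'.
Proof. by apply: RmU => x; rewrite invMg -mulmxA -!RmE !mulgA. Qed.
Lemma Rm1 : Rm 1%g = 1%:M.
Proof. by apply: RmU => x; rewrite mul1mx invg1 mulg1 mul1g. Qed.
Lemma Rm_th x : Rm (th x) = 1%:M.
Proof. by apply: RmU => y; rewrite -lthN -!thD mul1mx addrAC subrr add0r. Qed.
Lemma Rm_sec w : Rm (sec w) = Rm w.
Proof. by have [x {2}->] := lt_dec L w; rewrite RmM Rm_th mul1mx. Qed.
Lemma Rm_eq1 w : Rm w = 1%:M -> exists x, w = th x.
Proof.
move=> h; apply: (lt_self L) => x; have e := RmE w x; rewrite h mul1mx in e.
by rewrite -[in RHS]e mulgVK.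
Qed.

Definition NTl : fincong m := kfc (lt_sec L) (lt_fin L).
Lemma NTlP x y : proj NTl x = proj NTl y <-> sec x = sec y. Proof. exact: kfcP. Qed.
Lemma NTl1 x : proj NTl x = 1%g <-> sec x = 1%g.
Proof. by rewrite -(hom1 (proj_hom NTl)) NTlP lsec1. Qed.
Section Level.
Variable k : nat.
(** The level of the sublattice (k+1) T; the successor keeps the modulus nonzero. *)
Definition rK (x y : cox m) := exists z, y = (x * th (k.+1%:Z *: z))%g.
Lemma rK_refl x : rK x x. Proof. by exists 0; rewrite scaler0 lth0 mulg1. Qed.
Lemma rK_sym x y : rK x y -> rK y x.
Proof. by case=> z ->; exists (- z); rewrite scalerN lthN mulgK. Qed.
Lemma rK_trans x y z : rK x y -> rK y z -> rK x z.
Proof. by case=> u -> [v ->]; exists (u + v); rewrite scalerDr thD mulgA. Qed.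
Lemma rK_mul a b c d : rK a b -> rK c d -> rK (a * c)%g (b * d)%g.
Proof.
case=> u -> [v ->]; exists (Rm c^-1%g *m u + v).
rewrite scalerDr thD scalemxAr -RmE invgK -!mulgA; congr (_ * _)%g.
by rewrite !mulgA mulgV mul1g.
Qed.
Lemma rK_fin : exists s : seq (cox m), forall x, exists2 y, y \in s & rK x y.
Proof.
have [s hs] := lt_fin L.
pose mk (f : {ffun 'I_l -> 'I_k.+1}) (w : cox m) := (th (\col_i (f i : nat)%:Z) * w)%g.
exists [seq mk f w | f <- enum {: {ffun 'I_l -> 'I_k.+1}}, w <- s] => x.
have [z zE] := lt_dec L x.
pose f : {ffun 'I_l -> 'I_k.+1} := [ffun i => inord `|(z i 0%R %% k.+1%:Z)%Z|].
exists (mk f (sec x)); first by apply: allpairs_f => //; rewrite mem_enum.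
apply: rK_sym; pose q : 'cV[int]_l := \col_i (z i 0%R %/ k.+1%:Z)%Z.
set sx := sec x in zE *; rewrite [X in rK _ X]zE /mk.
have -> : z = \col_i (f i : nat)%:Z + k.+1%:Z *: q.
  apply/matrixP => i j; rewrite !mxE ord1 ffunE inordK.
    by rewrite gez0_abs ?modz_ge0 // [RHS]addrC mulrC -divz_eq.
  by rewrite -ltz_nat gez0_abs ?modz_ge0 // ltz_pmod.
exists (Rm sx^-1%g *m q); rewrite scalemxAr -RmE invgK thD -!mulgA; congr (_ * _)%g.
by rewrite !mulgA mulgV mul1g.
Qed.
Definition Kl : fincong m := mkfc rK_refl rK_sym rK_trans rK_mul rK_fin.
Lemma KlP x y : proj Kl x = proj Kl y <-> rK x y. Proof. exact: mkfcP. Qed.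
Lemma Kl_th x y : proj Kl (th x) = proj Kl (th y) <-> cmod k.+1 y x.
Proof.
rewrite KlP; split=> [[z]|[z ->]]; first by rewrite -thD => /(lt_inj L) ->; exists z.
by exists z; rewrite thD.
Qed.
Lemma Kl_sub : projsub Kl NTl.
Proof.
by apply/projsubP => x y /KlP [z ->]; apply/NTlP; rewrite (lt_sec L) (lt_secth L) mulg1.
Qed.
End Level.
(** The order of W/N times any lattice vector is trivial in W/N. *)
Lemma Kl_cofinal (N : fincong m) j : exists k, projsub (Kl k) N /\ (j.+1 %| k.+1)%N.
Proof.
have G0 : (0 < #|[set: fq N]|)%N by exact: cardG_gt0.
exists (#|[set: fq N]| * j.+1).-1; rewrite prednK ?muln_gt0 ?G0 // dvdn_mull //; split=> //.
apply/projsubP => x y /KlP [z ->]; rewrite prednK ?muln_gt0 ?G0 //.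
rewrite lthZ proj_hom (homX (proj_hom N)) expgM.
have -> : (proj N (th z) ^+ #|[set: fq N]| = 1)%g by rewrite expg_cardG ?inE.
by rewrite expg1n mulg1.
Qed.

(** The closure of the translation lattice in the completion. *)
Definition hatT (x : prof m) := pv x NTl = 1%g.
Lemma hatT_approx x k M : hatT x -> exists z, pv x (Kl k) = proj (Kl k) (th z) /\ pv x M = proj M (th z).
Proof.
move=> hx; have [w [e1 e2]] := approx2 x (Kl k) M.
have : proj NTl w = 1%g by rewrite -(pvP (@Kl_sub k) e1).
by move/NTl1/lsec_th => [z zE]; exists z; rewrite -zE.
Qed.
Lemma hatT_th z : hatT (iota (th z)).
Proof. by apply/NTl1; rewrite (lt_secth L). Qed.
Lemma hatT_comm x y : hatT x -> hatT y -> (x * y = y * x)%g.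
Proof.
move=> hx hy; apply: pv_ext => N; rewrite !pvM.
have [z [_ ->]] := hatT_approx 0 N hx; have [z' [_ ->]] := hatT_approx 0 N hy.
by rewrite -!proj_hom -!thD addrC.
Qed.
(** If e z vanishes modulo (k+1) e, then z vanishes modulo k+1; so [x] is examined at the level
    multiplied by its exponent. *)
Lemma hatT_torsion x e : (0 < e)%N -> hatT x -> (x ^+ e = 1)%g -> x = 1%g.
Proof.
case: e => // e _ hx xe; apply: pv_ext => N; rewrite pv1.
have [k [kN _]] := Kl_cofinal N 0.
pose j := (k.+1 * e.+1).-1; have jE : j.+1 = (k.+1 * e.+1)%N by [].
have [z [e1 e2]] := hatT_approx j N hx; rewrite e2.
have : proj (Kl j) (th (e.+1%:Z *: z)) = proj (Kl j) (th 0).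
  rewrite lth0 lthZ (homX (proj_hom _)) -e1 (hom1 (proj_hom _)).
  by rewrite -pvX xe pv1.
move/Kl_th => [C]; rewrite jE PoszM mulrC => eC.
have zE : z = k.+1%:Z *: (- C).
  have n0 : (e.+1%:Z : int) != 0 by [].
  apply: (zscaleI n0); rewrite scalerA scalerN; apply/eqP; rewrite -addr_eq0; apply/eqP; by rewrite -eC.
rewrite -(hom1 (proj_hom N)) -lth0; apply: (projsubP _ _).1 kN _ _ _.
by apply/Kl_th; exists C; rewrite zE scalerN addNr.
Qed.
(** At level [k] the matrix of a representative is 1 modulo k+1. Only finitely many matrices occur,
    so a [k] that bounds all their deviations from 1 forces equality. *)
Lemma hatT_self x : (forall z, x * iota (th z) = iota (th z) * x)%g -> hatT x.
Proof.
move=> h; have [s hs] := lt_fin L.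
pose b w := (\sum_i \sum_j absz ((Rm w - 1%:M)%R i j))%N; pose k := (\sum_(w <- s) b w)%N.
have [u [e1 e2]] := approx2 x (Kl k) NTl; rewrite /hatT e2; apply/NTl1.
have bu : (b u <= k)%N.
  have -> : b u = b (sec u) by rewrite /b Rm_sec.
  by rewrite /k (big_rem _ (hs u)) leq_addr.
have [y ->] : exists y, u = th y; last exact: lt_secth L y.
apply: Rm_eq1; apply/matrixP => i j; apply/eqP; rewrite -subr_eq0.
have /Kl_th [C eC] : proj (Kl k) (th (delta_mx j 0)) = proj (Kl k) (th (Rm u *m delta_mx j 0)).
  rewrite -RmE !proj_hom (homV (proj_hom _)) -e1 -[proj (Kl k) (th _)]/(pv (iota (th _)) (Kl k)).
  by rewrite -pvM h pvM mulgK.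
have d : (k.+1%:Z %| (Rm u - 1%:M) i j)%Z.
  move/matrixP/(_ i 0): eC; rewrite -colE !mxE andbT => ->.
  by rewrite [X in X - _]addrC addrK dvdz_mulr.
have bd : (absz ((Rm u - 1%:M)%R i j) <= k)%N.
  by apply: leq_trans bu; rewrite /b (bigD1 i) //= (bigD1 j) //= -addnA leq_addr.
have -> : Rm u i j - 1%:M i j = (Rm u - 1%:M) i j by rewrite !mxE.
rewrite -absz_eq0; apply: contraTT bd; rewrite -lt0n -ltnNge => h0.
by apply: dvdn_leq.
Qed.
End HatLat.

(** * Isomorphisms of completions preserve the completed lattices *)

Section FT.
Variables (V1 V2 : finType) (m1 : V1 -> V1 -> nat) (m2 : V2 -> V2 -> nat).
Variables (l1 l2 : nat) (th1 : 'cV[int]_l1 -> cox m1) (sec1 : cox m1 -> cox m1)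
    (r1 : 'I_l1 -> cox m1) (n1 : 'I_l1 -> 'I_l1 -> int).
Variables (th2 : 'cV[int]_l2 -> cox m2) (sec2 : cox m2 -> cox m2)
    (r2 : 'I_l2 -> cox m2) (n2 : 'I_l2 -> 'I_l2 -> int).
Hypotheses (L1 : lattice th1 sec1 r1 n1) (L2 : lattice th2 sec2 r2 n2).
Variables (F : prof m1 -> prof m2) (F' : prof m2 -> prof m1).
Hypotheses (hF : hom F) (cF : cts F) (FK : cancel F F') (FK' : cancel F' F).
Let hF' := inv_hom hF FK FK'.
(** The commutator [c] of w = F x with a translation lies in the closed lattice and commutes with
    [w], so w^q y = c^q y w^q. Some power of [w] lies in the closed lattice, which makes a power of
    [c] trivial; there is no torsion, so [w] centralizes the lattice. *)
Lemma FT x : hatT L1 x -> hatT L2 (F x).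
Proof.
move=> hx; set w := F x; apply: hatT_self => z; set y := iota (th2 z).
pose c := (w * y * w^-1 * y^-1)%g.
have hc : hatT L2 c.
  by rewrite /hatT !pvM !pvV (hatT_th L2) mulg1 invg1 mulg1 mulgV.
have cw : (w * c = c * w)%g.
  apply: (can_inj FK'); rewrite !hF' /w FK; apply: (hatT_comm hx).
  by rewrite /hatT !(homV hF') FK !pvM !pvV hx mul1g invg1 mulg1 mulgV.
have e : (w * y = c * y * w)%g by rewrite /c !mulgVK.
have eX q : (w ^+ q * y = c ^+ q * y * w ^+ q)%g.
  elim: q => [|q IH]; first by rewrite !expg0 !mul1g mulg1.
  rewrite expgS -mulgA IH !mulgA.
  have -> : (w * c ^+ q = c ^+ q * w)%g.
    by elim: q {IH} => [|q IH]; rewrite ?expg0 ?mul1g ?mulg1 // !expgS mulgA cw -!mulgA IH.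
  by rewrite -[(c ^+ q * w * y)%g]mulgA e (expgSr c) !mulgA.
pose E := #|[set: fq (NTl L2)]|; have E0 : (0 < E)%N by exact: cardG_gt0.
have hE : hatT L2 (w ^+ E)%g by rewrite /hatT pvX expg_cardG ?inE.
have cE : (c ^+ E = 1)%g.
  have := eX E; rewrite (hatT_comm hE (hatT_th L2 z)) => /mulIg; rewrite -/y => k.
  by apply: (mulIg y); rewrite mul1g.
by rewrite e (hatT_torsion E0 hc cE) mul1g.
Qed.
(** At a level fine enough for continuity, [x] is the (k+1)-st power of a translation, and [F]
    preserves powers. *)
Lemma FK_level k x : pv x (Kl L1 k) = 1%g -> pv (F x) (Kl L2 k) = 1%g.
Proof.
move=> hx; have hT : hatT L1 x by rewrite /hatT -(hom1 (proj_hom (NTl L1))); apply: (pvP (@Kl_sub _ _ _ _ _ _ _ L1 k)); rewrite hx (hom1 (proj_hom _)).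
have [N1 hN1] := cts_eq hF cF (Kl L2 k).
have [z [e1 e2]] := hatT_approx k N1 hT.
have /Kl_th [C zE] : proj (Kl L1 k) (th1 0) = proj (Kl L1 k) (th1 z).
  by rewrite -e1 hx (lth0 L1) (hom1 (proj_hom _)).
rewrite add0r in zE.
rewrite (hN1 x (iota (th1 C) ^+ k.+1)%g); last by rewrite e2 zE (lthZ L1) pvX (homX (proj_hom _)).
rewrite (homX hF) pvX; have [z' [-> _]] := hatT_approx k (NTl L2) (FT (hatT_th L1 C)).
rewrite -(homX (proj_hom _)) -(lthZ L2) -(hom1 (proj_hom (Kl L2 k))) -(lth0 L2).
by apply/Kl_th; exists (- z'); rewrite scalerN subrr.
Qed.
End FT.
Arguments FT {V1 V2 m1 m2 l1 l2 th1 sec1 r1 n1 th2 sec2 r2 n2} L1 L2 {F F'} hF FK FK' [x].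
Arguments FK_level {V1 V2 m1 m2 l1 l2 th1 sec1 r1 n1 th2 sec2 r2 n2} L1 L2 {F F'} hF cF FK FK' [k x].

Section LatIso.
Variables (V1 V2 : finType) (m1 : V1 -> V1 -> nat) (m2 : V2 -> V2 -> nat).
Variables (l1 l2 : nat) (th1 : 'cV[int]_l1 -> cox m1) (sec1 : cox m1 -> cox m1)
    (r1 : 'I_l1 -> cox m1) (n1 : 'I_l1 -> 'I_l1 -> int).
Variables (th2 : 'cV[int]_l2 -> cox m2) (sec2 : cox m2 -> cox m2)
    (r2 : 'I_l2 -> cox m2) (n2 : 'I_l2 -> 'I_l2 -> int).
Hypotheses (L1 : lattice th1 sec1 r1 n1) (L2 : lattice th2 sec2 r2 n2).
Variables (F : prof m1 -> prof m2) (F' : prof m2 -> prof m1).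
Hypotheses (hF : hom F) (cF : cts F) (FK : cancel F F') (FK' : cancel F' F).
Let hF' := inv_hom hF FK FK'.
Let cF' := inv_cts hF cF FK FK'.
Let N1 := NTl L1. Let N2 := NTl L2.
Let FT1 := FT L1 L2 hF FK FK'.
Let FT2 := FT L2 L1 hF' FK' FK.
Let f_ex w : exists u, pv (F (iota w)) N2 = proj N2 u. Proof. exact: approx. Qed.
Let f w := projT1 (cid (f_ex w)).
Let fE w : pv (F (iota w)) N2 = proj N2 (f w). Proof. by rewrite /f; case: cid. Qed.
Let f_mul w w' : sec2 (f (w * w')%g) = (sec2 (f w) * sec2 (f w'))%g.
Proof.
rewrite -(lt_sec L2); apply/(NTlP L2); rewrite -/N2 -fE iota_hom hF pvM !fE.
by rewrite proj_hom.
Qed.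
Let f_th z : sec2 (f (th1 z)) = 1%g.
Proof. by apply/(NTl1 L2); rewrite -/N2 -fE; apply: FT1; apply: hatT_th. Qed.
Let f_sec w : sec2 (f (sec1 w)) = sec2 (f w).
Proof. by have [x {2}->] := lt_dec L1 w; rewrite f_mul f_th mul1g. Qed.
Let rp (q : fq N1) : cox m1 := projT1 (cid (proj_surj q)).
Let rpE q : proj N1 (rp q) = q. Proof. by rewrite /rp; case: cid. Qed.
Let R1 q := Rm L1 (rp q).
Let R2 q := Rm L2 (f (rp q)).
Let R1E w : R1 (proj N1 w) = Rm L1 w.
Proof. by rewrite /R1 -Rm_sec -[RHS]Rm_sec; congr (Rm _ _); apply/(NTlP L1); rewrite -/N1 rpE. Qed.
Let R2E w : R2 (proj N1 w) = Rm L2 (f w).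
Proof.
rewrite /R2 -Rm_sec -[RHS]Rm_sec; congr (Rm _ _); rewrite -f_sec -[RHS]f_sec; congr (sec2 (f _)).
by apply/(NTlP L1); rewrite -/N1 rpE.
Qed.
Let R2fM w w' : Rm L2 (f (w * w')%g) = Rm L2 (f w) *m Rm L2 (f w').
Proof. by rewrite -Rm_sec f_mul RmM !Rm_sec. Qed.
Let R1M q q' : R1 (q * q')%g = R1 q *m R1 q'.
Proof. by rewrite -(rpE q) -(rpE q') -proj_hom !R1E RmM. Qed.
Let R2M q q' : R2 (q * q')%g = R2 q *m R2 q'.
Proof. by rewrite -(rpE q) -(rpE q') -proj_hom !R2E R2fM. Qed.
Let R11 : R1 1%g = 1%:M. Proof. by rewrite -(hom1 (proj_hom N1)) R1E Rm1. Qed.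
Let R21 : R2 1%g = 1%:M.
Proof. by rewrite -(hom1 (proj_hom N1)) R2E -Rm_sec -(lth0 L1) f_th Rm1. Qed.
Let R1r j i : R1 (proj N1 (r1 j)) *m delta_mx i 0 = delta_mx i 0 - n1 j i *: delta_mx j 0 :> 'cV_l1.
Proof. by rewrite R1E; apply: (lt_inj L1); rewrite -RmE (lt_r L1). Qed.

Lemma cmod_cols N p q (A B : 'M[int]_(p, q)) :
  (forall i, cmod N (A *m delta_mx i 0 : 'cV_p) (B *m delta_mx i 0)) -> cmod N A B.
Proof.
move=> h; have /fin_all_exists [C hC] : forall i, exists C : 'cV_p, A *m delta_mx i 0 = B *m delta_mx i 0 + N%:Z *: C by [].
exists (\matrix_(a, i) C i a 0); apply/matrixP => a i.
by move/matrixP/(_ a 0): (hC i); rewrite -!colE !mxE.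
Qed.
Let HX N : (0 < N)%N -> exists X : 'M[int]_(l2, l1),
  [/\ forall g, cmod N (R2 g *m X) (X *m R1 g),
      forall v : 'cV_l1, cmod N (X *m v) 0 -> cmod N v 0 &
      forall v' : 'cV_l2, exists v, cmod N v' (X *m v)].
Proof.
case: N => // k _.
have hx i : exists c, pv (F (iota (th1 (delta_mx i 0)))) (Kl L2 k) = proj (Kl L2 k) (th2 c).
  by have [c [e _]] := hatT_approx k N2 (FT1 (hatT_th L1 (delta_mx i 0))); exists c.
have /fin_all_exists [c hc] := hx.
pose X : 'M[int]_(l2, l1) := \matrix_(a, i) c i a 0; exists X.
have XE z : pv (F (iota (th1 z))) (Kl L2 k) = proj (Kl L2 k) (th2 (X *m z)).
  apply: (@col_ext l1 (fq (Kl L2 k)) (fun z => pv (F (iota (th1 z))) (Kl L2 k)) (fun z => proj (Kl L2 k) (th2 (X *m z)))).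
  - by move=> x y; rewrite (lt_hom L1) iota_hom hF pvM.
  - by move=> x y; rewrite mulmxDr (lt_hom L2) proj_hom.
  move=> i; rewrite hc; congr (proj _ (th2 _)); apply/matrixP => a b.
  by rewrite -colE !mxE ord1.
split=> [g|v h|v'].
- rewrite -(rpE g) R1E R2E; set w := rp g; apply: cmod_cols => i; rewrite -!mulmxA.
  have [u [e1 e2]] := approx2 (F (iota w)) (Kl L2 k) N2.
  have su : sec2 u = sec2 (f w) by apply/(NTlP L2); rewrite -/N2 -e2 fE.
  apply/(Kl_th L2); rewrite -XE -RmE !iota_hom !hF !pvM XE e1.
  rewrite -Rm_sec -su Rm_sec -RmE !proj_hom; congr (_ * _)%g.
  rewrite (homV (proj_hom _)) -e1 -pvV -(homV hF) -(homV (@iota_hom _ m1)) //.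
- rewrite -(add0r v); have : pv (iota (th1 v)) (Kl L1 k) = 1%g.
    rewrite -(FK (iota _)); apply: (FK_level L2 L1 hF' cF' FK' FK).
    by rewrite XE -(hom1 (proj_hom _)) -(lth0 L2); apply/(Kl_th L2); case: h => C ->; exists (- C); rewrite scalerN addrK.
  rewrite -(hom1 (proj_hom _)) -(lth0 L1) add0r => /esym /(Kl_th L1); exact.
have [v [e _]] := hatT_approx k N1 (FT2 (hatT_th L2 v')); exists v.
apply/(Kl_th L2); rewrite -XE.
have : pv (F (F' (iota (th2 v')) * (iota (th1 v))^-1)%g) (Kl L2 k) = 1%g.
  apply: (FK_level L1 L2 hF cF FK FK').
  by rewrite pvM pvV e mulgV.
rewrite hF FK' (homV hF) pvM pvV => /eqP; rewrite -eq_mulgV1 => /eqP <-.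
by [].
Qed.
Theorem lattice_cox_iso : cox_iso m1 m2.
Proof.
have [X [X' [Xr X'X XX']]] := @lattice_iso l1 l2 _ R1 R2 R1M R11 R2M (fun j => proj N1 (r1 j)) n1 R1r (lt_n2 L1) (lt_n0 L1) HX.
have eqv w : Rm L2 (f w) *m X = X *m Rm L1 w.
  rewrite -R2E -R1E; have [p pE] := lt_gen L1 w.
  have -> : proj N1 w = proj N1 (word r1 p) by apply/(NTlP L1); rewrite -pE (lsec_idem L1).
  elim: p {pE} => [|j p IH] /=; first by rewrite (hom1 (proj_hom _)) R11 R21 mulmx1 mul1mx.
  by rewrite proj_hom R1M R2M -mulmxA IH !mulmxA Xr.
have c_ex w : exists x, w = (th1 x * sec1 w)%g := lt_dec L1 w.
have /boolp.choice [c hc] := c_ex.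
have cM w w' : c (w * w')%g = c w + Rm L1 w *m c w'.
  apply: (lt_inj L1); apply: (mulIg (sec1 (w * w')%g)); rewrite -hc (lt_hom L1) -(Rm_sec L1 w) -RmE.
  by rewrite (lt_sec L1) {1}(hc w) {1}(hc w') !mulgA mulgVK.
(* The translation part [c] is a cocycle by [cM], and equivariance of [X] makes the product
   multiplicative; the linear part comes from the finite quotient of the completion. *)
pose Psi w := (th2 (X *m c w) * sec2 (f w))%g.
have PsiM : hom Psi.
  move=> w w'; rewrite /Psi cM mulmxDr (lt_hom L2) mulmxA -eqv -mulmxA -(Rm_sec L2 (f w)) -RmE f_mul.
  by rewrite !mulgA mulgVK.
have sP w : sec2 (Psi w) = sec2 (f w) by rewrite /Psi (lt_sec L2) (lt_secth L2) mul1g (lsec_idem L2).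
have Psi1 w : Psi w = 1%g -> w = 1%g.
  move=> e; have s1 : sec2 (f w) = 1%g by rewrite -sP e (lsec1 L2).
  have hw : sec1 w = 1%g.
    apply/(NTl1 L1); have : hatT L2 (F (iota w)) by rewrite /hatT -/N2 fE; apply/(NTl1 L2).
    by move/FT2; rewrite FK.
  move: e; rewrite /Psi s1 mulg1 -(lth0 L2) => /(lt_inj L2) /(congr1 (mulmx X')).
  by rewrite mulmxA X'X mul1mx mulmx0 => c0; rewrite (hc w) c0 hw (lth0 L1) mulg1.
apply/cox_iso_hom; exists Psi; split=> //.
  move=> x y e; have h : (x * y^-1)%g = 1%g by apply: Psi1; rewrite PsiM (homV PsiM) e mulgV.
  by rewrite -[x](mulgVK y) h mul1g.
move=> y; have [w0 w0E] := approx (F' (iota y)) N1.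
have h : hatT L1 (F' (iota y) * (iota w0)^-1)%g by rewrite /hatT pvM pvV -/N1 w0E mulgV.
have sy : sec2 y = sec2 (f w0).
  apply/(NTlP L2); rewrite -/N2 -fE; have := FT1 h; rewrite /hatT -/N2 hF FK' (homV hF) pvM pvV.
  by move/eqP; rewrite -eq_mulgV1 => /eqP.
have [b bE] := lt_dec L2 y; exists (th1 (X' *m b - c w0) * w0)%g.
have ct x : c (th1 x) = x.
  by apply: (lt_inj L1); have := hc (th1 x); rewrite (lt_secth L1) mulg1.
rewrite /Psi cM ct Rm_th mul1mx subrK mulmxA XX' mul1mx f_mul f_th mul1g -sy -bE.
by [].
Qed.
End LatIso.

(** * The decomposition theorem *)

Lemma cox_iso_sym (V1 V2 : finType) (m1 : V1 -> V1 -> nat) (m2 : V2 -> V2 -> nat) :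
  cox_iso m1 m2 -> cox_iso m2 m1.
Proof.
case/cox_iso_hom => f [hf fi fs]; have [g [gK gK']] := hom_iso_inv fi fs.
apply/cox_iso_hom; exists g; split; last by move=> y; exists (f y).
  by move=> x y; apply: fi; rewrite hf !gK'.
exact: can_inj gK'.
Qed.
Lemma cox_iso_trans (V1 V2 V3 : finType) (m1 : V1 -> V1 -> nat) (m2 : V2 -> V2 -> nat) (m3 : V3 -> V3 -> nat) :
  cox_iso m1 m2 -> cox_iso m2 m3 -> cox_iso m1 m3.
Proof.
case/cox_iso_hom => f [hf fi fs] /cox_iso_hom [g [hg gi gs]]; apply/cox_iso_hom.
exists (g \o f); split; first by move=> x y /=; rewrite hf hg.
  exact: inj_comp.
by move=> y; have [z <-] := gs y; have [x <-] := fs z; exists x.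
Qed.
Lemma prof_iso_trans (V1 V2 V3 : finType) (m1 : V1 -> V1 -> nat) (m2 : V2 -> V2 -> nat) (m3 : V3 -> V3 -> nat) :
  prof_iso m1 m2 -> prof_iso m2 m3 -> prof_iso m1 m3.
Proof.
case/prof_iso_hom => f [f' [hf cf fK fK']] /prof_iso_hom [g [g' [hg cg gK gK']]]; apply/prof_iso_hom.
exists (g \o f), (f' \o g'); split; first by move=> x y /=; rewrite hf hg.
- exact: cts_comp.
- exact: can_comp gK fK.
exact: can_comp fK' gK'.
Qed.
Lemma prof_iso_cox (V1 V2 : finType) (m1 : V1 -> V1 -> nat) (m2 : V2 -> V2 -> nat) :
  cox_iso m1 m2 -> prof_iso m1 m2.
Proof.
case/cox_iso_hom => f [hf fi fs]; have [g [gK gK']] := hom_iso_inv fi fs.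
have hg : hom g by move=> x y; apply: fi; rewrite hf !gK'.
apply/prof_iso_hom; exists (phat hf), (phat hg); split; [exact: phat_hom|exact: phat_cts| |].
  apply: (@cts_ext _ _ _ _ (phat hg \o phat hf) id) => //.
  - by move=> x y /=; rewrite !phat_hom.
  - by apply: cts_comp; exact: phat_cts.
  - by move=> N; exists N.
  by move=> s /=; rewrite !phat_iota gK.
apply: (@cts_ext _ _ _ _ (phat hf \o phat hg) id) => //.
- by move=> x y /=; rewrite !phat_hom.
- by apply: cts_comp; exact: phat_cts.
- by move=> N; exists N.
by move=> s /=; rewrite !phat_iota gK'.
Qed.
Lemma relab_iso (V V' : finType) (m : V -> V -> nat) (m' : V' -> V' -> nat) (e : V -> V') :
  injective e -> (forall y, exists x, e x = y) -> (forall x y, m' (e x) (e y) = m x y) -> cox_iso m m'.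
Proof.
move=> ei es em; have /fin_all_exists [e' e'K] := es.
have eK x : e' (e x) = x by apply: ei.
have e'i : injective e' by move=> x y h; rewrite -(e'K x) h e'K.
have em' x y : m (e' x) (e' y) = m' x y by rewrite -em !e'K.
pose f : cox m -> cox m' := relab m' e; pose g : cox m' -> cox m := relab m e'.
have hf : hom f := relab_hom ei em; have hg : hom g := relab_hom e'i em'.
have gK : cancel f g.
  apply: (@hom_ext _ m _ (g \o f) id) => //; first by move=> x y /=; rewrite hf hg.
  by move=> s /=; rewrite /f (relab_sg ei em) /g (relab_sg e'i em') eK.
have gK' : cancel g f.
  apply: (@hom_ext _ m' _ (f \o g) id) => //; first by move=> x y /=; rewrite hg hf.
  by move=> s /=; rewrite /g (relab_sg e'i em') /f (relab_sg ei em) e'K.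
apply/cox_iso_hom; exists f; split=> //; first exact: can_inj gK.
by move=> y; exists (g y).
Qed.

Section ReverseComp.
Variables (V V' : finType) (m : V -> V -> nat) (m' : V' -> V' -> nat).
Hypotheses (hm : is_cox_graph m) (hm' : is_cox_graph m').
Variables (e : V -> V') (ei : injective e) (em : forall x y, m' (e x) (e y) = m x y).
Hypothesis ecl : forall x y', dadj m' (e x) y' -> exists y, y' = e y.
Lemma fin_e_rev x : cox_finite (restrict m' (comp m' (e x))) -> cox_finite (restrict m (comp m x)).
Proof.
have h (y : subV (comp m' (e x))) : exists z : subV (comp m x), val y = e (val z).
  by have [z zx ez] := comp_e_surj ei em ecl (valP y); exists (Sub z zx).
have /fin_all_exists [f hf] := h.
apply: (@relabel_finite _ _ _ _ f) => [y y' yy|y y'|z].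
- by apply: val_inj; rewrite hf yy -hf.
- by rewrite /restrict -em -!hf.
have pr : e (val z) \in comp m' (e x) by rewrite (comp_e ei em ecl); exact: valP z.
by exists (Sub (e (val z)) pr); apply/val_inj/ei; rewrite -hf.
Qed.
Lemma aff_e_rev x : cox_affine_on m' (comp m' (e x)) -> cox_affine_on m (comp m x).
Proof.
case=> psd [f [[s sx fs] f0]]; split=> [g|]; last first.
  have [z zx sE] := comp_e_surj ei em ecl sx; exists (f \o e); split; first by exists z => //=; rewrite -sE.
  by rewrite -(qform_e ei em ecl).
pose f' (y : V') : RR := if [pick z | e z == y] is Some z then g z else 0.
have f'E z : f' (e z) = g z.
  by rewrite /f'; case: pickP => [w /eqP /ei ->//|/(_ z)]; rewrite eqxx.
have := psd f'; rewrite (qform_e ei em ecl); congr (_ <= _).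
by apply: eq_bigr => a _; apply: eq_bigr => b _; rewrite /= !f'E.
Qed.
End ReverseComp.
Section Nest.
Variables (V : finType) (m : V -> V -> nat) (hm : is_cox_graph m) (A : {set V}) (hA : sepA m A).
Let mA := restrict m A.
Let ecl (x : subV A) y' : dadj m (val x) y' -> exists y : subV A, y' = val y.
Proof. by move=> xy; have yA := sep_adj hA (valP x) xy; exists (Sub y' yA). Qed.
Lemma comp_restrict (x y : subV A) : (y \in comp mA x) = (val y \in comp m (val x)).
Proof. by rewrite (@comp_e _ _ mA m _ val_inj _ ecl). Qed.
Lemma fin_restrict (x : subV A) : cox_finite (restrict mA (comp mA x)) <-> cox_finite (restrict m (comp m (val x))).
Proof.
split=> h; first exact: (@fin_e _ _ mA m _ val_inj _ ecl).
exact: (@fin_e_rev _ _ mA m _ val_inj _ ecl).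
Qed.
Lemma aff_restrict (x : subV A) : cox_affine_on mA (comp mA x) <-> cox_affine_on m (comp m (val x)).
Proof.
split=> h; first exact: (@aff_e _ _ mA m _ val_inj _ ecl).
exact: (@aff_e_rev _ _ mA m _ val_inj _ ecl).
Qed.
End Nest.
Lemma sep_union (V : finType) (m : V -> V -> nat) (A : {set V}) :
  (forall s t, t \in comp m s -> s \in A -> t \in A) -> sepA m A.
Proof.
move=> h s t sA tA; have [//|/eqP m2] := eqVneq (m s t) 2%N.
exfalso; move: (tA) => /negP; apply; apply: (h s) => //.
apply: comp_adj (comp_refl _ _) _; rewrite /dadj; apply/andP; split; last exact/eqP.
by apply: contraNneq tA => <-.
Qed.
Lemma cox_iso_nest (V : finType) (m : V -> V -> nat) (A B : {set V}) (C : {set subV A}) :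
  B \subset A -> (forall x, (x \in C) = (val x \in B)) -> cox_iso (restrict (restrict m A) C) (restrict m B).
Proof.
move=> BA CE.
have pr (x : subV C) : val (val x) \in B by rewrite -CE; exact: valP x.
apply: (@relab_iso _ _ _ _ (fun x : subV C => Sub (val (val x)) (pr x) : subV B)) => [x y|y|x y].
- by move/(congr1 val) => /= /val_inj /val_inj.
- have yA : val y \in A := subsetP BA _ (valP y).
  have yC : (Sub (val y) yA : subV A) \in C by rewrite CE; exact: valP y.
  by exists (Sub (Sub (val y) yA) yC); apply: val_inj.
by [].
Qed.

(** * Finite factors and their separation from the affine part *)

Section AllFin.
Variables (S : finType) (m : S -> S -> nat) (hm : is_cox_graph m).
Local Notation es := (ev RR).
Local Notation "g ** v" := (@ga S m _ (aR m) g v) (at level 40).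
Let aRs := aR_sym hm.
Let aRd := aR_diag m.
Let aRr := resp_aR hm.
#[local] Hint Resolve aRs aRd aRr hm : core.
Lemma sg_neq1 s : sg m s <> 1%g.
Proof.
move=> h; have : sg m s ** es s = es s by rewrite h ga1.
rewrite ga_ev // => /ffunP /(_ s); rewrite !ffunE eqxx /=; lra.
Qed.
Lemma inc_fixA (A : {set S}) (hA : sepA m A) (x : cox (restrict m A)) t : t \notin A -> inc x ** es t = es t.
Proof.
move=> tA; elim/cox_ind: x => [|s x IH]; first by rewrite (hom1 (@inc_hom _ m A)) ga1.
rewrite inc_hom gaM // IH inc_sg ga_sg // /refl pair_ev aR_nadj ?scale0r ?subr0 //.
  by apply: contraNneq tA => <-; exact: valP s.
by apply: hA => //; exact: valP s.
Qed.
(** The orbit of a simple root involves only its own component, so all orbits are finite, and W acts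
    faithfully on the simple roots. *)
Lemma all_fin : (forall s, cox_finite (restrict m (comp m s))) -> cox_finite m.
Proof.
move=> hfin; have ex s : exists l : seq (vec S RR), forall w, w ** es s \in l.
  have [l hl] := hfin s; exists [seq inc (wd _ u) ** es s | u <- l] => w.
  have sA := @sepA_comp S m s; have [u ul e] := hl (wrep (ret (comp m s) w)).
  apply/mapP; exists u => //; rewrite {1}(decomp hm sA w) gaM // inc_fixA ?inE ?negbK; last 2 first.
  - exact: sepAC.
  - exact: connect0.
  by congr (inc _ ** _); rewrite -[ret _ _]wd_repr; apply/wdP.
have /fin_all_exists [l hl] := ex.
have [N hN] : exists N, forall s, (size (l s) <= N)%N.
  exists (\sum_s size (l s))%N => s; by rewrite (bigD1 s) //= leq_addr.
pose h (w : cox m) : {ffun S -> 'I_N.+1} := [ffun s => inord (index (w ** es s) (l s))].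
have hi w w' : h w = h w' -> w = w'.
  move=> /ffunP e; apply: (cox_faithful2 hm) => s; move: (e s); rewrite /h !ffunE => /(congr1 val) /=; rewrite !inordK.
  - by move=> ie; rewrite -(nth_index 0 (hl s w)) ie nth_index.
  - by rewrite ltnS; apply: leq_trans (index_size _ _) (hN s).
  by rewrite ltnS; apply: leq_trans (index_size _ _) (hN s).
have pick f : exists g, forall w, h w = f -> g = w.
  by have [[w e]|no] := pselect (exists w, h w = f);
    [exists w => w' e'; apply: hi; rewrite e e'|exists 1%g => w e; case: no; exists w].
have /fin_all_exists [g hg] := pick.
exists [seq wrep (g f) | f <- enum {: {ffun S -> 'I_N.+1}}] => w.
exists (wrep (g (h (wd m w)))); first by apply: map_f; rewrite mem_enum.
by apply/wdP; rewrite wd_repr (hg _ (wd m w)).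
Qed.
End AllFin.

Lemma fin_level (V : finType) (m : V -> V -> nat) : cox_finite m ->
  exists N0 : fincong m, (forall x y : cox m, proj N0 x = proj N0 y -> x = y) /\
    forall x y : prof m, pv x N0 = pv y N0 -> x = y.
Proof.
case=> l hl; have hid : hom (fun x : cox m => x) by [].
have fin : exists s : seq (cox m), forall x, x \in s.
  exists [seq wd m u | u <- l] => x; have [w ->] := wd_surj x; have [u ul e] := hl w.
  by apply/mapP; exists u => //; apply/wdP.
have P x y : proj (kfc hid fin) x = proj (kfc hid fin) y -> x = y by move/kfcP.
exists (kfc hid fin); split=> // x y e; apply: pv_ext => N; apply: pv_sub e.
by apply/projsubP => a b /P ->.
Qed.

Section SA.
Variables (V1 V2 : finType) (m1 : V1 -> V1 -> nat) (m2 : V2 -> V2 -> nat) (B1 : {set V1}) (B2 : {set V2}).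
Hypotheses (hm1 : is_cox_graph m1) (hm2 : is_cox_graph m2) (hB1 : sepA m1 B1) (hB2 : sepA m2 B2).
Hypotheses (f1 : cox_finite (restrict m1 B1)).
Variables (l2 : nat) (th2 : 'cV[int]_l2 -> cox (restrict m2 (~: B2))) (sec2 : cox (restrict m2 (~: B2)) -> cox (restrict m2 (~: B2)))
    (r2 : 'I_l2 -> cox (restrict m2 (~: B2))) (n2 : 'I_l2 -> 'I_l2 -> int).
Hypothesis L2 : lattice th2 sec2 r2 n2.
Variables (F : prof m1 -> prof m2) (F' : prof m2 -> prof m1).
Hypotheses (hF : hom F) (cF : cts F) (FK : cancel F F') (FK' : cancel F' F).
Let hF' := inv_hom hF FK FK'.
Let hC1 := sepAC hm1 hB1. Let hC2 := sepAC hm2 hB2.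
Let g (x : prof (restrict m1 B1)) := hret hm2 hC2 (F (hinc x)).
Let g_hom : hom g. Proof. by move=> x y; rewrite /g hinc_hom hF hret_hom. Qed.
(* The image of the finite normal subgroup [x] meets the torsion-free [T^] trivially, so it centralizes [T^]. *)
Lemma sph_to_aff (x : prof (restrict m1 B1)) : hret hm2 hC2 (F (hinc x)) = 1%g.
Proof.
have [N0 [_ hN0]] := fin_level f1; pose E := #|[set: fq N0]|.
have E0 : (0 < E)%N by exact: cardG_gt0.
have xE (y : prof (restrict m1 B1)) : (y ^+ E = 1)%g.
  by apply: hN0; rewrite pvX expg_cardG ?inE // pv1.
have gE y : (g y ^+ E = 1)%g by rewrite -(homX g_hom) xE (hom1 g_hom).
rewrite -/(g x); set a := g x.
have comm t : hatT L2 t -> (a * t * a^-1 * t^-1 = 1)%g.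
  move=> ht; have hc : hatT L2 (a * t * a^-1 * t^-1)%g.
    by rewrite /hatT !pvM !pvV ht mulg1 invg1 mulg1 mulgV.
  pose y := F' (hinc t); pose s := hret hm1 hB1 y.
  (* The component of [y] in the complementary factor commutes with the first factor, so only [s]
     acts there. *)
  have cj (z : prof (restrict m1 B1)) : (y * hinc z * y^-1 = hinc (s * z * s^-1))%g.
    rewrite !hinc_hom (homV (@hinc_hom _ m1 B1)) {1 2}(hat_decomp hm1 hB1 y) -/s invMg !mulgA.
    congr (_ * _)%g; rewrite -!mulgA; congr (_ * _)%g.
    by rewrite mulgA -(hinc_comm hB1) mulgK.
  have e : (t * a^-1 * t^-1 = g (s * x^-1 * s^-1))%g.
    rewrite /g -cj !hF FK' (homV hF) FK' !hret_hom hincK (homV (@hret_hom _ _ hm2 _ hC2)) hincK.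
    by rewrite /a (homV (@hinc_hom _ m1 B1)) (homV hF) (homV (@hret_hom _ _ hm2 _ hC2)).
  apply: (hatT_torsion E0 hc); rewrite -!mulgA [(t * _)%g]mulgA e /a -g_hom; exact: gE.
have ha : hatT L2 a.
  apply: hatT_self => z; have /eqP := comm _ (hatT_th L2 z) => /eqP e.
  by apply: (mulIg a^-1%g); rewrite mulgK; apply: (mulIg (iota (th2 z))^-1%g); rewrite e mulgV.
exact: hatT_torsion E0 ha (gE x).
Qed.
End SA.

Record split2 (V : finType) (m : V -> V -> nat) (B : {set V}) : Prop := Split2 {
  s2_cox : is_cox_graph m;
  s2_sep : sepA m B;
  s2_fin : cox_finite (restrict m B);
  s2_lat : exists l (th : 'cV[int]_l -> cox (restrict m (~: B))) sec (r : 'I_l -> cox (restrict m (~: B))) n,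
    lattice th sec r n }.

Section Product.
Variables (V1 V2 : finType) (m1 : V1 -> V1 -> nat) (m2 : V2 -> V2 -> nat) (B1 : {set V1}) (B2 : {set V2}).
Hypotheses (hm1 : is_cox_graph m1) (hm2 : is_cox_graph m2) (hB1 : sepA m1 B1) (hB2 : sepA m2 B2).
Lemma ret_in (V : finType) (m : V -> V -> nat) (hm : is_cox_graph m) (A : {set V}) (hA : sepA m A)
  (x : cox (restrict m (~: A))) : ret A (inc x) = 1%g.
Proof.
have := decomp hm hA (inc x); rewrite (incK hm (sepAC hm hA)) => e.
have : inc (ret A (inc x)) = 1%g by apply: (mulIg (inc x)); rewrite mul1g -e.
move/(congr1 (ret A)); by rewrite (incK hm hA) (hom1 (ret_hom hm hA)).
Qed.
Lemma hret_in (V : finType) (m : V -> V -> nat) (hm : is_cox_graph m) (A : {set V}) (hA : sepA m A)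
  (hC : sepA m (~: A)) (x : prof (restrict m A)) : hret hm hC (hinc x) = 1%g.
Proof.
have -> : hC = sepAC hm hA by exact: Prop_irrelevance.
have := hat_decomp hm hA (hinc x); rewrite hincK => e.
have : hinc (hret hm (sepAC hm hA) (hinc x)) = 1%g by apply: (mulgI (hinc x)); rewrite mulg1 -e.
by move/(congr1 (hret hm (sepAC hm hA))); rewrite hincK (hom1 (@hret_hom _ _ hm _ _)).
Qed.
Lemma cox_iso_prod : cox_iso (restrict m1 B1) (restrict m2 B2) ->
  cox_iso (restrict m1 (~: B1)) (restrict m2 (~: B2)) -> cox_iso m1 m2.
Proof.
case/cox_iso_hom => f [hf fi fs] /cox_iso_hom [g [hg gi gs]].
have hC1 := sepAC hm1 hB1; have hC2 := sepAC hm2 hB2.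
pose Phi w := (inc (f (ret B1 w)) * inc (g (ret (~: B1) w)))%g : cox m2.
apply/cox_iso_hom; exists Phi; split.
- move=> x y; rewrite /Phi !(ret_hom hm1 _) // hf hg !inc_hom -!mulgA; congr (_ * _)%g.
  by rewrite !mulgA (inc_comm hB2).
- move=> x y e.
  have := congr1 (ret B2) e; rewrite /Phi !(ret_hom hm2 hB2) !(incK hm2 hB2) !(ret_in hm2 hB2) !mulg1 => /fi e1.
  have := congr1 (ret (~: B2)) e; rewrite /Phi !(ret_hom hm2 hC2) !(incK hm2 hC2) !(ret_inc_out hm2 hB2) !mul1g => /gi e2.
  by rewrite (decomp hm1 hB1 x) (decomp hm1 hB1 y) e1 e2.
move=> y; have [a aE] := fs (ret B2 y); have [b bE] := gs (ret (~: B2) y).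
exists (inc a * inc b)%g; rewrite /Phi !(ret_hom hm1 _) // !(incK hm1 _) //.
by rewrite (ret_in hm1 hB1) (ret_inc_out hm1 hB1) mulg1 mul1g aE bE -(decomp hm2 hB2).
Qed.
Lemma cts_mul (V3 V4 : finType) (m3 : V3 -> V3 -> nat) (m4 : V4 -> V4 -> nat) (f g : prof m3 -> prof m4) :
  cts f -> cts g -> cts (fun x => f x * g x)%g.
Proof.
move=> cf cg N; have [N1 h1] := cf N; have [N2 h2] := cg N.
exists (fmeet N1 N2) => y e; rewrite pvM (h1 y) ?(h2 y) ?mulg1 //.
  by apply: etrans (pv1 N2); apply: pv_sub (@fmeetr _ _ N1 N2) _; rewrite e pv1.
by apply: etrans (pv1 N1); apply: pv_sub (@fmeetl _ _ N1 N2) _; rewrite e pv1.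
Qed.
Lemma prof_iso_prod : prof_iso (restrict m1 B1) (restrict m2 B2) ->
  prof_iso (restrict m1 (~: B1)) (restrict m2 (~: B2)) -> prof_iso m1 m2.
Proof.
case/prof_iso_hom => f [f' [hf cf fK fK']] /prof_iso_hom [g [g' [hg cg gK gK']]].
pose hC1 := sepAC hm1 hB1; pose hC2 := sepAC hm2 hB2.
pose Phi x := (hinc (f (hret hm1 hB1 x)) * hinc (g (hret hm1 hC1 x)))%g : prof m2.
pose Phi' x := (hinc (f' (hret hm2 hB2 x)) * hinc (g' (hret hm2 hC2 x)))%g : prof m1.
apply/prof_iso_hom; exists Phi, Phi'; split.
- move=> x y; rewrite /Phi !hret_hom hf hg !hinc_hom -!mulgA; congr (_ * _)%g.
  by rewrite !mulgA (hinc_comm hB2).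
- apply: cts_mul.
    exact: cts_comp (cts_comp (@hret_cts _ _ hm1 _ hB1) cf) (@hinc_cts _ m2 B2).
  exact: cts_comp (cts_comp (@hret_cts _ _ hm1 _ hC1) cg) (@hinc_cts _ m2 (~: B2)).
- move=> x; rewrite /Phi' /Phi !hret_hom !hincK hret_out !(hret_in hm2 hB2) mulg1 mul1g fK gK.
  by rewrite -(hat_decomp hm1 hB1).
move=> x; rewrite /Phi' /Phi !hret_hom !hincK hret_out !(hret_in hm1 hB1) mulg1 mul1g fK' gK'.
by rewrite -(hat_decomp hm2 hB2).
Qed.
End Product.

Lemma fin_iota (V : finType) (m : V -> V -> nat) : cox_finite m -> forall x : prof m, exists w, x = iota w.
Proof.
case/fin_level => N0 [_ h] x; have [w e] := approx x N0; exists w; exact: h.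
Qed.
(** By [sph_to_aff] in both directions the isomorphism is block triangular, so its diagonal blocks
    are invertible. A finite group is its own completion, and [lattice_cox_iso] treats the affine
    block. *)
Lemma sa_split (V1 V2 : finType) (m1 : V1 -> V1 -> nat) (m2 : V2 -> V2 -> nat) B1 B2 :
  split2 m1 B1 -> split2 m2 B2 -> prof_iso m1 m2 ->
  cox_iso (restrict m1 B1) (restrict m2 B2) /\ cox_iso (restrict m1 (~: B1)) (restrict m2 (~: B2)).
Proof.
case=> hm1 hB1 f1 [l1 [th1 [sec1 [r1 [n1 L1]]]]] [hm2 hB2 f2 [l2 [th2 [sec2 [r2 [n2 L2]]]]]].
case/prof_iso_hom => F [F' [hF cF FK FK']].
have hF' := inv_hom hF FK FK'; have cF' := inv_cts hF cF FK FK'.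
pose hC1 := sepAC hm1 hB1; pose hC2 := sepAC hm2 hB2.
have K (x : prof (restrict m1 B1)) : F (hinc x) = hinc (hret hm2 hB2 (F (hinc x))).
  rewrite {1}(hat_decomp hm2 hB2 (F (hinc x))) (@sph_to_aff V1 V2 m1 m2 B1 B2 hm1 hm2 hB1 hB2 f1 l2 th2 sec2 r2 n2 L2 F F' hF FK' x).
  by rewrite (hom1 (@hinc_hom _ m2 _)) mulg1.
have K' (x : prof (restrict m2 B2)) : F' (hinc x) = hinc (hret hm1 hB1 (F' (hinc x))).
  rewrite {1}(hat_decomp hm1 hB1 (F' (hinc x))) (@sph_to_aff V2 V1 m2 m1 B2 B1 hm2 hm1 hB2 hB1 f2 l1 th1 sec1 r1 n1 L1 F' F hF' FK x).
  by rewrite (hom1 (@hinc_hom _ m1 _)) mulg1.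
split.
  pose al (x : prof (restrict m1 B1)) := hret hm2 hB2 (F (hinc x)).
  pose al' (x : prof (restrict m2 B2)) := hret hm1 hB1 (F' (hinc x)).
  have alK x : al' (al x) = x by rewrite /al' /al -K FK hincK.
  have alK' x : al (al' x) = x by rewrite /al' /al -K' FK' hincK.
  have /boolp.choice [f hf] w := fin_iota f2 (al (iota w)).
  have ii1 := iota_inj (restrict_cox hm1 B1); have ii2 := iota_inj (restrict_cox hm2 B2).
  apply/cox_iso_hom; exists f; split.
  - by move=> x y; apply: ii2; rewrite iota_hom -!hf iota_hom /al hinc_hom hF hret_hom.
  - by move=> x y e; apply: ii1; rewrite -(alK (iota x)) -(alK (iota y)) !hf e.
  move=> y; have [w e] := fin_iota f1 (al' (iota y)); exists w; apply: ii2.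
  by rewrite -hf -e alK'.
pose be (x : prof (restrict m1 (~: B1))) := hret hm2 hC2 (F (hinc x)).
pose be' (x : prof (restrict m2 (~: B2))) := hret hm1 hC1 (F' (hinc x)).
have bh : hom be by move=> x y; rewrite /be hinc_hom hF hret_hom.
have bc : cts be := cts_comp (cts_comp (@hinc_cts _ m1 _) cF) (@hret_cts _ _ hm2 _ hC2).
have beK : cancel be be'.
  move=> x; rewrite /be' /be; set y := F (hinc x).
  have -> : hinc (hret hm2 hC2 y) = ((hinc (hret hm2 hB2 y))^-1 * y)%g.
    by rewrite {3}(hat_decomp hm2 hB2 y) mulKg; congr (hinc _).
  rewrite hF' (homV hF') K' hret_hom (homV (@hret_hom _ _ hm1 _ hC1)) (hret_in hm1 hB1) invg1 mul1g.
  by rewrite /y FK hincK.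
have beK' : cancel be' be.
  move=> x; rewrite /be' /be; set y := F' (hinc x).
  have -> : hinc (hret hm1 hC1 y) = ((hinc (hret hm1 hB1 y))^-1 * y)%g.
    by rewrite {3}(hat_decomp hm1 hB1 y) mulKg; congr (hinc _).
  rewrite hF (homV hF) K hret_hom (homV (@hret_hom _ _ hm2 _ hC2)) (hret_in hm2 hB2) invg1 mul1g.
  by rewrite /y FK' hincK.
exact: (lattice_cox_iso L1 L2 bh bc beK beK').
Qed.

Lemma split2_vab (V : finType) (m : V -> V -> nat) B : split2 m B -> vab m.
Proof.
case=> hm hB f1 [l [th [sec [r [n L]]]]]; have hC := sepAC hm hB.
have [N0 [h0 _]] := fin_level f1.
exists (fmeet (fpull (ret_hom hm hB) N0) (fpull (ret_hom hm hC) (NTl L))).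
have E x : proj (fmeet (fpull (ret_hom hm hB) N0) (fpull (ret_hom hm hC) (NTl L))) x = 1%g ->
    exists z, x = inc (th z).
  rewrite -(hom1 (proj_hom _)) => /fmeetP [/fpullP /h0 e1 /fpullP e2].
  rewrite (hom1 (ret_hom hm hB)) in e1.
  have : sec (ret (~: B) x) = 1%g.
    by apply/(NTl1 L); rewrite e2 (hom1 (ret_hom hm hC)) (hom1 (proj_hom _)).
  case/(lsec_th L) => z zE; exists z.
  by rewrite (decomp hm hB x) e1 (hom1 (@inc_hom _ m B)) mul1g zE.
move=> x y /E [z ->] /E [z' ->]; by rewrite -!inc_hom -!(lt_hom L) addrC.
Qed.

Section Decomposition.
Variables (V : finType) (m : V -> V -> nat) (hm : is_cox_graph m).
Let A := sph_set m :|: aff_set m.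
Let B := [set x : subV A | val x \in sph_set m].
Lemma sph_comp s t : t \in comp m s -> (t \in sph_set m) = (s \in sph_set m).
Proof. by move=> h; rewrite !inE (comp_eq hm h). Qed.
Lemma aff_comp s t : t \in comp m s -> (t \in aff_set m) = (s \in aff_set m).
Proof. by move=> h; rewrite !inE (comp_eq hm h). Qed.
Lemma sph_aff_disj v : v \in sph_set m -> v \notin aff_set m.
Proof.
rewrite !inE => /asboolP f; apply/asboolP => a; exact: (affine_infinite hm a f).
Qed.
Lemma sepA_sphaff : sepA m A.
Proof. by apply: sep_union => s t h; rewrite !in_setU (sph_comp h) (aff_comp h). Qed.
Lemma B_mem x : (x \in B) = (val x \in sph_set m). Proof. by rewrite in_set. Qed.
Lemma B_compl x : (x \in ~: B) = (val x \in aff_set m).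
Proof.
rewrite in_setC B_mem; have := valP x; rewrite /A in_setU => /orP[h|h].
  by rewrite h (negPf (sph_aff_disj h)).
by rewrite h; apply: contraL h => /sph_aff_disj.
Qed.
Lemma split2_sphaff : split2 (restrict m A) B.
Proof.
have hA := sepA_sphaff; have hmA : is_cox_graph (restrict m A) := restrict_cox hm A.
have hB : sepA (restrict m A) B.
  by apply: sep_union => s t; rewrite (comp_restrict hA) => h; rewrite !B_mem (sph_comp h).
have hC := sepAC hmA hB; split=> //.
  apply: all_fin; first exact: restrict_cox.
  move=> s; apply/(fin_restrict hB)/(fin_restrict hA).
  by have := valP s; rewrite B_mem in_set => /asboolP.
apply: aff_lattice; first exact: restrict_cox.
move=> s; apply/(aff_restrict hC)/(aff_restrict hA).
by have := valP s; rewrite B_compl in_set => /asboolP.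
Qed.
Lemma split_graph_sphaff : split_graph m A.
Proof.
split=> //; [exact: sepA_sphaff|exact: split2_vab split2_sphaff|].
apply: (allgen_restrict hm (sepAC hm sepA_sphaff)) => x; rewrite !inE negb_or => /andP[h1 h2].
by split=> h; [move: h1|move: h2]; rewrite asboolT.
Qed.
Lemma iso_sph : cox_iso (restrict (restrict m A) B) (restrict m (sph_set m)).
Proof. by apply: cox_iso_nest; [exact: subsetUl|move=> x; rewrite in_set]. Qed.
Lemma iso_aff : cox_iso (restrict (restrict m A) (~: B)) (restrict m (aff_set m)).
Proof. by apply: cox_iso_nest; [exact: subsetUr|exact: B_compl]. Qed.
End Decomposition.

(** The last clause, on the product of spherical and affine parts, is what lifts rigidity from the
    generic part. *)
Lemma part1 (V1 V2 : finType) (m1 : V1 -> V1 -> nat) (m2 : V2 -> V2 -> nat) :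
  is_cox_graph m1 -> is_cox_graph m2 -> prof_iso m1 m2 ->
  [/\ cox_iso (restrict m1 (sph_set m1)) (restrict m2 (sph_set m2)),
      cox_iso (restrict m1 (aff_set m1)) (restrict m2 (aff_set m2)),
      prof_iso (restrict m1 (gen_set m1)) (restrict m2 (gen_set m2)) &
      cox_iso (restrict m1 (sph_set m1 :|: aff_set m1)) (restrict m2 (sph_set m2 :|: aff_set m2))].
Proof.
move=> hm1 hm2 h.
have [hA hG] := split_hat (split_graph_sphaff hm1) (split_graph_sphaff hm2) h.
have [hS hF] := sa_split (split2_sphaff hm1) (split2_sphaff hm2) hA.
split=> //.
- exact: cox_iso_trans (cox_iso_trans (cox_iso_sym (iso_sph m1)) hS) (iso_sph m2).
- exact: cox_iso_trans (cox_iso_trans (cox_iso_sym (iso_aff hm1)) hF) (iso_aff hm2).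
apply: cox_iso_prod hS hF; [exact: restrict_cox|exact: restrict_cox| |].
- exact: s2_sep (split2_sphaff hm1).
exact: s2_sep (split2_sphaff hm2).
Qed.
Lemma gen_rigid (V : finType) (m : V -> V -> nat) : is_cox_graph m ->
  prof_rigid (restrict m (gen_set m)) -> prof_rigid m.
Proof.
move=> hm rg V' m' hm' h; have [_ _ hG hA] := part1 hm' hm h.
apply: cox_iso_prod hA _ => //; [exact: sepA_sphaff|exact: sepA_sphaff|].
by apply: rg hG; apply: restrict_cox.
Qed.

Lemma allgen_empty (V : finType) (m : V -> V -> nat) : allgen m -> sph_set m = set0 /\ aff_set m = set0.
Proof.
by move=> h; split; apply/setP => x; rewrite !inE; apply/asboolP; case: (h x).
Qed.
Lemma iso_empty (V1 V2 : finType) (m1 : V1 -> V1 -> nat) (m2 : V2 -> V2 -> nat) (A : {set V1}) (B : {set V2}) :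
  is_cox_graph m1 -> B = set0 -> cox_iso (restrict m1 A) (restrict m2 B) -> A = set0.
Proof.
move=> hm1 B0; subst B; case/cox_iso_hom => f [hf fi _]; apply/setP => x; rewrite in_set0; apply/negP => xA.
have triv (w : cox (restrict m2 set0)) : w = 1%g.
  elim/cox_ind: w => [//|s w _]; by have := valP s; rewrite in_set0.
apply: (@sg_neq1 _ (restrict m1 A) (restrict_cox hm1 A) (Sub x xA)); apply: fi.
by rewrite (triv (f _)) (triv (f 1%g)).
Qed.

(** * Disjoint unions of Coxeter graphs and rigidity *)

Section Union.
Variables (V V' : finType) (m : V -> V -> nat) (m' : V' -> V' -> nat).
Hypotheses (hm : is_cox_graph m) (hm' : is_cox_graph m').
(** The label 2 between the two graphs makes the generators commute, so this presents the direct
    product. *)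
Definition dunion (x y : V + V') : nat :=
  match x, y with inl a, inl b => m a b | inr a, inr b => m' a b | _, _ => 2%N end.
Definition left_part : {set V + V'} := [set x | if x is inl _ then true else false].
Lemma dunion_cox : is_cox_graph dunion.
Proof.
case: hm => a1 [a2 a3]; case: hm' => b1 [b2 b3]; split; last split.
- by move=> [x|x] [y|y] //=.
- by move=> [x|x] /=.
by move=> [x|x] [y|y] /=.
Qed.
Lemma left_sep : sepA dunion left_part.
Proof. by move=> [x|x] [y|y]; rewrite !inE. Qed.
Lemma left_iso : cox_iso (restrict dunion left_part) m.
Proof.
have pr (x : V) : (inl x : V + V') \in left_part by rewrite inE.
apply: cox_iso_sym; apply: (@relab_iso _ _ _ _ (fun x => Sub (inl x) (pr x) : subV left_part)) => [x y|[[x|x] hx]|x y].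
- by move/(congr1 val) => /= [].
- by exists x; apply: val_inj.
- by exfalso; move: hx; rewrite inE.
by [].
Qed.
Lemma right_iso : cox_iso (restrict dunion (~: left_part)) m'.
Proof.
have pr (x : V') : (inr x : V + V') \in ~: left_part by rewrite !inE.
apply: cox_iso_sym; apply: (@relab_iso _ _ _ _ (fun x => Sub (inr x) (pr x) : subV (~: left_part))) => [x y|[[x|x] hx]|x y].
- by move/(congr1 val) => /= [].
- by exfalso; move: hx; rewrite !inE.
- by exists x; apply: val_inj.
by [].
Qed.
Lemma right_allgen : allgen m' -> allgen (restrict dunion (~: left_part)).
Proof.
move=> h; pose e (x : subV (~: left_part)) : V + V' := val x.
have ex (x : subV (~: left_part)) : exists y : V', val x = inr y.
  by have := valP x; case: (val x) => y; rewrite !inE // => _; exists y.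
have /fin_all_exists [g hg] := ex.
apply: (@allgen_e _ _ (restrict dunion (~: left_part)) m' g) => //.
- by move=> x y gg; apply: val_inj; rewrite !hg gg.
- by move=> x y; rewrite /restrict !hg.
move=> x y' _; have yC : (inr y' : V + V') \in ~: left_part by rewrite !inE.
exists (Sub (inr y') yC); have := hg (Sub (inr y') yC); rewrite /= => -[]; by [].
Qed.
End Union.

Lemma vab_iso (V1 V2 : finType) (m1 : V1 -> V1 -> nat) (m2 : V2 -> V2 -> nat) :
  cox_iso m1 m2 -> vab m2 -> vab m1.
Proof.
case/cox_iso_hom => f [hf fi _] [N hN]; exists (fpull hf N) => x y.
rewrite -(hom1 (proj_hom (fpull hf N))) => /fpullP hx /fpullP hy; apply: fi; rewrite !hf.
by apply: hN; rewrite ?hx ?hy (hom1 hf) (hom1 (proj_hom N)).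
Qed.

(** Multiply the competing group by the spherical and affine parts of W. Rigidity identifies the
    product with W, and [split_disc] cancels the common factor. *)
Lemma rigid_gen (V : finType) (m : V -> V -> nat) : is_cox_graph m ->
  prof_rigid m -> prof_rigid (restrict m (gen_set m)).
Proof.
move=> hm rg V' m' hm' h; set A := sph_set m :|: aff_set m.
have sA := split_graph_sphaff hm.
have [e1 e2] := allgen_empty (sg_gen sA).
have [i1 i2 _ _] := part1 hm' (restrict_cox hm _) h.
have s0 := iso_empty hm' e1 i1; have a0 := iso_empty hm' e2 i2.
(* The spherical and affine parts of the competitor are isomorphic to those of a generic group,
   which are empty. *)
have ag : allgen m'.
  move=> x; split=> k; [have : x \in sph_set m'|have : x \in aff_set m'].
  - by rewrite inE; apply/asboolP.
  - by rewrite s0 in_set0.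
  - by rewrite inE; apply/asboolP.
  by rewrite a0 in_set0.
have hmA : is_cox_graph (restrict m A) := restrict_cox hm A.
pose m3 := dunion (restrict m A) m'.
have hm3 : is_cox_graph m3 := dunion_cox hmA hm'.
have li := left_iso (restrict m A) m'; have ri := right_iso (restrict m A) m'.
have ls := @left_sep _ _ (restrict m A) m'.
have h3 : prof_iso m3 m.
  apply: (prof_iso_prod hm3 hm ls (sg_sep sA)); first exact: prof_iso_cox li.
  exact: prof_iso_trans (prof_iso_cox ri) h.
have s3 : split_graph m3 (left_part (subV A) V').
  by split=> //; [exact: vab_iso li (sg_vab sA)|exact: right_allgen].
exact: cox_iso_trans (cox_iso_sym ri) (split_disc s3 sA (rg _ _ hm3 h3)).
Qed.

Theorem theoremB :
  (forall (V1 : finType) (m1 : V1 -> V1 -> nat)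
          (V2 : finType) (m2 : V2 -> V2 -> nat),
      is_cox_graph m1 -> is_cox_graph m2 -> prof_iso m1 m2 ->
      [/\ cox_iso (restrict m1 (sph_set m1)) (restrict m2 (sph_set m2)),
          cox_iso (restrict m1 (aff_set m1)) (restrict m2 (aff_set m2)) &
          prof_iso (restrict m1 (gen_set m1)) (restrict m2 (gen_set m2))]) /\
  (forall (V : finType) (m : V -> V -> nat),
      is_cox_graph m -> (prof_rigid m <-> prof_rigid (restrict m (gen_set m)))).
Proof.
split=> [V1 m1 V2 m2 hm1 hm2 h|V m hm]; first by have [] := part1 hm1 hm2 h.
by split; [apply: rigid_gen|apply: gen_rigid].
Qed.
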